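(* Let $C\subset\mathbb{R}^3$ be a bounded domain with regular (smooth) boundary which is strictly convex, i.e. the principal curvatures of $\partial C$ with respect to the inward pointing unit normal are positive everywhere. Let $\Gamma\subset\partial C$ be a smooth Jordan curve and let $\epsilon>0$. Then there exists a complete proper minimal immersion $\psi:\mathbb{D}\to C$ of the open unit disk $\mathbb{D}$ such that the Hausdorff distance satisfies $\delta^H(\psi(\partial\mathbb{D}),\Gamma)<\epsilon$, where $\psi(\partial\mathbb{D})$ denotes the limit set of $\psi$.
   Context: An immersion $\psi:\mathbb{D}\to C$ is proper if preimages of compact subsets of $C$ are compact in $\mathbb{D}$; it is complete if the Riemannian metric it induces on $\mathbb{D}$ is complete. The limit set of $\psi$ is $\psi(\partial\mathbb{D}):=\overline{\psi(\mathbb{D})}\setminus\psi(\mathbb{D})$ (closure in $\mathbb{R}^3$); for a proper immersion into $C$ it is contained in $\partial C$ and equals the set of limits of $\psi(z_n)$ with $|z_n|\to1$. For nonempty compact sets $A,B\subset\mathbb{R}^3$, the Hausdorff distance is $\delta^H(A,B)=\max\{\sup_{x\in A}\inf_{y\in B}\|x-y\|,\ \sup_{y\in B}\inf_{x\in A}\|x-y\|\}$. *)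

(* Defs.v *)
From Stdlib Require Import Reals List.
From Coquelicot Require Import Coquelicot.
Open Scope R_scope.

Definition P3 := (R * R * R)%type.
Definition mk3 (a b c : R) : P3 := ((a, b), c).
Definition px (p : P3) : R := fst (fst p).
Definition py (p : P3) : R := snd (fst p).
Definition pz (p : P3) : R := snd p.
Definition sub3 (p q : P3) : P3 := mk3 (px p - px q) (py p - py q) (pz p - pz q).
Definition dot3 (p q : P3) : R := px p * px q + py p * py q + pz p * pz q.
Definition cross3 (p q : P3) : P3 :=
  mk3 (py p * pz q - pz p * py q) (pz p * px q - px p * pz q) (px p * py q - py p * px q).
Definition enorm3 (p : P3) : R := sqrt (dot3 p p).

Definition dderiv {V : NormedModule R_AbsRing} (f : V -> R) (v : V) : V -> R :=
  fun p => Derive (fun t => f (plus p (scal t v))) 0.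

(** C^k on an open set U, via iterated directional derivatives along the
    coordinate directions [dirs] (which exist and are continuous). *)
Fixpoint CkOn {V : NormedModule R_AbsRing} (dirs : list V) (k : nat)
  (U : V -> Prop) (f : V -> R) : Prop :=
  match k with
  | O => forall p, U p -> continuous f p
  | S k' => (forall p, U p -> continuous f p /\
               forall v, In v dirs -> ex_derive (fun t => f (plus p (scal t v))) 0)
            /\ forall v, In v dirs -> CkOn dirs k' U (dderiv f v)
  end.

Definition smooth_on {V : NormedModule R_AbsRing} (dirs : list V)
  (U : V -> Prop) (f : V -> R) : Prop := forall k, CkOn dirs k U f.

Definition basis1 : list R := (1 :: nil).
Definition basis2 : list (R * R) := ((1, 0) :: (0, 1) :: nil).
Definition basis3 : list P3 := (mk3 1 0 0 :: mk3 0 1 0 :: mk3 0 0 1 :: nil).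

Definition dderiv3 {V : NormedModule R_AbsRing} (g : V -> P3) (v : V) : V -> P3 :=
  fun p => mk3 (dderiv (fun q => px (g q)) v p) (dderiv (fun q => py (g q)) v p)
               (dderiv (fun q => pz (g q)) v p).
Definition smooth_map_on {V : NormedModule R_AbsRing} (dirs : list V)
  (U : V -> Prop) (g : V -> P3) : Prop :=
  smooth_on dirs U (fun q => px (g q)) /\ smooth_on dirs U (fun q => py (g q)) /\
  smooth_on dirs U (fun q => pz (g q)).

Definition grad3 (F : P3 -> R) (p : P3) : P3 :=
  mk3 (dderiv F (mk3 1 0 0) p) (dderiv F (mk3 0 1 0) p) (dderiv F (mk3 0 0 1) p).

Definition closure3 (A : P3 -> Prop) (x : P3) : Prop :=
  forall eps, 0 < eps -> exists y, A y /\ enorm3 (sub3 x y) < eps.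
Definition boundary3 (A : P3 -> Prop) (x : P3) : Prop := closure3 A x /\ ~ A x.
Definition connected3 (A : P3 -> Prop) : Prop :=
  ~ exists U V : P3 -> Prop, open U /\ open V /\
     (forall x, A x -> U x \/ V x) /\ (exists x, A x /\ U x) /\
     (exists x, A x /\ V x) /\ (forall x, A x -> U x -> V x -> False).
Definition bounded3 (A : P3 -> Prop) : Prop :=
  exists M, forall x, A x -> enorm3 x <= M.
Definition domain3 (C : P3 -> Prop) : Prop :=
  open C /\ connected3 C /\ (exists x, C x).

Definition compact_set {T : UniformSpace} (K : T -> Prop) : Prop :=
  forall (I : Type) (U : I -> T -> Prop), (forall i, open (U i)) ->
    (forall x, K x -> exists i, U i x) ->
    exists l : list I, forall x, K x -> exists i, In i l /\ U i x.

(** C has smooth (regular) boundary, strictly convex: near every boundary point p,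
    C is {F < 0} for a smooth F with grad F(p) <> 0, and the second fundamental
    form of the boundary w.r.t. the inward normal -grad F/|grad F|, namely
    Hess F(p)(v,v)/|grad F(p)| on tangent vectors v, is positive definite
    (i.e. all principal curvatures are positive). *)
Definition smooth_strictly_convex_boundary (C : P3 -> Prop) : Prop :=
  forall p, boundary3 C p ->
    exists r, 0 < r /\ exists F : P3 -> R,
      smooth_on basis3 (fun x => enorm3 (sub3 x p) < r) F /\
      (forall x, enorm3 (sub3 x p) < r -> (C x <-> F x < 0)) /\
      grad3 F p <> mk3 0 0 0 /\
      (forall v : P3, v <> mk3 0 0 0 -> dot3 v (grad3 F p) = 0 ->
         dderiv (dderiv F v) v p / enorm3 (grad3 F p) > 0).

Definition smooth_jordan_curve (G : P3 -> Prop) : Prop :=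
  exists g : R -> P3,
    smooth_map_on basis1 (fun _ => True) g /\
    (forall t, g (t + 1) = g t) /\
    (forall s t, 0 <= s < 1 -> 0 <= t < 1 -> g s = g t -> s = t) /\
    (forall t, dderiv3 g 1 t <> mk3 0 0 0) /\
    (forall x, G x <-> exists t, x = g t).

Definition Disk (p : R * R) : Prop := fst p ^ 2 + snd p ^ 2 < 1.

Definition psi_u (psi : R * R -> P3) := dderiv3 psi (1, 0).
Definition psi_v (psi : R * R -> P3) := dderiv3 psi (0, 1).

Definition immersion (psi : R * R -> P3) : Prop :=
  smooth_map_on basis2 Disk psi /\
  forall p, Disk p -> cross3 (psi_u psi p) (psi_v psi p) <> mk3 0 0 0.

Definition minimal_immersion (psi : R * R -> P3) : Prop :=
  immersion psi /\
  forall p, Disk p ->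
    let xu := psi_u psi p in let xv := psi_v psi p in
    let n := cross3 xu xv in
    let xuu := dderiv3 (psi_u psi) (1, 0) p in
    let xuv := dderiv3 (psi_u psi) (0, 1) p in
    let xvv := dderiv3 (psi_v psi) (0, 1) p in
    let E := dot3 xu xu in let F := dot3 xu xv in let G := dot3 xv xv in
    let e := dot3 xuu n / enorm3 n in let f := dot3 xuv n / enorm3 n in
    let g := dot3 xvv n / enorm3 n in
    (e * G - 2 * f * F + g * E) / (2 * (E * G - F ^ 2)) = 0.

Definition C1_curve_in_disk (gam : R -> R * R) : Prop :=
  (forall t, ex_derive (fun s => fst (gam s)) t /\ ex_derive (fun s => snd (gam s)) t /\
             continuous (Derive (fun s => fst (gam s))) t /\
             continuous (Derive (fun s => snd (gam s))) t) /\
  (forall t, 0 <= t <= 1 -> Disk (gam t)).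
Definition induced_length (psi : R * R -> P3) (gam : R -> R * R) : R :=
  RInt (fun t => enorm3 (mk3 (Derive (fun s => px (psi (gam s))) t)
                             (Derive (fun s => py (psi (gam s))) t)
                             (Derive (fun s => pz (psi (gam s))) t))) 0 1.
Definition induced_dist_lt (psi : R * R -> P3) (p q : R * R) (r : R) : Prop :=
  exists gam, C1_curve_in_disk gam /\ gam 0 = p /\ gam 1 = q /\
    induced_length psi gam < r.
Definition complete_immersion (psi : R * R -> P3) : Prop :=
  forall x : nat -> R * R, (forall n, Disk (x n)) ->
    (forall eps, 0 < eps -> exists N, forall m n, (N <= m)%nat -> (N <= n)%nat ->
        induced_dist_lt psi (x m) (x n) eps) ->
    exists p, Disk p /\ forall eps, 0 < eps -> exists N, forall n, (N <= n)%nat ->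
        induced_dist_lt psi (x n) p eps.

Definition proper_into (C : P3 -> Prop) (psi : R * R -> P3) : Prop :=
  (forall p, Disk p -> C (psi p)) /\
  forall K : P3 -> Prop, (forall x, K x -> C x) -> compact_set K ->
    compact_set (fun p => Disk p /\ K (psi p)).

(** Limit set psi(bD) = closure(psi(D)) \ psi(D). *)
Definition limit_set (psi : R * R -> P3) (x : P3) : Prop :=
  boundary3 (fun y => exists p, Disk p /\ y = psi p) x.

Definition dist_to (B : P3 -> Prop) (x : P3) : Rbar :=
  Glb_Rbar (fun s => exists y, B y /\ s = enorm3 (sub3 x y)).
Definition Rbar_max2 (a b : Rbar) : Rbar :=
  match Rbar_lt_dec a b with left _ => b | right _ => a end.
Definition hausdorff_dist (A B : P3 -> Prop) : Rbar :=
  Rbar_max2 (Lub_Rbar (fun r => exists x, A x /\ dist_to B x = Finite r))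
            (Lub_Rbar (fun r => exists y, B y /\ dist_to A y = Finite r)).

(* Main.v *)
(** A minimal disc is the real part of the null curve p0 + ∫ (u²-v², i(u²+v²), 2uv) of a pair of
    holomorphic functions without common zeros (a spinor); its metric is (|u|²+|v|²)|dz|.
    Replacing (u,v) by (u,v) + sqrt(2N+1) z^N P, with P a Laurent-polynomial approximation of a
    prescribed continuous spinor on the circle, changes the surface very little inside, and near
    the circle adds the real part of z^M times a null vector, i.e. moves the boundary in a
    prescribed plane by a prescribed length t, while crossing the annulus costs intrinsic length
    at least a constant times t.

    By Pythagoras, many small moves orthogonal to the displacement accumulated so far gain length
    1 at the cost of an arbitrarily small displacement.  Moving in the plane tangent to the nearest
    boundary point by sqrt(m depth), where m controls interior and exterior tangent balls
    uniformly, decreases the depth of the boundary curve by a fixed factor, so these displacements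
    are summable.  Alternating the two steps, starting from a thin polynomial disc whose
    boundary runs close to Γ and which is built by driving spikes along Γ, gives in the limit a
    complete proper minimal disc that stays close to the initial one.  Positivity of the curvatures
    is used only through the exterior tangent balls. *)

Require Import Defs.
From Stdlib Require Import Reals ZArith Lra Lia List ClassicalEpsilon.
From Coquelicot Require Import Coquelicot.
Open Scope R_scope.

(** * Vectors of R^3 and complex derivatives *)

(** The spinor turns the nonlinear condition that the derivative be a null vector into no condition
    at all: any pair of polynomials may be added, integration over the disc meets no periods, and
    only common zeros must be avoided, which a generic small constant achieves. The factor
    [sqrt (2N+1)] balances the expansion: the quadratic part has density [(2N+1) z^(2N)] and
    integrates to a displacement of order 1, while the cross term integrates to order [1 / sqrt N].
    On an annulus of width of order [1/N] the metric is of order [N], so the length gained does not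
    depend on [N].

    The geometric data enter as a direction and a length on the circle: a continuous plane field
    must be lifted to a spinor field that vanishes nowhere, which is a matter of general position.
    Before the limit every disc is polynomial on the closed disc, so depth and displacement are
    controlled on the whole boundary circle. The limit is only known on the open disc, and whatever
    it must inherit is recorded as a stable inequality with a tolerance on a subdisc. *)

Definition add3 (p q : P3) : P3 := mk3 (px p + px q) (py p + py q) (pz p + pz q).

Definition scl3 (a : R) (p : P3) : P3 := mk3 (a * px p) (a * py p) (a * pz p).

Lemma px_mk a b c : px (mk3 a b c) = a. Proof. reflexivity. Qed.

Lemma py_mk a b c : py (mk3 a b c) = b. Proof. reflexivity. Qed.

Lemma pz_mk a b c : pz (mk3 a b c) = c. Proof. reflexivity. Qed.

Lemma P3_eq (p q : P3) : px p = px q -> py p = py q -> pz p = pz q -> p = q.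
Proof.
  destruct p as [[a b] c], q as [[a' b'] c']; unfold px, py, pz; simpl.
  intros -> -> ->; reflexivity.
Qed.

Ltac vunf := unfold add3, scl3, sub3, dot3, cross3; repeat (rewrite px_mk || rewrite py_mk || rewrite pz_mk).

Ltac veq := apply P3_eq; vunf; try ring.

Lemma dot3_ge0 p : 0 <= dot3 p p.
Proof. unfold dot3; nra. Qed.

Lemma enorm3_ge0 p : 0 <= enorm3 p.
Proof. apply sqrt_pos. Qed.

Lemma enorm3_sq p : enorm3 p * enorm3 p = dot3 p p.
Proof. apply sqrt_sqrt, dot3_ge0. Qed.

Lemma sq_le_le a b : 0 <= b -> a * a <= b * b -> a <= b.
Proof. intros; nra. Qed.

Lemma enorm3_le p b : 0 <= b -> dot3 p p <= b * b -> enorm3 p <= b.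
Proof. intros; apply sq_le_le; [lra | rewrite enorm3_sq; lra]. Qed.

Lemma enorm3_lt p b : 0 <= b -> dot3 p p < b * b -> enorm3 p < b.
Proof. intros Hb H; pose proof (enorm3_ge0 p); rewrite <- enorm3_sq in H; nra. Qed.

Lemma enorm3_ge p b : 0 <= b -> b * b <= dot3 p p -> b <= enorm3 p.
Proof. intros; apply sq_le_le; [apply enorm3_ge0 | rewrite enorm3_sq; lra]. Qed.

Lemma dot3_CS p q : dot3 p q * dot3 p q <= dot3 p p * dot3 q q.
Proof.
  unfold dot3.
  set (a := px p); set (b := py p); set (c := pz p);
  set (x := px q); set (y := py q); set (z := pz q).
  assert (H : (a*a+b*b+c*c)*(x*x+y*y+z*z) - (a*x+b*y+c*z)*(a*x+b*y+c*z)
     = (a*y-b*x)*(a*y-b*x) + (b*z-c*y)*(b*z-c*y) + (c*x-a*z)*(c*x-a*z)) by ring.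
  pose proof (Rle_0_sqr (a*y-b*x)); pose proof (Rle_0_sqr (b*z-c*y)); pose proof (Rle_0_sqr (c*x-a*z)).
  unfold Rsqr in *; lra.
Qed.

Lemma dot3_le p q : Rabs (dot3 p q) <= enorm3 p * enorm3 q.
Proof.
  pose proof (enorm3_ge0 p); pose proof (enorm3_ge0 q).
  apply sq_le_le; [nra|].
  replace (Rabs (dot3 p q) * Rabs (dot3 p q)) with (dot3 p q * dot3 p q)
    by (rewrite <- Rabs_mult, Rabs_right; nra).
  pose proof (dot3_CS p q); rewrite <- !enorm3_sq in H1; nra.
Qed.

Lemma dot3_ub p q : dot3 p q <= enorm3 p * enorm3 q.
Proof. pose proof (dot3_le p q); pose proof (Rle_abs (dot3 p q)); lra. Qed.

Lemma dot3_lb p q : - (enorm3 p * enorm3 q) <= dot3 p q.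
Proof. pose proof (dot3_le p q); pose proof (Rle_abs (- dot3 p q)); rewrite Rabs_Ropp in *; lra. Qed.

Lemma enorm3_tri p q : enorm3 (add3 p q) <= enorm3 p + enorm3 q.
Proof.
  pose proof (enorm3_ge0 p); pose proof (enorm3_ge0 q).
  apply enorm3_le; [lra|].
  replace (dot3 (add3 p q) (add3 p q)) with (dot3 p p + 2 * dot3 p q + dot3 q q) by (vunf; ring).
  pose proof (dot3_ub p q); rewrite <- !enorm3_sq; nra.
Qed.

Lemma enorm3_sub_tri p q r : enorm3 (sub3 p r) <= enorm3 (sub3 p q) + enorm3 (sub3 q r).
Proof. replace (sub3 p r) with (add3 (sub3 p q) (sub3 q r)) by veq. apply enorm3_tri. Qed.

Lemma enorm3_sym p q : enorm3 (sub3 p q) = enorm3 (sub3 q p).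
Proof. unfold enorm3; f_equal; vunf; ring. Qed.

Lemma enorm3_scl a p : enorm3 (scl3 a p) = Rabs a * enorm3 p.
Proof.
  unfold enorm3. replace (dot3 (scl3 a p) (scl3 a p)) with (Rsqr a * dot3 p p) by (vunf; unfold Rsqr; ring).
  rewrite sqrt_mult; [| apply Rle_0_sqr | apply dot3_ge0]. now rewrite sqrt_Rsqr_abs.
Qed.

Lemma enorm3_0 : enorm3 (mk3 0 0 0) = 0.
Proof. unfold enorm3; replace (dot3 (mk3 0 0 0) (mk3 0 0 0)) with 0 by (vunf; ring); apply sqrt_0. Qed.

Lemma sub3_diag p : sub3 p p = mk3 0 0 0.
Proof. veq. Qed.

Lemma enorm3_eq0 p : enorm3 p = 0 -> p = mk3 0 0 0.
Proof.
  intros H; pose proof (enorm3_sq p) as E; rewrite H in E; unfold dot3 in E.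
  apply P3_eq; vunf; nra.
Qed.

Lemma enorm3_pos p : p <> mk3 0 0 0 -> 0 < enorm3 p.
Proof.
  intros H; destruct (enorm3_ge0 p) as [?|E]; [lra|].
  destruct H; apply enorm3_eq0; lra.
Qed.

Lemma px_le p : Rabs (px p) <= enorm3 p.
Proof. apply sq_le_le; [apply enorm3_ge0|]. rewrite enorm3_sq, <- Rabs_mult, Rabs_right; unfold dot3; nra. Qed.

Lemma py_le p : Rabs (py p) <= enorm3 p.
Proof. apply sq_le_le; [apply enorm3_ge0|]. rewrite enorm3_sq, <- Rabs_mult, Rabs_right; unfold dot3; nra. Qed.

Lemma pz_le p : Rabs (pz p) <= enorm3 p.
Proof. apply sq_le_le; [apply enorm3_ge0|]. rewrite enorm3_sq, <- Rabs_mult, Rabs_right; unfold dot3; nra. Qed.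

Lemma enorm3_le_sum p : enorm3 p <= Rabs (px p) + Rabs (py p) + Rabs (pz p).
Proof.
  pose proof (Rabs_pos (px p)); pose proof (Rabs_pos (py p)); pose proof (Rabs_pos (pz p)).
  apply enorm3_le; [lra|]. unfold dot3.
  assert (Hs : forall x, x * x = Rabs x * Rabs x) by (intros; rewrite <- Rabs_mult, Rabs_right; nra).
  rewrite (Hs (px p)), (Hs (py p)), (Hs (pz p)); nra.
Qed.

Lemma enorm3_diff p q : Rabs (enorm3 p - enorm3 q) <= enorm3 (sub3 p q).
Proof.
  apply Rabs_le; split.
  - assert (H := enorm3_tri p (sub3 q p)).
    replace (add3 p (sub3 q p)) with q in H by veq. rewrite (enorm3_sym q p) in H; lra.
  - assert (H := enorm3_tri q (sub3 p q)).
    replace (add3 q (sub3 p q)) with p in H by veq. lra.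
Qed.

(** Balls of the product uniform structure are cubes; the cube of half-side [eps / 4] fits into the
    Euclidean ball because the norm is at most the sum of the three coordinates. *)
Lemma locally3_intro (x : P3) (P : P3 -> Prop) eps :
  0 < eps -> (forall y, enorm3 (sub3 y x) < eps -> P y) -> locally x P.
Proof.
  intros He H. assert (He4 : 0 < eps / 4) by lra.
  exists (mkposreal _ He4). intros y Hy. apply H.
  destruct x as [[a b] c], y as [[a' b'] c'].
  destruct Hy as [[H1 H2] H3]; simpl in *.
  unfold ball in H1, H2, H3; simpl in H1, H2, H3; unfold AbsRing_ball, abs, minus, plus, opp in *; simpl in *.
  eapply Rle_lt_trans; [apply enorm3_le_sum|].
  unfold sub3; rewrite px_mk, py_mk, pz_mk; unfold px, py, pz; simpl.
  unfold Rminus; lra.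
Qed.

Lemma locally3_elim (x : P3) (P : P3 -> Prop) :
  locally x P -> exists eps, 0 < eps /\ forall y, enorm3 (sub3 y x) < eps -> P y.
Proof.
  intros [[e He] H]; exists e; split; [exact He|].
  intros y Hy; apply H.
  pose proof (px_le (sub3 y x)); pose proof (py_le (sub3 y x)); pose proof (pz_le (sub3 y x)).
  destruct x as [[a b] c], y as [[a' b'] c'].
  unfold sub3 in *; rewrite px_mk, py_mk, pz_mk in *; unfold px, py, pz in *; simpl in *.
  repeat split; simpl; unfold ball; simpl; unfold AbsRing_ball, abs, minus, plus, opp; simpl;
    unfold Rminus in *; lra.
Qed.

Lemma open3_elim (U : P3 -> Prop) x : open U -> U x ->
  exists eps, 0 < eps /\ forall y, enorm3 (sub3 y x) < eps -> U y.
Proof. intros HU Hx; apply locally3_elim, HU, Hx. Qed.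

(** * Complex moduli and complex differentiability *)

Lemma Cmod_ge_abs_re z : Rabs (fst z) <= Cmod z.
Proof. apply (re_le_Cmod z). Qed.

Lemma Cmod_sq z : Cmod z * Cmod z = fst z * fst z + snd z * snd z.
Proof. unfold Cmod; rewrite sqrt_sqrt; [ring | nra]. Qed.

Lemma Cmod_ge_abs_im z : Rabs (snd z) <= Cmod z.
Proof.
  apply sq_le_le; [apply Cmod_ge_0|]. rewrite Cmod_sq, <- Rabs_mult, Rabs_right; nra.
Qed.

Lemma Cmod_le_sum z : Cmod z <= Rabs (fst z) + Rabs (snd z).
Proof.
  pose proof (Rabs_pos (fst z)); pose proof (Rabs_pos (snd z)).
  assert (Hs : forall x, x * x = Rabs x * Rabs x) by (intros; rewrite <- Rabs_mult, Rabs_right; nra).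
  apply sq_le_le; [lra|]. rewrite Cmod_sq, (Hs (fst z)), (Hs (snd z)). nra.
Qed.

Lemma Cmod_sub_tri (a b c : C) : Cmod (a - c) <= Cmod (a - b) + Cmod (b - c).
Proof. replace (a - c)%C with ((a - b) + (b - c))%C by ring. apply Cmod_triangle. Qed.

Lemma Cmod_sym (a b : C) : Cmod (a - b) = Cmod (b - a).
Proof. replace (a - b)%C with (- (b - a))%C by ring. apply Cmod_opp. Qed.

Lemma Cmod_diff (a b : C) : Rabs (Cmod a - Cmod b) <= Cmod (a - b).
Proof.
  apply Rabs_le; split.
  - assert (H := Cmod_triangle a (b - a)). replace (a + (b - a))%C with b in H by ring.
    rewrite Cmod_sym in H; lra.
  - assert (H := Cmod_triangle b (a - b)). replace (b + (a - b))%C with a in H by ring. lra.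
Qed.

Lemma C_eq (a b : C) : fst a = fst b -> snd a = snd b -> a = b.
Proof. destruct a, b; simpl; intros -> ->; reflexivity. Qed.

(** Complex differentiability in increment form: without a quotient, [w = z] is no exception and
    sums and products of estimates can be formed directly. *)
Definition CD (f : C -> C) (z l : C) : Prop :=
  forall eps, 0 < eps -> exists del, 0 < del /\
    forall w, Cmod (w - z) < del -> Cmod (f w - f z - l * (w - z)) <= eps * Cmod (w - z).

Lemma CD_ext_at (f g : C -> C) z l r : 0 < r ->
  (forall w, Cmod (w - z) < r -> f w = g w) -> CD f z l -> CD g z l.
Proof.
  intros Hr Hfg Hf e He. destruct (Hf e He) as (d & Hd & H).
  exists (Rmin d r); split; [apply Rmin_glb_lt; lra|].
  intros w Hw. pose proof (Rmin_l d r); pose proof (Rmin_r d r).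
  rewrite <- !Hfg; [apply H; lra | replace (z - z)%C with (RtoC 0) by ring; rewrite Cmod_0; lra | lra].
Qed.

Lemma CD_const (c z : C) : CD (fun _ => c) z 0.
Proof.
  intros e He; exists 1; split; [lra|]; intros w _.
  replace (c - c - 0 * (w - z))%C with (RtoC 0) by ring.
  rewrite Cmod_0; pose proof (Cmod_ge_0 (w - z)); nra.
Qed.

Lemma CD_id (z : C) : CD (fun w => w) z 1.
Proof.
  intros e He; exists 1; split; [lra|]; intros w _.
  replace (w - z - 1 * (w - z))%C with (RtoC 0) by ring.
  rewrite Cmod_0; pose proof (Cmod_ge_0 (w - z)); nra.
Qed.

Lemma CD_plus f g z l m : CD f z l -> CD g z m -> CD (fun w => f w + g w)%C z (l + m)%C.
Proof.
  intros Hf Hg e He.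
  destruct (Hf (e/2)) as (d1 & Hd1 & H1); [lra|].
  destruct (Hg (e/2)) as (d2 & Hd2 & H2); [lra|].
  exists (Rmin d1 d2); split; [apply Rmin_glb_lt; lra|].
  intros w Hw. pose proof (Rmin_l d1 d2); pose proof (Rmin_r d1 d2).
  specialize (H1 w ltac:(lra)); specialize (H2 w ltac:(lra)).
  replace (f w + g w - (f z + g z) - (l + m) * (w - z))%C
    with ((f w - f z - l * (w - z)) + (g w - g z - m * (w - z)))%C by ring.
  eapply Rle_trans; [apply Cmod_triangle|]; lra.
Qed.

Lemma CD_lip f z l : CD f z l -> exists del, 0 < del /\
  forall w, Cmod (w - z) < del -> Cmod (f w - f z) <= (Cmod l + 1) * Cmod (w - z).
Proof.
  intros Hf; destruct (Hf 1) as (d & Hd & H); [lra|].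
  exists d; split; [lra|]; intros w Hw; specialize (H w Hw).
  replace (f w - f z)%C with ((f w - f z - l * (w - z)) + l * (w - z))%C by ring.
  eapply Rle_trans; [apply Cmod_triangle|]. rewrite Cmod_mult. lra.
Qed.

Lemma CD_mult f g z l m : CD f z l -> CD g z m ->
  CD (fun w => f w * g w)%C z (l * g z + f z * m)%C.
Proof.
  intros Hf Hg e He.
  set (A := Cmod (f z) + Cmod (g z) + Cmod l + 2).
  pose proof (Cmod_ge_0 (f z)); pose proof (Cmod_ge_0 (g z)); pose proof (Cmod_ge_0 l); pose proof (Cmod_ge_0 m).
  assert (HA : 0 < A) by (unfold A; lra).
  set (e1 := e / (3 * A)).
  assert (He1 : 0 < e1) by (apply Rdiv_lt_0_compat; lra).
  destruct (Hf e1 He1) as (d1 & Hd1 & K1).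
  destruct (Hg e1 He1) as (d2 & Hd2 & K2).
  destruct (CD_lip _ _ _ Hf) as (d3 & Hd3 & K3).
  destruct (CD_lip _ _ _ Hg) as (d4 & Hd4 & K4).
  (* Radius on which one factor of the second-order term [(f w - f z) * (g w - g z)] is already
     small; each of the three error terms may use [e / 3]. *)
  set (d5 := e / (3 * (A * (Cmod m + 1)))).
  assert (Hd5 : 0 < d5) by (apply Rdiv_lt_0_compat; [lra|]; apply Rmult_lt_0_compat; [lra|]; nra).
  exists (Rmin (Rmin (Rmin d1 d2) (Rmin d3 d4)) d5).
  split; [repeat apply Rmin_glb_lt; lra|].
  intros w Hw.
  assert (Hw5 : Cmod (w - z) < d5) by (eapply Rlt_le_trans; [apply Hw | apply Rmin_r]).
  assert (Hw' : Cmod (w - z) < Rmin (Rmin d1 d2) (Rmin d3 d4)) by (eapply Rlt_le_trans; [apply Hw | apply Rmin_l]).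
  pose proof (Rmin_l (Rmin d1 d2) (Rmin d3 d4)); pose proof (Rmin_r (Rmin d1 d2) (Rmin d3 d4)).
  pose proof (Rmin_l d1 d2); pose proof (Rmin_r d1 d2); pose proof (Rmin_l d3 d4); pose proof (Rmin_r d3 d4).
  specialize (K1 w ltac:(lra)); specialize (K2 w ltac:(lra));
  specialize (K3 w ltac:(lra)); specialize (K4 w ltac:(lra)).
  replace (f w * g w - f z * g z - (l * g z + f z * m) * (w - z))%C
    with ((f w - f z - l * (w - z)) * g z + f z * (g w - g z - m * (w - z)) + (f w - f z) * (g w - g z))%C by ring.
  eapply Rle_trans; [apply Cmod_triangle|].
  eapply Rle_trans; [apply Rplus_le_compat_r, Cmod_triangle|].
  rewrite !Cmod_mult.
  set (h := Cmod (w - z)) in *. assert (Hh : 0 <= h) by apply Cmod_ge_0.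
  pose proof (Cmod_ge_0 (f w - f z)); pose proof (Cmod_ge_0 (g w - g z)).
  pose proof (Cmod_ge_0 (f w - f z - l * (w - z))); pose proof (Cmod_ge_0 (g w - g z - m * (w - z))).
  assert (E1 : e1 * A = e / 3) by (unfold e1; field; lra).
  assert (E5 : d5 * (A * (Cmod m + 1)) = e / 3) by (unfold d5; field; split; lra).
  assert (P1 : Cmod (f w - f z - l * (w - z)) * Cmod (g z) <= e / 3 * h).
  { apply Rle_trans with ((e1 * h) * A); [| rewrite <- E1; lra].
    apply Rmult_le_compat; unfold A; lra. }
  assert (P2 : Cmod (f z) * Cmod (g w - g z - m * (w - z)) <= e / 3 * h).
  { apply Rle_trans with (A * (e1 * h)); [| rewrite <- E1; lra].
    apply Rmult_le_compat; unfold A; lra. }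
  assert (P3' : Cmod (f w - f z) * Cmod (g w - g z) <= e / 3 * h).
  { apply Rle_trans with ((A * h) * ((Cmod m + 1) * h)).
    - apply Rmult_le_compat; [lra|lra| | lra]. apply Rle_trans with (1 := K3).
      apply Rmult_le_compat_r; unfold A; lra.
    - rewrite <- E5.
      replace (A * h * ((Cmod m + 1) * h)) with ((h * (A * (Cmod m + 1))) * h) by ring.
      apply Rmult_le_compat_r; [lra|]. apply Rmult_le_compat_r; [|lra]. nra. }
  lra.
Qed.

Lemma CD_unique_val f z l m : l = m -> CD f z l -> CD f z m.
Proof. now intros ->. Qed.

Lemma CD_scal (c : C) f z l : CD f z l -> CD (fun w => c * f w)%C z (c * l)%C.
Proof.
  intros H. eapply CD_unique_val; [|apply (CD_mult _ _ _ _ _ (CD_const c z) H)]. ring.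
Qed.

Lemma CD_minus f g z l m : CD f z l -> CD g z m -> CD (fun w => f w - g w)%C z (l - m)%C.
Proof.
  intros Hf Hg.
  assert (H := CD_plus _ _ _ _ _ Hf (CD_scal (Copp 1) _ _ _ Hg)).
  apply CD_unique_val with (l := (l + Copp 1 * m)%C); [ring|].
  apply (CD_ext_at _ _ _ _ 1 Rlt_0_1) with (2 := H). intros w _; simpl. ring.
Qed.

Lemma CD_cont f z l : CD f z l -> forall eps, 0 < eps -> exists del, 0 < del /\
  forall w, Cmod (w - z) < del -> Cmod (f w - f z) < eps.
Proof.
  intros Hf e He. destruct (CD_lip _ _ _ Hf) as (d & Hd & H).
  pose proof (Cmod_ge_0 l).
  exists (Rmin d (e / (Cmod l + 1))).
  split; [apply Rmin_glb_lt; [lra|]; apply Rdiv_lt_0_compat; lra|].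
  intros w Hw. pose proof (Rmin_l d (e / (Cmod l + 1))); pose proof (Rmin_r d (e / (Cmod l + 1))).
  specialize (H w ltac:(lra)).
  eapply Rle_lt_trans; [apply H|].
  apply Rlt_le_trans with ((Cmod l + 1) * (e / (Cmod l + 1))).
  - apply Rmult_lt_compat_l; lra.
  - right; field; lra.
Qed.

(* c picks a real-linear functional of the complex value. *)
Lemma CD_line (f : C -> C) (c z v l : C) t :
  CD f (z + RtoC t * v)%C l ->
  is_derive (fun s : R => fst (c * f (z + RtoC s * v))%C) t (fst (c * (l * v))%C).
Proof.
  intros Hf. apply is_derive_Reals. intros e He.
  pose proof (Cmod_ge_0 c); pose proof (Cmod_ge_0 v).
  assert (Hcv : 0 < (Cmod c + 1) * (Cmod v + 1)) by nra.
  destruct (Hf (e / 2 / ((Cmod c + 1) * (Cmod v + 1)))) as (d & Hd & K1).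
  { repeat apply Rdiv_lt_0_compat; lra. }
  assert (Hdv : 0 < d / (Cmod v + 1)) by (apply Rdiv_lt_0_compat; lra).
  exists (mkposreal _ Hdv). intros h Hh0 Hh; simpl in Hh.
  set (w := (z + RtoC (t + h) * v)%C) in *. set (w0 := (z + RtoC t * v)%C) in *.
  assert (Ew : (w - w0 = RtoC h * v)%C) by (unfold w, w0; rewrite RtoC_plus; ring).
  assert (Hm : Cmod (w - w0) = Rabs h * Cmod v) by (rewrite Ew, Cmod_mult, Cmod_R; reflexivity).
  assert (Hw : Cmod (w - w0) < d).
  { rewrite Hm. apply Rle_lt_trans with (Rabs h * (Cmod v + 1)).
    - apply Rmult_le_compat_l; [apply Rabs_pos|lra].
    - apply Rlt_le_trans with (d / (Cmod v + 1) * (Cmod v + 1)); [apply Rmult_lt_compat_r; lra|right; field; lra]. }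
  specialize (K1 w Hw).
  replace ((fst (c * f w)%C - fst (c * f w0)%C) / h - fst (c * (l * v))%C)
    with (fst (c * (f w - f w0 - l * (w - w0)))%C / h).
  2:{ rewrite Ew. destruct c, v, l, (f w), (f w0); simpl. field; lra. }
  unfold Rdiv; rewrite Rabs_mult, Rabs_inv.
  assert (Hh' : 0 < Rabs h) by now apply Rabs_pos_lt.
  apply Rmult_lt_reg_r with (Rabs h); [lra|].
  rewrite Rmult_assoc, Rinv_l, Rmult_1_r by lra.
  eapply Rle_lt_trans; [apply Cmod_ge_abs_re|]. rewrite Cmod_mult.
  apply Rle_lt_trans with ((Cmod c + 1) * (e / 2 / ((Cmod c + 1) * (Cmod v + 1)) * Cmod (w - w0))).
  { apply Rmult_le_compat; [lra|apply Cmod_ge_0|lra|lra]. }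
  rewrite Hm.
  replace ((Cmod c + 1) * (e / 2 / ((Cmod c + 1) * (Cmod v + 1)) * (Rabs h * Cmod v)))
    with (e / 2 * Rabs h * (Cmod v / (Cmod v + 1))) by (field; lra).
  apply Rle_lt_trans with (e / 2 * Rabs h * 1); [|nra].
  apply Rmult_le_compat_l; [nra|].
  apply Rmult_le_reg_r with (Cmod v + 1); [lra|]. unfold Rdiv. rewrite Rmult_assoc, Rinv_l; lra.
Qed.

(** Apply the real mean value theorem to the real part of [f] times the conjugate of the total
    increment: along the segment this real function grows by exactly the squared modulus of the
    increment. *)
Lemma Cmod_mean_value (f g : C -> C) (z w : C) B :
  (forall t, 0 <= t <= 1 -> CD f (z + RtoC t * (w - z))%C (g (z + RtoC t * (w - z))%C)) ->
  (forall t, 0 <= t <= 1 -> Cmod (g (z + RtoC t * (w - z))%C) <= B) ->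
  Cmod (f w - f z) <= B * Cmod (w - z).
Proof.
  intros Hd HB.
  set (c := Cconj (f w - f z)).
  set (phi := fun s : R => fst (c * f (z + RtoC s * (w - z)))%C).
  destruct (MVT_gen phi 0 1 (fun t => fst (c * (g (z + RtoC t * (w - z)) * (w - z)))%C)) as (x & Hx & E).
  - intros x Hx. rewrite Rmin_left, Rmax_right in Hx by lra. apply CD_line, Hd; lra.
  - intros x Hx. rewrite Rmin_left, Rmax_right in Hx by lra.
    apply derivable_continuous_pt. exists (fst (c * (g (z + RtoC x * (w - z)) * (w - z)))%C).
    apply is_derive_Reals, CD_line, Hd; lra.
  - rewrite Rmin_left, Rmax_right in Hx by lra.
    unfold phi in E.
    replace (z + RtoC 1 * (w - z))%C with w in E by ring.
    replace (z + RtoC 0 * (w - z))%C with z in E by ring.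
    assert (E2 : fst (c * f w)%C - fst (c * f z)%C = Cmod (f w - f z) * Cmod (f w - f z)).
    { rewrite Cmod_sq. unfold c. destruct (f w), (f z); simpl; ring. }
    rewrite E2 in E.
    specialize (HB x Hx).
    set (G := g (z + RtoC x * (w - z))%C) in *.
    assert (H3 : fst (c * (G * (w - z)))%C <= Cmod (f w - f z) * (B * Cmod (w - z))).
    { eapply Rle_trans; [apply Rle_abs|]. eapply Rle_trans; [apply Cmod_ge_abs_re|].
      rewrite !Cmod_mult. unfold c; rewrite Cmod_conj.
      apply Rmult_le_compat_l; [apply Cmod_ge_0|]. apply Rmult_le_compat_r; [apply Cmod_ge_0|lra]. }
    pose proof (Cmod_ge_0 (f w - f z)); pose proof (Cmod_ge_0 (w - z)); pose proof (Cmod_ge_0 G).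
    destruct (Req_dec (Cmod (f w - f z)) 0); [nra|].
    apply Rmult_le_reg_l with (Cmod (f w - f z)); [lra|]. lra.
Qed.

(** * Complex polynomials as coefficient lists *)

Lemma CD_pow (z : C) n : CD (fun w => w ^ (S n))%C z (RtoC (INR (S n)) * z ^ n)%C.
Proof.
  induction n as [|n IH].
  - apply CD_unique_val with (l := RtoC 1); [simpl; ring|].
    apply (CD_ext_at (fun w => w) _ _ _ 1 Rlt_0_1) with (2 := CD_id z). intros; simpl; ring.
  - apply CD_unique_val with (l := (1 * z ^ (S n) + z * (RtoC (INR (S n)) * z ^ n))%C).
    + rewrite (S_INR (S n)), RtoC_plus. simpl (z ^ S n)%C. ring.
    + apply (CD_mult _ _ _ _ _ (CD_id z) IH).
Qed.

Fixpoint peval (l : list C) (z : C) : C :=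
  match l with nil => 0%C | c :: l' => (c + z * peval l' z)%C end.

Fixpoint padd (l m : list C) : list C :=
  match l, m with
  | nil, _ => m | _, nil => l
  | a :: l', b :: m' => (a + b)%C :: padd l' m'
  end.

Definition pscale (c : C) (l : list C) : list C := map (Cmult c) l.

Fixpoint pmul (l m : list C) : list C :=
  match l with nil => nil | a :: l' => padd (pscale a m) (RtoC 0 :: pmul l' m) end.

Definition pshift (n : nat) (l : list C) : list C := repeat (RtoC 0) n ++ l.

Fixpoint pder (l : list C) : list C :=
  match l with nil => nil | _ :: l' => padd l' (RtoC 0 :: pder l') end.

(* [z^(k+1) * peval (jint k l) z] is a primitive of [z^k * peval l z]. *)
Fixpoint jint (k : nat) (l : list C) : list C :=
  match l with nil => nil | c :: l' => (c / RtoC (INR (S k)))%C :: jint (S k) l' end.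

Definition prim (l : list C) : list C := RtoC 0 :: jint 0 l.

(** The l1 norm of the coefficients with weights [rho^n]. It dominates the sup norm on the disc of
    radius [rho], is submultiplicative and obeys Cauchy estimates, so it serves as the norm in which
    perturbations are measured. *)
Fixpoint pnorm (rho : R) (l : list C) : R :=
  match l with nil => 0 | c :: l' => Cmod c + rho * pnorm rho l' end.

Lemma peval_padd l m z : peval (padd l m) z = (peval l z + peval m z)%C.
Proof.
  revert m; induction l as [|a l IH]; intros [|b m]; simpl; try ring. rewrite IH; ring.
Qed.

Lemma peval_pscale c l z : peval (pscale c l) z = (c * peval l z)%C.
Proof. induction l as [|a l IH]; simpl; [ring|]. fold (pscale c l); rewrite IH; ring. Qed.

Lemma peval_pmul l m z : peval (pmul l m) z = (peval l z * peval m z)%C.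
Proof.
  induction l as [|a l IH]; simpl; [ring|].
  rewrite peval_padd, peval_pscale; simpl; rewrite IH; ring.
Qed.

Lemma peval_pshift n l z : peval (pshift n l) z = (z ^ n * peval l z)%C.
Proof.
  unfold pshift; induction n as [|n IH]; simpl; [ring|]. rewrite IH; ring.
Qed.

Lemma CD_peval l z : CD (peval l) z (peval (pder l) z).
Proof.
  induction l as [|c l IH]; [exact (CD_const 0 z)|].
  apply CD_unique_val with (l := (0 + (1 * peval l z + z * peval (pder l) z))%C).
  - simpl. rewrite peval_padd. simpl. ring.
  - exact (CD_plus (fun _ => c) _ _ _ _ (CD_const c z) (CD_mult _ _ _ _ _ (CD_id z) IH)).
Qed.

Lemma INR_S_neq0 k : RtoC (INR (S k)) <> RtoC 0.
Proof.
  intros H; apply RtoC_inj in H. pose proof (lt_0_INR (S k) ltac:(lia)). lra.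
Qed.

Lemma CD_jint l k z :
  CD (fun w => w ^ (S k) * peval (jint k l) w)%C z (z ^ k * peval l z)%C.
Proof.
  revert k; induction l as [|c l IH]; intros k.
  - apply CD_unique_val with (l := RtoC 0); [simpl; ring|].
    apply (CD_ext_at (fun _ => RtoC 0) _ _ _ 1 Rlt_0_1) with (2 := CD_const _ z). intros; simpl; ring.
  - apply CD_unique_val with
      (l := ((c / RtoC (INR (S k))) * (RtoC (INR (S k)) * z ^ k) + z ^ (S k) * peval l z)%C).
    + change (peval (c :: l) z) with (c + z * peval l z)%C.
      change (z ^ S k)%C with (z * z ^ k)%C. field. apply INR_S_neq0.
    + apply (CD_ext_at (fun w => (c / RtoC (INR (S k))) * w ^ (S k) + w ^ (S (S k)) * peval (jint (S k) l) w)%C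
               _ _ _ 1 Rlt_0_1).
      { intros w _. change (w ^ S (S k))%C with (w * w ^ S k)%C.
        change (peval (jint k (c :: l)) w) with (c / RtoC (INR (S k)) + w * peval (jint (S k) l) w)%C. ring. }
      apply CD_plus; [apply CD_scal, CD_pow | apply IH].
Qed.

Lemma CD_prim l z : CD (peval (prim l)) z (peval l z).
Proof.
  apply CD_unique_val with (l := (z ^ 0 * peval l z)%C); [simpl; ring|].
  apply (CD_ext_at _ _ _ _ 1 Rlt_0_1) with (2 := CD_jint l 0 z). intros; simpl; ring.
Qed.

Lemma pnorm_ge0 rho l : 0 <= rho -> 0 <= pnorm rho l.
Proof.
  intros; induction l as [|c l IH]; simpl; [lra|]. pose proof (Cmod_ge_0 c); nra.
Qed.

Lemma peval_le rho l z : Cmod z <= rho -> Cmod (peval l z) <= pnorm rho l.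
Proof.
  intros Hz; pose proof (Cmod_ge_0 z).
  induction l as [|c l IH]; simpl; [rewrite Cmod_0; lra|].
  eapply Rle_trans; [apply Cmod_triangle|]. rewrite Cmod_mult.
  pose proof (Cmod_ge_0 (peval l z)). nra.
Qed.

Lemma pnorm_mono r1 r2 l : 0 <= r1 <= r2 -> pnorm r1 l <= pnorm r2 l.
Proof.
  intros; induction l as [|c l IH]; simpl; [lra|].
  pose proof (pnorm_ge0 r1 l); nra.
Qed.

Lemma pnorm_padd rho l m : 0 <= rho -> pnorm rho (padd l m) <= pnorm rho l + pnorm rho m.
Proof.
  intros H; revert m; induction l as [|a l IH]; intros [|b m]; simpl; try lra.
  specialize (IH m). pose proof (Cmod_triangle a b). nra.
Qed.

Lemma pnorm_pscale rho c l : pnorm rho (pscale c l) = Cmod c * pnorm rho l.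
Proof.
  induction l as [|a l IH]; simpl; [ring|]. fold (pscale c l); rewrite IH, Cmod_mult; ring.
Qed.

Lemma pnorm_pmul rho l m : 0 <= rho -> pnorm rho (pmul l m) <= pnorm rho l * pnorm rho m.
Proof.
  intros H; induction l as [|a l IH]; simpl; [lra|].
  eapply Rle_trans; [apply pnorm_padd; lra|]. rewrite pnorm_pscale. simpl. rewrite Cmod_0. nra.
Qed.

Lemma pnorm_pshift rho n l : pnorm rho (pshift n l) = rho ^ n * pnorm rho l.
Proof.
  unfold pshift; induction n as [|n IH]; simpl; [ring|]. rewrite IH, Cmod_0; ring.
Qed.

Lemma Cmod_div_INR c k : Cmod (c / RtoC (INR (S k))) = Cmod c / INR (S k).
Proof.
  rewrite Cmod_div, Cmod_R, Rabs_right; [reflexivity| |apply INR_S_neq0].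
  pose proof (pos_INR (S k)); lra.
Qed.

Lemma pnorm_jint rho l k : 0 <= rho -> pnorm rho (jint k l) <= pnorm rho l / INR (S k).
Proof.
  intros Hr. assert (Gen : forall j, (k <= j)%nat -> pnorm rho (jint j l) <= pnorm rho l / INR (S k)).
  { pose proof (lt_0_INR (S k) ltac:(lia)) as HS.
    induction l as [|c l IH]; intros j Hj; cbn [jint pnorm]; [unfold Rdiv; lra|].
    rewrite Cmod_div_INR. specialize (IH (S j) ltac:(lia)).
    assert (Cmod c / INR (S j) <= Cmod c / INR (S k)).
    { apply Rmult_le_compat_l; [apply Cmod_ge_0|]. apply Rinv_le_contravar; [lra|]. apply le_INR; lia. }
    unfold Rdiv in *. rewrite Rmult_plus_distr_r. nra. }
  apply Gen; lia.
Qed.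

(** High-frequency limit: for a fixed polynomial [P] the primitive of [z^k P] is close to
    [z^(k+1) P / (k+1)], because coefficient [i] is divided by [k + i + 1] instead of [k + 1], a
    relative error of at most [i / (k + 1)]. *)
Lemma jint_close l k z : Cmod z <= 1 ->
  Cmod (RtoC (INR (S k)) * peval (jint k l) z - peval l z) <= INR (length l) * pnorm 1 l / INR (S k).
Proof.
  intros Hz. pose proof (lt_0_INR (S k) ltac:(lia)) as HS.
  assert (Gen : forall m i L, (i + length m <= L)%nat ->
    Cmod (RtoC (INR (S k)) * peval (jint (k + i) m) z - peval m z) <= INR L / INR (S k) * pnorm 1 m).
  { induction m as [|c m IH]; intros i L HL; cbn [peval pnorm jint].
    - replace (RtoC (INR (S k)) * 0 - 0)%C with (RtoC 0) by ring. rewrite Cmod_0; lra.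
    - simpl length in HL.
      replace (RtoC (INR (S k)) * (c / RtoC (INR (S (k + i))) + z * peval (jint (S (k + i)) m) z) - (c + z * peval m z))%C
        with ((- (RtoC (INR i) * (c / RtoC (INR (S (k + i)))))) + z * (RtoC (INR (S k)) * peval (jint (k + S i) m) z - peval m z))%C.
      2:{ replace (k + S i)%nat with (S (k + i)) by lia.
          replace (INR (S k)) with (INR (S (k + i)) - INR i) by (rewrite !S_INR, plus_INR; ring).
          rewrite RtoC_minus. field. apply INR_S_neq0. }
      eapply Rle_trans; [apply Cmod_triangle|]. rewrite Cmod_opp, !Cmod_mult, Cmod_div_INR, Cmod_R.
      specialize (IH (S i) L ltac:(lia)).
      rewrite Rabs_right by (pose proof (pos_INR i); lra).
      assert (INR i * (Cmod c / INR (S (k + i))) <= INR L / INR (S k) * Cmod c).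
      { unfold Rdiv. replace (INR i * (Cmod c * / INR (S (k + i)))) with ((INR i * / INR (S (k+i))) * Cmod c) by ring.
        apply Rmult_le_compat_r; [apply Cmod_ge_0|].
        apply Rmult_le_compat; [apply pos_INR| |apply le_INR; lia|].
        - left; apply Rinv_0_lt_compat, lt_0_INR; lia.
        - apply Rinv_le_contravar; [lra|apply le_INR; lia]. }
      pose proof (Cmod_ge_0 z).
      pose proof (Cmod_ge_0 (RtoC (INR (S k)) * peval (jint (k + S i) m) z - peval m z)). nra. }
  specialize (Gen l 0%nat (length l) ltac:(lia)). rewrite Nat.add_0_r in Gen.
  eapply Rle_trans; [apply Gen|]. right; field; lra.
Qed.

(** Cauchy estimate. The derivative of [c + z l] is [l + z l'], and in the induction the two
    contributions add up to [(r2 - r1) + r1 = r2]. *)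
Lemma pnorm_pder r1 r2 l : 0 <= r1 < r2 -> pnorm r1 (pder l) <= pnorm r2 l / (r2 - r1).
Proof.
  intros H. assert (Hd : 0 < r2 - r1) by lra.
  assert (pnorm r1 (pder l) * (r2 - r1) <= pnorm r2 l).
  { induction l as [|c l IH]; simpl; [lra|].
    assert (H1 := pnorm_padd r1 l (RtoC 0 :: pder l) ltac:(lra)). simpl in H1. rewrite Cmod_0 in H1.
    pose proof (pnorm_mono r1 r2 l ltac:(lra)). pose proof (Cmod_ge_0 c).
    assert (pnorm r1 (padd l (RtoC 0 :: pder l)) * (r2 - r1)
       <= (pnorm r2 l + r1 * pnorm r1 (pder l)) * (r2 - r1)) by (apply Rmult_le_compat_r; lra).
    nra. }
  apply Rmult_le_reg_r with (r2 - r1); [lra|]. unfold Rdiv; rewrite Rmult_assoc, Rinv_l; lra.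
Qed.

(** Synthetic division by [z - a]: the quotient has the Horner values of the tails at [a] as
    coefficients. *)
Fixpoint pquot (a : C) (l : list C) : list C :=
  match l with nil => nil | _ :: l' => match l' with nil => nil | _ => peval l' a :: pquot a l' end end.

Lemma pquot_length a l : length (pquot a l) = pred (length l).
Proof.
  induction l as [|c [|d l] IH]; try reflexivity.
  simpl in *. now rewrite IH.
Qed.

Lemma pquot_spec a l z : peval l z = (peval l a + (z - a) * peval (pquot a l) z)%C.
Proof.
  induction l as [|c l IH]; [simpl; ring|].
  destruct l as [|d l]; [simpl; ring|].
  change (pquot a (c :: d :: l)) with (peval (d :: l) a :: pquot a (d :: l)).
  change (peval (c :: d :: l) z) with (c + z * peval (d :: l) z)%C.
  change (peval (c :: d :: l) a) with (c + a * peval (d :: l) a)%C.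
  change (peval (peval (d :: l) a :: pquot a (d :: l)) z) with (peval (d :: l) a + z * peval (pquot a (d :: l)) z)%C.
  rewrite IH. ring.
Qed.

(** A coefficient list may consist of zeros, so nonvanishing at one point expresses that the
    polynomial is nonzero. The quotient by a root inherits this property and is shorter. *)
Lemma peval_finite_roots l z0 : peval l z0 <> 0%C ->
  exists roots, forall z, peval l z = 0%C -> In z roots.
Proof.
  remember (length l) as n eqn:Hn. revert l Hn.
  induction n as [|n IH]; intros l Hn H0.
  - destruct l; [|discriminate]. now destruct H0.
  - destruct (classic (exists a, peval l a = 0%C)) as [[a Ha]|Hno].
    2:{ exists nil. intros z Hz. destruct Hno; now exists z. }
    destruct (IH (pquot a l)) as [rs Hrs].
    + rewrite pquot_length; lia.
    + intros E; apply H0. rewrite (pquot_spec a), Ha, E; ring.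
    + exists (a :: rs). intros z Hz.
      rewrite (pquot_spec a), Ha in Hz.
      destruct (classic (z = a)) as [->|Hza]; [left; reflexivity|right].
      apply Hrs. destruct (Ceq_dec (peval (pquot a l) z) 0) as [E|E]; [exact E|].
      exfalso. apply (Cmult_neq_0 (z - a) (peval (pquot a l) z)); [|exact E|].
      * intros E'. apply Hza. replace z with ((z - a) + a)%C by ring. rewrite E'. ring.
      * rewrite <- Hz. ring.
Qed.

(** Source of the generic choices: a nonvanishing spinor on the circle and the removal of common
    zeros both come down to avoiding finitely many values. *)
Lemma avoid_finite (l : list R) eps : 0 < eps -> exists x, 0 < x < eps /\ ~ In x l.
Proof.
  revert eps; induction l as [|a l IH]; intros eps He.
  - exists (eps / 2); split; [lra|simpl; tauto].
  - destruct (Rlt_dec 0 a) as [Ha|Ha].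
    + destruct (IH (Rmin eps a)) as (x & Hx & Hn); [apply Rmin_glb_lt; lra|].
      pose proof (Rmin_l eps a); pose proof (Rmin_r eps a).
      exists x; split; [lra|]. intros [E|E]; [lra|tauto].
    + destruct (IH eps He) as (x & Hx & Hn). exists x; split; [lra|]. intros [E|E]; [lra|tauto].
Qed.

(** * The Weierstrass theorem on the circle *)

Fixpoint Csum (f : nat -> C) (n : nat) : C :=
  match n with O => 0%C | S n' => (Csum f n' + f n')%C end.

Fixpoint Rsum (f : nat -> R) (n : nat) : R :=
  match n with O => 0 | S n' => Rsum f n' + f n' end.

Lemma Csum_ext f g n : (forall k, (k < n)%nat -> f k = g k) -> Csum f n = Csum g n.
Proof. induction n as [|n IH]; intros H; simpl; [reflexivity|]. rewrite IH, H; auto. Qed.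

Lemma Rsum_ext f g n : (forall k, (k < n)%nat -> f k = g k) -> Rsum f n = Rsum g n.
Proof. induction n as [|n IH]; intros H; simpl; [reflexivity|]. rewrite IH, H; auto. Qed.

Lemma Csum_plus f g n : Csum (fun k => f k + g k)%C n = (Csum f n + Csum g n)%C.
Proof. induction n as [|n IH]; simpl; [ring|]. rewrite IH; ring. Qed.

Lemma Csum_scal c f n : Csum (fun k => c * f k)%C n = (c * Csum f n)%C.
Proof. induction n as [|n IH]; simpl; [ring|]. rewrite IH; ring. Qed.

Lemma Rsum_plus f g n : Rsum (fun k => f k + g k) n = Rsum f n + Rsum g n.
Proof. induction n as [|n IH]; simpl; [ring|]. rewrite IH; ring. Qed.

Lemma Rsum_scal c f n : Rsum (fun k => c * f k) n = c * Rsum f n.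
Proof. induction n as [|n IH]; simpl; [ring|]. rewrite IH; ring. Qed.

Lemma Csum_0 f n : (forall k, (k < n)%nat -> f k = RtoC 0) -> Csum f n = RtoC 0.
Proof. induction n as [|n IH]; intros H; simpl; [reflexivity|]. rewrite IH, H; auto. ring. Qed.

Lemma Csum_swap (f : nat -> nat -> C) n m :
  Csum (fun i => Csum (fun j => f i j) m) n = Csum (fun j => Csum (fun i => f i j) n) m.
Proof.
  induction n as [|n IH]; simpl.
  - symmetry; apply Csum_0; reflexivity.
  - rewrite IH, <- Csum_plus. reflexivity.
Qed.

Lemma Csum_RtoC f n : Csum (fun k => RtoC (f k)) n = RtoC (Rsum f n).
Proof. induction n as [|n IH]; simpl; [reflexivity|]. now rewrite IH, RtoC_plus. Qed.

Lemma Cmod_Csum f n : Cmod (Csum f n) <= Rsum (fun k => Cmod (f k)) n.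
Proof.
  induction n as [|n IH]; simpl; [rewrite Cmod_0; lra|].
  eapply Rle_trans; [apply Cmod_triangle|]; lra.
Qed.

Lemma Rsum_le f g n : (forall k, (k < n)%nat -> f k <= g k) -> Rsum f n <= Rsum g n.
Proof.
  induction n as [|n IH]; intros H; simpl; [lra|].
  specialize (IH (fun k Hk => H k (Nat.lt_trans _ _ _ Hk (Nat.lt_succ_diag_r n)))). specialize (H n ltac:(lia)). lra.
Qed.

Lemma Csum_single f n k : (k < n)%nat -> (forall j, (j < n)%nat -> j <> k -> f j = RtoC 0) -> Csum f n = f k.
Proof.
  intros Hk H. induction n as [|n IH]; [lia|]. simpl.
  destruct (Nat.eq_dec k n) as [->|Hne].
  - rewrite Csum_0; [ring|]. intros j Hj; apply H; lia.
  - rewrite IH; [|lia|intros; apply H; lia]. rewrite (H n); [ring|lia|lia].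
Qed.

Lemma Csum_head f n : Csum f (S n) = (f 0%nat + Csum (fun k => f (S k)) n)%C.
Proof. induction n as [|n IH]; simpl in *; [ring|]. rewrite IH; ring. Qed.

Fixpoint bin (n k : nat) : R :=
  match n, k with
  | _, O => 1 | O, S _ => 0
  | S n', S k' => bin n' k' + bin n' (S k')
  end.

Lemma bin_out n k : (n < k)%nat -> bin n k = 0.
Proof.
  revert k; induction n as [|n IH]; intros [|k] H; simpl; try lia; [reflexivity|].
  rewrite !IH by lia; ring.
Qed.

Lemma bin_fact n k : (k <= n)%nat -> bin n k * (INR (fact k) * INR (fact (n - k))) = INR (fact n).
Proof.
  revert k; induction n as [|n IH]; intros k Hk.
  - replace k with 0%nat by lia. simpl; ring.
  - destruct k as [|k].
    + simpl (bin _ _). rewrite Nat.sub_0_r. simpl (fact 0). simpl (INR 1). ring.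
    + simpl (bin _ _). replace (S n - S k)%nat with (n - k)%nat by lia.
      destruct (Nat.eq_dec k n) as [->|Hne].
      * rewrite (bin_out n (S n)) by lia. specialize (IH n (le_n _)).
        rewrite Nat.sub_diag in *. change (fact (S n)) with (S n * fact n)%nat. rewrite mult_INR.
        transitivity (INR (S n) * (bin n n * (INR (fact n) * INR (fact 0)))); [ring|]. rewrite IH; ring.
      * assert (H1 := IH k ltac:(lia)). assert (H2 := IH (S k) ltac:(lia)).
        replace (n - k)%nat with (S (n - S k)) in * by lia.
        change (fact (S n)) with (S n * fact n)%nat.
        change (fact (S k)) with (S k * fact k)%nat in *.
        change (fact (S (n - S k))) with (S (n - S k) * fact (n - S k))%nat in *.
        rewrite !mult_INR in *.
        assert (E : INR (S n) = INR (S k) + INR (S (n - S k))) by (rewrite <- plus_INR; f_equal; lia).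
        rewrite E.
        transitivity ((bin n k * (INR (fact k) * (INR (S (n - S k)) * INR (fact (n - S k))))) * INR (S k)
           + (bin n (S k) * (INR (S k) * INR (fact k) * INR (fact (n - S k)))) * INR (S (n - S k))); [ring|].
        rewrite H1, H2; ring.
Qed.

(** The ratio of consecutive central coefficients makes the second moment of the kernel below equal
    to [2 / (n + 1)] times its mass. *)
Lemma bin_central n : (INR n + 1) * bin (2 * S n) (S n) = (4 * INR n + 2) * bin (2 * n) n.
Proof.
  assert (H1 := bin_fact (2 * n) n ltac:(lia)).
  assert (H2 := bin_fact (2 * S n) (S n) ltac:(lia)).
  replace (2 * n - n)%nat with n in H1 by lia.
  replace (2 * S n - S n)%nat with (S n) in H2 by lia.
  replace (2 * S n)%nat with (S (S (2 * n))) in * by lia.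
  change (fact (S (S (2 * n)))) with (S (S (2 * n)) * (S (2 * n) * fact (2 * n)))%nat in H2.
  change (fact (S n)) with (S n * fact n)%nat in H2.
  rewrite !mult_INR in H2. rewrite <- H1 in H2.
  rewrite !S_INR, mult_INR in H2. simpl (INR 2) in H2.
  assert (Hf := INR_fact_lt_0 n). pose proof (pos_INR n).
  set (F := INR (fact n)) in *. set (x := INR n) in *.
  set (A := bin (2 * n) n) in *. set (B := bin (S (S (2 * n))) (S n)) in *.
  apply Rmult_eq_reg_r with ((x + 1) * (F * F)); [|nra].
  transitivity (B * ((x + 1) * F * ((x + 1) * F))); [ring|]. rewrite H2; ring.
Qed.

Lemma bin_pos n k : (k <= n)%nat -> 0 < bin n k.
Proof.
  intros H. pose proof (bin_fact n k H) as E.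
  pose proof (INR_fact_lt_0 k); pose proof (INR_fact_lt_0 (n-k)); pose proof (INR_fact_lt_0 n).
  assert (0 < INR (fact k) * INR (fact (n - k))) by nra. nra.
Qed.

Lemma Cbinomial (w : C) n : ((1 + w) ^ n)%C = Csum (fun k => RtoC (bin n k) * w ^ k)%C (S n).
Proof.
  induction n as [|n IH]; [simpl; ring|].
  change ((1 + w) ^ S n)%C with ((1 + w) * (1 + w) ^ n)%C. rewrite IH.
  rewrite (Csum_head _ (S n)).
  rewrite (Csum_ext (fun k => RtoC (bin (S n) (S k)) * w ^ S k)%C
    (fun k => w * (RtoC (bin n k) * w ^ k) + RtoC (bin n (S k)) * w ^ S k)%C).
  2:{ intros k _. change (bin (S n) (S k)) with (bin n k + bin n (S k)). rewrite RtoC_plus. simpl; ring. }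
  rewrite Csum_plus, Csum_scal.
  assert (E : (Csum (fun k => RtoC (bin n k) * w ^ k) (S n) =
    1 + Csum (fun k => RtoC (bin n (S k)) * w ^ S k) (S n))%C).
  { rewrite Csum_head. change (Csum (fun k => RtoC (bin n (S k)) * w ^ S k)%C (S n))
      with (Csum (fun k => RtoC (bin n (S k)) * w ^ S k)%C n + RtoC (bin n (S n)) * w ^ S n)%C.
    rewrite (bin_out n (S n)) by lia. destruct n; simpl (bin _ 0); simpl (w ^ 0)%C; ring. }
  change (bin (S n) 0) with 1. change (w ^ 0)%C with (RtoC 1).
  set (S1 := Csum (fun k => RtoC (bin n k) * w ^ k)%C (S n)) in *.
  set (S2 := Csum (fun k => RtoC (bin n (S k)) * w ^ S k)%C (S n)) in *.
  transitivity (w * S1 + (1 + S2))%C; [rewrite <- E|]; ring.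
Qed.

(** * Roots of unity and the de la Vallee Poussin kernel *)

Definition unit_root (m : nat) : C := (cos (2 * PI / INR m), sin (2 * PI / INR m)).

Lemma cis_pow x k : ((cos x, sin x) ^ k)%C = (cos (INR k * x), sin (INR k * x)).
Proof.
  induction k as [|k IH].
  - simpl. rewrite Rmult_0_l, cos_0, sin_0. reflexivity.
  - change ((cos x, sin x) ^ S k)%C with (Cmult (cos x, sin x) ((cos x, sin x) ^ k)%C).
    rewrite IH, S_INR. replace ((INR k + 1) * x) with (x + INR k * x) by ring.
    rewrite cos_plus, sin_plus. apply C_eq; simpl; ring.
Qed.

Lemma Cmod_cis x : Cmod (cos x, sin x) = 1.
Proof.
  apply Rsqr_inj; [apply Cmod_ge_0|lra|]. unfold Rsqr; rewrite Cmod_sq; simpl.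
  pose proof (sin2_cos2 x); unfold Rsqr in *; lra.
Qed.

Lemma unit_root_pow m : (0 < m)%nat -> (unit_root m ^ m)%C = 1%C.
Proof.
  intros H. unfold unit_root. rewrite cis_pow.
  replace (INR m * (2 * PI / INR m)) with (2 * PI).
  - rewrite cos_2PI, sin_2PI; reflexivity.
  - field. apply not_0_INR; lia.
Qed.

(** The real part decides: [cos x = 1 - 2 sin^2 (x / 2)], and [x / 2] lies strictly between 0 and
    [PI]. *)
Lemma unit_root_pow_neq m k : (0 < k < m)%nat -> (unit_root m ^ k)%C <> 1%C.
Proof.
  intros H E. unfold unit_root in E. rewrite cis_pow in E.
  apply (f_equal fst) in E; simpl in E.
  set (x := INR k * (2 * PI / INR m)) in *.
  assert (Hm : 0 < INR m) by (apply lt_0_INR; lia).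
  assert (Hk : 0 < INR k) by (apply lt_0_INR; lia).
  assert (Hkm : INR k < INR m) by (apply lt_INR; lia).
  pose proof PI_RGT_0.
  assert (E2 : x / 2 = PI * (INR k / INR m)) by (unfold x; field; lra).
  assert (0 < INR k / INR m < 1).
  { split; [apply Rdiv_lt_0_compat; lra|]. apply Rmult_lt_reg_r with (INR m); [lra|]. unfold Rdiv; rewrite Rmult_assoc, Rinv_l; lra. }
  assert (Hs : 0 < sin (x / 2)) by (apply sin_gt_0; rewrite E2; nra).
  replace x with (2 * (x / 2)) in E by field. rewrite cos_2a_sin in E. nra.
Qed.

Lemma geom_zero (q : C) m : q <> 1%C -> (q ^ m)%C = 1%C -> Csum (fun j => q ^ j)%C m = RtoC 0.
Proof.
  intros Hq Hm.
  assert (E : ((q - 1) * Csum (fun j => q ^ j) m = q ^ m - 1)%C).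
  { clear Hm. induction m as [|m IH]; [simpl; ring|].
    simpl Csum. rewrite Cmult_plus_distr_l, IH. simpl; ring. }
  rewrite Hm in E. destruct (Ceq_dec (Csum (fun j => q ^ j)%C m) 0) as [E0|E0]; [exact E0|].
  exfalso. apply (Cmult_neq_0 (q - 1) (Csum (fun j => q ^ j)%C m)); auto.
  - intros E1; apply Hq. replace q with ((q - 1) + 1)%C by ring. rewrite E1; ring.
  - rewrite E; ring.
Qed.

Lemma unit_conj (z : C) : Cmod z = 1 -> (z * Cconj z)%C = RtoC 1.
Proof. intros H. rewrite <- Cmod2_conj, H. f_equal. ring. Qed.

Lemma Cpow_unit (z : C) k : Cmod z = 1 -> Cmod (z ^ k)%C = 1.
Proof. intros H; rewrite Cmod_pow, H; apply pow1. Qed.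

(** The de la Vallee Poussin kernel: at [w = e^(it)] it is [(2 cos (t/2))^(2n)], a nonnegative
    trigonometric polynomial of degree [n] with its peak at [w = 1]. *)
Definition kern (n : nat) (w : C) : R := (Cmod (1 + w) * Cmod (1 + w)) ^ n.

Lemma kern_C n w : Cmod w = 1 -> RtoC (kern n w) = ((1 + w) ^ (2 * n) * Cconj w ^ n)%C.
Proof.
  intros Hw. pose proof (unit_conj w Hw) as E. unfold kern. rewrite RtoC_pow.
  assert (E1 : RtoC (Cmod (1 + w) * Cmod (1 + w)) = ((1 + w) * (1 + w) * Cconj w)%C).
  { replace (Cmod (1 + w) * Cmod (1 + w)) with (Cmod (1 + w) ^ 2) by ring.
    rewrite Cmod2_conj, Cplus_conj.
    transitivity ((1 + w) * (Cconj w + w * Cconj w))%C; [|ring].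
    rewrite E. f_equal. replace (Cconj 1) with (RtoC 1) by (apply C_eq; simpl; ring). ring. }
  rewrite E1. clear E1.
  induction n as [|n IH]; [simpl; ring|].
  replace (2 * S n)%nat with (S (S (2 * n))) by lia. cbn [Cpow]. rewrite IH. ring.
Qed.

Lemma kern_pow_cancel (w : C) a b : Cmod w = 1 -> (w ^ (a + b) * Cconj w ^ a)%C = (w ^ b)%C.
Proof.
  intros H. induction a as [|a IH]; [simpl; ring|].
  replace (S a + b)%nat with (S (a + b)) by lia. simpl.
  transitivity ((w * Cconj w) * (w ^ (a + b) * Cconj w ^ a))%C; [ring|]. rewrite IH, unit_conj; [ring|exact H].
Qed.

(** Discrete orthogonality: the frequencies [k - n] of the kernel satisfy [|k - n| <= n < m], so
    over the [m]-th roots of unity all but the constant one sum to zero. The finite sum is therefore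
    exact and no integral is required. *)
Lemma kern_sum n m z : (n < m)%nat -> Cmod z = 1 ->
  Rsum (fun j => kern n (z * Cconj (unit_root m ^ j))%C) m = INR m * bin (2 * n) n.
Proof.
  intros Hm Hz. apply RtoC_inj. rewrite <- Csum_RtoC.
  set (o := unit_root m).
  assert (Ho : Cmod o = 1) by apply Cmod_cis.
  assert (Hw : forall j, Cmod (z * Cconj (o ^ j)) = 1).
  { intros j. rewrite Cmod_mult, Cmod_conj, Cpow_unit, Hz by exact Ho. ring. }
  rewrite (Csum_ext _ (fun j => Csum (fun k => RtoC (bin (2 * n) k) * ((z * Cconj (o ^ j)) ^ k * Cconj (z * Cconj (o ^ j)) ^ n))%C (S (2 * n)))).
  2:{ intros j _. rewrite kern_C, Cbinomial by apply Hw.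
      rewrite Cmult_comm, <- Csum_scal. apply Csum_ext; intros; ring. }
  rewrite Csum_swap.
  rewrite (Csum_single _ _ n); [|lia|].
  - rewrite (Csum_ext _ (fun _ => RtoC (bin (2 * n) n))).
    + rewrite Csum_RtoC. f_equal. generalize (bin (2 * n) n); intros c. clear.
      induction m as [|m IH]; [simpl; ring|]. simpl Rsum. rewrite S_INR, IH; ring.
    + intros j _. assert (E := kern_pow_cancel _ n 0 (Hw j)). rewrite Nat.add_0_r in E. rewrite E. simpl; ring.
  - intros k Hk Hkn. rewrite Csum_scal.
    rewrite (Csum_ext _ (fun j => (z ^ k * Cconj z ^ n) * (Cconj o ^ k * o ^ n) ^ j)%C).
    2:{ intros j _. rewrite Cmult_conj, !Cpow_conj, Cconj_conj.
        rewrite !Cpow_mult_l. rewrite <- !Cpow_mult_r. rewrite (Nat.mul_comm j k), (Nat.mul_comm j n). ring. }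
    rewrite Csum_scal, geom_zero; [ring| |].
    + intros E.
      destruct (Nat.lt_ge_cases k n) as [Hlt|Hge].
      * apply (unit_root_pow_neq m (n - k)); [lia|]. fold o.
        rewrite <- (kern_pow_cancel o k (n - k) Ho). replace (k + (n - k))%nat with n by lia.
        rewrite <- E; ring.
      * apply (unit_root_pow_neq m (k - n)); [lia|]. fold o.
        apply (f_equal Cconj) in E. rewrite Cmult_conj, !Cpow_conj, Cconj_conj in E.
        rewrite <- (kern_pow_cancel o n (k - n) Ho). replace (n + (k - n))%nat with k by lia.
        rewrite E. apply C_eq; simpl; ring.
    + rewrite Cpow_mult_l, <- !Cpow_mult_r, (Nat.mul_comm k m), (Nat.mul_comm n m), !Cpow_mult_r.
      rewrite <- Cpow_conj. unfold o. rewrite unit_root_pow by lia.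
      replace (Cconj 1) with (RtoC 1) by (apply C_eq; simpl; ring).
      rewrite !Cpow_1_l; ring.
Qed.

Fixpoint ppow (l : list C) (n : nat) : list C :=
  match n with O => RtoC 1 :: nil | S n' => pmul l (ppow l n') end.

Fixpoint psum (f : nat -> list C) (n : nat) : list C :=
  match n with O => nil | S n' => padd (psum f n') (f n') end.

Lemma peval_ppow l n z : peval (ppow l n) z = (peval l z ^ n)%C.
Proof. induction n as [|n IH]; simpl; [ring|]. rewrite peval_pmul, IH; reflexivity. Qed.

Lemma peval_psum f n z : peval (psum f n) z = Csum (fun k => peval (f k) z) n.
Proof. induction n as [|n IH]; simpl; [reflexivity|]. rewrite peval_padd, IH; reflexivity. Qed.

Definition circle_uc (g : C -> C) : Prop :=
  forall eps, 0 < eps -> exists del, 0 < del /\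
    forall z w, Cmod z = 1 -> Cmod w = 1 -> Cmod (z - w) < del -> Cmod (g z - g w) < eps.

Lemma kern_ge0 n w : 0 <= kern n w.
Proof. apply pow_le. pose proof (Cmod_ge_0 (1 + w)); nra. Qed.

(** By the parallelogram law [|z - v|^2 = 4 - |1 + w|^2] for [w = z / v], so the moment is
    [4 kern n - kern (S n)] and both masses are known. *)
Lemma kern_moment n m z : (S n < m)%nat -> Cmod z = 1 ->
  Rsum (fun j => kern n (z * Cconj (unit_root m ^ j))%C *
    (Cmod (z - unit_root m ^ j) * Cmod (z - unit_root m ^ j))) m
  = INR m * bin (2 * n) n * (2 / (INR n + 1)).
Proof.
  intros Hm Hz. set (o := unit_root m). assert (Ho : Cmod o = 1) by apply Cmod_cis.
  rewrite (Rsum_ext _ (fun j => 4 * kern n (z * Cconj (o ^ j))%C + (-1) * kern (S n) (z * Cconj (o ^ j))%C)).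
  - rewrite Rsum_plus, !Rsum_scal. unfold o. rewrite !kern_sum by (auto; lia).
    pose proof (bin_central n). pose proof (pos_INR n).
    replace (bin (2 * S n) (S n)) with ((4 * INR n + 2) * bin (2 * n) n / (INR n + 1)).
    + field; lra.
    + rewrite <- H. field; lra.
  - intros j _. set (v := (o ^ j)%C). assert (Hv : Cmod v = 1) by (apply Cpow_unit, Ho).
    set (w := (z * Cconj v)%C).
    assert (E : Cmod (z - v) * Cmod (z - v) = 4 - Cmod (1 + w) * Cmod (1 + w)).
    { replace (z - v)%C with ((w - 1) * v)%C.
      - rewrite Cmod_mult, Hv.
        assert (Hw : Cmod w = 1) by (unfold w; rewrite Cmod_mult, Cmod_conj, Hz, Hv; ring).
        pose proof (Cmod_sq w) as Ew. rewrite Hw in Ew.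
        replace (Cmod (w - 1) * 1 * (Cmod (w - 1) * 1)) with (Cmod (w - 1) * Cmod (w - 1)) by ring.
        rewrite !Cmod_sq. destruct w as [a b]; simpl in *. nra.
      - unfold w. transitivity (z * (v * Cconj v) - v)%C; [ring|]. rewrite unit_conj by exact Hv. ring. }
    rewrite E. unfold kern. simpl pow. ring.
Qed.

(** The approximant is the average of the values of [g] at roots of unity against the kernel. As in
    Bernstein's proof, nodes closer than [del] cost at most [eta / 2], and the others are bounded by
    the second moment divided by [del^2]. *)
Lemma circle_weierstrass (g : C -> C) G eta : circle_uc g ->
  (forall z, Cmod z = 1 -> Cmod (g z) <= G) -> 0 < eta ->
  exists d P, forall z, Cmod z = 1 -> Cmod (Cconj z ^ d * peval P z - g z) <= eta.
Proof.
  intros Hg HG He.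
  destruct (Hg (eta / 2)) as (del & Hdel & Hu); [lra|].
  assert (HG0 : 0 <= G).
  { eapply Rle_trans; [apply (Cmod_ge_0 (g 1))|]. apply HG. apply Cmod_1. }
  (* Makes the far contribution [(2 G / del^2) * 2 / (n + 1)] at most [eta / 2]. *)
  destruct (INR_unbounded (2 * G * 2 / (del * del) / (eta / 2))) as [n Hn].
  set (m := S (S n)). set (o := unit_root m). assert (Ho : Cmod o = 1) by apply Cmod_cis.
  set (A := INR m * bin (2 * n) n).
  assert (HA : 0 < A).
  { apply Rmult_lt_0_compat; [apply lt_0_INR; unfold m; lia|apply bin_pos; lia]. }
  (* In [kern_C] the factor [Cconj w ^ n] with [w = z * Cconj (o^j)] splits: [(o^j)^n] goes into the
     coefficient and [Cconj z ^ n] stays in front of the polynomial. *)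
  exists n, (psum (fun j => pscale (g (o ^ j)%C * (o ^ j) ^ n / RtoC A)%C
     (ppow (RtoC 1 :: Cconj (o ^ j)%C :: nil) (2 * n))) m).
  intros z Hz.
  assert (E : (Cconj z ^ n * peval (psum (fun j => pscale (g (o ^ j)%C * (o ^ j) ^ n / RtoC A)%C
     (ppow (RtoC 1 :: Cconj (o ^ j)%C :: nil) (2 * n))) m) z - g z)%C =
     Csum (fun j => (g (o ^ j) - g z) * RtoC (kern n (z * Cconj (o ^ j)) / A))%C m).
  { rewrite peval_psum, <- Csum_scal.
    rewrite (Csum_ext _ (fun j => g (o ^ j) * RtoC (kern n (z * Cconj (o ^ j)) / A))%C).
    - rewrite (Csum_ext (fun j => (g (o ^ j) - g z) * RtoC (kern n (z * Cconj (o ^ j)) / A))%C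
        (fun j => g (o ^ j) * RtoC (kern n (z * Cconj (o ^ j)) / A) + (- g z) * RtoC (kern n (z * Cconj (o ^ j)) / A))%C)
        by (intros; ring).
      rewrite Csum_plus, Csum_scal, Csum_RtoC.
      replace (Rsum (fun k => kern n (z * Cconj (o ^ k))%C / A) m) with 1; [ring|].
      rewrite (Rsum_ext _ (fun j => / A * kern n (z * Cconj (o ^ j))%C)) by (intros; unfold Rdiv; ring).
      rewrite Rsum_scal. unfold o. rewrite kern_sum by (unfold m; auto; lia). unfold A. field.
      split; [apply Rgt_not_eq, bin_pos; lia | apply not_0_INR; unfold m; lia].
    - intros j _. rewrite peval_pscale, peval_ppow.
      set (v := (o ^ j)%C). assert (Hv : Cmod v = 1) by (apply Cpow_unit, Ho).
      rewrite RtoC_div by lra. rewrite kern_C by (rewrite Cmod_mult, Cmod_conj, Hz, Hv; ring).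
      cbn [peval]. rewrite Cmult_conj, Cconj_conj, Cpow_mult_l.
      replace (1 + z * (Cconj v + z * 0))%C with (1 + z * Cconj v)%C by ring. unfold Cdiv; ring. }
  rewrite E. eapply Rle_trans; [apply Cmod_Csum|].
  apply Rle_trans with (Rsum (fun j => eta / 2 / A * kern n (z * Cconj (o ^ j))%C
     + 2 * G / (del * del) / A * (kern n (z * Cconj (o ^ j))%C * (Cmod (z - o ^ j) * Cmod (z - o ^ j)))) m).
  - apply Rsum_le. intros j _. set (v := (o ^ j)%C). assert (Hv : Cmod v = 1) by (apply Cpow_unit, Ho).
    rewrite Cmod_mult, Cmod_R, Rabs_right.
    2:{ apply Rle_ge, Rdiv_le_0_compat; [apply kern_ge0|lra]. }
    set (k := kern n (z * Cconj v)%C). assert (Hk : 0 <= k) by apply kern_ge0.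
    set (h := Cmod (z - v)). assert (Hh : 0 <= h) by apply Cmod_ge_0.
    assert (Hb : Cmod (g v - g z) <= eta / 2 + 2 * G / (del * del) * (h * h)).
    { assert (0 <= 2 * G / (del * del)) by (apply Rdiv_le_0_compat; nra).
      destruct (Rlt_le_dec h del) as [Hlt|Hge].
      - assert (Cmod (g v - g z) < eta / 2) by (apply Hu; auto; rewrite Cmod_sym; exact Hlt). nra.
      - assert (Cmod (g v - g z) <= 2 * G).
        { replace (g v - g z)%C with (g v + - g z)%C by ring. eapply Rle_trans; [apply Cmod_triangle|].
          rewrite Cmod_opp. pose proof (HG v Hv); pose proof (HG z Hz); lra. }
        assert (2 * G <= 2 * G / (del * del) * (h * h)).
        { replace (2 * G) with (2 * G / (del * del) * (del * del)) at 1 by (field; lra).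
          apply Rmult_le_compat_l; nra. }
        lra. }
    apply Rle_trans with ((eta / 2 + 2 * G / (del * del) * (h * h)) * (k / A)).
    + apply Rmult_le_compat_r; [apply Rdiv_le_0_compat; lra|exact Hb].
    + right; field; split; lra.
  - rewrite Rsum_plus, !Rsum_scal. unfold o. rewrite kern_sum, kern_moment by (unfold m; auto; lia).
    fold A. pose proof (pos_INR n).
    replace (eta / 2 / A * A) with (eta / 2) by (field; lra).
    replace (2 * G / (del * del) / A * (A * (2 / (INR n + 1)))) with ((2 * G * 2 / (del * del)) / (INR n + 1)) by (field; lra).
    assert (2 * G * 2 / (del * del) / (INR n + 1) <= eta / 2); [|lra].
    apply Rmult_le_reg_r with (INR n + 1); [lra|]. unfold Rdiv at 1. rewrite Rmult_assoc, Rinv_l by lra.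
    rewrite Rmult_1_r.
    apply (Rmult_lt_compat_r (eta / 2)) in Hn; [|lra].
    replace (2 * G * 2 / (del * del) / (eta / 2) * (eta / 2)) with (2 * G * 2 / (del * del)) in Hn by (field; lra).
    nra.
Qed.

(** * Compactness and uniform continuity *)

(** Compactness in gauge form: the radius may depend on the centre, and centres lie in [K], where
    local hypotheses are available. *)
Definition covers {T : Type} (d : T -> T -> R) (K : T -> Prop) : Prop :=
  forall del : T -> R, (forall t, K t -> 0 < del t) ->
    exists l : list T, (forall t, In t l -> K t) /\
      forall x, K x -> exists t, In t l /\ d x t < del t.

(** The passage from local to uniform constants, used for every compactness argument of this kind:
    take the least of the finitely many local constants. Upper bounds fit the scheme by writing them
    as [/ m]. *)
Lemma covers_uniform {T : Type} (d : T -> T -> R) (K : T -> Prop) (P : T -> R -> Prop) :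
  covers d K -> (forall x m m', P x m -> 0 < m' <= m -> P x m') ->
  (forall x, K x -> exists del m, 0 < del /\ 0 < m /\ forall y, K y -> d y x < del -> P y m) ->
  exists m, 0 < m /\ forall y, K y -> P y m.
Proof.
  intros HK Hmono Hloc.
  assert (Hex : exists dm : T -> R * R, forall x, K x -> 0 < fst (dm x) /\ 0 < snd (dm x) /\
     forall y, K y -> d y x < fst (dm x) -> P y (snd (dm x))).
  { exists (fun x => epsilon (inhabits (0, 0)) (fun p : R * R => 0 < fst p /\ 0 < snd p /\
      forall y, K y -> d y x < fst p -> P y (snd p))).
    intros x Hx. apply epsilon_spec. destruct (Hloc x Hx) as (e & m & H). now exists (e, m). }
  destruct Hex as [dm Hdm].
  destruct (HK (fun x => fst (dm x))) as (l & Hl & Hc); [intros t Ht; apply Hdm, Ht|].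
  assert (Hm : exists m, 0 < m /\ forall t, In t l -> m <= snd (dm t)).
  { clear Hc. induction l as [|a l IH]; [exists 1; split; [lra|intros ? []]|].
    destruct IH as (m & Hm & H); [intros; apply Hl; now right|].
    assert (Ha : 0 < snd (dm a)) by (apply Hdm, Hl; now left).
    exists (Rmin m (snd (dm a))); split; [now apply Rmin_glb_lt|].
    intros t [<-|Ht]; [apply Rmin_r|]. eapply Rle_trans; [apply Rmin_l|auto]. }
  destruct Hm as (m & Hm & Hml). exists m; split; [exact Hm|].
  intros y Hy. destruct (Hc y Hy) as (t & Ht & Hd).
  apply Hmono with (snd (dm t)); [apply Hdm; auto|split; auto].
Qed.

(** Extend the gauge to points outside the closed set [K] by radii so small that their balls miss
    [K]; such centres can then be dropped from the list. *)
Lemma covers_of_grid {T : Type} (d : T -> T -> R) (K : T -> Prop) :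
  (forall del : T -> posreal, exists l : list T, forall x, K x -> exists t, In t l /\ d x t < del t) ->
  (forall x, ~ K x -> exists r, 0 < r /\ forall y, d y x < r -> ~ K y) ->
  covers d K.
Proof.
  intros Hg Hcl del Hdel.
  assert (Hex : exists del' : T -> posreal, forall x,
     (K x -> pos (del' x) = del x) /\ (~ K x -> forall y, d y x < del' x -> ~ K y)).
  { exists (fun x => epsilon (inhabits (mkposreal 1 Rlt_0_1)) (fun p : posreal =>
      (K x -> pos p = del x) /\ (~ K x -> forall y, d y x < p -> ~ K y))).
    intros x. apply epsilon_spec. destruct (classic (K x)) as [Hx|Hx].
    - exists (mkposreal _ (Hdel x Hx)). split; [reflexivity|tauto].
    - destruct (Hcl x Hx) as (r & Hr & H). exists (mkposreal r Hr). split; [tauto|intros _; exact H]. }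
  destruct Hex as [del' Hd'].
  destruct (Hg del') as [l Hl].
  exists (filter (fun t => if excluded_middle_informative (K t) then true else false) l).
  split.
  - intros t Ht. apply filter_In in Ht as [_ Ht].
    destruct (excluded_middle_informative (K t)); [assumption|discriminate].
  - intros x Hx. destruct (Hl x Hx) as (t & Ht & Hxt).
    assert (Kt : K t) by (apply NNPP; intros Hn; exact (proj2 (Hd' t) Hn x Hxt Hx)).
    exists t. split.
    + apply filter_In; split; [exact Ht|]. destruct (excluded_middle_informative (K t)); tauto.
    + rewrite <- (proj1 (Hd' t) Kt); exact Hxt.
Qed.

Definition distC (z w : C) : R := Cmod (z - w).

Definition dist3 (p q : P3) : R := enorm3 (sub3 p q).

Lemma covers_C (K : C -> Prop) M :
  (forall z, K z -> Cmod z <= M) ->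
  (forall x, ~ K x -> exists r, 0 < r /\ forall y, distC y x < r -> ~ K y) -> covers distC K.
Proof.
  intros HM Hcl. apply covers_of_grid; [|exact Hcl]. intros del.
  set (a := (- M, (- M, tt)) : Compactness.Tn 2 R). set (b := (M, (M, tt)) : Compactness.Tn 2 R).
  set (tc := fun x : Compactness.Tn 2 R => (fst x, fst (snd x)) : C).
  (* The finite cover consists of coordinate boxes; half of the radius in each of two coordinates
     stays within the Euclidean ball. *)
  set (de := fun x : Compactness.Tn 2 R => pos_div_2 (del (tc x))).
  destruct (NNPP _ (compactness_list 2 a b de)) as [l Hl].
  exists (map tc l). intros z Hz.
  destruct (Hl ((fst z, (snd z, tt)) : Compactness.Tn 2 R)) as (t & Ht & _ & Hct).
  - specialize (HM z Hz). pose proof (Cmod_ge_abs_re z); pose proof (Cmod_ge_abs_im z).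
    assert (Rabs (fst z) <= M) by lra. assert (Rabs (snd z) <= M) by lra.
    apply Rabs_le_between in H1, H2. simpl. repeat split; try exact I; lra.
  - exists (tc t). split; [now apply in_map|]. destruct t as [t1 [t2 []]].
    simpl in Hct. destruct Hct as (H1 & H2 & _).
    unfold distC. eapply Rle_lt_trans; [apply Cmod_le_sum|].
    unfold tc, de in *. simpl in *. unfold tc in *; simpl in *.
    unfold Rminus in *. lra.
Qed.

Lemma covers_P3 (K : P3 -> Prop) M :
  (forall z, K z -> enorm3 z <= M) ->
  (forall x, ~ K x -> exists r, 0 < r /\ forall y, dist3 y x < r -> ~ K y) -> covers dist3 K.
Proof.
  intros HM Hcl. apply covers_of_grid; [|exact Hcl]. intros del.
  set (a := (- M, (- M, (- M, tt))) : Compactness.Tn 3 R). set (b := (M, (M, (M, tt))) : Compactness.Tn 3 R).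
  set (tc := fun x : Compactness.Tn 3 R => mk3 (fst x) (fst (snd x)) (fst (snd (snd x)))).
  assert (H4 : forall x, 0 < del x / 4) by (intros x; pose proof (cond_pos (del x)); lra).
  set (de := fun x : Compactness.Tn 3 R => mkposreal _ (H4 (tc x))).
  destruct (NNPP _ (compactness_list 3 a b de)) as [l Hl].
  exists (map tc l). intros z Hz.
  destruct (Hl ((px z, (py z, (pz z, tt))) : Compactness.Tn 3 R)) as (t & Ht & _ & Hct).
  - specialize (HM z Hz). pose proof (px_le z); pose proof (py_le z); pose proof (pz_le z).
    assert (Rabs (px z) <= M) by lra. assert (Rabs (py z) <= M) by lra. assert (Rabs (pz z) <= M) by lra.
    apply Rabs_le_between in H2, H3, H5. simpl. repeat split; try exact I; lra.
  - exists (tc t). split; [now apply in_map|]. destruct t as [t1 [t2 [t3 []]]].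
    simpl in Hct. destruct Hct as (H1 & H2 & H3 & _).
    unfold dist3. eapply Rle_lt_trans; [apply enorm3_le_sum|].
    vunf. unfold de, tc in *. simpl in *. unfold tc in *; simpl in *.
    repeat (rewrite px_mk || rewrite py_mk || rewrite pz_mk).
    pose proof (cond_pos (del (mk3 t1 t2 t3))). lra.
Qed.

Lemma covers_circle : covers distC (fun z => Cmod z = 1).
Proof.
  apply covers_C with 1; [intros; lra|]. intros x Hx.
  exists (Rabs (Cmod x - 1)). split; [apply Rabs_pos_lt; lra|].
  intros y Hy E. unfold distC in Hy. pose proof (Cmod_diff y x). rewrite E in H.
  rewrite Rabs_minus_sym in H. lra.
Qed.

Lemma covers_cdisk M : covers distC (fun z => Cmod z <= M).
Proof.
  apply covers_C with M; [auto|]. intros x Hx.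
  exists (Cmod x - M). split; [lra|]. intros y Hy E. unfold distC in Hy.
  pose proof (Cmod_diff y x). rewrite Rabs_minus_sym in H. pose proof (Rle_abs (Cmod x - Cmod y)). lra.
Qed.

Lemma cont_pos_min (K : C -> Prop) (h : C -> R) : covers distC K ->
  (forall z, K z -> 0 < h z) ->
  (forall z, K z -> forall eps, 0 < eps -> exists del, 0 < del /\
     forall w, K w -> Cmod (w - z) < del -> Rabs (h w - h z) < eps) ->
  exists m, 0 < m /\ forall z, K z -> m <= h z.
Proof.
  intros HK Hpos Hc. apply (covers_uniform distC K (fun z m => m <= h z) HK); [intros; lra|].
  intros x Hx. destruct (Hc x Hx (h x / 2)) as (del & Hdel & H); [specialize (Hpos x Hx); lra|].
  exists del, (h x / 2). specialize (Hpos x Hx). repeat split; try lra.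
  intros y Hy Hd. specialize (H y Hy Hd). apply Rabs_lt_between in H. lra.
Qed.

(** * Uniformly continuous functions on the circle *)

Definition circle_ucr (g : C -> R) : Prop :=
  forall eps, 0 < eps -> exists del, 0 < del /\
    forall z w, Cmod z = 1 -> Cmod w = 1 -> Cmod (z - w) < del -> Rabs (g z - g w) < eps.

Definition circle_ucv (g : C -> P3) : Prop :=
  forall eps, 0 < eps -> exists del, 0 < del /\
    forall z w, Cmod z = 1 -> Cmod w = 1 -> Cmod (z - w) < del -> enorm3 (sub3 (g z) (g w)) < eps.

Lemma ucr_pos_min h : circle_ucr h -> (forall z, Cmod z = 1 -> 0 < h z) ->
  exists m, 0 < m /\ forall z, Cmod z = 1 -> m <= h z.
Proof.
  intros Hu Hp. apply cont_pos_min; [apply covers_circle|exact Hp|].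
  intros z Hz e He. destruct (Hu e He) as (d & Hd & H). exists d; split; [exact Hd|]. intros; now apply H.
Qed.

Lemma uc_bounded g : circle_uc g -> exists G, 0 < G /\ forall z, Cmod z = 1 -> Cmod (g z) <= G.
Proof.
  intros Hu. destruct (Hu 1 Rlt_0_1) as (d & Hd & H).
  destruct (covers_uniform distC (fun z => Cmod z = 1) (fun z m => Cmod (g z) <= / m) covers_circle) as (m & Hm & Hb).
  - intros x m m' Hx Hm. eapply Rle_trans; [apply Hx|]. apply Rinv_le_contravar; lra.
  - intros x Hx. pose proof (Cmod_ge_0 (g x)). exists d, (/ (Cmod (g x) + 1)).
    split; [exact Hd|]. split; [apply Rinv_0_lt_compat; lra|].
    intros y Hy Hd'. rewrite Rinv_inv. specialize (H y x Hy Hx Hd').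
    pose proof (Cmod_diff (g y) (g x)). apply Rabs_le_between in H1. lra.
  - exists (/ m). split; [now apply Rinv_0_lt_compat|exact Hb].
Qed.

Lemma uc_plus f g : circle_uc f -> circle_uc g -> circle_uc (fun z => f z + g z)%C.
Proof.
  intros Hf Hg e He. destruct (Hf (e/2)) as (d1 & ? & H1); [lra|]. destruct (Hg (e/2)) as (d2 & ? & H2); [lra|].
  exists (Rmin d1 d2); split; [now apply Rmin_glb_lt|]. intros z w Hz Hw Hd.
  pose proof (Rmin_l d1 d2); pose proof (Rmin_r d1 d2).
  specialize (H1 z w Hz Hw ltac:(lra)); specialize (H2 z w Hz Hw ltac:(lra)).
  replace (f z + g z - (f w + g w))%C with ((f z - f w) + (g z - g w))%C by ring.
  eapply Rle_lt_trans; [apply Cmod_triangle|]; lra.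
Qed.

Lemma uc_mult f g : circle_uc f -> circle_uc g -> circle_uc (fun z => f z * g z)%C.
Proof.
  intros Hf Hg e He.
  destruct (uc_bounded f Hf) as (F & HF & HFb). destruct (uc_bounded g Hg) as (G & HG & HGb).
  destruct (Hf (e/(2*G))) as (d1 & ? & H1); [apply Rdiv_lt_0_compat; lra|].
  destruct (Hg (e/(2*F))) as (d2 & ? & H2); [apply Rdiv_lt_0_compat; lra|].
  exists (Rmin d1 d2); split; [now apply Rmin_glb_lt|]. intros z w Hz Hw Hd.
  pose proof (Rmin_l d1 d2); pose proof (Rmin_r d1 d2).
  specialize (H1 z w Hz Hw ltac:(lra)); specialize (H2 z w Hz Hw ltac:(lra)).
  replace (f z * g z - f w * g w)%C with ((f z - f w) * g z + f w * (g z - g w))%C by ring.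
  eapply Rle_lt_trans; [apply Cmod_triangle|]. rewrite !Cmod_mult.
  specialize (HFb w Hw). specialize (HGb z Hz).
  pose proof (Cmod_ge_0 (f w)); pose proof (Cmod_ge_0 (g z)).
  pose proof (Cmod_ge_0 (f z - f w)); pose proof (Cmod_ge_0 (g z - g w)).
  assert (Cmod (f z - f w) * Cmod (g z) <= Cmod (f z - f w) * G) by nra.
  assert (Cmod (f w) * Cmod (g z - g w) <= F * Cmod (g z - g w)) by nra.
  assert (E1 : e / (2 * G) * G = e / 2) by (field; lra).
  assert (E2 : F * (e / (2 * F)) = e / 2) by (field; lra). nra.
Qed.

Lemma uc_const c : circle_uc (fun _ => c).
Proof.
  intros e He; exists 1; split; [lra|]. intros. replace (c - c)%C with (RtoC 0) by ring. rewrite Cmod_0; lra.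
Qed.

Lemma uc_id : circle_uc (fun z => z).
Proof. intros e He; exists e; split; auto. Qed.

Lemma uc_ext f g : (forall z, Cmod z = 1 -> f z = g z) -> circle_uc f -> circle_uc g.
Proof.
  intros E Hf e He. destruct (Hf e He) as (d & Hd & H). exists d; split; [exact Hd|].
  intros z w Hz Hw Hzw. rewrite <- !E by assumption. auto.
Qed.

Lemma uc_RtoC h : circle_ucr h -> circle_uc (fun z => RtoC (h z)).
Proof.
  intros Hh e He. destruct (Hh e He) as (d & Hd & H). exists d; split; [exact Hd|].
  intros z w Hz Hw Hzw. rewrite <- RtoC_minus, Cmod_R. auto.
Qed.

Lemma ucr_RtoC h : circle_uc (fun z => RtoC (h z)) -> circle_ucr h.
Proof.
  intros Hh e He. destruct (Hh e He) as (d & Hd & H). exists d; split; [exact Hd|].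
  intros z w Hz Hw Hzw. rewrite <- Cmod_R, RtoC_minus. auto.
Qed.

Lemma ucr_re f : circle_uc f -> circle_ucr (fun z => fst (f z)).
Proof.
  intros Hh e He. destruct (Hh e He) as (d & Hd & H). exists d; split; [exact Hd|].
  intros z w Hz Hw Hzw. eapply Rle_lt_trans; [|apply (H z w Hz Hw Hzw)].
  apply (Cmod_ge_abs_re (f z - f w)%C).
Qed.

Lemma ucr_plus f g : circle_ucr f -> circle_ucr g -> circle_ucr (fun z => f z + g z).
Proof.
  intros Hf Hg. apply ucr_RtoC. apply (uc_ext (fun z => RtoC (f z) + RtoC (g z))%C); [intros; now rewrite RtoC_plus|].
  apply uc_plus; now apply uc_RtoC.
Qed.

Lemma ucr_mult f g : circle_ucr f -> circle_ucr g -> circle_ucr (fun z => f z * g z).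
Proof.
  intros Hf Hg. apply ucr_RtoC. apply (uc_ext (fun z => RtoC (f z) * RtoC (g z))%C); [intros; now rewrite RtoC_mult|].
  apply uc_mult; now apply uc_RtoC.
Qed.

Lemma ucr_const c : circle_ucr (fun _ => c).
Proof. intros e He; exists 1; split; [lra|]. intros; unfold Rminus; rewrite Rplus_opp_r, Rabs_R0; lra. Qed.

Lemma ucr_minus f g : circle_ucr f -> circle_ucr g -> circle_ucr (fun z => f z - g z).
Proof.
  intros Hf Hg. assert (H := ucr_plus _ _ Hf (ucr_mult _ _ (ucr_const (-1)) Hg)).
  intros e He. destruct (H e He) as (d & Hd & H'). exists d; split; [exact Hd|].
  intros z w Hz Hw Hzw. specialize (H' z w Hz Hw Hzw).
  replace (f z - g z - (f w - g w)) with (f z + -1 * g z - (f w + -1 * g w)) by ring. exact H'.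
Qed.

Lemma ucr_sqrt f : circle_ucr f -> (forall z, Cmod z = 1 -> 0 <= f z) -> circle_ucr (fun z => sqrt (f z)).
Proof.
  (* For nonnegative numbers the square of a difference of square roots is at most the difference of
     the numbers. *)
  intros Hf Hp e He. destruct (Hf (e * e)) as (d & Hd & H); [nra|]. exists d; split; [exact Hd|].
  intros z w Hz Hw Hzw. specialize (H z w Hz Hw Hzw).
  assert (Hz0 := Hp z Hz). assert (Hw0 := Hp w Hw).
  assert (S1 := sqrt_sqrt _ Hz0). assert (S2 := sqrt_sqrt _ Hw0).
  assert (P1 := sqrt_pos (f z)). assert (P2 := sqrt_pos (f w)).
  set (a := sqrt (f z)) in *. set (b := sqrt (f w)) in *.
  rewrite <- S1, <- S2 in H. apply Rabs_lt_between in H. apply Rabs_lt_between. split; nra.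
Qed.

Lemma ucr_inv f m : 0 < m -> (forall z, Cmod z = 1 -> m <= f z) -> circle_ucr f -> circle_ucr (fun z => / f z).
Proof.
  intros Hm Hp Hf e He. destruct (Hf (e * (m * m))) as (d & Hd & H); [apply Rmult_lt_0_compat; nra|].
  exists d; split; [exact Hd|]. intros z w Hz Hw Hzw. specialize (H z w Hz Hw Hzw).
  assert (Hz0 := Hp z Hz). assert (Hw0 := Hp w Hw).
  replace (/ f z - / f w) with (- (f z - f w) / (f z * f w)) by (field; split; lra).
  unfold Rdiv. rewrite Rabs_mult, Rabs_Ropp, (Rabs_right (/ (f z * f w))).
  2:{ apply Rle_ge; left; apply Rinv_0_lt_compat; nra. }
  apply Rmult_lt_reg_r with (f z * f w); [nra|]. rewrite Rmult_assoc, Rinv_l by nra.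
  rewrite Rmult_1_r. eapply Rlt_le_trans; [apply H|]. apply Rmult_le_compat_l; [lra|]. nra.
Qed.

Lemma uc_peval l : circle_uc (peval l).
Proof.
  induction l as [|c l IH]; [apply uc_const|].
  apply (uc_plus (fun _ => c) (fun z => z * peval l z)%C); [apply uc_const|]. apply uc_mult; [apply uc_id|exact IH].
Qed.

Lemma ucv_px g : circle_ucv g -> circle_ucr (fun z => px (g z)).
Proof.
  intros Hg e He. destruct (Hg e He) as (d & Hd & H). exists d; split; [exact Hd|].
  intros z w Hz Hw Hzw. eapply Rle_lt_trans; [apply (px_le (sub3 (g z) (g w)))|]. auto.
Qed.

Lemma ucv_py g : circle_ucv g -> circle_ucr (fun z => py (g z)).
Proof.
  intros Hg e He. destruct (Hg e He) as (d & Hd & H). exists d; split; [exact Hd|].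
  intros z w Hz Hw Hzw. eapply Rle_lt_trans; [apply (py_le (sub3 (g z) (g w)))|]. auto.
Qed.

Lemma ucv_pz g : circle_ucv g -> circle_ucr (fun z => pz (g z)).
Proof.
  intros Hg e He. destruct (Hg e He) as (d & Hd & H). exists d; split; [exact Hd|].
  intros z w Hz Hw Hzw. eapply Rle_lt_trans; [apply (pz_le (sub3 (g z) (g w)))|]. auto.
Qed.

Lemma ucv_mk f g h : circle_ucr f -> circle_ucr g -> circle_ucr h -> circle_ucv (fun z => mk3 (f z) (g z) (h z)).
Proof.
  intros Hf Hg Hh e He.
  destruct (Hf (e/3)) as (d1 & ? & H1); [lra|]. destruct (Hg (e/3)) as (d2 & ? & H2); [lra|].
  destruct (Hh (e/3)) as (d3 & ? & H3); [lra|].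
  exists (Rmin (Rmin d1 d2) d3); split; [repeat apply Rmin_glb_lt; lra|]. intros z w Hz Hw Hd.
  pose proof (Rmin_l (Rmin d1 d2) d3); pose proof (Rmin_r (Rmin d1 d2) d3).
  pose proof (Rmin_l d1 d2); pose proof (Rmin_r d1 d2).
  specialize (H1 z w Hz Hw ltac:(lra)); specialize (H2 z w Hz Hw ltac:(lra)); specialize (H3 z w Hz Hw ltac:(lra)).
  eapply Rle_lt_trans; [apply enorm3_le_sum|]. vunf. lra.
Qed.

(** * Lifting null vectors to spinors *)

(** As [z * Cconj z = 1] on the circle, conjugation becomes reversal of the conjugated coefficients,
    up to a power of [z]. Hence the real part of a Laurent polynomial is governed by a
    polynomial. *)
Lemma peval_conj_rev Q : forall n, (length Q <= S n)%nat ->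
  exists L, forall z, Cmod z = 1 -> peval L z = (z ^ n * Cconj (peval Q z))%C.
Proof.
  induction Q as [|c Q IH]; intros n Hn.
  - exists nil. intros z _. simpl. apply C_eq; simpl; ring.
  - destruct n as [|n].
    + exists (Cconj c :: nil). intros z _. destruct Q; [|simpl in Hn; lia].
      simpl. apply C_eq; simpl; ring.
    + destruct (IH n) as [L HL]; [simpl in Hn; lia|].
      exists (padd (pshift (S n) (Cconj c :: nil)) L). intros z Hz.
      rewrite peval_padd, peval_pshift, HL by exact Hz. cbn [peval].
      rewrite Cplus_conj, Cmult_conj. change (z ^ S n)%C with (z * z ^ n)%C.
      transitivity (z * z ^ n * Cconj c + z ^ n * Cconj (peval Q z) * (z * Cconj z))%C; [|ring].
      rewrite unit_conj by exact Hz. ring.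
Qed.

(** The approximation is chosen for its zero set: being that of a polynomial, it is either the whole
    circle or finite, which a merely continuous function does not guarantee. *)
Lemma real_circle_approx (g : C -> R) eta : circle_ucr g -> 0 < eta ->
  exists h L, circle_ucr h /\ (forall z, Cmod z = 1 -> Rabs (h z - g z) <= eta) /\
    forall z, Cmod z = 1 -> (h z = 0 <-> peval L z = 0%C).
Proof.
  intros Hg He. assert (Hg' := uc_RtoC _ Hg).
  destruct (uc_bounded _ Hg') as (G & HG & HGb).
  destruct (circle_weierstrass _ G eta Hg' HGb He) as (d & P & HP).
  destruct (peval_conj_rev P (length P) ltac:(lia)) as [R HR]. set (n := length P) in *.
  (* With [w = Cconj z ^ d * P z], the second witness evaluates on the circle to
     [z^(n+d) * (w + Cconj w)], that is [z^(n+d)] times twice the real part of [w]. *)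
  exists (fun z => fst (Cconj z ^ d * peval P z)%C), (padd (pshift n P) (pshift (2 * d) R)).
  split; [|split].
  - apply ucr_re. apply uc_mult; [|apply uc_peval].
    assert (Hc : circle_uc Cconj).
    { intros e Hee; exists e; split; [exact Hee|]. intros z w _ _ H.
      rewrite <- Cminus_conj, Cmod_conj; exact H. }
    clear - Hc. induction d as [|d IH]; [apply (uc_const (RtoC 1))|]. apply (uc_mult Cconj (fun z => Cconj z ^ d)%C); assumption.
  - intros z Hz. specialize (HP z Hz). eapply Rle_trans; [|apply HP].
    apply (Cmod_ge_abs_re (Cconj z ^ d * peval P z - RtoC (g z))%C).
  - intros z Hz. rewrite peval_padd, !peval_pshift, HR by exact Hz.
    set (w := (Cconj z ^ d * peval P z)%C).
    assert (E : (z ^ n * peval P z + z ^ (2 * d) * (z ^ n * Cconj (peval P z)))%C =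
      (z ^ (n + d) * RtoC (2 * fst w))%C).
    { assert (Ew : (RtoC (2 * fst w) = w + Cconj w)%C) by (apply C_eq; simpl; ring).
      rewrite Ew. unfold w. rewrite Cmult_conj, Cpow_conj, Cconj_conj, Cpow_add_r.
      replace (2 * d)%nat with (d + d)%nat by lia. rewrite Cpow_add_r.
      assert (E1 : (z ^ d * Cconj z ^ d = 1)%C).
      { rewrite <- Cpow_mult_l, unit_conj, Cpow_1_l by exact Hz. reflexivity. }
      transitivity (z ^ n * peval P z * (z ^ d * Cconj z ^ d) + z ^ d * z ^ d * (z ^ n * Cconj (peval P z)))%C.
      - rewrite E1; ring.
      - ring. }
    rewrite E. split; intros H.
    + rewrite H. replace (2 * 0) with 0 by ring. ring.
    + destruct (Req_dec (fst w) 0) as [Hw|Hw]; [exact Hw|exfalso].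
      apply (Cmult_neq_0 (z ^ (n + d)) (RtoC (2 * fst w)))%C; [| |exact H].
      * apply Cpow_nz. intros E0; rewrite E0, Cmod_0 in Hz; lra.
      * intros E0. apply RtoC_inj in E0. lra.
Qed.

(* Real part of [c] times the null vector (a^2-b^2, i(a^2+b^2), 2ab) of the spinor (a, b). *)
Definition nullv (c a b : C) : P3 :=
  mk3 (fst (c * (a * a - b * b))%C) (fst (c * (Ci * (a * a + b * b)))%C) (fst (c * (2 * (a * b)))%C).

Lemma nullv_sq c a b : dot3 (nullv c a b) (nullv c a b) =
  (Cmod c * Cmod c) * ((Cmod a * Cmod a + Cmod b * Cmod b) * (Cmod a * Cmod a + Cmod b * Cmod b)).
Proof.
  rewrite !Cmod_sq. unfold nullv. vunf. destruct c, a, b; simpl. ring.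
Qed.

Lemma enorm3_nullv c a b : enorm3 (nullv c a b) = Cmod c * (Cmod a * Cmod a + Cmod b * Cmod b).
Proof.
  pose proof (Cmod_ge_0 c); pose proof (Cmod_ge_0 a); pose proof (Cmod_ge_0 b).
  apply Rsqr_inj; [apply enorm3_ge0| |].
  - apply Rmult_le_pos; nra.
  - unfold Rsqr. rewrite enorm3_sq, nullv_sq. ring.
Qed.

Lemma nullv_dot c a b (n : P3) :
  dot3 (nullv c a b) n =
  fst (c * (a * a * (px n, py n) - b * b * (px n, Ropp (py n)) + 2 * (a * b) * RtoC (pz n)))%C.
Proof. unfold nullv. vunf. destruct c, a, b; simpl. ring. Qed.

(* The columns of the rank-one matrix ((m-n3, n1-i n2), (n1+i n2, m+n3)), m = |n|, are
   spinors whose null vectors span the plane orthogonal to n. *)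
Definition spin1 (m : R) (g : C) (n : P3) : C := (RtoC (m - pz n) + g * (px n, Ropp (py n)))%C.

Definition spin2 (m : R) (g : C) (n : P3) : C := ((px n, py n) + g * RtoC (m + pz n))%C.

(** The matrix has rank one, so any combination [(a, b)] of its columns satisfies the
    proportionality relations [E1] and [E2]. They annihilate the complex pairing of the null vector
    with [n], not only its real part; therefore the phase [c] is arbitrary. *)
Lemma spin_orth c m g n k : m * m = dot3 n n ->
  dot3 (nullv c (k * spin1 m g n)%C (k * spin2 m g n)%C) n = 0.
Proof.
  intros Hm. rewrite nullv_dot.
  set (a := spin1 m g n). set (b := spin2 m g n).
  assert (E0 : ((px n, py n) * (px n, Ropp (py n)) = RtoC (m - pz n) * RtoC (m + pz n))%C).
  { unfold dot3 in Hm. apply C_eq; simpl; nra. }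
  assert (E1 : (a * (px n, py n) = b * RtoC (m - pz n))%C).
  { unfold a, b, spin1, spin2. rewrite Cmult_plus_distr_r, <- Cmult_assoc, (Cmult_comm (px n, Ropp (py n))), E0. ring. }
  assert (E2 : (a * RtoC (m + pz n) = b * (px n, Ropp (py n)))%C).
  { unfold a, b, spin1, spin2. rewrite (Cmult_plus_distr_r (px n, py n)), E0. ring. }
  replace (k * a * (k * a) * (px n, py n) - k * b * (k * b) * (px n, Ropp (py n)) + 2 * (k * a * (k * b)) * RtoC (pz n))%C
    with (k * k * (a * (a * (px n, py n)) - b * (b * (px n, Ropp (py n))) + 2 * (a * b) * RtoC (pz n)))%C by ring.
  rewrite E1, <- E2.
  replace (a * (b * RtoC (m - pz n)) - b * (a * RtoC (m + pz n)) + 2 * (a * b) * RtoC (pz n))%C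
    with (RtoC 0); [rewrite !Cmult_0_r; reflexivity|].
  rewrite RtoC_minus, RtoC_plus. ring.
Qed.

(** A combination [column 1 + g * column 2] with constant [g] is continuous and gives the right
    plane; the difficulty is to choose [g] so that it vanishes nowhere on the circle. It can then be
    rescaled to have squared norm [tau]. *)
Lemma spinor_lift (nu : C -> P3) (tau : C -> R) eta :
  circle_ucv nu -> (forall z, Cmod z = 1 -> enorm3 (nu z) = 1) ->
  circle_ucr tau -> (forall z, Cmod z = 1 -> 0 <= tau z) -> 0 < eta ->
  exists a b, circle_uc a /\ circle_uc b /\
    (forall z, Cmod z = 1 -> Cmod (a z) * Cmod (a z) + Cmod (b z) * Cmod (b z) = tau z) /\
    forall z c, Cmod z = 1 -> Cmod c <= 1 -> Rabs (dot3 (nullv c (a z) (b z)) (nu z)) <= eta.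
Proof.
  intros Hnu Hn1 Htau Ht0 He.
  destruct (uc_bounded _ (uc_RtoC _ Htau)) as (T & HT & HTb).
  set (e' := Rmin (1 / 2) (eta / T)).
  assert (He' : 0 < e') by (apply Rmin_glb_lt; [lra|apply Rdiv_lt_0_compat; lra]).
  assert (He1 : e' <= 1 / 2) by apply Rmin_l. assert (He2 : e' <= eta / T) by apply Rmin_r.
  destruct (real_circle_approx (fun z => py (nu z)) e' (ucv_py _ Hnu) He') as (h & L & Hh & Hha & HL).
  (* Replacing one coordinate of the normal tilts the plane slightly; this is the only source of the
     error [eta], since orthogonality to [n] is exact. *)
  set (n := fun z => mk3 (px (nu z)) (h z) (pz (nu z))).
  set (m := fun z => sqrt (dot3 (n z) (n z))).
  assert (Hnd : forall z, Cmod z = 1 -> enorm3 (sub3 (n z) (nu z)) <= e').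
  { intros z Hz. eapply Rle_trans; [apply enorm3_le_sum|]. unfold n. vunf.
    unfold Rminus at 1 3. rewrite !Rplus_opp_r, Rabs_R0. specialize (Hha z Hz). lra. }
  assert (Hm : forall z, m z * m z = dot3 (n z) (n z)) by (intros; apply sqrt_sqrt, dot3_ge0).
  assert (Hm2 : forall z, Cmod z = 1 -> 1 / 2 <= m z).
  { intros z Hz. change (1 / 2 <= enorm3 (n z)). specialize (Hnd z Hz).
    pose proof (enorm3_diff (n z) (nu z)) as H. rewrite (Hn1 z Hz) in H. apply Rabs_le_between in H. lra. }
  assert (Hux : circle_ucr (fun z => px (nu z))) by now apply ucv_px.
  assert (Huz : circle_ucr (fun z => pz (nu z))) by now apply ucv_pz.
  assert (Hum : circle_ucr m).
  { apply ucr_sqrt; [|intros; apply dot3_ge0].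
    assert (H := ucr_plus _ _ (ucr_plus _ _ (ucr_mult _ _ Hux Hux) (ucr_mult _ _ Hh Hh)) (ucr_mult _ _ Huz Huz)).
    exact H. }
  assert (Hmz : forall z, Cmod z = 1 -> m z + pz (n z) <> 0 \/ (m z + pz (n z) = 0 /\ px (n z) = 0 /\ py (n z) = 0 /\ m z - pz (n z) > 0)).
  { intros z Hz. destruct (Req_dec (m z + pz (n z)) 0) as [E|E]; [right|now left].
    specialize (Hm z). specialize (Hm2 z Hz). unfold dot3 in Hm.
    assert (E3 : pz (n z) = - m z) by lra. rewrite E3 in *.
    assert (Ex : px (n z) * px (n z) + py (n z) * py (n z) = 0) by nra.
    destruct (Rplus_sqr_eq_0 (px (n z)) (py (n z)) Ex) as [-> ->]. repeat split; lra. }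
  assert (Hg : exists g, forall z, Cmod z = 1 -> ~ (spin1 (m z) g (n z) = 0%C /\ spin2 (m z) g (n z) = 0%C)).
  { assert (Hcol : forall z g1 g2, Cmod z = 1 -> spin1 (m z) (g1, g2) (n z) = 0%C -> spin2 (m z) (g1, g2) (n z) = 0%C ->
       m z + pz (n z) <> 0 /\ px (n z) = - (g1 * (m z + pz (n z))) /\ h z = - (g2 * (m z + pz (n z)))).
    { intros z g1 g2 Hz E1 E2. apply (f_equal fst) in E1. unfold spin1 in E1. simpl in E1.
      assert (E3 := f_equal snd E2). apply (f_equal fst) in E2. unfold spin2 in E2, E3. simpl in E2, E3.
      change (h z) with (py (n z)).
      destruct (Hmz z Hz) as [H|(H1 & H2 & H3 & H4)]; [|exfalso; rewrite H2, H3 in E1; change (pz (n z)) with (pz (nu z)) in H4; lra].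
      change (pz (n z)) with (pz (nu z)) in *. split; [exact H|split; lra]. }
    (* A zero of the combination forces [n1 = - g1 (m + n3)] and [h = - g2 (m + n3)] with
       [m + n3 <> 0]. If [h] vanishes identically, [g = i] contradicts the second equation.
       Otherwise a real [g] leaves only the finitely many zeros of [h], each of which excludes one
       value. *)
    destruct (classic (forall z, Cmod z = 1 -> peval L z = 0%C)) as [Hall|Hnall].
    - exists Ci. intros z Hz [E1 E2]. destruct (Hcol z 0 1 Hz E1 E2) as (H1 & _ & H3).
      apply (HL z Hz) in Hall as H0; [|exact Hz]. lra.
    - apply not_all_ex_not in Hnall as [z0 Hz0]. apply imply_to_and in Hz0 as [Hz0 Hz1].
      destruct (peval_finite_roots L z0 Hz1) as [rs Hrs].
      destruct (avoid_finite (map (fun z => - (px (n z) / (m z + pz (n z)))) rs) 1 ltac:(lra)) as (g & Hgp & Hgn).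
      exists (RtoC g). intros z Hz [E1 E2]. destruct (Hcol z g 0 Hz E1 E2) as (H1 & H2 & H3).
      apply Hgn. apply in_map_iff. exists z. split.
      + rewrite H2. field. exact H1.
      + apply Hrs. apply (HL z Hz). rewrite H3; ring. }
  destruct Hg as [g Hg].
  assert (Hus1 : circle_uc (fun z => spin1 (m z) g (n z))).
  { unfold spin1. apply uc_plus; [apply uc_RtoC, ucr_minus; assumption|].
    apply uc_mult; [apply uc_const|].
    apply (uc_ext (fun z => RtoC (px (nu z)) + (0, -1) * RtoC (h z))%C).
    - intros z _. unfold n. vunf. apply C_eq; simpl; ring.
    - apply uc_plus; [apply uc_RtoC, Hux|]. apply uc_mult; [apply uc_const|apply uc_RtoC, Hh]. }
  assert (Hus2 : circle_uc (fun z => spin2 (m z) g (n z))).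
  { unfold spin2. apply uc_plus.
    - apply (uc_ext (fun z => RtoC (px (nu z)) + (0, 1) * RtoC (h z))%C).
      + intros z _. unfold n. vunf. apply C_eq; simpl; ring.
      + apply uc_plus; [apply uc_RtoC, Hux|]. apply uc_mult; [apply uc_const|apply uc_RtoC, Hh].
    - apply uc_mult; [apply uc_const|]. apply uc_RtoC, ucr_plus; assumption. }
  set (s1 := fun z => spin1 (m z) g (n z)) in *. set (s2 := fun z => spin2 (m z) g (n z)) in *.
  set (q := fun z => Cmod (s1 z) * Cmod (s1 z) + Cmod (s2 z) * Cmod (s2 z)).
  assert (Hmod : forall f, circle_uc f -> circle_ucr (fun z => Cmod (f z))).
  { intros f Hf e Hee. destruct (Hf e Hee) as (d & Hd & H). exists d; split; [exact Hd|].
    intros z w Hz Hw Hzw. eapply Rle_lt_trans; [apply Cmod_diff|]. auto. }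
  assert (Huq : circle_ucr q) by (apply ucr_plus; apply ucr_mult; apply Hmod; assumption).
  assert (Hq0 : forall z, Cmod z = 1 -> 0 < q z).
  { intros z Hz. unfold q. pose proof (Cmod_ge_0 (s1 z)); pose proof (Cmod_ge_0 (s2 z)).
    destruct (Req_dec (Cmod (s1 z)) 0) as [E1|]; [|nra].
    destruct (Req_dec (Cmod (s2 z)) 0) as [E2|]; [|nra].
    exfalso. apply (Hg z Hz). split; now apply Cmod_eq_0. }
  destruct (ucr_pos_min q Huq Hq0) as (mq & Hmq & Hmqb).
  (* [q] is bounded below by compactness, so the quotient is uniformly continuous; zeros of [tau]
     are allowed. *)
  set (k := fun z => sqrt (tau z * / q z)).
  assert (Hk0 : forall z, Cmod z = 1 -> 0 <= tau z * / q z).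
  { intros z Hz. apply Rmult_le_pos; [auto|]. left; apply Rinv_0_lt_compat; auto. }
  assert (Huk : circle_uc (fun z => RtoC (k z))).
  { apply uc_RtoC, ucr_sqrt; [|exact Hk0]. apply ucr_mult; [exact Htau|]. now apply (ucr_inv q mq). }
  exists (fun z => RtoC (k z) * s1 z)%C, (fun z => RtoC (k z) * s2 z)%C.
  assert (Hsum : forall z, Cmod z = 1 -> Cmod (RtoC (k z) * s1 z) * Cmod (RtoC (k z) * s1 z) +
     Cmod (RtoC (k z) * s2 z) * Cmod (RtoC (k z) * s2 z) = tau z).
  { intros z Hz. rewrite !Cmod_mult, Cmod_R, Rabs_right by (apply Rle_ge, sqrt_pos).
    transitivity ((k z * k z) * q z); [unfold q; ring|]. unfold k. rewrite sqrt_sqrt by auto.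
    field. apply Rgt_not_eq, Hq0, Hz. }
  split; [now apply uc_mult|]. split; [now apply uc_mult|]. split; [exact Hsum|].
  intros z c Hz Hc.
  set (v := nullv c _ _).
  assert (Ev : dot3 v (n z) = 0) by (apply spin_orth, Hm).
  assert (Hv : enorm3 v <= tau z).
  { unfold v. rewrite enorm3_nullv, Hsum by exact Hz. specialize (Ht0 z Hz). pose proof (Cmod_ge_0 c). nra. }
  replace (dot3 v (nu z)) with (- dot3 v (sub3 (n z) (nu z))).
  2:{ replace (dot3 v (sub3 (n z) (nu z))) with (dot3 v (n z) - dot3 v (nu z)) by (vunf; ring). lra. }
  rewrite Rabs_Ropp. eapply Rle_trans; [apply dot3_le|].
  specialize (Hnd z Hz). specialize (HTb z Hz). rewrite Cmod_R in HTb. pose proof (Rle_abs (tau z)).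
  pose proof (enorm3_ge0 v). pose proof (enorm3_ge0 (sub3 (n z) (nu z))).
  apply Rle_trans with (T * (eta / T)); [|right; field; lra].
  apply Rmult_le_compat; lra.
Qed.

(** * Polynomial minimal discs *)

Lemma peval_lip l z w : Cmod z <= 1 -> Cmod w <= 1 ->
  Cmod (peval l z - peval l w) <= pnorm 1 (pder l) * Cmod (z - w).
Proof.
  intros Hz Hw. apply (Cmod_mean_value (peval l) (peval (pder l)) w z).
  - intros; apply CD_peval.
  - intros t Ht. apply peval_le.
    replace (w + RtoC t * (z - w))%C with (RtoC (1 - t) * w + RtoC t * z)%C by (rewrite RtoC_minus; ring).
    eapply Rle_trans; [apply Cmod_triangle|]. rewrite !Cmod_mult, !Cmod_R, !Rabs_right by lra. nra.
Qed.

(** Allows identities between integrals of polynomials to be checked by differentiation instead of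
    on coefficient lists. *)
Lemma primitive_unique (F G f : C -> C) : (forall z, CD F z (f z)) -> (forall z, CD G z (f z)) ->
  F 0%C = G 0%C -> forall z, F z = G z.
Proof.
  intros HF HG H0 z.
  assert (H := Cmod_mean_value (fun w => F w - G w)%C (fun _ => RtoC 0) 0 z 0).
  simpl in H. rewrite H0, Rmult_0_l in H.
  assert (E : (F z - G z - (G 0 - G 0) = 0)%C).
  { apply Cmod_eq_0. apply Rle_antisym; [apply H|apply Cmod_ge_0].
    - intros t _. eapply CD_unique_val; [|apply CD_minus; [apply HF|apply HG]]. ring.
    - intros; rewrite Cmod_0; lra. }
  replace (F z) with ((F z - G z - (G 0 - G 0)) + G z)%C by ring. rewrite E; ring.
Qed.

Definition bint (X Y : list C) (z : C) : C := peval (prim (pmul X Y)) z.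

Definition surf0 (U V : list C) (z : C) : P3 :=
  mk3 (fst (bint U U z - bint V V z)%C) (fst (Ci * (bint U U z + bint V V z))%C) (fst (2 * bint U V z)%C).

Definition surf (p0 : P3) (U V : list C) (z : C) : P3 := add3 p0 (surf0 U V z).

(** Density of the induced length with respect to [|dz|]. *)
Definition sn2 (U V : list C) (z : C) : R :=
  Cmod (peval U z) * Cmod (peval U z) + Cmod (peval V z) * Cmod (peval V z).

(** The linear and quadratic parts keep their factors [z^N] and [z^(2N)], so that [jint] divides
    their coefficients by at least [N + 1] and [2N + 1]. *)
Lemma bint_perturb X Y P Q N k z :
  bint (padd X (pshift N (pscale k P))) (padd Y (pshift N (pscale k Q))) z =
  (bint X Y z + k * (z ^ (S N) * peval (jint N (padd (pmul X Q) (pmul Y P))) z)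
     + k * k * (z ^ (S (2 * N)) * peval (jint (2 * N) (pmul P Q)) z))%C.
Proof.
  revert z. apply primitive_unique with
    (f := peval (pmul (padd X (pshift N (pscale k P))) (padd Y (pshift N (pscale k Q))))).
  - intros; apply CD_prim.
  - intros z. eapply CD_unique_val; [|apply CD_plus; [apply CD_plus; [apply CD_prim|apply CD_scal, CD_jint]|apply CD_scal, CD_jint]].
    rewrite !peval_pmul, !peval_padd, !peval_pshift, !peval_pscale, !peval_pmul.
    replace (2 * N)%nat with (N + N)%nat by lia. rewrite Cpow_add_r. ring.
  - unfold bint. simpl. ring.
Qed.

Lemma padd_length l m : (length (padd l m) <= Nat.max (length l) (length m))%nat.
Proof.
  revert m; induction l as [|a l IH]; intros [|b m]; simpl; try lia. specialize (IH m). lia.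
Qed.

Lemma pmul_length l m : (length (pmul l m) <= length l + length m)%nat.
Proof.
  induction l as [|a l IH]; simpl; [lia|].
  pose proof (padd_length (pscale a m) (RtoC 0 :: pmul l m)). unfold pscale in *. rewrite length_map in H. simpl in H. 
  unfold pscale. lia.
Qed.

(** With [k^2 = 2N + 1] the linear part is at most [k * 2 S A / (N + 1) <= 4 S A / k], and by
    [jint_close] the quadratic part differs from [z^(2N+1) P Q] by at most [L A^2 / k^2]. *)
Lemma bint_perturb_close X Y P Q N L A S z :
  pnorm 1 X <= S -> pnorm 1 Y <= S -> pnorm 1 P <= A -> pnorm 1 Q <= A ->
  (length P + length Q <= L)%nat -> Cmod z <= 1 ->
  let k := sqrt (INR (Datatypes.S (2 * N))) in
  Cmod (bint (padd X (pshift N (pscale k P))) (padd Y (pshift N (pscale k Q))) z - bint X Y z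
     - z ^ (Datatypes.S (2 * N)) * (peval P z * peval Q z)) <= (4 * S * A + INR L * A * A) / k.
Proof.
  intros HX HY HP HQ HL Hz k.
  assert (Hk2 : k * k = INR (Datatypes.S (2 * N))) by (apply sqrt_sqrt, pos_INR).
  assert (Hk1 : 1 <= k).
  { unfold k. rewrite <- sqrt_1. apply sqrt_le_1_alt. rewrite S_INR. pose proof (pos_INR (2 * N)); lra. }
  rewrite bint_perturb.
  set (J1 := peval (jint N _) z). set (J2 := peval (jint (2 * N) _) z).
  replace (bint X Y z + k * (z ^ Datatypes.S N * J1) + k * k * (z ^ Datatypes.S (2 * N) * J2) - bint X Y z -
     z ^ Datatypes.S (2 * N) * (peval P z * peval Q z))%C
    with (k * (z ^ Datatypes.S N * J1) + z ^ Datatypes.S (2 * N) * (RtoC (INR (Datatypes.S (2 * N))) * J2 - peval (pmul P Q) z))%C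
    by (rewrite peval_pmul, <- Hk2, RtoC_mult; ring).
  eapply Rle_trans; [apply Cmod_triangle|].
  rewrite !Cmod_mult, !Cmod_pow, Cmod_R, (Rabs_right k) by lra.
  pose proof (pnorm_ge0 1 X ltac:(lra)); pose proof (pnorm_ge0 1 Y ltac:(lra));
  pose proof (pnorm_ge0 1 P ltac:(lra)); pose proof (pnorm_ge0 1 Q ltac:(lra)).
  pose proof (Cmod_ge_0 z) as Hz0.
  assert (Hp : forall n, 0 <= Cmod z ^ n <= 1).
  { intros n; split; [now apply pow_le|]. rewrite <- (pow1 n). now apply pow_incr. }
  assert (B1 : k * (Cmod z ^ Datatypes.S N * Cmod J1) <= 4 * S * A / k).
  { assert (HJ : Cmod J1 <= 2 * S * A / INR (Datatypes.S N)).
    { unfold J1. eapply Rle_trans; [apply (peval_le 1), Hz|]. eapply Rle_trans; [apply pnorm_jint; lra|].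
      apply Rmult_le_compat_r; [left; apply Rinv_0_lt_compat, lt_0_INR; lia|].
      eapply Rle_trans; [apply pnorm_padd; lra|].
      pose proof (pnorm_pmul 1 X Q ltac:(lra)). pose proof (pnorm_pmul 1 Y P ltac:(lra)). nra. }
    assert (HN : 0 < INR (Datatypes.S N)) by (apply lt_0_INR; lia).
    assert (HNk : k * k <= 2 * INR (Datatypes.S N)).
    { rewrite Hk2, !S_INR, mult_INR. simpl (INR 2). pose proof (pos_INR N). lra. }
    apply Rle_trans with (k * (2 * S * A / INR (Datatypes.S N))).
    - apply Rmult_le_compat_l; [lra|]. specialize (Hp (Datatypes.S N)). pose proof (Cmod_ge_0 J1). nra.
    - apply Rmult_le_reg_r with (k * INR (Datatypes.S N)); [nra|].
      replace (k * (2 * S * A / INR (Datatypes.S N)) * (k * INR (Datatypes.S N))) with (2 * S * A * (k * k)) by (field; lra).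
      replace (4 * S * A / k * (k * INR (Datatypes.S N))) with (2 * S * A * (2 * INR (Datatypes.S N))) by (field; lra).
      apply Rmult_le_compat_l; [nra|lra]. }
  assert (B2 : Cmod z ^ Datatypes.S (2 * N) * Cmod (INR (Datatypes.S (2 * N)) * J2 - peval (pmul P Q) z) <= INR L * A * A / k).
  { assert (HJ := jint_close (pmul P Q) (2 * N) z Hz). fold J2 in HJ.
    apply Rle_trans with (1 * (INR L * (A * A) / INR (Datatypes.S (2 * N)))).
    - apply Rmult_le_compat; [apply Hp|apply Cmod_ge_0|apply Hp|].
      eapply Rle_trans; [apply HJ|]. apply Rmult_le_compat_r; [left; apply Rinv_0_lt_compat, lt_0_INR; lia|].
      apply Rmult_le_compat; [apply pos_INR|apply pnorm_ge0; lra| |].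
      + apply le_INR. pose proof (pmul_length P Q). lia.
      + eapply Rle_trans; [apply pnorm_pmul; lra|]. nra.
    - rewrite <- Hk2, Rmult_1_l. unfold Rdiv. rewrite !Rmult_assoc. pose proof (pos_INR L).
      apply Rmult_le_compat_l; [lra|]. rewrite <- !Rmult_assoc. apply Rmult_le_compat_l; [nra|].
      apply Rinv_le_contravar; nra. }
  unfold Rdiv in *. lra.
Qed.

Lemma surf0_perturb_close U V P Q N L A S z :
  pnorm 1 U <= S -> pnorm 1 V <= S -> pnorm 1 P <= A -> pnorm 1 Q <= A ->
  (2 * length P <= L)%nat -> (2 * length Q <= L)%nat -> Cmod z <= 1 ->
  let k := sqrt (INR (Datatypes.S (2 * N))) in
  enorm3 (sub3 (sub3 (surf0 (padd U (pshift N (pscale k P))) (padd V (pshift N (pscale k Q))) z) (surf0 U V z))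
     (nullv (z ^ (Datatypes.S (2 * N))) (peval P z) (peval Q z))) <= 6 * ((4 * S * A + INR L * A * A) / k).
Proof.
  intros HU HV HP HQ HL1 HL2 Hz k.
  assert (H1 := bint_perturb_close U U P P N L A S z HU HU HP HP ltac:(lia) Hz).
  assert (H2 := bint_perturb_close V V Q Q N L A S z HV HV HQ HQ ltac:(lia) Hz).
  assert (H3 := bint_perturb_close U V P Q N L A S z HU HV HP HQ ltac:(lia) Hz).
  cbv zeta in H1, H2, H3. fold k in H1, H2, H3.
  set (E := (4 * S * A + INR L * A * A) / k) in *.
  set (U' := padd U _) in *. set (V' := padd V _) in *.
  set (w := (z ^ Datatypes.S (2 * N))%C) in *.
  set (e1 := (bint U' U' z - bint U U z - w * (peval P z * peval P z))%C) in *.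
  set (e2 := (bint V' V' z - bint V V z - w * (peval Q z * peval Q z))%C) in *.
  set (e3 := (bint U' V' z - bint U V z - w * (peval P z * peval Q z))%C) in *.
  eapply Rle_trans; [apply enorm3_le_sum|]. unfold surf0, nullv. vunf.
  assert (K1 : forall x y : C, Cmod x <= E -> Cmod y <= E -> Cmod (x - y) <= 2 * E).
  { intros x y Hx Hy. replace (x - y)%C with (x + - y)%C by ring. eapply Rle_trans; [apply Cmod_triangle|]. rewrite Cmod_opp; lra. }
  assert (K2 : forall x y : C, Cmod x <= E -> Cmod y <= E -> Cmod (Ci * (x + y)) <= 2 * E).
  { intros x y Hx Hy. rewrite Cmod_mult, Cmod_Ci. pose proof (Cmod_triangle x y). lra. }
  assert (K3 : forall x : C, Cmod x <= E -> Cmod (2 * x) <= 2 * E).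
  { intros x Hx. rewrite Cmod_mult, Cmod_R, Rabs_right; lra. }
  assert (Rabs (fst (bint U' U' z - bint V' V' z)%C - fst (bint U U z - bint V V z)%C -
    fst (w * (peval P z * peval P z - peval Q z * peval Q z))%C) <= 2 * E).
  { eapply Rle_trans; [|apply (K1 e1 e2 H1 H2)]. eapply Rle_trans; [|apply Cmod_ge_abs_re].
    right; f_equal. unfold e1, e2. generalize (peval P z), (peval Q z); intros; destruct (bint U' U' z), (bint V' V' z), (bint U U z), (bint V V z), w, c, c0; simpl; ring. }
  assert (Rabs (fst (Ci * (bint U' U' z + bint V' V' z))%C - fst (Ci * (bint U U z + bint V V z))%C -
    fst (w * (Ci * (peval P z * peval P z + peval Q z * peval Q z)))%C) <= 2 * E).
  { eapply Rle_trans; [|apply (K2 e1 e2 H1 H2)]. eapply Rle_trans; [|apply Cmod_ge_abs_re].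
    right; f_equal. unfold e1, e2. generalize (peval P z), (peval Q z); intros; destruct (bint U' U' z), (bint V' V' z), (bint U U z), (bint V V z), w, c, c0; simpl; ring. }
  assert (Rabs (fst (2 * bint U' V' z)%C - fst (2 * bint U V z)%C - fst (w * (2 * (peval P z * peval Q z)))%C) <= 2 * E).
  { eapply Rle_trans; [|apply (K3 e3 H3)]. eapply Rle_trans; [|apply Cmod_ge_abs_re].
    right; f_equal. unfold e3. generalize (peval P z), (peval Q z); intros; destruct (bint U' V' z), (bint U V z), w, c, c0; simpl; ring. }
  lra.
Qed.

Lemma nullv_scale c k a b : nullv c (k * a)%C (k * b)%C = nullv (c * (k * k))%C a b.
Proof. unfold nullv. apply P3_eq; vunf; destruct c, k, a, b; simpl; ring. Qed.

Lemma nullv_lip c a b a' b' G e : Cmod c <= 1 -> Cmod a <= G -> Cmod b <= G -> Cmod a' <= G -> Cmod b' <= G ->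
  Cmod (a - a') <= e -> Cmod (b - b') <= e ->
  enorm3 (sub3 (nullv c a b) (nullv c a' b')) <= 12 * G * e.
Proof.
  intros Hc Ha Hb Ha' Hb' Ea Eb.
  assert (K : forall x y x' y' : C, Cmod x <= G -> Cmod y' <= G -> Cmod (x - x') <= e -> Cmod (y - y') <= e ->
     Cmod (x * y - x' * y') <= 2 * G * e).
  { intros x y x' y' Hx Hy Hxx Hyy.
    replace (x * y - x' * y')%C with (x * (y - y') + (x - x') * y')%C by ring.
    eapply Rle_trans; [apply Cmod_triangle|]. rewrite !Cmod_mult.
    pose proof (Cmod_ge_0 x); pose proof (Cmod_ge_0 y'); pose proof (Cmod_ge_0 (x - x')); pose proof (Cmod_ge_0 (y - y')). nra. }
  assert (K1 := K a a a' a' Ha Ha' Ea Ea). assert (K2 := K b b b' b' Hb Hb' Eb Eb).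
  assert (K3 := K a b a' b' Ha Hb' Ea Eb).
  assert (M : forall x y, Cmod x <= y -> Cmod (c * x) <= y).
  { intros x y Hx. rewrite Cmod_mult. pose proof (Cmod_ge_0 x); pose proof (Cmod_ge_0 c); nra. }
  eapply Rle_trans; [apply enorm3_le_sum|]. unfold nullv. vunf.
  assert (Rabs (fst (c * (a * a - b * b))%C - fst (c * (a' * a' - b' * b'))%C) <= 4 * G * e).
  { eapply Rle_trans; [|apply (M ((a * a - a' * a') - (b * b - b' * b'))%C)].
    - eapply Rle_trans; [|apply Cmod_ge_abs_re]. right; f_equal. destruct c, a, a', b, b'; simpl; ring.
    - replace ((a * a - a' * a') - (b * b - b' * b'))%C with ((a * a - a' * a') + - (b * b - b' * b'))%C by ring.
      eapply Rle_trans; [apply Cmod_triangle|]. rewrite Cmod_opp. lra. }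
  assert (Rabs (fst (c * (Ci * (a * a + b * b)))%C - fst (c * (Ci * (a' * a' + b' * b')))%C) <= 4 * G * e).
  { eapply Rle_trans; [|apply (M (Ci * ((a * a - a' * a') + (b * b - b' * b')))%C)].
    - eapply Rle_trans; [|apply Cmod_ge_abs_re]. right; f_equal. destruct c, a, a', b, b'; simpl; ring.
    - rewrite Cmod_mult, Cmod_Ci, Rmult_1_l.
      eapply Rle_trans; [apply Cmod_triangle|]. lra. }
  assert (Rabs (fst (c * (2 * (a * b)))%C - fst (c * (2 * (a' * b')))%C) <= 4 * G * e).
  { eapply Rle_trans; [|apply (M (2 * (a * b - a' * b'))%C)].
    - eapply Rle_trans; [|apply Cmod_ge_abs_re]. right; f_equal. destruct c, a, a', b, b'; simpl; ring.
    - rewrite Cmod_mult, Cmod_R, Rabs_right; lra. }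
  lra.
Qed.

Lemma surf0_lip U V : exists K, 0 < K /\ forall z w, Cmod z <= 1 -> Cmod w <= 1 ->
  enorm3 (sub3 (surf0 U V z) (surf0 U V w)) <= K * Cmod (z - w).
Proof.
  set (k1 := pnorm 1 (pder (prim (pmul U U)))). set (k2 := pnorm 1 (pder (prim (pmul V V)))).
  set (k3 := pnorm 1 (pder (prim (pmul U V)))).
  exists (2 * k1 + 2 * k2 + 2 * k3 + 1).
  assert (0 <= k1) by (apply pnorm_ge0; lra). assert (0 <= k2) by (apply pnorm_ge0; lra).
  assert (0 <= k3) by (apply pnorm_ge0; lra).
  split; [lra|]. intros z w Hz Hw.
  assert (H1' := peval_lip (prim (pmul U U)) z w Hz Hw). fold k1 in H1'.
  assert (H2' := peval_lip (prim (pmul V V)) z w Hz Hw). fold k2 in H2'.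
  assert (H3' := peval_lip (prim (pmul U V)) z w Hz Hw). fold k3 in H3'.
  pose proof (Cmod_ge_0 (z - w)).
  eapply Rle_trans; [apply enorm3_le_sum|]. unfold surf0, bint. vunf.
  set (a := peval (prim (pmul U U)) z) in *. set (a' := peval (prim (pmul U U)) w) in *.
  set (b := peval (prim (pmul V V)) z) in *. set (b' := peval (prim (pmul V V)) w) in *.
  set (c := peval (prim (pmul U V)) z) in *. set (c' := peval (prim (pmul U V)) w) in *.
  set (d := Cmod (z - w)) in *.
  assert (Rabs (fst (a - b)%C - fst (a' - b')%C) <= k1 * d + k2 * d).
  { eapply Rle_trans; [|apply Rplus_le_compat; [apply H1'|apply H2']].
    rewrite <- (Cmod_opp (b - b')). eapply Rle_trans; [|apply Cmod_triangle]. eapply Rle_trans; [|apply Cmod_ge_abs_re].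
    right; f_equal. destruct a, a', b, b'; simpl; ring. }
  assert (Rabs (fst (Ci * (a + b))%C - fst (Ci * (a' + b'))%C) <= k1 * d + k2 * d).
  { eapply Rle_trans; [|apply Rplus_le_compat; [apply H1'|apply H2']].
    eapply Rle_trans; [|apply Cmod_triangle]. eapply Rle_trans; [|apply Cmod_ge_abs_im].
    rewrite <- Rabs_Ropp. right; f_equal. destruct a, a', b, b'; simpl; ring. }
  assert (Rabs (fst (2 * c)%C - fst (2 * c')%C) <= 2 * k3 * d).
  { replace (fst (2 * c)%C - fst (2 * c')%C) with (2 * fst (c - c')%C) by (destruct c, c'; simpl; ring).
    rewrite Rabs_mult, (Rabs_right 2) by lra. pose proof (Cmod_ge_abs_re (c - c')%C). nra. }
  nra.
Qed.

(** Bernoulli's inequality for [1 / sqrt r = 1 + h] gives [r^N <= 1 / (N h)^2], which beats the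
    growth of [sqrt (2N + 1)]. So one frequency can be large for the boundary and negligible on the
    inner disc. *)
Lemma large_N r K e n0 : 0 < r < 1 -> 0 < e ->
  exists N, (n0 <= N)%nat /\ (1 <= N)%nat /\ K <= sqrt (INR (S (2 * N))) /\
    sqrt (INR (S (2 * N))) * r ^ N <= e /\ r < 1 - / (2 * INR N).
Proof.
  intros Hr He. set (s := sqrt r).
  assert (Hs : s * s = r) by (apply sqrt_sqrt; lra).
  assert (Hs0 : 0 < s) by (apply sqrt_lt_R0; lra). assert (Hs1 : s < 1) by nra.
  set (h := / s - 1). assert (Hh : 0 < h).
  { unfold h. assert (1 < / s); [|lra]. rewrite <- Rinv_1. apply Rinv_lt_contravar; lra. }
  destruct (INR_unbounded (Rmax (K * K) (Rmax (3 / (h * h * e)) (/ (1 - r))))) as [n Hn].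
  set (N := (n0 + n + 1)%nat). exists N.
  assert (HN : INR n <= INR N) by (apply le_INR; unfold N; lia).
  assert (HN1 : 1 <= INR N) by (change 1 with (INR 1); apply le_INR; unfold N; lia).
  pose proof (Rmax_l (K * K) (Rmax (3 / (h * h * e)) (/ (1 - r)))).
  pose proof (Rmax_r (K * K) (Rmax (3 / (h * h * e)) (/ (1 - r)))).
  pose proof (Rmax_l (3 / (h * h * e)) (/ (1 - r))). pose proof (Rmax_r (3 / (h * h * e)) (/ (1 - r))).
  assert (E2 : INR (S (2 * N)) = 2 * INR N + 1) by (rewrite S_INR, mult_INR; simpl; ring).
  split; [unfold N; lia|]. split; [unfold N; lia|]. split; [|split].
  - destruct (Rle_lt_dec K 0) as [HK|HK]; [pose proof (sqrt_pos (INR (S (2 * N)))); lra|].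
    apply sq_le_le; [apply sqrt_pos|]. rewrite sqrt_sqrt by apply pos_INR. lra.
  - assert (B : s ^ N * (1 + INR N * h) <= 1).
    { assert (Hb := poly N h Hh). replace (1 + h) with (/ s) in Hb by (unfold h; ring).
      rewrite pow_inv in Hb. assert (0 < s ^ N) by now apply pow_lt.
      apply (Rmult_le_compat_l (s ^ N)) in Hb; [|lra]. rewrite Rinv_r in Hb by lra. lra. }
    assert (Hsn : 0 < s ^ N) by now apply pow_lt.
    assert (Er : r ^ N = s ^ N * s ^ N) by (rewrite <- Hs, Rpow_mult_distr; reflexivity).
    assert (Hq : sqrt (INR (S (2 * N))) <= 3 * INR N).
    { apply sq_le_le; [lra|]. rewrite sqrt_sqrt by apply pos_INR. nra. }
    assert (B2 : s ^ N * (INR N * h) <= 1) by nra.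
    assert (B3 : (s ^ N * s ^ N) * ((INR N * h) * (INR N * h)) <= 1).
    { replace (s ^ N * s ^ N * (INR N * h * (INR N * h))) with ((s ^ N * (INR N * h)) * (s ^ N * (INR N * h))) by ring.
      assert (0 <= s ^ N * (INR N * h)) by (apply Rmult_le_pos; nra). nra. }
    rewrite Er.
    apply Rle_trans with (3 * INR N * (s ^ N * s ^ N)); [apply Rmult_le_compat_r; nra|].
    assert (H3 : 3 / (h * h * e) <= INR N) by lra.
    assert (Hhe : 0 < h * h * e) by (apply Rmult_lt_0_compat; nra).
    assert (H4 : 3 <= INR N * (h * h * e)).
    { apply (Rmult_le_compat_r (h * h * e)) in H3; [|lra]. unfold Rdiv in H3. rewrite Rmult_assoc, Rinv_l in H3; lra. }
    apply Rmult_le_reg_r with (INR N * h * (INR N * h)); [apply Rmult_lt_0_compat; nra|].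
    apply Rle_trans with (3 * INR N * 1).
    + replace (3 * INR N * (s ^ N * s ^ N) * (INR N * h * (INR N * h))) with
        (3 * INR N * (s ^ N * s ^ N * (INR N * h * (INR N * h)))) by ring.
      apply Rmult_le_compat_l; lra.
    + replace (e * (INR N * h * (INR N * h))) with (INR N * (INR N * (h * h * e))) by ring. nra.
  - assert (/ (2 * INR N) < 1 - r); [|lra].
    rewrite <- (Rinv_inv (1 - r)). apply Rinv_lt_contravar.
    + apply Rmult_lt_0_compat; [apply Rinv_0_lt_compat|]; lra.
    + lra.
Qed.

(** * The Riemann-Hilbert step *)

(** The first clause is the immersion condition on the closed disc. The second keeps [V] a nonzero
    polynomial, hence with finitely many zeros; perturbations divisible by [z] preserve it. *)
Definition good (U V : list C) : Prop :=
  (forall z, Cmod z <= 1 -> 0 < sn2 U V z) /\ peval V 0 <> 0%C.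

(** Both Laurent approximations are brought to the same pole order. The common factor [z^d] only
    multiplies the null vector by [z^(2d)], a phase on the circle. *)
Lemma circle_weierstrass_pair (a b : C -> C) eta : circle_uc a -> circle_uc b -> 0 < eta ->
  exists d P Q, forall z, Cmod z = 1 ->
    Cmod (peval P z - z ^ d * a z) <= eta /\ Cmod (peval Q z - z ^ d * b z) <= eta.
Proof.
  intros Ha Hb He.
  destruct (uc_bounded a Ha) as (A & _ & HA). destruct (uc_bounded b Hb) as (B & _ & HB).
  destruct (circle_weierstrass a A eta Ha HA He) as (d1 & P & HP).
  destruct (circle_weierstrass b B eta Hb HB He) as (d2 & Q & HQ).
  exists (d1 + d2)%nat, (pshift d2 P), (pshift d1 Q). intros z Hz.
  assert (Hc : forall d, (z ^ d * Cconj z ^ d = 1)%C).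
  { intros d. rewrite <- Cpow_mult_l, unit_conj by exact Hz. apply Cpow_1_l. }
  rewrite !peval_pshift. split.
  - replace (z ^ d2 * peval P z - z ^ (d1 + d2) * a z)%C with (z ^ (d1 + d2) * (Cconj z ^ d1 * peval P z - a z))%C.
    + rewrite Cmod_mult, Cpow_unit, Rmult_1_l by exact Hz. auto.
    + rewrite Cpow_add_r. transitivity (z ^ d2 * (z ^ d1 * Cconj z ^ d1) * peval P z - z ^ d1 * z ^ d2 * a z)%C; [ring|].
      rewrite Hc; ring.
  - replace (z ^ d1 * peval Q z - z ^ (d1 + d2) * b z)%C with (z ^ (d1 + d2) * (Cconj z ^ d2 * peval Q z - b z))%C.
    + rewrite Cmod_mult, Cpow_unit, Rmult_1_l by exact Hz. auto.
    + rewrite Cpow_add_r. transitivity (z ^ d1 * (z ^ d2 * Cconj z ^ d2) * peval Q z - z ^ d1 * z ^ d2 * b z)%C; [ring|].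
      rewrite Hc; ring.
Qed.

(* A constant added to the first component removes the common zeros. *)
Lemma nonvanishing_shift U V P Q k N eta : good U V -> 0 < k -> (1 <= N)%nat -> 0 < eta ->
  exists lam : R, 0 < lam < eta /\
    good (padd U (pshift N (pscale k (padd P (RtoC lam :: nil))))) (padd V (pshift N (pscale k Q))).
Proof.
  intros [HUV HV] Hk HN He.
  set (V' := padd V (pshift N (pscale k Q))).
  assert (HV' : peval V' 0 <> 0%C).
  { unfold V'. rewrite peval_padd, peval_pshift. destruct N; [lia|]. simpl.
    replace (peval V 0 + 0 * 0 ^ N * peval (pscale k Q) 0)%C with (peval V 0) by ring. exact HV. }
  (* The second component does not depend on [lam], and at each of its zeros, none of which is 0,
     exactly one complex value of the added constant cancels the first component. *)
  destruct (peval_finite_roots V' 0 HV') as [rs Hrs].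
  destruct (avoid_finite (map (fun z => fst (- ((peval U z + k * (z ^ N * peval P z)) / (k * z ^ N)))%C) rs) eta He)
    as (lam & Hlam & Hn).
  exists lam. split; [exact Hlam|]. split; [|exact HV'].
  intros z Hz. unfold sn2. set (u := peval _ z). fold V'. set (v := peval V' z).
  pose proof (Cmod_ge_0 u); pose proof (Cmod_ge_0 v).
  destruct (Req_dec (Cmod v) 0) as [Ev|]; [|nra].
  destruct (Req_dec (Cmod u) 0) as [Eu|]; [|nra].
  exfalso. apply Cmod_eq_0 in Ev, Eu.
  assert (Hz0 : z <> 0%C) by (intros ->; now apply HV').
  assert (Hzn : (k * z ^ N)%C <> 0%C).
  { apply Cmult_neq_0; [intros E; apply RtoC_inj in E; lra|now apply Cpow_nz]. }
  apply Hn. apply in_map_iff. exists z. split; [|apply Hrs, Ev].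
  transitivity (fst (RtoC lam)); [f_equal|reflexivity].
  unfold u in Eu. rewrite peval_padd, peval_pshift, peval_pscale, peval_padd in Eu. simpl (peval (RtoC lam :: nil) z) in Eu.
  transitivity (- ((peval U z + z ^ N * (k * (peval P z + (lam + z * 0)))) / (k * z ^ N)) + RtoC lam)%C.
  - field. split; [now apply Cpow_nz|intros E; apply RtoC_inj in E; lra].
  - rewrite Eu. field. split; [now apply Cpow_nz|intros E; apply RtoC_inj in E; lra].
Qed.

Lemma Cmod_sq_add_ge (x y : C) : Cmod y * Cmod y / 2 - Cmod x * Cmod x <= Cmod (x + y) * Cmod (x + y).
Proof. rewrite !Cmod_sq. destruct x as [x1 x2], y as [y1 y2]; simpl.
  pose proof (Rle_0_sqr (2 * x1 + y1)); pose proof (Rle_0_sqr (2 * x2 + y2)); unfold Rsqr in *; lra.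
Qed.

Lemma Cmod_scale_circle (rho : R) z : Cmod z = 1 -> 0 <= rho -> Cmod (rho * z) = rho.
Proof. intros Hz Hr. rewrite Cmod_mult, Cmod_R, Hz, Rabs_right by lra. ring. Qed.

(* Cut-off near the circle: with [k^2 = 2N+1] the quadratic term of the perturbed null curve
   integrates to [z^(2N+1)] times the null vector of (P, Q), and the cross term is O(1/k). *)
Lemma riemann_hilbert U V (a b : C -> C) r0 eta t :
  good U V -> circle_uc a -> circle_uc b -> r0 < 1 -> 0 < eta -> 0 < t ->
  exists A B r M, let U' := padd U A in let V' := padd V B in
    r0 <= r /\ 1 / 2 <= r < 1 /\ good U' V' /\ pnorm r A <= eta /\ pnorm r B <= eta /\
    (forall z, Cmod z <= r -> enorm3 (sub3 (surf0 U' V' z) (surf0 U V z)) <= eta) /\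
    (forall z rho, Cmod z = 1 -> r <= rho <= 1 -> exists c, Cmod c <= 1 /\ (rho = 1 -> c = (z ^ M)%C) /\
       enorm3 (sub3 (sub3 (surf0 U' V' (rho * z)) (surf0 U V z)) (nullv c (a z) (b z))) <= eta) /\
    (/ eta <= INR M) /\
    ((forall z, Cmod z = 1 -> t <= Cmod (a z) * Cmod (a z) + Cmod (b z) * Cmod (b z)) ->
      exists r1 r2, r < r1 < r2 /\ r2 < 1 /\
        forall z, r1 <= Cmod z <= r2 -> t / 128 <= sn2 U' V' z * (r2 - r1)).
Proof.
  intros Hgood Ha Hb Hr0 He Ht.
  destruct (uc_bounded a Ha) as (Ga & HGa & HGab). destruct (uc_bounded b Hb) as (Gb & HGb & HGbb).
  set (G := Ga + Gb + 3).
  (* Approximation errors will be [3 * e1]: [400 G] absorbs the Lipschitz constant [12 G] of the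
     null vector, and [sqrt (t / 72)] makes the squared error at most [t / 8]. *)
  set (e1 := Rmin (Rmin 1 (eta / (400 * G))) (Rmin (eta / 10) (sqrt (t / 72)))).
  assert (Hst : 0 < sqrt (t / 72)) by (apply sqrt_lt_R0; lra).
  assert (He1 : 0 < e1).
  { repeat apply Rmin_glb_lt; try lra. apply Rdiv_lt_0_compat; unfold G; lra. }
  assert (He1a : e1 <= 1) by (unfold e1; eapply Rle_trans; [apply Rmin_l|apply Rmin_l]).
  assert (He1b : e1 <= eta / (400 * G)) by (unfold e1; eapply Rle_trans; [apply Rmin_l|apply Rmin_r]).
  assert (He1c : e1 <= eta / 10) by (unfold e1; eapply Rle_trans; [apply Rmin_r|apply Rmin_l]).
  assert (He1d : e1 <= sqrt (t / 72)) by (unfold e1; eapply Rle_trans; [apply Rmin_r|apply Rmin_r]).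
  assert (He1t : e1 * e1 <= t / 72) by (rewrite <- (sqrt_sqrt (t / 72)) by lra; nra).
  destruct (circle_weierstrass_pair a b e1 Ha Hb He1) as (d & P & Q & HPQ).
  set (KP := pnorm 1 (pder P) + pnorm 1 (pder Q)).
  assert (HKP0 : 0 <= pnorm 1 (pder P)) by (apply pnorm_ge0; lra).
  assert (HKQ0 : 0 <= pnorm 1 (pder Q)) by (apply pnorm_ge0; lra).
  destruct (surf0_lip U V) as (Ks & HKs & HLs).
  (* So close to 1 that between radii [r] and 1 the polynomials [P], [Q] and the old surface change
     by at most [e1] along a ray. *)
  set (r := Rmax (Rmax r0 (1 / 2)) (1 - e1 / (KP + Ks + 1))).
  assert (HKK : 0 < KP + Ks + 1) by (unfold KP; lra).
  assert (Hq : 0 < e1 / (KP + Ks + 1)) by (apply Rdiv_lt_0_compat; lra).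
  assert (Hr1 : r0 <= r) by (unfold r; eapply Rle_trans; [|apply Rmax_l]; apply Rmax_l).
  assert (Hr2 : 1 / 2 <= r) by (unfold r; eapply Rle_trans; [|apply Rmax_l]; apply Rmax_r).
  assert (Hr3 : 1 - e1 / (KP + Ks + 1) <= r) by apply Rmax_r.
  assert (Hr4 : r < 1) by (unfold r; repeat apply Rmax_lub_lt; lra).
  set (S := pnorm 1 U + pnorm 1 V + 1).
  set (A := pnorm 1 P + pnorm 1 Q + 1).
  set (L := (2 * (length P + length Q) + 2)%nat).
  assert (HU0 : 0 <= pnorm 1 U) by (apply pnorm_ge0; lra). assert (HV0 : 0 <= pnorm 1 V) by (apply pnorm_ge0; lra).
  assert (HP0 : 0 <= pnorm 1 P) by (apply pnorm_ge0; lra). assert (HQ0 : 0 <= pnorm 1 Q) by (apply pnorm_ge0; lra).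
  set (E := 4 * S * A + INR L * A * A).
  assert (HE : 0 <= E) by (unfold E; pose proof (pos_INR L); assert (0 <= S) by (unfold S; lra); assert (0 <= A) by (unfold A; lra); nra).
  (* The lower bounds on [k] control, in turn, the cross-term error, the old spinor against the new
     one in the metric, and the frequency. The upper bounds on [k r^N] keep the change on the inner
     disc below [eta]. *)
  destruct (large_N r (Rmax (60 * E / eta + 1) (Rmax (128 * S * S / t + 1) (/ eta + 1)))
     (Rmin (eta / A) (eta / (8 * (A * A)))) 0 ltac:(lra)) as (N & _ & HN1 & HNK & HNr & HNr2).
  { assert (0 < A) by (unfold A; lra). apply Rmin_glb_lt; apply Rdiv_lt_0_compat; nra. }
  set (k := sqrt (INR (Datatypes.S (2 * N)))) in *.
  assert (Hk2 : k * k = INR (Datatypes.S (2 * N))) by (apply sqrt_sqrt, pos_INR).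
  assert (HNKa : 60 * E / eta + 1 <= k) by (eapply Rle_trans; [apply Rmax_l|exact HNK]).
  assert (HNKb : 128 * S * S / t + 1 <= k) by (eapply Rle_trans; [|exact HNK]; eapply Rle_trans; [|apply Rmax_r]; apply Rmax_l).
  assert (HNKc : / eta + 1 <= k) by (eapply Rle_trans; [|exact HNK]; eapply Rle_trans; [|apply Rmax_r]; apply Rmax_r).
  assert (Hk1 : 1 <= k).
  { assert (0 <= 60 * E / eta) by (apply Rdiv_le_0_compat; lra). lra. }
  assert (HA0 : 0 < A) by (unfold A; lra).
  assert (HNra : k * r ^ N <= eta / A) by (eapply Rle_trans; [exact HNr|apply Rmin_l]).
  assert (HNrb : k * r ^ N <= eta / (8 * (A * A))) by (eapply Rle_trans; [exact HNr|apply Rmin_r]).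
  destruct (nonvanishing_shift U V P Q k N e1 Hgood ltac:(lra) HN1 He1) as (lam & Hlam & Hgood').
  set (P' := padd P (RtoC lam :: nil)) in *.
  assert (HP' : forall z, peval P' z = (peval P z + RtoC lam)%C).
  { intros z. unfold P'. rewrite peval_padd. simpl. ring. }
  assert (HnP' : pnorm 1 P' <= A).
  { unfold P'. eapply Rle_trans; [apply pnorm_padd; lra|]. simpl. rewrite Cmod_R, Rabs_right by lra. unfold A. lra. }
  assert (HnQ : pnorm 1 Q <= A) by (unfold A; lra).
  assert (HlP' : (2 * length P' <= L)%nat).
  { unfold P'. pose proof (padd_length P (RtoC lam :: nil)). simpl in H. unfold L. lia. }
  assert (HlQ : (2 * length Q <= L)%nat) by (unfold L; lia).
  assert (Hclose := fun z => surf0_perturb_close U V P' Q N L A S z ltac:(unfold S; lra) ltac:(unfold S; lra) HnP' HnQ HlP' HlQ).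
  cbv zeta in Hclose. fold k in Hclose.
  assert (HEk : 6 * (E / k) <= eta / 10).
  { assert (60 * E / eta <= k) by lra.
    apply Rmult_le_reg_r with (10 * k / eta); [apply Rdiv_lt_0_compat; lra|].
    replace (6 * (E / k) * (10 * k / eta)) with (60 * E / eta) by (field; lra).
    replace (eta / 10 * (10 * k / eta)) with k by (field; lra). lra. }
  fold E in Hclose.
  (* The phase collects [2N + 1] from the integration and [2d] from the common pole order. *)
  exists (pshift N (pscale k P')), (pshift N (pscale k Q)), r, (2 * N + 1 + 2 * d)%nat.
  cbv zeta. set (U' := padd U _) in *. set (V' := padd V _) in *.
  assert (Hpn : forall l, pnorm 1 l <= A -> pnorm r (pshift N (pscale k l)) <= eta).
  { intros l Hl. rewrite pnorm_pshift, pnorm_pscale, Cmod_R, Rabs_right by lra.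
    pose proof (pnorm_mono r 1 l ltac:(lra)). pose proof (pnorm_ge0 r l ltac:(lra)).
    assert (0 <= r ^ N) by (apply pow_le; lra).
    apply Rle_trans with (eta / A * A); [|right; field; lra].
    replace (r ^ N * (k * pnorm r l)) with (k * r ^ N * pnorm r l) by ring.
    apply Rmult_le_compat; [nra|lra|lra|lra]. }
  assert (Htrack : forall z rho, Cmod z = 1 -> r <= rho <= 1 ->
    Cmod (peval P' (rho * z) - z ^ d * a z) <= 3 * e1 /\ Cmod (peval Q (rho * z) - z ^ d * b z) <= 3 * e1).
  { intros z rho Hz Hrho. destruct (HPQ z Hz) as [K1 K2].
    assert (Hrz : Cmod (rho * z) = rho) by (apply Cmod_scale_circle; lra).
    assert (Hd : Cmod (rho * z - z) = 1 - rho).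
    { replace (rho * z - z)%C with (RtoC (rho - 1) * z)%C by (rewrite RtoC_minus; ring).
      rewrite Cmod_mult, Cmod_R, Hz, Rabs_left1 by lra. ring. }
    assert (Hd2 : (KP + Ks + 1) * (1 - rho) <= e1).
    { apply Rle_trans with ((KP + Ks + 1) * (e1 / (KP + Ks + 1))); [apply Rmult_le_compat_l; lra|right; field; lra]. }
    assert (L1 := peval_lip P (rho * z) z ltac:(lra) ltac:(lra)). rewrite Hd in L1.
    assert (L2 := peval_lip Q (rho * z) z ltac:(lra) ltac:(lra)). rewrite Hd in L2.
    assert (pnorm 1 (pder P) * (1 - rho) <= e1) by (unfold KP in Hd2; nra).
    assert (pnorm 1 (pder Q) * (1 - rho) <= e1) by (unfold KP in Hd2; nra).
    split.
    - rewrite HP'.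
      replace (peval P (rho * z) + lam - z ^ d * a z)%C with
        ((peval P (rho * z) - peval P z) + ((peval P z - z ^ d * a z) + lam))%C by ring.
      eapply Rle_trans; [apply Cmod_triangle|]. eapply Rle_trans; [apply Rplus_le_compat_l, Cmod_triangle|].
      rewrite Cmod_R, (Rabs_right lam) by lra. lra.
    - eapply Rle_trans; [apply (Cmod_sub_tri _ (peval Q z))|]. lra. }
  split; [exact Hr1|]. split; [lra|]. split; [exact Hgood'|]. split; [now apply Hpn|]. split; [now apply Hpn|].
  split; [|split; [|split]].
  - intros z Hz. specialize (Hclose z ltac:(lra)).
    set (n := nullv _ _ _) in Hclose.
    assert (Hn : enorm3 n <= eta / 4).
    { unfold n. rewrite enorm3_nullv, Cmod_pow.
      pose proof (peval_le 1 P' z ltac:(lra)). pose proof (peval_le 1 Q z ltac:(lra)).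
      pose proof (Cmod_ge_0 (peval P' z)). pose proof (Cmod_ge_0 (peval Q z)). pose proof (Cmod_ge_0 z).
      assert (Hzz : Cmod z ^ Datatypes.S (2 * N) <= r ^ N).
      { apply Rle_trans with (r ^ Datatypes.S (2 * N)); [apply pow_incr; lra|].
        replace (Datatypes.S (2 * N)) with (N + Datatypes.S N)%nat by lia. rewrite pow_add.
        assert (0 <= r ^ N) by (apply pow_le; lra).
        assert (r ^ Datatypes.S N <= 1) by (rewrite <- (pow1 (Datatypes.S N)); apply pow_incr; lra).
        nra. }
      assert (0 <= Cmod z ^ Datatypes.S (2 * N)) by (apply pow_le; lra).
      assert (r ^ N <= eta / (8 * (A * A))) by (assert (0 <= r ^ N) by (apply pow_le; lra); nra).
      apply Rle_trans with (eta / (8 * (A * A)) * (A * A + A * A)); [|right; field; lra].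
      apply Rmult_le_compat; nra. }
    assert (T := enorm3_tri (sub3 (sub3 (surf0 U' V' z) (surf0 U V z)) n) n).
    replace (add3 (sub3 (sub3 (surf0 U' V' z) (surf0 U V z)) n) n) with (sub3 (surf0 U' V' z) (surf0 U V z)) in T by veq.
    lra.
  - intros z rho Hz Hrho.
    exists ((rho * z) ^ Datatypes.S (2 * N) * (z ^ d * z ^ d))%C.
    assert (Hrz : Cmod (rho * z) = rho) by (apply Cmod_scale_circle; lra).
    set (c0 := ((rho * z) ^ Datatypes.S (2 * N))%C).
    assert (Hc0 : Cmod c0 <= 1).
    { unfold c0. rewrite Cmod_pow, Hrz. rewrite <- (pow1 (Datatypes.S (2 * N))). apply pow_incr; lra. }
    split; [|split].
    + rewrite !Cmod_mult, Cpow_unit by exact Hz. lra.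
    + intros ->. unfold c0. replace (1 * z)%C with z by ring. rewrite <- !Cpow_add_r. f_equal. lia.
    + rewrite <- nullv_scale.
      assert (Hcl := Hclose (rho * z)%C ltac:(lra)). fold c0 in Hcl.
      destruct (Htrack z rho Hz Hrho) as [K1 K2].
      assert (Ba : Cmod (z ^ d * a z) <= Ga) by (rewrite Cmod_mult, Cpow_unit, Rmult_1_l by exact Hz; auto).
      assert (Bb : Cmod (z ^ d * b z) <= Gb) by (rewrite Cmod_mult, Cpow_unit, Rmult_1_l by exact Hz; auto).
      assert (Bp : Cmod (peval P' (rho * z)) <= G).
      { pose proof (Cmod_diff (peval P' (rho * z)) (z ^ d * a z)) as T. apply Rabs_le_between in T. unfold G; lra. }
      assert (Bq : Cmod (peval Q (rho * z)) <= G).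
      { pose proof (Cmod_diff (peval Q (rho * z)) (z ^ d * b z)) as T. apply Rabs_le_between in T. unfold G; lra. }
      assert (Hnl := nullv_lip c0 (peval P' (rho * z)) (peval Q (rho * z)) (z ^ d * a z) (z ^ d * b z) G (3 * e1)
         Hc0 Bp Bq ltac:(unfold G; lra) ltac:(unfold G; lra) K1 K2).
      assert (HG1 : 12 * G * (3 * e1) <= eta / 10).
      { apply Rle_trans with (12 * G * (3 * (eta / (400 * G)))); [|].
        - apply Rmult_le_compat_l; unfold G in *; lra.
        - replace (12 * G * (3 * (eta / (400 * G)))) with (36 / 400 * eta) by (field; unfold G; lra). lra. }
      assert (HL := HLs (rho * z)%C z ltac:(lra) ltac:(lra)).
      assert (Hd : Cmod (rho * z - z) = 1 - rho).
      { replace (rho * z - z)%C with (RtoC (rho - 1) * z)%C by (rewrite RtoC_minus; ring).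
        rewrite Cmod_mult, Cmod_R, Hz, Rabs_left1 by lra. ring. }
      rewrite Hd in HL.
      assert (Hd2 : Ks * (1 - rho) <= e1).
      { apply Rle_trans with ((KP + Ks + 1) * (e1 / (KP + Ks + 1))); [|right; field; lra].
        assert (0 <= KP) by (unfold KP; lra). apply Rmult_le_compat; lra. }
      set (x := surf0 U' V' (rho * z)) in *. set (y := surf0 U V (rho * z)) in *. set (y' := surf0 U V z) in *.
      set (n1 := nullv c0 (peval P' (rho * z)) (peval Q (rho * z))) in *. set (n2 := nullv c0 (z ^ d * a z)%C (z ^ d * b z)%C) in *.
      replace (sub3 (sub3 x y') n2) with (add3 (sub3 (sub3 x y) n1) (add3 (sub3 y y') (sub3 n1 n2))) by veq.
      eapply Rle_trans; [apply enorm3_tri|]. eapply Rle_trans; [apply Rplus_le_compat_l, enorm3_tri|]. lra.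
  -    apply Rle_trans with k; [lra|]. apply Rle_trans with (k * k); [clear - Hk1; nra|]. rewrite Hk2. apply le_INR. lia.
  - intros Hsig.
    assert (HNp : 0 < INR N) by (apply lt_0_INR; lia).
    (* Here [|z|^N >= 1/2] by Bernoulli, so the metric is at least [k^2 t / 32] minus the old
       contribution, hence at least [k^2 t / 64]; multiplied by the width [1 / (4N)] with
       [k^2 >= 2N] this gives [t / 128]. *)
    exists (1 - / (2 * INR N)), (1 - / (4 * INR N)).
    assert (I4 : / (2 * INR N) = 2 * / (4 * INR N)) by (field; lra).
    assert (I0 : 0 < / (4 * INR N)) by (apply Rinv_0_lt_compat; lra).
    split; [lra|]. split; [lra|].
    intros z Hz.
    set (rho := Cmod z) in *.
    assert (Hrho : r <= rho <= 1) by lra.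
    set (w := (RtoC (/ rho) * z)%C).
    assert (Hir : 0 < / rho) by (apply Rinv_0_lt_compat; lra).
    assert (Hw : Cmod w = 1).
    { unfold w. rewrite Cmod_mult, Cmod_R, Rabs_right by lra. fold rho. field; lra. }
    assert (Ez : z = (rho * w)%C).
    { unfold w. rewrite Cmult_assoc, <- RtoC_mult, Rinv_r by lra. ring. }
    destruct (Htrack w rho Hw Hrho) as [K1 K2]. rewrite <- Ez in K1, K2.
    assert (Hlow : t / 4 <= Cmod (peval P' z) * Cmod (peval P' z) + Cmod (peval Q z) * Cmod (peval Q z)).
    { assert (Q1 := Cmod_sq_add_ge (peval P' z - w ^ d * a w) (w ^ d * a w)).
      assert (Q2 := Cmod_sq_add_ge (peval Q z - w ^ d * b w) (w ^ d * b w)).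
      replace (peval P' z - w ^ d * a w + w ^ d * a w)%C with (peval P' z) in Q1 by ring.
      replace (peval Q z - w ^ d * b w + w ^ d * b w)%C with (peval Q z) in Q2 by ring.
      rewrite !(Cmod_mult (w ^ d)), !Cpow_unit, !Rmult_1_l in Q1, Q2 by exact Hw.
      specialize (Hsig w Hw).
      pose proof (Cmod_ge_0 (peval P' z - w ^ d * a w)). pose proof (Cmod_ge_0 (peval Q z - w ^ d * b w)).
      assert (Cmod (peval P' z - w ^ d * a w) * Cmod (peval P' z - w ^ d * a w) <= t / 8) by nra.
      assert (Cmod (peval Q z - w ^ d * b w) * Cmod (peval Q z - w ^ d * b w) <= t / 8) by nra.
      lra. }
    assert (Hpow : 1 / 2 <= rho ^ N).
    { assert (Hbb : 1 / 2 <= (1 - / (2 * INR N)) ^ N).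
      { assert (Gen : forall x n, 0 <= x <= 1 -> 1 - INR n * x <= (1 - x) ^ n).
        { intros x n Hx. induction n as [|n IH]; [simpl; lra|]. rewrite S_INR. simpl.
          assert (0 <= (1 - x) ^ n <= 1).
          { split; [apply pow_le; lra|]. apply Rle_trans with (1 ^ n); [apply pow_incr; lra|rewrite pow1; lra]. }
          nra. }
        assert (Hx : 0 <= / (2 * INR N) <= 1) by lra.
        specialize (Gen _ N Hx). replace (INR N * / (2 * INR N)) with (1 / 2) in Gen by (field; lra). lra. }
      apply Rle_trans with (1 := Hbb). apply pow_incr; lra. }
    unfold sn2, U', V'. rewrite !peval_padd, !peval_pshift, !peval_pscale.
    assert (Q1 := Cmod_sq_add_ge (peval U z) (z ^ N * (k * peval P' z))).
    assert (Q2 := Cmod_sq_add_ge (peval V z) (z ^ N * (k * peval Q z))).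
    set (u1 := Cmod (peval U z + _)) in *. set (v1 := Cmod (peval V z + _)) in *.
    rewrite !Cmod_mult, Cmod_pow, Cmod_R, Rabs_right in Q1, Q2 by lra. fold rho in Q1, Q2.
    assert (BU := peval_le 1 U z ltac:(fold rho; lra)). assert (BV := peval_le 1 V z ltac:(fold rho; lra)).
    pose proof (Cmod_ge_0 (peval U z)); pose proof (Cmod_ge_0 (peval V z)).
    set (p := Cmod (peval P' z)) in *. set (q := Cmod (peval Q z)) in *.
    assert (HSS : Cmod (peval U z) * Cmod (peval U z) + Cmod (peval V z) * Cmod (peval V z) <= S * S).
    { unfold S. nra. }
    assert (Hrp : 1 / 4 <= rho ^ N * rho ^ N) by nra.
    assert (Hmain : k * k * (t / 32) - S * S <= u1 * u1 + v1 * v1).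
    { assert (k * k * (t / 32) <= rho ^ N * (k * p) * (rho ^ N * (k * p)) / 2 + rho ^ N * (k * q) * (rho ^ N * (k * q)) / 2); [|lra].
      replace (rho ^ N * (k * p) * (rho ^ N * (k * p)) / 2 + rho ^ N * (k * q) * (rho ^ N * (k * q)) / 2)
        with (k * k * ((rho ^ N * rho ^ N) * (p * p + q * q) / 2)) by field.
      apply Rmult_le_compat_l; [nra|]. nra. }
    assert (HSk : S * S <= k * k * (t / 64)).
    { assert (128 * S * S / t <= k) by lra.
      assert (128 * S * S <= k * t).
      { apply (Rmult_le_compat_r t) in H1; [|lra]. unfold Rdiv in H1. rewrite Rmult_assoc, Rinv_l in H1; lra. }
      assert (k * t <= k * k * t) by nra. nra. }
    replace (1 - / (4 * INR N) - (1 - / (2 * INR N))) with (/ (4 * INR N)) by (rewrite I4; ring).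
    apply Rle_trans with (k * k * (t / 64) * / (4 * INR N)).
    + rewrite Hk2, S_INR, mult_INR. change (INR 2) with 2.
      set (x := / (4 * INR N)) in *. assert (Ex : INR N * x = 1 / 4) by (unfold x; field; lra).
      replace ((2 * INR N + 1) * (t / 64) * x) with (2 * (INR N * x) * (t / 64) + x * (t / 64)) by ring.
      rewrite Ex. assert (0 < x * (t / 64)) by (apply Rmult_lt_0_compat; lra). lra.
    + apply Rmult_le_compat_r; lra.
Qed.

(** A change that is small on the disc of radius [r], both in the coefficient norm, which later
    yields convergence of all derivatives, and in position. The increments are explicit because the
    limit spinor is their sum. *)
Definition adm (r eta : R) (U V U' V' : list C) : Prop :=
  exists A B, U' = padd U A /\ V' = padd V B /\ pnorm r A <= eta /\ pnorm r B <= eta /\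
    forall z, Cmod z <= r -> enorm3 (sub3 (surf0 U' V' z) (surf0 U V z)) <= eta.

Lemma padd_assoc l m n : padd (padd l m) n = padd l (padd m n).
Proof.
  revert m n; induction l as [|a l IH]; intros [|b m] [|c n]; simpl; try reflexivity.
  rewrite IH. f_equal. ring.
Qed.

Lemma padd_nil_r l : padd l nil = l.
Proof. destruct l; reflexivity. Qed.

Lemma adm_refl r eta U V : 0 <= eta -> adm r eta U V U V.
Proof.
  intros He. exists nil, nil. rewrite !padd_nil_r. simpl. repeat split; try lra.
  intros z _. rewrite sub3_diag, enorm3_0. exact He.
Qed.

Lemma adm_weaken r r' e e' U V U' V' : 0 <= r' <= r -> e <= e' -> adm r e U V U' V' -> adm r' e' U V U' V'.
Proof.
  intros Hr He (A & B & -> & -> & HA & HB & H). exists A, B. repeat split.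
  - pose proof (pnorm_mono r' r A Hr). lra.
  - pose proof (pnorm_mono r' r B Hr). lra.
  - intros z Hz. specialize (H z ltac:(lra)). lra.
Qed.

Lemma adm_trans r e e' U V U1 V1 U2 V2 : 0 <= r -> adm r e U V U1 V1 -> adm r e' U1 V1 U2 V2 -> adm r (e + e') U V U2 V2.
Proof.
  intros Hr (A & B & -> & -> & HA & HB & H) (A' & B' & -> & -> & HA' & HB' & H').
  exists (padd A A'), (padd B B'). rewrite !padd_assoc. repeat split.
  - eapply Rle_trans; [apply pnorm_padd, Hr|]; lra.
  - eapply Rle_trans; [apply pnorm_padd, Hr|]; lra.
  - intros z Hz. specialize (H z Hz). specialize (H' z Hz). rewrite !padd_assoc in H'.
    eapply Rle_trans; [apply enorm3_sub_tri|]. rewrite Rplus_comm. apply Rplus_le_compat; eassumption.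
Qed.

(** Spinors disappear from the interface: a unit normal field and a length are prescribed. On the
    circle the phase has modulus 1, so the length is attained; at smaller radii the move may be
    shorter. *)
Lemma rh_step U V (nu : C -> P3) (tau : C -> R) r0 eta t :
  good U V -> circle_ucv nu -> (forall z, Cmod z = 1 -> enorm3 (nu z) = 1) ->
  circle_ucr tau -> (forall z, Cmod z = 1 -> 0 <= tau z) -> r0 < 1 -> 0 < eta -> 0 < t ->
  exists U' V' r, r0 <= r /\ 1 / 2 <= r < 1 /\ good U' V' /\ adm r eta U V U' V' /\
    (forall z rho, Cmod z = 1 -> r <= rho <= 1 -> exists w, Rabs (dot3 w (nu z)) <= eta /\
       enorm3 w <= tau z /\ (rho = 1 -> enorm3 w = tau z) /\
       enorm3 (sub3 (sub3 (surf0 U' V' (rho * z)) (surf0 U V z)) w) <= eta) /\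
    ((forall z, Cmod z = 1 -> t <= tau z) ->
      exists r1 r2, r < r1 < r2 /\ r2 < 1 /\
        forall z, r1 <= Cmod z <= r2 -> t / 128 <= sn2 U' V' z * (r2 - r1)).
Proof.
  intros Hg Hnu Hn1 Htau Ht0 Hr0 He Ht.
  destruct (spinor_lift nu tau eta Hnu Hn1 Htau Ht0 He) as (a & b & Ha & Hb & Hab & Horth).
  destruct (riemann_hilbert U V a b r0 eta t Hg Ha Hb Hr0 He Ht) as (A & B & r & M & H1 & H2 & H3 & H4 & H5 & H6 & H7 & _ & H8).
  exists (padd U A), (padd V B), r. split; [exact H1|]. split; [exact H2|]. split; [exact H3|].
  split; [exists A, B; repeat split; assumption|]. split.
  - intros z rho Hz Hrho. destruct (H7 z rho Hz Hrho) as (c & Hc & Hc1 & Hcl).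
    exists (nullv c (a z) (b z)). split; [now apply Horth|].
    rewrite enorm3_nullv, Hab by exact Hz. specialize (Ht0 z Hz). pose proof (Cmod_ge_0 c).
    split; [nra|]. split; [|exact Hcl]. intros E. rewrite (Hc1 E), Cpow_unit by exact Hz. ring.
  - intros Ht1. apply H8. intros z Hz. rewrite Hab by exact Hz. auto.
Qed.

(** * The conformal factor and radial barriers *)

Lemma sn2_lip U V : exists K, 0 < K /\ forall z w, Cmod z <= 1 -> Cmod w <= 1 ->
  Rabs (sn2 U V z - sn2 U V w) <= K * Cmod (z - w).
Proof.
  assert (Hone : forall l, exists K, 0 < K /\ forall z w, Cmod z <= 1 -> Cmod w <= 1 ->
    Rabs (Cmod (peval l z) * Cmod (peval l z) - Cmod (peval l w) * Cmod (peval l w)) <= K * Cmod (z - w)).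
  { intros l. set (S := pnorm 1 l). set (D := pnorm 1 (pder l)).
    assert (0 <= S) by (apply pnorm_ge0; lra). assert (0 <= D) by (apply pnorm_ge0; lra).
    exists (2 * S * D + 1). split; [nra|]. intros z w Hz Hw.
    assert (Hl := peval_lip l z w Hz Hw). fold D in Hl.
    assert (Bz := peval_le 1 l z Hz). assert (Bw := peval_le 1 l w Hw). fold S in Bz, Bw.
    pose proof (Cmod_ge_0 (peval l z)); pose proof (Cmod_ge_0 (peval l w)); pose proof (Cmod_ge_0 (z - w)).
    pose proof (Cmod_diff (peval l z) (peval l w)) as Hd.
    replace (Cmod (peval l z) * Cmod (peval l z) - Cmod (peval l w) * Cmod (peval l w)) with
      ((Cmod (peval l z) + Cmod (peval l w)) * (Cmod (peval l z) - Cmod (peval l w))) by ring.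
    rewrite Rabs_mult, (Rabs_right (_ + _)) by lra.
    pose proof (Rabs_pos (Cmod (peval l z) - Cmod (peval l w))).
    apply Rle_trans with ((2 * S) * (D * Cmod (z - w))); [apply Rmult_le_compat; lra|nra]. }
  destruct (Hone U) as (K1 & HK1 & L1). destruct (Hone V) as (K2 & HK2 & L2).
  exists (K1 + K2). split; [lra|]. intros z w Hz Hw. specialize (L1 z w Hz Hw). specialize (L2 z w Hz Hw).
  unfold sn2.
  match goal with |- Rabs (?a + ?b - (?c + ?d)) <= _ => replace (a + b - (c + d)) with ((a - c) + (b - d)) by ring end.
  eapply Rle_trans; [apply Rabs_triang|]. lra.
Qed.

Lemma good_min U V : good U V -> exists m, 0 < m /\ forall z, Cmod z <= 1 -> m <= sn2 U V z.
Proof.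
  intros [Hg _]. apply cont_pos_min; [apply covers_cdisk|exact Hg|].
  destruct (sn2_lip U V) as (K & HK & HL).
  intros z Hz e He. exists (e / K). split; [now apply Rdiv_lt_0_compat|].
  intros w Hw Hd. eapply Rle_lt_trans; [now apply HL|].
  apply Rlt_le_trans with (K * (e / K)); [now apply Rmult_lt_compat_l|right; field; lra].
Qed.

(* A radial minorant of the conformal factor: [b (|z|^2)] supported in r <= |z| <= r',
   with mass [l]; it forces curves crossing the annulus to have induced length >= l. *)
Definition barrier (r r' l : R) (U V : list C) : Prop :=
  exists b : R -> R, (forall x, continuous b x) /\ (forall x, 0 <= b x) /\
    (forall x, x <= r * r -> b x = 0) /\ (forall x, r' * r' <= x -> b x = 0) /\
    l <= RInt b 0 1 /\ exists k, 0 < k /\ forall z, Cmod z <= 1 -> 2 * b (Cmod z * Cmod z) + k <= sn2 U V z.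

Lemma cont_ex_RInt (b : R -> R) x y : (forall x, continuous b x) -> ex_RInt b x y.
Proof. intros H; apply (ex_RInt_continuous b x y); intros; apply H. Qed.

(** A tent over [[al, be]]; on the middle half of the interval it is at least [h / 2], which already
    gives the integral. *)
Lemma tent_function al be h : 0 <= al < be -> be <= 1 -> 0 < h ->
  exists b : R -> R, (forall x, continuous b x) /\ (forall x, 0 <= b x <= h) /\
    (forall x, x <= al -> b x = 0) /\ (forall x, be <= x -> b x = 0) /\ h * (be - al) / 4 <= RInt b 0 1.
Proof.
  intros Hab Hb Hh. set (d := be - al). assert (Hd : 0 < d) by (unfold d; lra).
  set (b := fun x => h * Rmax 0 (1 - Rabs (2 * x - al - be) / d)).
  assert (Hc : forall x, continuous b x).
  { intros x. apply continuity_pt_filterlim. unfold b.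
    apply continuity_pt_mult; [apply continuity_pt_const; intros ? ?; reflexivity|].
    assert (Hm : forall f, continuity_pt f x -> continuity_pt (fun x => Rmax 0 (f x)) x).
    { intros f Hf. apply continuity_pt_ext with (fun x => (f x + Rabs (f x)) * / 2).
      - intros y. unfold Rmax, Rabs. destruct (Rle_dec 0 (f y)), (Rcase_abs (f y)); lra.
      - apply continuity_pt_mult; [|apply continuity_pt_const; intros ? ?; reflexivity].
        apply continuity_pt_plus; [exact Hf|]. apply (continuity_pt_comp f Rabs); [exact Hf|apply Rcontinuity_abs]. }
    apply Hm. apply continuity_pt_minus; [apply continuity_pt_const; intros ? ?; reflexivity|].
    apply continuity_pt_mult; [|apply continuity_pt_const; intros ? ?; reflexivity].
    apply (continuity_pt_comp (fun x => 2 * x - al - be) Rabs); [|apply Rcontinuity_abs].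
    apply derivable_continuous_pt. reg. }
  assert (Hbd : forall x, 0 <= b x <= h).
  { intros x. unfold b. pose proof (Rmax_l 0 (1 - Rabs (2 * x - al - be) / d)).
    assert (0 <= Rabs (2 * x - al - be) / d) by (apply Rdiv_le_0_compat; [apply Rabs_pos|lra]).
    assert (Rmax 0 (1 - Rabs (2 * x - al - be) / d) <= 1) by (apply Rmax_lub; lra). nra. }
  assert (Hz : forall x, d <= Rabs (2 * x - al - be) -> b x = 0).
  { intros x Hx. unfold b. rewrite Rmax_left; [ring|].
    assert (1 <= Rabs (2 * x - al - be) / d); [|lra].
    apply Rmult_le_reg_r with d; [lra|]. unfold Rdiv; rewrite Rmult_assoc, Rinv_l; lra. }
  exists b. split; [exact Hc|]. split; [exact Hbd|]. split; [|split].
  - intros x Hx. apply Hz. rewrite Rabs_left1; unfold d; lra.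
  - intros x Hx. apply Hz. rewrite Rabs_right; unfold d; lra.
  - set (x1 := (3 * al + be) / 4). set (x2 := (al + 3 * be) / 4).
    assert (Hx1 : 0 <= x1) by (unfold x1; lra). assert (Hx2 : x2 <= 1) by (unfold x2; lra).
    assert (Hx12 : x1 <= x2) by (unfold x1, x2; lra).
    rewrite <- (RInt_Chasles b 0 x1 1) by now apply cont_ex_RInt.
    rewrite <- (RInt_Chasles b x1 x2 1) by now apply cont_ex_RInt.
    assert (P1 : 0 <= RInt b 0 x1) by (apply RInt_ge_0; [lra|now apply cont_ex_RInt|intros; apply Hbd]).
    assert (P2 : 0 <= RInt b x2 1) by (apply RInt_ge_0; [lra|now apply cont_ex_RInt|intros; apply Hbd]).
    assert (P3' : RInt (fun _ => h / 2) x1 x2 <= RInt b x1 x2).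
    { apply RInt_le; [lra|apply ex_RInt_const|now apply cont_ex_RInt|].
      intros x Hx. unfold b.
      assert (1 / 2 <= 1 - Rabs (2 * x - al - be) / d).
      { assert (Rabs (2 * x - al - be) <= d / 2) by (apply Rabs_le; unfold d, x1, x2 in *; lra).
        assert (Rabs (2 * x - al - be) / d <= 1 / 2); [|lra].
        apply Rmult_le_reg_r with d; [lra|]. unfold Rdiv; rewrite Rmult_assoc, Rinv_l; lra. }
      pose proof (Rmax_r 0 (1 - Rabs (2 * x - al - be) / d)). nra. }
    rewrite RInt_const in P3'. unfold scal in P3'; simpl in P3'; unfold mult in P3'; simpl in P3'.
    unfold plus; simpl. replace (x2 - x1) with (d / 2) in P3' by (unfold x1, x2, d; field).
    fold d. lra.
Qed.

(** The tent has a quarter of the guaranteed metric as height, so that [2 b] uses half of it and the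
    other half pays for the constant [k]. In the variable [|z|^2] the base is
    [(r2 - r1) (r2 + r1) >= r2 - r1]; with the factor 4 of the tent, [2048 = 128 * 4 * 4]. *)
Lemma barrier_annulus U V r r1 r2 t : good U V -> 1 / 2 <= r < r1 -> r1 < r2 < 1 -> 0 < t ->
  (forall z, r1 <= Cmod z <= r2 -> t / 128 <= sn2 U V z * (r2 - r1)) -> barrier r r2 (t / 2048) U V.
Proof.
  intros Hg Hr Hr2 Ht H.
  destruct (good_min U V Hg) as (m & Hm & Hmin).
  set (h := t / 512 / (r2 - r1)).
  assert (Hh : 0 < h) by (unfold h; repeat apply Rdiv_lt_0_compat; lra).
  destruct (tent_function (r1 * r1) (r2 * r2) h) as (b & Hc & Hbd & Hz1 & Hz2 & HI); [split; nra|nra|exact Hh|].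
  exists b. split; [exact Hc|]. split; [apply Hbd|]. split; [intros; apply Hz1; nra|]. split; [exact Hz2|].
  split.
  - eapply Rle_trans; [|exact HI]. unfold h.
    replace (t / 512 / (r2 - r1) * (r2 * r2 - r1 * r1) / 4) with (t / 2048 * (r2 + r1)) by (field; lra). nra.
  - exists (m / 2). split; [lra|]. intros z Hz. specialize (Hmin z Hz).
    destruct (Rlt_le_dec (Cmod z) r1) as [Hlt|Hge].
    { rewrite Hz1; [lra|]. pose proof (Cmod_ge_0 z). nra. }
    destruct (Rlt_le_dec r2 (Cmod z)) as [Hlt|Hle].
    { rewrite Hz2; [lra|]. nra. }
    specialize (H z (conj Hge Hle)). specialize (Hbd (Cmod z * Cmod z)).
    assert (4 * h <= sn2 U V z).
    { apply Rmult_le_reg_r with (r2 - r1); [lra|]. unfold h.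
      replace (4 * (t / 512 / (r2 - r1)) * (r2 - r1)) with (t / 128) by (field; lra). lra. }
    lra.
Qed.

Lemma barrier_zero r U V : good U V -> barrier r r 0 U V.
Proof.
  intros Hg. destruct (good_min U V Hg) as (m & Hm & Hmin).
  exists (fun _ => 0). split; [intros; apply continuous_const|].
  split; [intros; lra|]. split; [reflexivity|]. split; [reflexivity|]. split.
  - rewrite RInt_const. unfold scal; simpl; unfold mult; simpl. lra.
  - exists m. split; [exact Hm|]. intros z Hz. specialize (Hmin z Hz). lra.
Qed.

Lemma sn2_perturb U V U' V' r e S : adm r e U V U' V' -> 0 <= r <= 1 -> 0 <= e <= 1 ->
  pnorm 1 U <= S -> pnorm 1 V <= S ->
  forall z, Cmod z <= r -> Rabs (sn2 U' V' z - sn2 U V z) <= 2 * (2 * S + 1) * e.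
Proof.
  intros (A & B & -> & -> & HA & HB & _) Hr He HU HV z Hz. unfold sn2. rewrite !peval_padd.
  assert (K : forall X D, pnorm 1 X <= S -> pnorm r D <= e ->
     Rabs (Cmod (peval X z + peval D z) * Cmod (peval X z + peval D z) - Cmod (peval X z) * Cmod (peval X z)) <= (2 * S + 1) * e).
  { intros X D HX HD. set (x := peval X z). set (d := peval D z).
    assert (Hx : Cmod x <= S) by (eapply Rle_trans; [apply (peval_le 1); lra|exact HX]).
    assert (Hd : Cmod d <= e) by (eapply Rle_trans; [apply (peval_le r); lra|exact HD]).
    pose proof (Cmod_triangle x d). pose proof (Cmod_ge_0 x). pose proof (Cmod_ge_0 d). pose proof (Cmod_ge_0 (x + d)).
    assert (Cmod x <= Cmod (x + d) + Cmod d).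
    { replace x with ((x + d) + - d)%C at 1 by ring. eapply Rle_trans; [apply Cmod_triangle|]. rewrite Cmod_opp; lra. }
    apply Rabs_le. split; nra. }
  specialize (K U A HU HA) as K1. specialize (K V B HV HB) as K2.
  apply Rabs_le_between in K1, K2. apply Rabs_le. lra.
Qed.

(** Up to radius [r'] the slack [k] absorbs the change of the metric; beyond it [b] vanishes and
    goodness of the new pair supplies a constant. *)
Lemma barrier_persist r r' l U V : good U V -> barrier r r' l U V -> 0 <= r' < 1 ->
  exists e, 0 < e /\ forall U' V', good U' V' -> adm r' e U V U' V' -> barrier r r' l U' V'.
Proof.
  intros Hg (b & Hc & Hb0 & Hz1 & Hz2 & HI & k & Hk & Hbk) Hr'.
  set (S := pnorm 1 U + pnorm 1 V). assert (HU0 : 0 <= pnorm 1 U) by (apply pnorm_ge0; lra).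
  assert (HV0 : 0 <= pnorm 1 V) by (apply pnorm_ge0; lra).
  assert (HS : 0 <= S) by (unfold S; lra).
  exists (Rmin 1 (k / (4 * (2 * S + 1)))). split; [apply Rmin_glb_lt; [lra|apply Rdiv_lt_0_compat; lra]|].
  set (e := Rmin _ _). intros U' V' Hg' Hadm.
  assert (He1 : e <= 1) by apply Rmin_l. assert (He2 : e <= k / (4 * (2 * S + 1))) by apply Rmin_r.
  assert (He : 0 <= e) by (apply Rmin_glb; [lra|left; apply Rdiv_lt_0_compat; lra]).
  assert (Hek : 2 * (2 * S + 1) * e <= k / 2).
  { apply Rle_trans with (2 * (2 * S + 1) * (k / (4 * (2 * S + 1)))); [apply Rmult_le_compat_l; lra|right; field; lra]. }
  destruct (good_min U' V' Hg') as (m & Hm & Hmin).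
  exists b. do 5 (split; [assumption|]). exists (Rmin m (k / 2)). split; [apply Rmin_glb_lt; lra|].
  pose proof (Rmin_l m (k / 2)); pose proof (Rmin_r m (k / 2)).
  intros z Hz. destruct (Rle_lt_dec (Cmod z) r') as [Hle|Hlt].
  - assert (Hp := sn2_perturb U V U' V' r' e S Hadm ltac:(lra) ltac:(lra) ltac:(unfold S; lra) ltac:(unfold S; lra) z Hle).
    apply Rabs_le_between in Hp. specialize (Hbk z Hz). lra.
  - rewrite Hz2 by nra. specialize (Hmin z Hz). lra.
Qed.

(** At every radius at most one of the two functions is nonzero, so the same metric is never charged
    twice. *)
Lemma barrier_add r r' r'' l l' U V : 0 <= r <= r' -> r' <= r'' ->
  barrier r r' l U V -> barrier r' r'' l' U V -> barrier r r'' (l + l') U V.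
Proof.
  intros Hr Hr' (b & Hc & Hb0 & Hz1 & Hz2 & HI & k & Hk & Hbk) (b' & Hc' & Hb0' & Hz1' & Hz2' & HI' & k' & Hk' & Hbk').
  exists (fun x => b x + b' x). split; [|split; [|split; [|split; [|split]]]].
  - intros x. apply (continuous_plus b b'); auto.
  - intros x. specialize (Hb0 x). specialize (Hb0' x). lra.
  - intros x Hx. rewrite Hz1, Hz1'; nra.
  - intros x Hx. rewrite Hz2, Hz2'; nra.
  - assert (E : RInt (fun x => b x + b' x) 0 1 = RInt b 0 1 + RInt b' 0 1).
    { apply (RInt_plus b b' 0 1); now apply cont_ex_RInt. }
    rewrite E; lra.
  - exists (Rmin k k'). split; [now apply Rmin_glb_lt|]. pose proof (Rmin_l k k'); pose proof (Rmin_r k k').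
    intros z Hz. specialize (Hbk z Hz). specialize (Hbk' z Hz). specialize (Hb0 (Cmod z * Cmod z)). specialize (Hb0' (Cmod z * Cmod z)).
    destruct (Rle_lt_dec (Cmod z) r') as [Hle|Hlt].
    + rewrite Hz1'; [lra|]. pose proof (Cmod_ge_0 z). nra.
    + rewrite Hz2; [lra|]. nra.
Qed.

(** * Gaining intrinsic length *)

Lemma polar z : exists (rho : R) w, Cmod w = 1 /\ rho = Cmod z /\ z = (rho * w)%C.
Proof.
  destruct (Req_dec (Cmod z) 0) as [E|E].
  - exists 0, 1%C. rewrite Cmod_1. apply Cmod_eq_0 in E as E'. rewrite E'. repeat split; [now rewrite Cmod_0|ring].
  - exists (Cmod z), (RtoC (/ Cmod z) * z)%C. pose proof (Cmod_ge_0 z).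
    split; [|split; [reflexivity|]].
    + rewrite Cmod_mult, Cmod_R, Rabs_right; [field; exact E|]. apply Rle_ge; left; apply Rinv_0_lt_compat; lra.
    + rewrite Cmult_assoc, <- RtoC_mult, Rinv_r by exact E. ring.
Qed.

Lemma surf0_radial U V eta : 0 < eta -> exists r, r < 1 /\
  forall z rho, Cmod z = 1 -> 0 <= rho -> r <= rho <= 1 -> enorm3 (sub3 (surf0 U V (rho * z)) (surf0 U V z)) <= eta.
Proof.
  intros He. destruct (surf0_lip U V) as (K & HK & HL).
  exists (1 - eta / K). split; [assert (0 < eta / K) by (now apply Rdiv_lt_0_compat); lra|].
  intros z rho Hz Hr0 Hr.
  assert (Hd : Cmod (rho * z - z) = 1 - rho).
  { replace (rho * z - z)%C with (RtoC (rho - 1) * z)%C by (rewrite RtoC_minus; ring).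
    rewrite Cmod_mult, Cmod_R, Hz, Rabs_left1 by lra. ring. }
  eapply Rle_trans; [apply HL|].
  - rewrite Cmod_scale_circle by lra. lra.
  - lra.
  - rewrite Hd. apply Rle_trans with (K * (eta / K)); [apply Rmult_le_compat_l; lra|right; field; lra].
Qed.

Lemma dot3_add_sq p q : dot3 (add3 p q) (add3 p q) = dot3 p p + 2 * dot3 p q + dot3 q q.
Proof. vunf; ring. Qed.

Definition disp (U V U' V' : list C) (z : C) : P3 := sub3 (surf0 U' V' z) (surf0 U V z).

(* Pythagoras: moving orthogonally to the accumulated displacement by [t] increases its square by [t^2]. *)
Lemma completeness_step U0 V0 U V (nu : C -> P3) r0 r1 l t X Y eta :
  good U V -> 1 / 2 <= r0 <= r1 -> r1 < 1 -> barrier r0 r1 l U V ->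
  circle_ucv nu -> (forall z, Cmod z = 1 -> enorm3 (nu z) = 1) ->
  (forall z, Cmod z = 1 -> disp U0 V0 U V z = scl3 (enorm3 (disp U0 V0 U V z)) (nu z)) ->
  (forall z, Cmod z <= 1 -> dot3 (disp U0 V0 U V z) (disp U0 V0 U V z) <= X) ->
  (forall z, Cmod z = 1 -> Y <= dot3 (disp U0 V0 U V z) (disp U0 V0 U V z)) ->
  0 < t -> 0 < eta ->
  exists U' V' r2, good U' V' /\ adm r0 eta U V U' V' /\ r1 <= r2 < 1 /\ barrier r0 r2 (l + t / 2048) U' V' /\
    (forall z, Cmod z <= 1 -> dot3 (disp U0 V0 U' V' z) (disp U0 V0 U' V' z) <= X + t * t + eta) /\
    (forall z, Cmod z = 1 -> Y + t * t - eta <= dot3 (disp U0 V0 U' V' z) (disp U0 V0 U' V' z)).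
Proof.
  intros Hg Hr0 Hr1 Hbar Hnu Hn1 Hdir HX HY Ht He.
  assert (HX0 : 0 <= X).
  { eapply Rle_trans; [apply dot3_ge0|apply (HX 0%C)]. rewrite Cmod_0; lra. }
  (* [X + 1] bounds the norm of a displacement whose square is at most [X], and [t] bounds the new
     move. *)
  set (M := X + 1 + t).
  assert (HM : 1 <= M) by (unfold M; lra).
  destruct (barrier_persist r0 r1 l U V Hg Hbar ltac:(lra)) as (ep & Hep & Hpers).
  set (e := Rmin (Rmin 1 ep) (Rmin eta (eta / (40 * M)))).
  assert (He0 : 0 < e) by (repeat apply Rmin_glb_lt; try lra; apply Rdiv_lt_0_compat; lra).
  assert (He1 : e <= 1) by (unfold e; eapply Rle_trans; [apply Rmin_l|apply Rmin_l]).
  assert (He2 : e <= ep) by (unfold e; eapply Rle_trans; [apply Rmin_l|apply Rmin_r]).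
  assert (He3 : e <= eta) by (unfold e; eapply Rle_trans; [apply Rmin_r|apply Rmin_l]).
  assert (He4 : e <= eta / (40 * M)) by (unfold e; eapply Rle_trans; [apply Rmin_r|apply Rmin_r]).
  assert (HeM : 40 * M * e <= eta).
  { apply Rle_trans with (40 * M * (eta / (40 * M))); [apply Rmult_le_compat_l; lra|right; field; lra]. }
  destruct (surf0_radial U0 V0 e He0) as (rr & Hrr & Hrad).
  destruct (rh_step U V nu (fun _ => t) (Rmax r1 rr) e t Hg Hnu Hn1 (ucr_const t) ltac:(intros; lra)
     ltac:(apply Rmax_lub_lt; lra) He0 Ht) as (U' & V' & r & Hr & Hrb & Hg' & Hadm & Hout & Hcross).
  pose proof (Rmax_l r1 rr). pose proof (Rmax_r r1 rr).
  destruct (Hcross ltac:(intros; lra)) as (s1 & s2 & Hs & Hs2 & Hcr).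
  assert (Hadm0 : adm r0 eta U V U' V') by (apply (adm_weaken r r0 e eta); [lra|lra|exact Hadm]).
  assert (HD : forall z, Cmod z <= 1 -> enorm3 (disp U0 V0 U V z) <= X + 1).
  { intros z Hz. apply enorm3_le; [lra|]. specialize (HX z Hz). nra. }
  (* Outside radius r the new displacement is the old boundary one plus an orthogonal w plus an error. *)
  assert (Hkey : forall z rho, Cmod z = 1 -> r <= rho <= 1 -> exists w, enorm3 w <= t /\ (rho = 1 -> enorm3 w = t) /\
     Rabs (dot3 (disp U0 V0 U V z) w) <= M * e /\
     Rabs (dot3 (disp U0 V0 U' V' (rho * z)) (disp U0 V0 U' V' (rho * z))
       - (dot3 (disp U0 V0 U V z) (disp U0 V0 U V z) + dot3 w w)) <= 20 * M * e).
  { intros z rho Hz Hrho. destruct (Hout z rho Hz Hrho) as (w & Hw1 & Hw2 & Hw3 & Hw4).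
    exists w. split; [exact Hw2|]. split; [exact Hw3|].
    set (D := disp U0 V0 U V z). assert (HDz : enorm3 D <= X + 1) by (apply HD; lra).
    pose proof (enorm3_ge0 D) as HD0.
    assert (Hdw : Rabs (dot3 D w) <= M * e).
    { assert (Ed : dot3 D w = enorm3 D * dot3 w (nu z)).
      { unfold D at 1. rewrite Hdir by exact Hz. fold D. vunf. ring. }
      rewrite Ed, Rabs_mult, (Rabs_right (enorm3 D)) by lra.
      apply Rmult_le_compat; [lra|apply Rabs_pos|unfold M; lra|lra]. }
    split; [exact Hdw|].
    set (D' := disp U0 V0 U' V' (rho * z)).
    set (q := add3 D w). set (err := sub3 D' q).
    assert (Herr : enorm3 err <= 2 * e).
    { replace err with (add3 (sub3 (sub3 (surf0 U' V' (rho * z)) (surf0 U V z)) w)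
         (sub3 (surf0 U0 V0 z) (surf0 U0 V0 (rho * z)))) by (unfold err, q, D', D, disp; veq).
      eapply Rle_trans; [apply enorm3_tri|].
      rewrite (enorm3_sym (surf0 U0 V0 z)). specialize (Hrad z rho Hz ltac:(lra) ltac:(lra)). lra. }
    replace D' with (add3 q err) by (unfold err; veq).
    rewrite dot3_add_sq. unfold q at 1 2. rewrite dot3_add_sq.
    replace (dot3 D D + 2 * dot3 D w + dot3 w w + 2 * dot3 q err + dot3 err err - (dot3 D D + dot3 w w))
      with (2 * dot3 D w + 2 * dot3 q err + dot3 err err) by ring.
    assert (Hq : enorm3 q <= M) by (unfold q; eapply Rle_trans; [apply enorm3_tri|]; unfold M; lra).
    assert (Hqe := dot3_le q err). pose proof (enorm3_ge0 q). pose proof (enorm3_ge0 err).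
    assert (enorm3 q * enorm3 err <= M * (2 * e)) by (apply Rmult_le_compat; lra).
    assert (dot3 err err <= 4 * e * e) by (rewrite <- enorm3_sq; nra).
    pose proof (dot3_ge0 err).
    apply Rabs_le_between in Hdw. assert (Hqe2 : Rabs (dot3 q err) <= M * (2 * e)) by lra. apply Rabs_le_between in Hqe2.
    apply Rabs_le. assert (e * e <= M * e) by nra. lra. }
  exists U', V', s2. split; [exact Hg'|]. split; [exact Hadm0|]. split; [lra|]. split; [|split].
  - apply barrier_add with r1; [lra|lra| |].
    + apply Hpers; [exact Hg'|]. apply (adm_weaken r r1 e ep); [lra|lra|exact Hadm].
    + destruct (barrier_annulus U' V' r s1 s2 t Hg' ltac:(lra) ltac:(lra) Ht Hcr) as (b & B1 & B2 & B3 & B4 & B5).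
      exists b. split; [exact B1|]. split; [exact B2|]. split; [|split; [exact B4|exact B5]].
      intros x Hx. apply B3. nra.
  - intros z Hz. destruct (Rle_lt_dec (Cmod z) r) as [Hle|Hlt].
    + destruct Hadm as (A & B & _ & _ & _ & _ & Hin). specialize (Hin z Hle).
      set (D := disp U0 V0 U V z). set (err := sub3 (surf0 U' V' z) (surf0 U V z)) in *.
      replace (disp U0 V0 U' V' z) with (add3 D err) by (unfold D, err, disp; veq).
      rewrite dot3_add_sq. assert (HDz := HD z Hz). fold D in HDz.
      assert (Hde := dot3_ub D err). pose proof (enorm3_ge0 D). pose proof (enorm3_ge0 err).
      assert (enorm3 D * enorm3 err <= M * e) by (apply Rmult_le_compat; unfold M; lra).
      assert (dot3 err err <= e * e) by (rewrite <- enorm3_sq; nra).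
      assert (Hxx := HX z Hz). fold D in Hxx. assert (e * e <= M * e) by nra. nra.
    + destruct (polar z) as (rho & w0 & Hw0 & -> & Ez).
      destruct (Hkey w0 (Cmod z) Hw0 ltac:(lra)) as (w & K1 & _ & K2 & K3). rewrite <- Ez in K3.
      apply Rabs_le_between in K3. assert (dot3 w w <= t * t) by (rewrite <- enorm3_sq; pose proof (enorm3_ge0 w); nra).
      specialize (HX w0 ltac:(lra)). lra.
  - intros z Hz. destruct (Hkey z 1 Hz ltac:(lra)) as (w & _ & K1 & K2 & K3).
    replace (1 * z)%C with z in K3 by ring. rewrite <- (enorm3_sq w), K1 in K3 by reflexivity.
    apply Rabs_le_between in K3. specialize (HY z Hz). lra.
Qed.

Lemma ucv_of_lip (g : C -> P3) K : 0 < K ->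
  (forall z w, Cmod z <= 1 -> Cmod w <= 1 -> enorm3 (sub3 (g z) (g w)) <= K * Cmod (z - w)) -> circle_ucv g.
Proof.
  intros HK HL e He. exists (e / K). split; [now apply Rdiv_lt_0_compat|].
  intros z w Hz Hw Hd. eapply Rle_lt_trans; [apply HL; lra|].
  apply Rlt_le_trans with (K * (e / K)); [now apply Rmult_lt_compat_l|right; field; lra].
Qed.

Lemma ucv_surf0 U V : circle_ucv (surf0 U V).
Proof. destruct (surf0_lip U V) as (K & HK & HL). now apply (ucv_of_lip _ K). Qed.

Lemma ucv_sub f g : circle_ucv f -> circle_ucv g -> circle_ucv (fun z => sub3 (f z) (g z)).
Proof.
  intros Hf Hg. unfold sub3. apply ucv_mk; apply ucr_minus;
    first [now apply ucv_px|now apply ucv_py|now apply ucv_pz].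
Qed.

Lemma ucr_dot f g : circle_ucv f -> circle_ucv g -> circle_ucr (fun z => dot3 (f z) (g z)).
Proof.
  intros Hf Hg. unfold dot3. repeat apply ucr_plus; apply ucr_mult;
    first [now apply ucv_px|now apply ucv_py|now apply ucv_pz].
Qed.

Lemma ucr_norm f : circle_ucv f -> circle_ucr (fun z => enorm3 (f z)).
Proof. intros Hf. apply ucr_sqrt; [now apply ucr_dot|intros; apply dot3_ge0]. Qed.

Lemma ucv_scl h f : circle_ucr h -> circle_ucv f -> circle_ucv (fun z => scl3 (h z) (f z)).
Proof.
  intros Hh Hf. unfold scl3. apply ucv_mk; apply ucr_mult; try exact Hh;
    first [now apply ucv_px|now apply ucv_py|now apply ucv_pz].
Qed.

Lemma ucv_normalize f m : 0 < m -> (forall z, Cmod z = 1 -> m <= enorm3 (f z)) -> circle_ucv f ->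
  circle_ucv (fun z => scl3 (/ enorm3 (f z)) (f z)).
Proof.
  intros Hm Hb Hf. apply ucv_scl; [|exact Hf]. apply (ucr_inv _ m); auto. now apply ucr_norm.
Qed.

Lemma enorm3_unit p : 0 < enorm3 p -> enorm3 (scl3 (/ enorm3 p) p) = 1.
Proof.
  intros H. rewrite enorm3_scl, Rabs_right; [field; lra|]. apply Rle_ge; left; now apply Rinv_0_lt_compat.
Qed.

(** The lower bound on the displacement is carried along because the next move must be orthogonal to
    its direction, and that direction is continuous only while the displacement stays away from
    zero. The error is quantified inside, so earlier steps can be made as exact as a later one
    demands. *)
Lemma completeness_iterate U0 V0 r0 t k : good U0 V0 -> 1 / 2 <= r0 < 1 -> 0 < t -> forall eta, 0 < eta ->
  exists U V r, good U V /\ adm r0 eta U0 V0 U V /\ r0 <= r < 1 /\ barrier r0 r (INR (S k) * (t / 2048)) U V /\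
    (forall z, Cmod z <= 1 -> dot3 (disp U0 V0 U V z) (disp U0 V0 U V z) <= INR (S k) * (t * t) + eta) /\
    (forall z, Cmod z = 1 -> INR (S k) * (t * t) - eta <= dot3 (disp U0 V0 U V z) (disp U0 V0 U V z)).
Proof.
  intros Hg Hr0 Ht. induction k as [|k IH]; intros eta He.
  - assert (HD : forall z, disp U0 V0 U0 V0 z = mk3 0 0 0) by (intros; apply sub3_diag).
    assert (HD2 : forall z, dot3 (disp U0 V0 U0 V0 z) (disp U0 V0 U0 V0 z) = 0) by (intros; rewrite HD; vunf; ring).
    (* The displacement is still zero, so any constant unit normal satisfies the direction
       condition. *)
    destruct (completeness_step U0 V0 U0 V0 (fun _ => mk3 0 0 1) r0 r0 0 t 0 0 eta) as (U & V & r & H1 & H2 & H3 & H4 & H5 & H6); auto; try lra.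
    + now apply barrier_zero.
    + intros e Hee. exists 1. split; [lra|]. intros. rewrite sub3_diag, enorm3_0. exact Hee.
    + intros z _. unfold enorm3. replace (dot3 (mk3 0 0 1) (mk3 0 0 1)) with 1 by (vunf; ring). apply sqrt_1.
    + intros z _. rewrite HD, enorm3_0. veq.
    + intros; rewrite HD2; lra.
    + intros; rewrite HD2; lra.
    + exists U, V, r. simpl INR. rewrite !Rmult_1_l. rewrite Rplus_0_l in H4.
      split; [exact H1|]. split; [exact H2|]. split; [lra|]. split; [exact H4|]. split.
      * intros z Hz. specialize (H5 z Hz). lra.
      * intros z Hz. specialize (H6 z Hz). lra.
  - set (e1 := Rmin (eta / 2) (t * t / 2)).
    assert (He1 : 0 < e1) by (apply Rmin_glb_lt; nra).
    assert (He1a : e1 <= eta / 2) by apply Rmin_l. assert (He1b : e1 <= t * t / 2) by apply Rmin_r.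
    destruct (IH e1 He1) as (U & V & r & Hg1 & Ha1 & Hr1 & Hb1 & HX1 & HY1).
    assert (Hk : 1 <= INR (S k)) by (rewrite S_INR; pose proof (pos_INR k); lra).
    assert (HDlow : forall z, Cmod z = 1 -> t / 2 <= enorm3 (disp U0 V0 U V z)).
    { intros z Hz. apply enorm3_ge; [lra|]. specialize (HY1 z Hz).
      assert (t * t <= INR (S k) * (t * t)) by (clear - Hk Ht; nra). assert (0 < t * t) by (clear - Ht; nra). lra. }
    set (nu := fun z => scl3 (/ enorm3 (disp U0 V0 U V z)) (disp U0 V0 U V z)).
    destruct (completeness_step U0 V0 U V nu r0 r (INR (S k) * (t / 2048)) t (INR (S k) * (t * t) + e1) (INR (S k) * (t * t) - e1) e1)
      as (U' & V' & r2 & H1 & H2 & H3 & H4 & H5 & H6); auto; try lra.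
    + apply (ucv_normalize (disp U0 V0 U V) (t / 2)); [lra|exact HDlow|].
      apply ucv_sub; apply ucv_surf0.
    + intros z Hz. apply enorm3_unit. specialize (HDlow z Hz). lra.
    + intros z Hz. specialize (HDlow z Hz). unfold nu.
      set (p := disp U0 V0 U V z) in *. apply P3_eq; vunf; field; lra.
    + exists U', V', r2. rewrite (S_INR (S k)). split; [exact H1|]. split; [|split; [lra|split]].
      * apply (adm_weaken r0 r0 (e1 + e1)); [lra|lra|]. apply (adm_trans r0 e1 e1 U0 V0 U V); [lra|assumption|assumption].
      * replace ((INR (S k) + 1) * (t / 2048)) with (INR (S k) * (t / 2048) + t / 2048) by ring. exact H4.
      * split; intros z Hz; [specialize (H5 z Hz)|specialize (H6 z Hz)]; lra.
Qed.

Lemma completeness_lemma U V r0 eta : good U V -> 1 / 2 <= r0 < 1 -> 0 < eta ->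
  exists U' V' r, good U' V' /\ adm r0 eta U V U' V' /\ r0 <= r < 1 /\ barrier r0 r 1 U' V' /\
    (forall z, Cmod z <= 1 -> enorm3 (disp U V U' V' z) <= eta).
Proof.
  intros Hg Hr He.
  set (e2 := eta * eta). assert (He2 : 0 < e2) by (unfold e2; nra).
  (* Displacement^2 ~ k t^2 while the length gained is k t / 2048. *)
  set (t := Rmin 1 (e2 / 8192)). assert (Ht : 0 < t) by (apply Rmin_glb_lt; lra).
  assert (Ht1 : t <= 1) by apply Rmin_l. assert (Ht2 : t <= e2 / 8192) by apply Rmin_r.
  (* With [k + 1] steps the gain [(k + 1) t / 2048] reaches 1, while [(k + 1) t^2 <= 4096 t] is at
     most [eta^2 / 2]. *)
  destruct (nfloor_ex (2048 / t)) as (k & Hk1 & Hk2); [apply Rdiv_le_0_compat; lra|].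
  destruct (completeness_iterate U V r0 t k Hg Hr Ht (Rmin eta (e2 / 4))) as (U' & V' & r & H1 & H2 & H3 & H4 & H5 & _).
  { apply Rmin_glb_lt; lra. }
  pose proof (Rmin_l eta (e2 / 4)). pose proof (Rmin_r eta (e2 / 4)).
  rewrite S_INR in *.
  assert (Hkt : 2048 <= (INR k + 1) * t).
  { apply Rlt_le. apply Rmult_lt_reg_r with (/ t); [now apply Rinv_0_lt_compat|]. rewrite Rmult_assoc, Rinv_r by lra. lra. }
  assert (Hkt2 : INR k * t <= 2048).
  { apply Rmult_le_reg_r with (/ t); [now apply Rinv_0_lt_compat|]. rewrite Rmult_assoc, Rinv_r by lra. lra. }
  exists U', V', r. split; [exact H1|]. split; [apply (adm_weaken r0 r0 (Rmin eta (e2 / 4))); [lra|lra|exact H2]|].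
  split; [exact H3|]. split.
  - destruct H4 as (b & B1 & B2 & B3 & B4 & B5 & B6). exists b. do 4 (split; [assumption|]). split; [|exact B6]. lra.
  - intros z Hz. apply enorm3_le; [lra|]. fold e2. specialize (H5 z Hz).
    assert ((INR k + 1) * (t * t) <= 4096 * t) by nra. lra.
Qed.

(** * Uniform tangent balls *)

Definition e1 : P3 := mk3 1 0 0.

Definition e2 : P3 := mk3 0 1 0.

Definition e3 : P3 := mk3 0 0 1.

Lemma plus_scal3 (p v : P3) (t : R) : plus p (scal t v) = add3 p (scl3 t v).
Proof. destruct p as [[a b] c], v as [[x y] z]; reflexivity. Qed.

Lemma cont3_elim (G : P3 -> R) x : continuous G x -> forall eps, 0 < eps ->
  exists del, 0 < del /\ forall y, enorm3 (sub3 y x) < del -> Rabs (G y - G x) < eps.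
Proof.
  intros H eps He. apply locally3_elim.
  apply (H (fun z => Rabs (z - G x) < eps)). exists (mkposreal _ He). intros z Hz. exact Hz.
Qed.

Lemma is_derive_shift (G : P3 -> R) x v s :
  ex_derive (fun t => G (plus (add3 x (scl3 s v)) (scal t v))) 0 ->
  is_derive (fun t => G (add3 x (scl3 t v))) s (dderiv G v (add3 x (scl3 s v))).
Proof.
  intros H. apply Derive_correct in H. unfold dderiv.
  set (L := Derive _ 0) in *.
  apply (is_derive_ext (fun t => (fun t => G (plus (add3 x (scl3 s v)) (scal t v))) (t - s))).
  - intros t. simpl. rewrite plus_scal3. f_equal. veq.
  - replace L with (1 * L) by ring.
    apply (is_derive_comp (fun t => G (plus (add3 x (scl3 s v)) (scal t v))) (fun t => t - s)).
    + replace (s - s) with 0 by ring. exact H.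
    + auto_derive; [exact I|ring].
Qed.

Lemma axis_increment (G : P3 -> R) x v s :
  (forall t, Rabs t <= Rabs s -> ex_derive (fun u => G (plus (add3 x (scl3 t v)) (scal u v))) 0) ->
  exists c, Rabs c <= Rabs s /\ G (add3 x (scl3 s v)) - G x = s * dderiv G v (add3 x (scl3 c v)).
Proof.
  intros H.
  destruct (MVT_gen (fun t => G (add3 x (scl3 t v))) 0 s (fun t => dderiv G v (add3 x (scl3 t v)))) as (c & Hc & E).
  - intros t Ht. apply is_derive_shift, H. unfold Rmin, Rmax in Ht. destruct (Rle_dec 0 s); unfold Rabs; destruct (Rcase_abs t), (Rcase_abs s); lra.
  - intros t Ht. apply derivable_continuous_pt. eexists. apply is_derive_Reals, is_derive_shift, H.
    unfold Rmin, Rmax in Ht. destruct (Rle_dec 0 s); unfold Rabs; destruct (Rcase_abs t), (Rcase_abs s); lra.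
  - exists c. split.
    + unfold Rmin, Rmax in Hc. destruct (Rle_dec 0 s); unfold Rabs; destruct (Rcase_abs c), (Rcase_abs s); lra.
    + replace (add3 x (scl3 0 v)) with x in E by veq. rewrite E. ring.
Qed.

Definition C1b (U : P3 -> Prop) (G : P3 -> R) : Prop :=
  forall v, In v basis3 -> (forall x, U x -> ex_derive (fun t => G (plus x (scal t v))) 0) /\
    forall x, U x -> continuous (dderiv G v) x.

(** Smoothness is given along the coordinate axes only, while curvature concerns all directions.
    Continuous partial derivatives suffice: the increment is split into three steps parallel to the
    axes, with the mean value theorem on each. *)
Lemma differentiable_line (U : P3 -> Prop) G x v : open U -> U x -> C1b U G ->
  is_derive (fun t => G (add3 x (scl3 t v))) 0
    (px v * dderiv G e1 x + py v * dderiv G e2 x + pz v * dderiv G e3 x).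
Proof.
  intros HU Hx HC.
  destruct (HC e1) as [D1 K1]; [simpl; tauto|]. destruct (HC e2) as [D2 K2]; [simpl; tauto|].
  destruct (HC e3) as [D3 K3]; [simpl; tauto|].
  destruct (open3_elim U x HU Hx) as (r & Hr & HrU).
  apply is_derive_Reals. intros eps He.
  set (N := Rabs (px v) + Rabs (py v) + Rabs (pz v) + 1).
  pose proof (Rabs_pos (px v)); pose proof (Rabs_pos (py v)); pose proof (Rabs_pos (pz v)).
  assert (HN : 0 < N) by (unfold N; lra).
  assert (He' : 0 < eps / (2 * N)) by (apply Rdiv_lt_0_compat; lra).
  destruct (cont3_elim _ x (K1 x Hx) _ He') as (d1 & Hd1 & C1).
  destruct (cont3_elim _ x (K2 x Hx) _ He') as (d2 & Hd2 & C2).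
  destruct (cont3_elim _ x (K3 x Hx) _ He') as (d3 & Hd3 & C3).
  set (d := Rmin r (Rmin d1 (Rmin d2 d3))).
  assert (Hd : 0 < d) by (repeat apply Rmin_glb_lt; lra).
  assert (Hdr : d <= r) by apply Rmin_l.
  assert (Hdd1 : d <= d1) by (unfold d; eapply Rle_trans; [apply Rmin_r|apply Rmin_l]).
  assert (Hdd2 : d <= d2) by (unfold d; eapply Rle_trans; [apply Rmin_r|]; eapply Rle_trans; [apply Rmin_r|apply Rmin_l]).
  assert (Hdd3 : d <= d3) by (unfold d; eapply Rle_trans; [apply Rmin_r|]; eapply Rle_trans; [apply Rmin_r|apply Rmin_r]).
  assert (HdN : 0 < d / N) by (apply Rdiv_lt_0_compat; lra).
  exists (mkposreal _ HdN). intros h Hh0 Hh; simpl in Hh.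
  assert (HhN : Rabs h * N < d).
  { apply Rlt_le_trans with (d / N * N); [now apply Rmult_lt_compat_r|right; field; lra]. }
  pose proof (Rabs_pos h).
  set (a := h * px v). set (b := h * py v). set (c := h * pz v).
  assert (Ea : Rabs a = Rabs h * Rabs (px v)) by apply Rabs_mult.
  assert (Eb : Rabs b = Rabs h * Rabs (py v)) by apply Rabs_mult.
  assert (Ec : Rabs c = Rabs h * Rabs (pz v)) by apply Rabs_mult.
  assert (Hnear : forall s1 s2 s3, Rabs s1 <= Rabs a -> Rabs s2 <= Rabs b -> Rabs s3 <= Rabs c ->
    enorm3 (sub3 (mk3 (px x + s1) (py x + s2) (pz x + s3)) x) < d).
  { intros s1 s2 s3 H1' H2' H3'. eapply Rle_lt_trans; [apply enorm3_le_sum|]. vunf.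
    replace (px x + s1 - px x) with s1 by ring. replace (py x + s2 - py x) with s2 by ring.
    replace (pz x + s3 - pz x) with s3 by ring.
    apply Rle_lt_trans with (Rabs h * N); [|exact HhN]. unfold N. lra. }
  set (x1 := add3 x (scl3 a e1)). set (x2 := add3 x1 (scl3 b e2)).
  destruct (axis_increment G x e1 a) as (c1 & Hc1 & I1).
  { intros t Ht. apply D1, HrU. replace (add3 x (scl3 t e1)) with (mk3 (px x + t) (py x + 0) (pz x + 0)) by (unfold e1; veq).
    eapply Rlt_le_trans; [apply Hnear; rewrite ?Rabs_R0; try apply Rabs_pos; lra|lra]. }
  destruct (axis_increment G x1 e2 b) as (c2 & Hc2 & I2).
  { intros t Ht. apply D2, HrU. replace (add3 x1 (scl3 t e2)) with (mk3 (px x + a) (py x + t) (pz x + 0)) by (unfold x1, e1, e2; veq).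
    eapply Rlt_le_trans; [apply Hnear; rewrite ?Rabs_R0; try apply Rabs_pos; lra|lra]. }
  destruct (axis_increment G x2 e3 c) as (c3 & Hc3 & I3).
  { intros t Ht. apply D3, HrU. replace (add3 x2 (scl3 t e3)) with (mk3 (px x + a) (py x + b) (pz x + t)) by (unfold x2, x1, e1, e2, e3; veq).
    eapply Rlt_le_trans; [apply Hnear; rewrite ?Rabs_R0; try apply Rabs_pos; lra|lra]. }
  assert (M1 : Rabs (dderiv G e1 (add3 x (scl3 c1 e1)) - dderiv G e1 x) < eps / (2 * N)).
  { apply C1. replace (add3 x (scl3 c1 e1)) with (mk3 (px x + c1) (py x + 0) (pz x + 0)) by (unfold e1; veq).
    eapply Rlt_le_trans; [apply Hnear; rewrite ?Rabs_R0; try apply Rabs_pos; lra|lra]. }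
  assert (M2 : Rabs (dderiv G e2 (add3 x1 (scl3 c2 e2)) - dderiv G e2 x) < eps / (2 * N)).
  { apply C2. replace (add3 x1 (scl3 c2 e2)) with (mk3 (px x + a) (py x + c2) (pz x + 0)) by (unfold x1, e1, e2; veq).
    eapply Rlt_le_trans; [apply Hnear; rewrite ?Rabs_R0; try apply Rabs_pos; lra|lra]. }
  assert (M3 : Rabs (dderiv G e3 (add3 x2 (scl3 c3 e3)) - dderiv G e3 x) < eps / (2 * N)).
  { apply C3. replace (add3 x2 (scl3 c3 e3)) with (mk3 (px x + a) (py x + b) (pz x + c3)) by (unfold x2, x1, e1, e2, e3; veq).
    eapply Rlt_le_trans; [apply Hnear; rewrite ?Rabs_R0; try apply Rabs_pos; lra|lra]. }
  replace (add3 x (scl3 (0 + h) v)) with (add3 x2 (scl3 c e3)) by (unfold x2, x1, a, b, c, e1, e2, e3; veq).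
  replace (add3 x (scl3 0 v)) with x by veq.
  set (g1 := dderiv G e1 (add3 x (scl3 c1 e1))) in *. set (g2 := dderiv G e2 (add3 x1 (scl3 c2 e2))) in *.
  set (g3 := dderiv G e3 (add3 x2 (scl3 c3 e3))) in *.
  fold x1 in I1. fold x2 in I2.
  replace ((G (add3 x2 (scl3 c e3)) - G x) / h - (px v * dderiv G e1 x + py v * dderiv G e2 x + pz v * dderiv G e3 x))
    with (px v * (g1 - dderiv G e1 x) + py v * (g2 - dderiv G e2 x) + pz v * (g3 - dderiv G e3 x)).
  2:{ replace (G (add3 x2 (scl3 c e3)) - G x) with (a * g1 + b * g2 + c * g3) by lra. unfold a, b, c. field. exact Hh0. }
  eapply Rle_lt_trans; [apply Rabs_triang|]. eapply Rle_lt_trans; [apply Rplus_le_compat_r, Rabs_triang|].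
  rewrite !Rabs_mult.
  apply Rle_lt_trans with (N * (eps / (2 * N))).
  - unfold N in *. nra.
  - replace (N * (eps / (2 * N))) with (eps / 2) by (field; lra). lra.
Qed.

(** After subtracting the tangent and [A t^2 / 2], the mean value theorem reduces the claim to the
    first derivative; [A = k] and [A = K] give the two bounds. *)
Lemma second_order (f f' f'' : R -> R) k K :
  (forall t, 0 <= t <= 1 -> is_derive f t (f' t)) -> (forall t, 0 <= t <= 1 -> is_derive f' t (f'' t)) ->
  (forall t, 0 <= t <= 1 -> k <= f'' t <= K) -> k / 2 <= f 1 - f 0 - f' 0 <= K / 2.
Proof.
  intros H1 H2 HK.
  assert (Hf' : forall t, 0 <= t <= 1 -> k * t <= f' t - f' 0 <= K * t).
  { intros t Ht. destruct (MVT_gen f' 0 t f'') as (c & Hc & E).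
    - intros x Hx. rewrite Rmin_left, Rmax_right in Hx by lra. apply H2; lra.
    - intros x Hx. rewrite Rmin_left, Rmax_right in Hx by lra. apply derivable_continuous_pt. eexists. apply is_derive_Reals, H2; lra.
    - rewrite Rmin_left, Rmax_right in Hc by lra. specialize (HK c ltac:(lra)). rewrite E. nra. }
  assert (Hq : forall A, exists c, 0 <= c <= 1 /\ f 1 - f 0 - f' 0 - A / 2 = f' c - f' 0 - A * c).
  { intros A.
    assert (HD : forall x, 0 <= x <= 1 -> is_derive (fun t => f t + (- f' 0 * t - A / 2 * (t * t))) x (f' x + (- f' 0 - A * x))).
    { intros x Hx. apply (is_derive_plus f); [now apply H1|]. auto_derive; [exact I|field]. }
    destruct (MVT_gen (fun t => f t + (- f' 0 * t - A / 2 * (t * t))) 0 1 (fun t => f' t + (- f' 0 - A * t))) as (c & Hc & E).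
    - intros x Hx. rewrite Rmin_left, Rmax_right in Hx by lra. apply HD; lra.
    - intros x Hx. rewrite Rmin_left, Rmax_right in Hx by lra.
      apply derivable_continuous_pt. eexists. apply is_derive_Reals, HD; lra.
    - rewrite Rmin_left, Rmax_right in Hc by lra. exists c. split; [lra|]. lra. }
  split.
  - destruct (Hq k) as (c & Hc & E). specialize (Hf' c Hc). lra.
  - destruct (Hq K) as (c & Hc & E). specialize (Hf' c Hc). lra.
Qed.

(** * The Hessian quadratic form along lines *)

Definition hess (F : P3 -> R) (x : P3) (v : P3) : R :=
  px v * (px v * dderiv (dderiv F e1) e1 x + py v * dderiv (dderiv F e1) e2 x + pz v * dderiv (dderiv F e1) e3 x) +
  py v * (px v * dderiv (dderiv F e2) e1 x + py v * dderiv (dderiv F e2) e2 x + pz v * dderiv (dderiv F e2) e3 x) +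
  pz v * (px v * dderiv (dderiv F e3) e1 x + py v * dderiv (dderiv F e3) e2 x + pz v * dderiv (dderiv F e3) e3 x).

Lemma CkOn2_C1b U F : CkOn basis3 2 U F -> C1b U F /\ (forall v, In v basis3 -> C1b U (dderiv F v)).
Proof.
  intros [H1 H2]. split.
  - intros v Hv. split; [intros x Hx; now apply H1|]. intros x Hx. apply (proj1 (H2 v Hv)); assumption.
  - intros v Hv w Hw. destruct (H2 v Hv) as [H3 H4]. split; [intros x Hx; now apply H3|]. intros x Hx. apply (H4 w Hw x Hx).
Qed.

Lemma is_derive_line_at (U : P3 -> Prop) G x v s : open U -> U (add3 x (scl3 s v)) -> C1b U G ->
  is_derive (fun t => G (add3 x (scl3 t v))) s (dot3 v (grad3 G (add3 x (scl3 s v)))).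
Proof.
  intros HU Hx HC. assert (H := differentiable_line U G (add3 x (scl3 s v)) v HU Hx HC).
  apply (is_derive_ext (fun t => (fun t => G (add3 (add3 x (scl3 s v)) (scl3 t v))) (t - s))).
  - intros t. simpl. f_equal. veq.
  - replace (dot3 v (grad3 G (add3 x (scl3 s v)))) with
      (1 * (px v * dderiv G e1 (add3 x (scl3 s v)) + py v * dderiv G e2 (add3 x (scl3 s v)) + pz v * dderiv G e3 (add3 x (scl3 s v)))).
    2:{ unfold dot3, grad3. rewrite px_mk, py_mk, pz_mk. fold e1 e2 e3. ring. }
    apply (is_derive_comp (fun t => G (add3 (add3 x (scl3 s v)) (scl3 t v))) (fun t => t - s)).
    + replace (s - s) with 0 by ring. exact H.
    + auto_derive; [exact I|ring].
Qed.

Lemma is_derive_lin3 (a b c : R) (f g h : R -> R) x l m n :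
  is_derive f x l -> is_derive g x m -> is_derive h x n ->
  is_derive (fun t => a * f t + b * g t + c * h t) x (a * l + b * m + c * n).
Proof.
  intros Hf Hg Hh. apply (is_derive_plus (fun t => a * f t + b * g t)); [|now apply is_derive_scal].
  apply (is_derive_plus (fun t => a * f t)); now apply is_derive_scal.
Qed.

Lemma is_derive_line2 (U : P3 -> Prop) F x v s : open U -> U (add3 x (scl3 s v)) ->
  (forall w, In w basis3 -> C1b U (dderiv F w)) ->
  is_derive (fun t => dot3 v (grad3 F (add3 x (scl3 t v)))) s (hess F (add3 x (scl3 s v)) v).
Proof.
  intros HU Hx HC.
  assert (H1 := is_derive_line_at U (dderiv F e1) x v s HU Hx (HC e1 ltac:(simpl; tauto))).
  assert (H2 := is_derive_line_at U (dderiv F e2) x v s HU Hx (HC e2 ltac:(simpl; tauto))).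
  assert (H3 := is_derive_line_at U (dderiv F e3) x v s HU Hx (HC e3 ltac:(simpl; tauto))).
  apply (is_derive_ext (fun t => px v * dderiv F e1 (add3 x (scl3 t v)) + py v * dderiv F e2 (add3 x (scl3 t v)) + pz v * dderiv F e3 (add3 x (scl3 t v)))).
  - intros t. unfold dot3, grad3. rewrite px_mk, py_mk, pz_mk. reflexivity.
  - unfold hess.
    replace (px v * (px v * dderiv (dderiv F e1) e1 (add3 x (scl3 s v)) + py v * dderiv (dderiv F e1) e2 (add3 x (scl3 s v)) + pz v * dderiv (dderiv F e1) e3 (add3 x (scl3 s v))))
      with (px v * dot3 v (grad3 (dderiv F e1) (add3 x (scl3 s v)))) by (unfold dot3, grad3; rewrite px_mk, py_mk, pz_mk; fold e1 e2 e3; ring).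
    replace (py v * (px v * dderiv (dderiv F e2) e1 (add3 x (scl3 s v)) + py v * dderiv (dderiv F e2) e2 (add3 x (scl3 s v)) + pz v * dderiv (dderiv F e2) e3 (add3 x (scl3 s v))))
      with (py v * dot3 v (grad3 (dderiv F e2) (add3 x (scl3 s v)))) by (unfold dot3, grad3; rewrite px_mk, py_mk, pz_mk; fold e1 e2 e3; ring).
    replace (pz v * (px v * dderiv (dderiv F e3) e1 (add3 x (scl3 s v)) + py v * dderiv (dderiv F e3) e2 (add3 x (scl3 s v)) + pz v * dderiv (dderiv F e3) e3 (add3 x (scl3 s v))))
      with (pz v * dot3 v (grad3 (dderiv F e3) (add3 x (scl3 s v)))) by (unfold dot3, grad3; rewrite px_mk, py_mk, pz_mk; fold e1 e2 e3; ring).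
    now apply is_derive_lin3.
Qed.

(* The iterated directional derivative in the curvature hypothesis is the Hessian form. *)
Lemma dderiv2_hess U F x v : open U -> U x -> CkOn basis3 2 U F -> dderiv (dderiv F v) v x = hess F x v.
Proof.
  intros HU Hx HC. destruct (CkOn2_C1b U F HC) as [HC1 HC2].
  destruct (open3_elim U x HU Hx) as (r & Hr & HrU).
  assert (Hb : exists d : posreal, forall t, Rabs t < d -> U (add3 x (scl3 t v))).
  { pose proof (enorm3_ge0 v). assert (Hd : 0 < r / (enorm3 v + 1)) by (apply Rdiv_lt_0_compat; lra).
    exists (mkposreal _ Hd). intros t Ht; simpl in Ht. apply HrU.
    replace (sub3 (add3 x (scl3 t v)) x) with (scl3 t v) by veq. rewrite enorm3_scl.
    apply Rle_lt_trans with (Rabs t * (enorm3 v + 1)); [apply Rmult_le_compat_l; [apply Rabs_pos|lra]|].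
    apply Rlt_le_trans with (r / (enorm3 v + 1) * (enorm3 v + 1)); [apply Rmult_lt_compat_r; lra|right; field; lra]. }
  destruct Hb as [d Hd].
  unfold dderiv at 1.
  transitivity (Derive (fun t => dot3 v (grad3 F (add3 x (scl3 t v)))) 0).
  - apply Derive_ext_loc. exists d. intros t Ht.
    assert (Ht' : Rabs t < d).
    { unfold ball in Ht; simpl in Ht; unfold AbsRing_ball, abs, minus, plus, opp in Ht; simpl in Ht.
      rewrite Ropp_0, Rplus_0_r in Ht. exact Ht. }
    rewrite plus_scal3. unfold dderiv at 1.
    apply is_derive_unique.
    apply (is_derive_ext (fun u => F (add3 (add3 x (scl3 t v)) (scl3 u v)))); [intros u; f_equal; symmetry; apply plus_scal3|].
    assert (H := is_derive_line_at U F (add3 x (scl3 t v)) v 0 HU).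
    replace (add3 (add3 x (scl3 t v)) (scl3 0 v)) with (add3 x (scl3 t v)) in H by veq.
    apply H; [now apply Hd|exact HC1].
  - apply is_derive_unique. assert (H := is_derive_line2 U F x v 0 HU).
    replace (add3 x (scl3 0 v)) with x in H by veq. now apply H.
Qed.

Lemma quad9_le a11 a12 a13 a21 a22 a23 a31 a32 a33 B (v : P3) :
  Rabs a11 <= B -> Rabs a12 <= B -> Rabs a13 <= B -> Rabs a21 <= B -> Rabs a22 <= B -> Rabs a23 <= B ->
  Rabs a31 <= B -> Rabs a32 <= B -> Rabs a33 <= B ->
  Rabs (px v * (px v * a11 + py v * a12 + pz v * a13) + py v * (px v * a21 + py v * a22 + pz v * a23) +
    pz v * (px v * a31 + py v * a32 + pz v * a33)) <= 9 * B * dot3 v v.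
Proof.
  intros B11 B12 B13 B21 B22 B23 B31 B32 B33.
  assert (K : forall x y a, Rabs x <= enorm3 v -> Rabs y <= enorm3 v -> Rabs a <= B ->
    - (B * dot3 v v) <= x * (y * a) <= B * dot3 v v).
  { intros x y a Hx Hy Ha. apply Rabs_le_between. rewrite !Rabs_mult, <- enorm3_sq.
    pose proof (Rabs_pos x); pose proof (Rabs_pos y); pose proof (Rabs_pos a).
    replace (B * (enorm3 v * enorm3 v)) with (enorm3 v * (enorm3 v * B)) by ring.
    apply Rmult_le_compat; [lra|apply Rmult_le_pos; lra|lra|apply Rmult_le_compat; lra]. }
  pose proof (px_le v) as X; pose proof (py_le v) as Y; pose proof (pz_le v) as Z.
  pose proof (K _ _ _ X X B11). pose proof (K _ _ _ X Y B12). pose proof (K _ _ _ X Z B13).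
  pose proof (K _ _ _ Y X B21). pose proof (K _ _ _ Y Y B22). pose proof (K _ _ _ Y Z B23).
  pose proof (K _ _ _ Z X B31). pose proof (K _ _ _ Z Y B32). pose proof (K _ _ _ Z Z B33).
  apply Rabs_le. lra.
Qed.

Lemma hess_diff F x p B v :
  (forall v w, In v basis3 -> In w basis3 -> Rabs (dderiv (dderiv F v) w x - dderiv (dderiv F v) w p) <= B) ->
  Rabs (hess F x v - hess F p v) <= 9 * B * dot3 v v.
Proof.
  intros H.
  assert (I1 : In e1 basis3) by (simpl; tauto). assert (I2 : In e2 basis3) by (simpl; tauto).
  assert (I3 : In e3 basis3) by (simpl; tauto).
  replace (hess F x v - hess F p v) with
   (px v * (px v * (dderiv (dderiv F e1) e1 x - dderiv (dderiv F e1) e1 p) + py v * (dderiv (dderiv F e1) e2 x - dderiv (dderiv F e1) e2 p) + pz v * (dderiv (dderiv F e1) e3 x - dderiv (dderiv F e1) e3 p)) +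
    py v * (px v * (dderiv (dderiv F e2) e1 x - dderiv (dderiv F e2) e1 p) + py v * (dderiv (dderiv F e2) e2 x - dderiv (dderiv F e2) e2 p) + pz v * (dderiv (dderiv F e2) e3 x - dderiv (dderiv F e2) e3 p)) +
    pz v * (px v * (dderiv (dderiv F e3) e1 x - dderiv (dderiv F e3) e1 p) + py v * (dderiv (dderiv F e3) e2 x - dderiv (dderiv F e3) e2 p) + pz v * (dderiv (dderiv F e3) e3 x - dderiv (dderiv F e3) e3 p)))
    by (unfold hess; ring).
  apply quad9_le; apply H; assumption.
Qed.

Lemma hess_bound F p : exists B, 0 < B /\ forall v, Rabs (hess F p v) <= B * dot3 v v.
Proof.
  set (s := fun v w => Rabs (dderiv (dderiv F v) w p)).
  assert (Hs : forall v w, 0 <= s v w) by (intros; apply Rabs_pos).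
  set (B := s e1 e1 + s e1 e2 + s e1 e3 + s e2 e1 + s e2 e2 + s e2 e3 + s e3 e1 + s e3 e2 + s e3 e3 + 1).
  pose proof (Hs e1 e1); pose proof (Hs e1 e2); pose proof (Hs e1 e3); pose proof (Hs e2 e1); pose proof (Hs e2 e2);
  pose proof (Hs e2 e3); pose proof (Hs e3 e1); pose proof (Hs e3 e2); pose proof (Hs e3 e3).
  exists (9 * B). split; [unfold B; lra|]. intros v. unfold hess. apply quad9_le;
  match goal with |- Rabs (dderiv (dderiv F ?v) ?w p) <= _ => change (s v w <= B) end; unfold B; lra.
Qed.

Lemma hess_scl F p a v : hess F p (scl3 a v) = a * a * hess F p v.
Proof. unfold hess, scl3. rewrite px_mk, py_mk, pz_mk. ring. Qed.

Lemma covers_sphere : covers dist3 (fun v => enorm3 v = 1).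
Proof.
  apply covers_P3 with 1; [intros; lra|]. intros x Hx.
  exists (Rabs (enorm3 x - 1)). split; [apply Rabs_pos_lt; lra|].
  intros y Hy E. unfold dist3 in Hy. pose proof (enorm3_diff y x). rewrite E in H.
  rewrite Rabs_minus_sym in H. lra.
Qed.

Lemma hess_cont_vec F p v0 eps : 0 < eps -> enorm3 v0 = 1 -> exists del, 0 < del /\
  forall v, enorm3 v = 1 -> enorm3 (sub3 v v0) < del -> Rabs (hess F p v - hess F p v0) < eps.
Proof.
  intros He Hv0.
  set (s := fun v w => Rabs (dderiv (dderiv F v) w p)).
  assert (Hs : forall v w, 0 <= s v w) by (intros; apply Rabs_pos).
  set (B := s e1 e1 + s e1 e2 + s e1 e3 + s e2 e1 + s e2 e2 + s e2 e3 + s e3 e1 + s e3 e2 + s e3 e3 + 1).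
  pose proof (Hs e1 e1); pose proof (Hs e1 e2); pose proof (Hs e1 e3); pose proof (Hs e2 e1); pose proof (Hs e2 e2);
  pose proof (Hs e2 e3); pose proof (Hs e3 e1); pose proof (Hs e3 e2); pose proof (Hs e3 e3).
  assert (HB : 0 < B) by (unfold B; lra).
  exists (eps / (20 * B)). split; [apply Rdiv_lt_0_compat; lra|].
  intros v Hv Hd. set (d := enorm3 (sub3 v v0)) in *. assert (Hd0 : 0 <= d) by apply enorm3_ge0.
  assert (HdB : 20 * B * d < eps).
  { apply Rlt_le_trans with (20 * B * (eps / (20 * B))); [apply Rmult_lt_compat_l; lra|right; field; lra]. }
  assert (K : forall x y x0 y0 a, Rabs x <= 1 -> Rabs y0 <= 1 -> Rabs (x - x0) <= d -> Rabs (y - y0) <= d -> Rabs a <= B ->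
    - (2 * B * d) <= x * (y * a) - x0 * (y0 * a) <= 2 * B * d).
  { intros x y x0 y0 a Hx Hy Hxx Hyy Ha. apply Rabs_le_between.
    replace (x * (y * a) - x0 * (y0 * a)) with (a * (x * (y - y0) + (x - x0) * y0)) by ring.
    rewrite Rabs_mult.
    assert (Rabs (x * (y - y0) + (x - x0) * y0) <= 2 * d).
    { eapply Rle_trans; [apply Rabs_triang|]. rewrite !Rabs_mult.
      pose proof (Rabs_pos x); pose proof (Rabs_pos y0); pose proof (Rabs_pos (x - x0)); pose proof (Rabs_pos (y - y0)). nra. }
    pose proof (Rabs_pos a). pose proof (Rabs_pos (x * (y - y0) + (x - x0) * y0)).
    replace (2 * B * d) with (B * (2 * d)) by ring. apply Rmult_le_compat; lra. }
  assert (X := px_le v); assert (Y := py_le v); assert (Z := pz_le v). rewrite Hv in X, Y, Z.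
  assert (X0 := px_le v0); assert (Y0 := py_le v0); assert (Z0 := pz_le v0). rewrite Hv0 in X0, Y0, Z0.
  assert (DX := px_le (sub3 v v0)); assert (DY := py_le (sub3 v v0)); assert (DZ := pz_le (sub3 v v0)).
  fold d in DX, DY, DZ. unfold sub3 in DX, DY, DZ. rewrite px_mk in DX. rewrite py_mk in DY. rewrite pz_mk in DZ.
  assert (A : forall u w, s u w <= B -> Rabs (dderiv (dderiv F u) w p) <= B) by (intros; assumption).
  pose proof (K _ _ _ _ _ X X0 DX DX (A e1 e1 ltac:(unfold B; lra))).
  pose proof (K _ _ _ _ _ X Y0 DX DY (A e1 e2 ltac:(unfold B; lra))).
  pose proof (K _ _ _ _ _ X Z0 DX DZ (A e1 e3 ltac:(unfold B; lra))).
  pose proof (K _ _ _ _ _ Y X0 DY DX (A e2 e1 ltac:(unfold B; lra))).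
  pose proof (K _ _ _ _ _ Y Y0 DY DY (A e2 e2 ltac:(unfold B; lra))).
  pose proof (K _ _ _ _ _ Y Z0 DY DZ (A e2 e3 ltac:(unfold B; lra))).
  pose proof (K _ _ _ _ _ Z X0 DZ DX (A e3 e1 ltac:(unfold B; lra))).
  pose proof (K _ _ _ _ _ Z Y0 DZ DY (A e3 e2 ltac:(unfold B; lra))).
  pose proof (K _ _ _ _ _ Z Z0 DZ DZ (A e3 e3 ltac:(unfold B; lra))).
  assert (0 <= B * d) by nra.
  unfold hess. apply Rabs_lt_between. lra.
Qed.

(* Finsler's lemma: positivity on the orthogonal complement of [g] becomes positivity everywhere
   after adding a large multiple of the square of [g]. *)
Lemma finsler F p g : (forall v, v <> mk3 0 0 0 -> dot3 v g = 0 -> 0 < hess F p v) ->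
  exists h, 0 < h /\ forall v, h * dot3 v v <= hess F p v + / h * (dot3 v g * dot3 v g).
Proof.
  intros Hpos.
  destruct (covers_uniform dist3 (fun v => enorm3 v = 1)
    (fun v h => h <= hess F p v + / h * (dot3 v g * dot3 v g)) covers_sphere) as (h & Hh & H).
  - intros x m m' Hx Hm. assert (/ m <= / m') by (apply Rinv_le_contravar; lra).
    pose proof (Rle_0_sqr (dot3 x g)); unfold Rsqr in *. nra.
  - intros v0 Hv0. destruct (Rlt_le_dec 0 (hess F p v0)) as [Hp|Hn].
    + destruct (hess_cont_vec F p v0 (hess F p v0 / 2)) as (del & Hdel & H); [lra|exact Hv0|].
      exists del, (hess F p v0 / 2). split; [exact Hdel|]. split; [lra|]. intros v Hv Hd.
      specialize (H v Hv Hd). apply Rabs_lt_between in H.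
      assert (0 < / (hess F p v0 / 2)) by (apply Rinv_0_lt_compat; lra).
      pose proof (Rle_0_sqr (dot3 v g)); unfold Rsqr in *. nra.
    + assert (Hb : dot3 v0 g <> 0).
      { intros E. specialize (Hpos v0). assert (v0 <> mk3 0 0 0) by (intros ->; rewrite enorm3_0 in Hv0; lra).
        specialize (Hpos H E). lra. }
      set (b := dot3 v0 g) in *. set (a := hess F p v0) in *.
      destruct (hess_cont_vec F p v0 1) as (d1 & Hd1 & H1); [lra|exact Hv0|].
      assert (Hbp : 0 < Rabs b) by now apply Rabs_pos_lt.
      pose proof (enorm3_ge0 g).
      set (d2 := Rabs b / (2 * (enorm3 g + 1))). assert (Hd2 : 0 < d2) by (apply Rdiv_lt_0_compat; lra).
      (* Near [v0] the Hessian is at least [a - 1] and the squared pairing with [g] at least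
         [b^2 / 4]; dividing the latter by [m] must cover the deficit [2 - a]. *)
      set (m := Rmin 1 (b * b / (4 * (2 - a)))).
      assert (Hbb : 0 < b * b) by (rewrite <- (Rabs_right (b * b)), Rabs_mult by nra; nra).
      assert (Hm : 0 < m) by (apply Rmin_glb_lt; [lra|apply Rdiv_lt_0_compat; lra]).
      assert (Hm1 : m <= 1) by apply Rmin_l. assert (Hm2 : m <= b * b / (4 * (2 - a))) by apply Rmin_r.
      exists (Rmin d1 d2), m. split; [now apply Rmin_glb_lt|]. split; [exact Hm|].
      intros v Hv Hd. unfold dist3 in Hd. pose proof (Rmin_l d1 d2). pose proof (Rmin_r d1 d2).
      specialize (H1 v Hv ltac:(lra)). apply Rabs_lt_between in H1. fold a in H1.
      assert (Hvg : Rabs b / 2 <= Rabs (dot3 v g)).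
      { assert (E : Rabs (dot3 v g - b) <= Rabs b / 2).
        { replace (dot3 v g - b) with (dot3 (sub3 v v0) g) by (unfold b; vunf; ring).
          eapply Rle_trans; [apply dot3_le|]. pose proof (enorm3_ge0 (sub3 v v0)).
          apply Rle_trans with (d2 * (enorm3 g + 1)); [apply Rmult_le_compat; lra|].
          right. unfold d2. field. lra. }
        pose proof (Rabs_triang_inv b (b - dot3 v g)). rewrite (Rabs_minus_sym b) in H3.
        replace (b - (b - dot3 v g)) with (dot3 v g) in H3 by ring. lra. }
      assert (Hsq : b * b / 4 <= dot3 v g * dot3 v g).
      { replace (dot3 v g * dot3 v g) with (Rabs (dot3 v g) * Rabs (dot3 v g)) by (rewrite <- Rabs_mult; apply Rabs_right; nra).
        replace (b * b) with (Rabs b * Rabs b) by (rewrite <- Rabs_mult; apply Rabs_right; nra). nra. }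
      assert (2 - a <= / m * (dot3 v g * dot3 v g)); [|lra].
      apply Rle_trans with (/ m * (b * b / 4)).
      * apply Rmult_le_reg_l with m; [lra|]. rewrite <- Rmult_assoc, Rinv_r, Rmult_1_l by lra.
        apply (Rmult_le_compat_r (2 - a)) in Hm2; [|lra].
        replace (b * b / (4 * (2 - a)) * (2 - a)) with (b * b / 4) in Hm2 by (field; lra). lra.
      * apply Rmult_le_compat_l; [left; now apply Rinv_0_lt_compat|lra].
  - exists h. split; [exact Hh|]. intros v.
    destruct (Req_dec (enorm3 v) 0) as [E|E].
    + apply enorm3_eq0 in E. subst v. unfold hess. vunf. right; ring.
    + pose proof (enorm3_ge0 v). set (u := scl3 (/ enorm3 v) v).
      assert (Hu : enorm3 u = 1).
      { unfold u. rewrite enorm3_scl, Rabs_right; [field; lra|]. apply Rle_ge; left; apply Rinv_0_lt_compat; lra. }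
      specialize (H u Hu).
      assert (Ev : v = scl3 (enorm3 v) u) by (unfold u; apply P3_eq; vunf; field; lra).
      rewrite Ev, hess_scl.
      replace (dot3 (scl3 (enorm3 v) u) g) with (enorm3 v * dot3 u g) by (vunf; ring).
      replace (dot3 (scl3 (enorm3 v) u) (scl3 (enorm3 v) u)) with (enorm3 v * enorm3 v) by (rewrite <- enorm3_sq, enorm3_scl, Hu, Rabs_right by lra; ring).
      apply Rle_trans with (enorm3 v * enorm3 v * (hess F p u + / h * (dot3 u g * dot3 u g))); [|right; ring].
      rewrite Rmult_comm. apply Rmult_le_compat_l; [nra|exact H].
Qed.

(* [m] is at once the radius of an interior tangent ball and the inverse radius of a local exterior one. *)
Definition pinched (C : P3 -> Prop) (q : P3) (m : R) : Prop :=
  exists n, enorm3 n = 1 /\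
    (forall x, dot3 (sub3 x q) (sub3 x q) < - (2 * m * dot3 n (sub3 x q)) -> C x) /\
    (forall x, C x -> enorm3 (sub3 x q) < m -> dot3 (sub3 x q) (sub3 x q) < - (2 / m * dot3 n (sub3 x q))).

Lemma pinched_mono C q m m' : pinched C q m -> 0 < m' <= m -> pinched C q m'.
Proof.
  intros (n & Hn & H1 & H2) Hm. exists n. split; [exact Hn|]. split.
  - intros x Hx. apply H1. pose proof (dot3_ge0 (sub3 x q)). set (a := dot3 n (sub3 x q)) in *.
    assert (a < 0) by nra. nra.
  - intros x Hx Hd. specialize (H2 x Hx ltac:(lra)). pose proof (dot3_ge0 (sub3 x q)).
    set (a := dot3 n (sub3 x q)) in *.
    assert (H2m : 0 < 2 / m) by (apply Rdiv_lt_0_compat; lra).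
    assert (a < 0) by nra.
    assert (2 / m <= 2 / m') by (apply Rmult_le_compat_l; [lra|apply Rinv_le_contravar; lra]). nra.
Qed.

(** * Interior and exterior tangent balls *)

Lemma ball3_open p r : open (fun x => enorm3 (sub3 x p) < r).
Proof.
  intros x Hx. apply (locally3_intro x _ (r - enorm3 (sub3 x p))); [lra|].
  intros y Hy. pose proof (enorm3_sub_tri y x p). lra.
Qed.

Lemma segment_ball p q y r : enorm3 (sub3 q p) < r -> enorm3 (sub3 (add3 q y) p) < r ->
  forall t, 0 <= t <= 1 -> enorm3 (sub3 (add3 q (scl3 t y)) p) < r.
Proof.
  intros Hq Hy t Ht.
  replace (sub3 (add3 q (scl3 t y)) p) with (add3 (scl3 (1 - t) (sub3 q p)) (scl3 t (sub3 (add3 q y) p))) by veq.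
  eapply Rle_lt_trans; [apply enorm3_tri|]. rewrite !enorm3_scl, !Rabs_right by lra.
  destruct (Req_dec t 0) as [->|Ht0]; [|nra]. rewrite Rmult_0_l, Rplus_0_r, Rminus_0_r, Rmult_1_l. exact Hq.
Qed.

(** Second-order Taylor expansion of [F] at boundary points [q] near [p]. An upper bound of the
    Hessian gives the interior ball. For the exterior one, the Finsler inequality at [p] persists
    near [p] in the form [h/2 |y|^2 - b^2 / h] with [b] the pairing of [y] with the gradient at [q];
    near [q] the square of [b] is dominated by [b] itself. *)
Lemma local_pinching C p : open C -> smooth_strictly_convex_boundary C -> boundary3 C p ->
  exists del m, 0 < del /\ 0 < m /\ forall q, boundary3 C q -> dist3 q p < del -> pinched C q m.
Proof.
  intros HopC Hsc Hp.
  destruct (Hsc p Hp) as (r & Hr & F & HF & HCF & Hgrad & Hhess).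
  set (U := fun x => enorm3 (sub3 x p) < r) in *.
  assert (HU : open U) by apply ball3_open.
  assert (HUp : U p) by (unfold U; rewrite sub3_diag, enorm3_0; exact Hr).
  assert (HC2 : CkOn basis3 2 U F) by apply HF.
  destruct (CkOn2_C1b U F HC2) as [HC1 HC1'].
  assert (HF0 : forall x, U x -> continuous F x) by (intros x Hx; apply (proj1 HC2 x Hx)).
  set (g := grad3 F p) in *.
  assert (Hg : 0 < enorm3 g) by now apply enorm3_pos.
  destruct (finsler F p g) as (h & Hh & Hfin).
  { intros v Hv0 Hv. specialize (Hhess v Hv0 Hv). rewrite (dderiv2_hess U F p v HU HUp HC2) in Hhess.
    apply (Rmult_lt_reg_r (/ enorm3 g)); [now apply Rinv_0_lt_compat|]. unfold Rdiv in Hhess. lra. }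
  destruct (hess_bound F p) as (B & HB & HBv).
  set (G := enorm3 g) in *.
  (* Allowed oscillation of gradient and second derivatives: the gradient stays comparable to [G],
     the Hessian loses at most [h / 8], and replacing the gradient at [p] by the one at [q] costs at
     most [h / 4]. *)
  set (w := Rmin (Rmin (G / 2) 1) (Rmin (h / 72) (h * h / (16 * (2 * G + 1))))).
  assert (Hhh : 0 < h * h / (16 * (2 * G + 1))) by (apply Rdiv_lt_0_compat; nra).
  assert (Hw : 0 < w) by (repeat apply Rmin_glb_lt; lra).
  assert (Hw1 : w <= G / 2) by (unfold w; eapply Rle_trans; [apply Rmin_l|apply Rmin_l]).
  assert (Hw2 : w <= 1) by (unfold w; eapply Rle_trans; [apply Rmin_l|apply Rmin_r]).
  assert (Hw3 : w <= h / 72) by (unfold w; eapply Rle_trans; [apply Rmin_r|apply Rmin_l]).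
  assert (Hw4 : w <= h * h / (16 * (2 * G + 1))) by (unfold w; eapply Rle_trans; [apply Rmin_r|apply Rmin_r]).
  assert (Hosc : exists d, 0 < d /\ d <= r /\ forall x, enorm3 (sub3 x p) < d ->
     enorm3 (sub3 (grad3 F x) g) <= w /\
     forall u v, In u basis3 -> In v basis3 -> Rabs (dderiv (dderiv F u) v x - dderiv (dderiv F u) v p) <= w).
  { assert (Hone : forall (fs : list (P3 -> R)) e, 0 < e -> (forall f, In f fs -> continuous f p) ->
      exists d, 0 < d /\ forall x f, In f fs -> enorm3 (sub3 x p) < d -> Rabs (f x - f p) < e).
    { intros fs e He. induction fs as [|f fs IH]; intros Hc.
      - exists 1. split; [lra|]. intros x f [].
      - destruct IH as (d & Hd & H); [intros; apply Hc; now right|].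
        destruct (cont3_elim f p (Hc f (or_introl eq_refl)) e He) as (d' & Hd' & H').
        exists (Rmin d d'). split; [now apply Rmin_glb_lt|]. pose proof (Rmin_l d d'). pose proof (Rmin_r d d').
        intros x f0 [<-|Hf] Hx; [apply H'; lra|apply H; [exact Hf|lra]]. }
    destruct (Hone (map (dderiv F) basis3) (w / 3)) as (d1 & Hd1 & H1); [lra| |].
    { intros f Hf. apply in_map_iff in Hf as (v & <- & Hv). now apply (HC1 v Hv). }
    destruct (Hone (flat_map (fun u => map (dderiv (dderiv F u)) basis3) basis3) w Hw) as (d2 & Hd2 & H2).
    { intros f Hf. apply in_flat_map in Hf as (u & Hu & Hf). apply in_map_iff in Hf as (v & <- & Hv).
      now apply (HC1' u Hu v Hv). }
    exists (Rmin r (Rmin d1 d2)). split; [repeat apply Rmin_glb_lt; lra|]. split; [apply Rmin_l|].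
    pose proof (Rmin_r r (Rmin d1 d2)). pose proof (Rmin_l d1 d2). pose proof (Rmin_r d1 d2).
    intros x Hx. split.
    - eapply Rle_trans; [apply enorm3_le_sum|]. unfold g, grad3. vunf.
      assert (Q1 := H1 x (dderiv F e1) ltac:(simpl; tauto) ltac:(lra)).
      assert (Q2 := H1 x (dderiv F e2) ltac:(simpl; tauto) ltac:(lra)).
      assert (Q3 := H1 x (dderiv F e3) ltac:(simpl; tauto) ltac:(lra)).
      unfold e1, e2, e3 in *. lra.
    - intros u v Hu Hv. apply Rlt_le, (H2 x (dderiv (dderiv F u) v)); [|lra].
      apply in_flat_map. exists u. split; [exact Hu|]. now apply in_map. }
  destruct Hosc as (d & Hd & Hdr & Hosc).
  (* Positivity would keep nearby points out of [C], against closure; negativity would put [q]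
     itself into the open set [C]. *)
  assert (HFq : forall q, boundary3 C q -> enorm3 (sub3 q p) < d -> F q = 0).
  { intros q [Hcl Hnq] Hqd. apply Rle_antisym.
    - apply Rnot_lt_le. intros Hpos.
      destruct (cont3_elim F q (HF0 q ltac:(unfold U; lra)) (F q) Hpos) as (d1 & Hd1 & Hc).
      destruct (Hcl (Rmin d1 (d - enorm3 (sub3 q p)))) as (y & HyC & Hy); [apply Rmin_glb_lt; lra|].
      pose proof (Rmin_l d1 (d - enorm3 (sub3 q p))). pose proof (Rmin_r d1 (d - enorm3 (sub3 q p))).
      rewrite enorm3_sym in Hy. specialize (Hc y ltac:(lra)). apply Rabs_lt_between in Hc.
      pose proof (enorm3_sub_tri y q p). apply HCF in HyC; lra.
    - apply Rnot_lt_le. intros Hneg. apply Hnq, HCF; lra. }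
  set (L := B + 9).
  set (m := Rmin (Rmin (d / 8) (G / (4 * L))) (Rmin (h / (6 * (2 * G))) (h / (4 * (2 * G))))).
  assert (HL : 0 < L) by (unfold L; lra).
  assert (Hm : 0 < m) by (repeat apply Rmin_glb_lt; try lra; apply Rdiv_lt_0_compat; lra).
  assert (Hm1 : m <= d / 8) by (unfold m; eapply Rle_trans; [apply Rmin_l|apply Rmin_l]).
  assert (Hm2 : m <= G / (4 * L)) by (unfold m; eapply Rle_trans; [apply Rmin_l|apply Rmin_r]).
  assert (Hm3 : m <= h / (6 * (2 * G))) by (unfold m; eapply Rle_trans; [apply Rmin_r|apply Rmin_l]).
  assert (Hm4 : m <= h / (4 * (2 * G))) by (unfold m; eapply Rle_trans; [apply Rmin_r|apply Rmin_r]).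
  exists (d / 4), m. split; [lra|]. split; [exact Hm|].
  intros q Hq Hqp. unfold dist3 in Hqp.
  destruct (Hosc q ltac:(lra)) as [Hgq _]. set (gq := grad3 F q) in *.
  assert (HGq : G / 2 <= enorm3 gq <= 2 * G).
  { pose proof (enorm3_diff gq g) as T. apply Rabs_le_between in T. fold G in T. lra. }
  assert (HF00 : F q = 0) by (apply HFq; [exact Hq|lra]).
  assert (Taylor : forall x k K, enorm3 (sub3 x p) < d ->
     (forall t, 0 <= t <= 1 -> k <= hess F (add3 q (scl3 t (sub3 x q))) (sub3 x q) <= K) ->
     k / 2 <= F x - dot3 (sub3 x q) gq <= K / 2).
  { intros x k K Hx Hk. set (y := sub3 x q) in *.
    assert (Hseg : forall t, 0 <= t <= 1 -> U (add3 q (scl3 t y))).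
    { intros t Ht. apply segment_ball; [lra| |exact Ht]. replace (add3 q y) with x by (unfold y; veq). lra. }
    assert (S2 := second_order (fun t => F (add3 q (scl3 t y))) (fun t => dot3 y (grad3 F (add3 q (scl3 t y))))
       (fun t => hess F (add3 q (scl3 t y)) y) k K).
    simpl in S2.
    replace (add3 q (scl3 1 y)) with x in S2 by (unfold y; veq).
    replace (add3 q (scl3 0 y)) with q in S2 by veq. rewrite HF00 in S2. fold gq in S2.
    rewrite Rminus_0_r in S2. apply S2; [| |exact Hk].
    - intros t Ht. apply (is_derive_line_at U); auto.
    - intros t Ht. apply (is_derive_line2 U); auto. }
  assert (Hseg : forall x, enorm3 (sub3 x p) < d -> forall t, 0 <= t <= 1 ->
     Rabs (hess F (add3 q (scl3 t (sub3 x q))) (sub3 x q) - hess F p (sub3 x q)) <= 9 * w * dot3 (sub3 x q) (sub3 x q)).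
  { intros x Hx t Ht. apply hess_diff. apply Hosc. apply segment_ball; [lra| |exact Ht].
    replace (add3 q (sub3 x q)) with x by veq. exact Hx. }
  exists (scl3 (/ enorm3 gq) gq). split.
  { rewrite enorm3_scl, Rabs_right; [field; lra|]. apply Rle_ge; left; apply Rinv_0_lt_compat; lra. }
  assert (Ea : forall y, enorm3 gq * dot3 (scl3 (/ enorm3 gq) gq) y = dot3 y gq) by (intros; vunf; field; lra).
  split.
  - intros x Hx. set (y := sub3 x q) in *. set (a := dot3 (scl3 (/ enorm3 gq) gq) y) in *.
    specialize (Ea y). fold a in Ea.
    pose proof (dot3_ge0 y). pose proof (enorm3_ge0 y).
    assert (Ha : a < 0) by nra.
    assert (Hab : - a <= enorm3 y).
    { assert (T := dot3_lb (scl3 (/ enorm3 gq) gq) y). fold a in T.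
      rewrite enorm3_scl, Rabs_right in T by (apply Rle_ge; left; apply Rinv_0_lt_compat; lra).
      rewrite Rinv_l, Rmult_1_l in T by lra. lra. }
    (* The interior ball has diameter [2 m], so its points stay where the expansion is valid. *)
    assert (Hy2 : enorm3 y <= 2 * m).
    { rewrite <- enorm3_sq in Hx. apply Rnot_lt_le. intros Hc. nra. }
    assert (Hxp : enorm3 (sub3 x p) < d).
    { pose proof (enorm3_sub_tri x q p). fold y in H1. lra. }
    apply HCF; [lra|].
    assert (Tl := Taylor x (- (L * dot3 y y)) (L * dot3 y y) Hxp).
    destruct Tl as [_ Tl].
    { intros t Ht. specialize (Hseg x Hxp t Ht). apply Rabs_le_between in Hseg. fold y in Hseg. fold y.
      specialize (HBv y). apply Rabs_le_between in HBv. unfold L. nra. }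
    fold y in Tl. rewrite <- Ea in Tl.
    assert (HLm : L * m <= G / 4).
    { apply Rle_trans with (L * (G / (4 * L))); [apply Rmult_le_compat_l; lra|right; field; lra]. }
    assert (L * dot3 y y <= L * m * (- (2 * a))) by nra.
    assert (enorm3 gq * a <= G / 2 * a) by nra. nra.
  - intros x HxC Hxm. set (y := sub3 x q) in *. set (a := dot3 (scl3 (/ enorm3 gq) gq) y) in *.
    specialize (Ea y). fold a in Ea.
    pose proof (dot3_ge0 y) as Hyy. pose proof (enorm3_ge0 y) as Hy0.
    assert (Hxp : enorm3 (sub3 x p) < d).
    { pose proof (enorm3_sub_tri x q p). fold y in H. lra. }
    assert (HFx : F x < 0) by (apply HCF; [lra|exact HxC]).
    set (b := dot3 y gq) in *.
    assert (Hlow : forall t, 0 <= t <= 1 -> h / 2 * dot3 y y - / h * (b * b) <= hess F (add3 q (scl3 t y)) y).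
    { intros t Ht. specialize (Hseg x Hxp t Ht). fold y in Hseg. apply Rabs_le_between in Hseg.
      specialize (Hfin y).
      assert (Hgg : / h * (dot3 y g * dot3 y g) <= / h * (b * b) + h / 4 * dot3 y y).
      { assert (Hih : 0 < / h) by now apply Rinv_0_lt_compat.
        assert (Hs : dot3 y g * dot3 y g <= b * b + w * (4 * (2 * G + 1)) * dot3 y y).
        { assert (Hdd : Rabs (dot3 y g - b) <= w * enorm3 y).
          { replace (dot3 y g - b) with (- dot3 y (sub3 gq g)) by (unfold b; vunf; ring). rewrite Rabs_Ropp.
            eapply Rle_trans; [apply dot3_le|]. rewrite Rmult_comm. apply Rmult_le_compat_r; lra. }
          assert (Hb1 : Rabs (dot3 y g) <= G * enorm3 y) by (rewrite Rmult_comm; apply dot3_le).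
          assert (Hb2 : Rabs b <= 2 * G * enorm3 y).
          { eapply Rle_trans; [apply dot3_le|]. rewrite Rmult_comm. apply Rmult_le_compat_r; lra. }
          assert (Hprod : Rabs ((dot3 y g - b) * (dot3 y g + b)) <= (w * enorm3 y) * (3 * G * enorm3 y)).
          { rewrite Rabs_mult. apply Rmult_le_compat; try apply Rabs_pos; [exact Hdd|].
            eapply Rle_trans; [apply Rabs_triang|]. lra. }
          apply Rabs_le_between in Hprod.
          assert ((w * enorm3 y) * (3 * G * enorm3 y) <= w * (4 * (2 * G + 1)) * dot3 y y).
          { rewrite <- enorm3_sq. replace (w * enorm3 y * (3 * G * enorm3 y)) with (w * (3 * G) * (enorm3 y * enorm3 y)) by ring.
            apply Rmult_le_compat_r; [nra|]. apply Rmult_le_compat_l; lra. }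
          nra. }
        assert (Hw5 : w * (4 * (2 * G + 1)) <= h * h / 4).
        { apply Rle_trans with (h * h / (16 * (2 * G + 1)) * (4 * (2 * G + 1))); [apply Rmult_le_compat_r; lra|right; field; lra]. }
        apply Rle_trans with (/ h * (b * b + h * h / 4 * dot3 y y)).
        - apply Rmult_le_compat_l; [lra|]. eapply Rle_trans; [exact Hs|]. apply Rplus_le_compat_l, Rmult_le_compat_r; lra.
        - right. field. lra. }
      assert (9 * w * dot3 y y <= h / 8 * dot3 y y) by (apply Rmult_le_compat_r; lra). lra. }
    set (u := sub3 x q) in Taylor. 
    destruct (Taylor x (h / 2 * dot3 y y - / h * (b * b)) (2 * L * dot3 y y) Hxp) as [Tl _].
    { intros t Ht. split; [apply Hlow, Ht|]. specialize (Hseg x Hxp t Ht). fold y in Hseg. fold y. apply Rabs_le_between in Hseg.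
      specialize (HBv y). apply Rabs_le_between in HBv. unfold L. nra. }
    fold y in Tl. fold b in Tl.
    (* Now [b^2 / h <= |b| / 2], which forces [b < 0] and turns the quadratic remainder into a
       fraction of the linear term. *)
    assert (Hbs : Rabs b <= h / 2).
    { eapply Rle_trans; [apply dot3_le|].
      apply Rle_trans with (h / (4 * (2 * G)) * (2 * G)); [apply Rmult_le_compat; lra|]. 
      replace (h / (4 * (2 * G)) * (2 * G)) with (h / 4) by (field; lra). lra. }
    assert (Hibb : / h * (b * b) <= Rabs b / 2).
    { replace (b * b) with (Rabs b * Rabs b) by (rewrite <- Rabs_mult; apply Rabs_right; nra).
      pose proof (Rabs_pos b). apply Rmult_le_reg_l with h; [lra|]. rewrite <- Rmult_assoc, Rinv_r, Rmult_1_l by lra. nra. }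
    assert (Hbneg : b < 0).
    { apply Rnot_le_lt. intros Hb0. rewrite Rabs_right in Hibb by lra. assert (0 <= h / 2 * dot3 y y) by (apply Rmult_le_pos; lra). lra. }
    rewrite Rabs_left in Hibb by lra.
    assert (Hmain : h * dot3 y y < - (5 * b)) by lra.
    (* h |y|^2 < -5b = -5|g_q| (n.y) and |g_q| <= 2G *)
    assert (Hm5 : 12 * G <= h * / m).
    { apply Rmult_le_reg_r with m; [lra|]. replace (h * / m * m) with h by (field; lra).
      apply Rle_trans with (12 * G * (h / (6 * (2 * G)))); [apply Rmult_le_compat_l; lra|right; field; lra]. }
    assert (Ha : a < 0) by nra.
    assert (H5 : - (5 * b) <= 12 * G * (- a) - G * (- a)) by (rewrite <- Ea; nra).
    apply Rmult_lt_reg_l with h; [lra|].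
    replace (h * - (2 / m * a)) with (2 * (h * / m) * (- a)) by (field; lra). nra.
Qed.

Lemma covers_boundary C : open C -> bounded3 C -> covers dist3 (boundary3 C).
Proof.
  intros Ho [M HM]. apply covers_P3 with (M + 1).
  - intros x [Hcl _]. destruct (Hcl 1 Rlt_0_1) as (y & Hy & Hd). specialize (HM y Hy).
    pose proof (enorm3_tri y (sub3 x y)). replace (add3 y (sub3 x y)) with x in H by veq. lra.
  - intros x Hx. destruct (classic (C x)) as [HC|HC].
    + destruct (open3_elim C x Ho HC) as (e & He & H). exists e. split; [exact He|].
      intros y Hy [_ Hn]. apply Hn, H, Hy.
    + assert (Hcl : ~ closure3 C x) by (intros H; apply Hx; now split).
      apply not_all_ex_not in Hcl as [e He]. apply imply_to_and in He as [He Hno].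
      exists (e / 2). split; [lra|]. intros y Hy [Hcy _]. unfold dist3 in Hy.
      destruct (Hcy (e / 2)) as (z & Hz & Hyz); [lra|]. apply Hno. exists z. split; [exact Hz|].
      pose proof (enorm3_sub_tri x y z). rewrite (enorm3_sym x y) in H. lra.
Qed.

Theorem uniform_pinching C : open C -> bounded3 C -> smooth_strictly_convex_boundary C ->
  exists m, 0 < m /\ m <= 1 /\ forall q, boundary3 C q -> pinched C q m.
Proof.
  intros Ho Hb Hs.
  destruct (covers_uniform dist3 (boundary3 C) (pinched C) (covers_boundary C Ho Hb)) as (m & Hm & H).
  - intros; eapply pinched_mono; eassumption.
  - intros p Hp. now apply local_pinching.
  - exists (Rmin m 1). split; [apply Rmin_glb_lt; lra|]. split; [apply Rmin_r|].
    intros q Hq. apply pinched_mono with m; [auto|]. split; [apply Rmin_glb_lt; lra|apply Rmin_l].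
Qed.

(** * Pushing the boundary outwards *)

(** Distance to the complement rather than to the boundary: it is 1-Lipschitz on all of space, and a
    ball of this radius around [x] certifies membership in [C]. *)
Definition depth (C : P3 -> Prop) (x : P3) : R :=
  real (Glb_Rbar (fun s => exists y, ~ C y /\ s = enorm3 (sub3 x y))).

Lemma bounded_complement C : bounded3 C -> exists y, ~ C y.
Proof.
  intros [M HM]. exists (mk3 (Rabs M + 1) 0 0). intros H. specialize (HM _ H).
  pose proof (px_le (mk3 (Rabs M + 1) 0 0)). rewrite px_mk in H0.
  pose proof (Rle_abs (Rabs M + 1)). pose proof (Rle_abs M). lra.
Qed.

Lemma depth_glb C x : bounded3 C ->
  is_glb_Rbar (fun s => exists y, ~ C y /\ s = enorm3 (sub3 x y)) (Finite (depth C x)).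
Proof.
  intros Hb. destruct (bounded_complement C Hb) as [y0 Hy0]. unfold depth.
  assert (H := Glb_Rbar_correct (fun s => exists y, ~ C y /\ s = enorm3 (sub3 x y))).
  destruct (Glb_Rbar _) as [g| |] eqn:E; simpl.
  - exact H.
  - exfalso. apply (proj1 H (enorm3 (sub3 x y0))). now exists y0.
  - exfalso. assert (F : Rbar_le (Finite 0) m_infty); [|exact F].
    apply (proj2 H). intros s (y & _ & ->). simpl. apply enorm3_ge0.
Qed.

Lemma depth_le C x y : bounded3 C -> ~ C y -> depth C x <= enorm3 (sub3 x y).
Proof. intros Hb Hy. apply (proj1 (depth_glb C x Hb)). now exists y. Qed.

Lemma depth_ge C x b : bounded3 C -> (forall y, ~ C y -> b <= enorm3 (sub3 x y)) -> b <= depth C x.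
Proof. intros Hb H. apply (proj2 (depth_glb C x Hb) (Finite b)). intros s (y & Hy & ->). simpl. auto. Qed.

Lemma depth_ge0 C x : bounded3 C -> 0 <= depth C x.
Proof. intros Hb. apply depth_ge; [exact Hb|]. intros; apply enorm3_ge0. Qed.

Lemma depth_lip C x y : bounded3 C -> depth C x <= depth C y + enorm3 (sub3 x y).
Proof.
  intros Hb. assert (depth C x - enorm3 (sub3 x y) <= depth C y); [|lra].
  apply depth_ge; [exact Hb|]. intros z Hz. assert (H := depth_le C x z Hb Hz).
  pose proof (enorm3_sub_tri x y z). lra.
Qed.

Lemma depth_in C x y : bounded3 C -> enorm3 (sub3 x y) < depth C x -> C y.
Proof. intros Hb H. apply NNPP. intros Hn. pose proof (depth_le C x y Hb Hn). lra. Qed.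

Lemma depth_pos C x : open C -> bounded3 C -> C x -> 0 < depth C x.
Proof.
  intros Ho Hb Hx. destruct (open3_elim C x Ho Hx) as (e & He & H).
  apply Rlt_le_trans with e; [exact He|]. apply depth_ge; [exact Hb|]. intros y Hy.
  apply Rnot_lt_le. intros Hlt. apply Hy, H. rewrite enorm3_sym. exact Hlt.
Qed.

(** If the infimum were not attained, compactness of the relevant part of the complement would give
    a uniform excess over it. *)
Lemma depth_nearest C x : open C -> bounded3 C -> exists q, ~ C q /\ enorm3 (sub3 x q) = depth C x.
Proof.
  intros Ho Hb. apply NNPP. intros Hno.
  set (K := fun y => ~ C y /\ enorm3 (sub3 x y) <= depth C x + 1).
  assert (HK : covers dist3 K).
  { apply covers_P3 with (enorm3 x + depth C x + 1).
    - intros y [_ Hy]. pose proof (enorm3_tri x (sub3 y x)). replace (add3 x (sub3 y x)) with y in H by veq.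
      rewrite (enorm3_sym y x) in H. lra.
    - intros y Hy. destruct (classic (C y)) as [HC|HC].
      + destruct (open3_elim C y Ho HC) as (e & He & H). exists e. split; [exact He|].
        intros z Hz [Hn _]. apply Hn, H, Hz.
      + assert (depth C x + 1 < enorm3 (sub3 x y)).
        { apply Rnot_le_lt. intros Hle. apply Hy. now split. }
        exists (enorm3 (sub3 x y) - (depth C x + 1)). split; [lra|]. intros z Hz [_ Hzz]. unfold dist3 in Hz.
        pose proof (enorm3_sub_tri x z y). lra. }
  destruct (covers_uniform dist3 K (fun y m => depth C x + m <= enorm3 (sub3 x y)) HK) as (m & Hm & H).
  - intros; lra.
  - intros y [Hy1 Hy2]. pose proof (depth_le C x y Hb Hy1).
    assert (depth C x <> enorm3 (sub3 x y)) by (intros E; apply Hno; exists y; now split).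
    exists ((enorm3 (sub3 x y) - depth C x) / 2), ((enorm3 (sub3 x y) - depth C x) / 2).
    split; [lra|]. split; [lra|]. intros z _ Hz. unfold dist3 in Hz. pose proof (enorm3_sub_tri x z y). lra.
  - assert (depth C x + Rmin m 1 <= depth C x); [|pose proof (Rmin_glb_lt m 1 0); lra].
    apply depth_ge; [exact Hb|]. intros y Hy.
    destruct (Rle_lt_dec (enorm3 (sub3 x y)) (depth C x + 1)) as [Hle|Hlt].
    + specialize (H y (conj Hy Hle)). pose proof (Rmin_l m 1). lra.
    + pose proof (Rmin_r m 1). lra.
Qed.

(** The open ball of radius [depth C x] around [x] lies in [C], and the segment from [q] to [x]
    enters it at once. *)
Lemma nearest_boundary C x q : bounded3 C -> C x -> ~ C q -> enorm3 (sub3 x q) = depth C x -> boundary3 C q.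
Proof.
  intros Hb Hx Hq Hd. split; [|exact Hq]. intros eps He.
  set (d := depth C x) in *.
  assert (Hd0 : 0 < d).
  { destruct (depth_ge0 C x Hb) as [H|H]; [exact H|]. exfalso. apply Hq.
    assert (E : sub3 x q = mk3 0 0 0) by (apply enorm3_eq0; unfold d in *; lra).
    replace q with (sub3 x (sub3 x q)) by veq. rewrite E. replace (sub3 x (mk3 0 0 0)) with x by veq. exact Hx. }
  set (s := Rmin 1 (eps / (2 * d))).
  assert (Hs : 0 < s) by (apply Rmin_glb_lt; [lra|apply Rdiv_lt_0_compat; lra]).
  assert (Hs1 : s <= 1) by apply Rmin_l. assert (Hs2 : s <= eps / (2 * d)) by apply Rmin_r.
  exists (add3 q (scl3 s (sub3 x q))). split.
  - apply (depth_in C x); [exact Hb|]. fold d.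
    replace (sub3 x (add3 q (scl3 s (sub3 x q)))) with (scl3 (1 - s) (sub3 x q)) by veq.
    rewrite enorm3_scl, Rabs_right, Hd by lra. nra.
  - replace (sub3 q (add3 q (scl3 s (sub3 x q)))) with (scl3 (- s) (sub3 x q)) by veq.
    rewrite enorm3_scl, Rabs_Ropp, Rabs_right, Hd by lra.
    apply Rle_lt_trans with (eps / (2 * d) * d); [apply Rmult_le_compat_r; lra|].
    replace (eps / (2 * d) * d) with (eps / 2) by (field; lra). lra.
Qed.

(* The nearest-point direction is the normal of the pinching condition: a ball around x touches
   the boundary at q from inside. *)
Lemma nearest_normal C m x q : bounded3 C -> C x -> ~ C q -> enorm3 (sub3 x q) = depth C x ->
  0 < depth C x -> 0 < m ->
  forall n, enorm3 n = 1 ->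
  (forall y, C y -> enorm3 (sub3 y q) < m -> dot3 (sub3 y q) (sub3 y q) < - (2 / m * dot3 n (sub3 y q))) ->
  sub3 q x = scl3 (depth C x) n.
Proof.
  intros Hb Hx Hq Hd Hd0 Hm n Hn Hout. set (d := depth C x) in *.
  set (u := scl3 (/ d) (sub3 x q)).
  assert (Hu : enorm3 u = 1).
  { unfold u. rewrite enorm3_scl, Hd, Rabs_right; [field; lra|]. apply Rle_ge; left; apply Rinv_0_lt_compat; lra. }
  assert (Eu : sub3 x q = scl3 d u) by (unfold u; apply P3_eq; vunf; field; lra).
  assert (Huu : dot3 u u = 1) by (rewrite <- enorm3_sq, Hu; ring).
  assert (Hnn : dot3 n n = 1) by (rewrite <- enorm3_sq, Hn; ring).
  destruct (classic (add3 u n = mk3 0 0 0)) as [E|E].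
  - replace (sub3 q x) with (scl3 (-1) (sub3 x q)) by veq. rewrite Eu.
    replace u with (sub3 (add3 u n) n) by veq. rewrite E. veq.
  (* Moving from [q] along [u + n] enters the ball around [x], as its pairing with [u] is
     [1 + c > 0], although the equally positive pairing with [n] places the point outside the
     exterior ball. *)
  - exfalso. apply enorm3_pos in E. set (c := dot3 u n).
    assert (Hc : 0 < 1 + c).
    { assert (0 < dot3 (add3 u n) (add3 u n)) by (rewrite <- enorm3_sq; nra). rewrite dot3_add_sq in H. fold c in H. lra. }
    assert (Hc1 : c <= 1) by (unfold c; pose proof (dot3_ub u n); rewrite Hu, Hn in *; lra).
    set (s := Rmin (d / 4) (m / 4)). assert (Hs : 0 < s) by (apply Rmin_glb_lt; lra).
    assert (Hs1 : s <= d / 4) by apply Rmin_l. assert (Hs2 : s <= m / 4) by apply Rmin_r.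
    set (e := add3 u n). set (y := add3 q (scl3 s e)).
    assert (Hee : dot3 e e = 2 + 2 * c) by (unfold e; rewrite dot3_add_sq; fold c; lra).
    assert (Heu : dot3 e u = 1 + c) by (unfold e, c; replace (dot3 (add3 u n) u) with (dot3 u u + dot3 u n) by (vunf; ring); lra).
    assert (Hen : dot3 n e = 1 + c) by (unfold e, c; replace (dot3 n (add3 u n)) with (dot3 u n + dot3 n n) by (vunf; ring); lra).
    assert (He2 : enorm3 e <= 2) by (unfold e; pose proof (enorm3_tri u n); lra).
    assert (Hy : sub3 y q = scl3 s e) by (unfold y; veq).
    assert (HCy : C y).
    { apply (depth_in C x); [exact Hb|]. fold d. apply enorm3_lt; [lra|].
      replace (sub3 x y) with (sub3 (scl3 d u) (scl3 s e)) by (rewrite <- Eu; unfold y; veq).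
      replace (dot3 (sub3 (scl3 d u) (scl3 s e)) (sub3 (scl3 d u) (scl3 s e))) with
        (d * d * dot3 u u - 2 * d * s * dot3 e u + s * s * dot3 e e) by (vunf; ring).
      rewrite Huu, Heu, Hee. assert (0 < s * (1 + c)) by nra. assert (0 < s * (1 + c) * (d - s)) by (apply Rmult_lt_0_compat; lra). lra. }
    assert (Hlt : enorm3 (sub3 y q) < m).
    { rewrite Hy, enorm3_scl, Rabs_right by lra. pose proof (enorm3_ge0 e). nra. }
    specialize (Hout y HCy Hlt). rewrite Hy in Hout.
    replace (dot3 (scl3 s e) (scl3 s e)) with (s * s * dot3 e e) in Hout by (vunf; ring).
    replace (dot3 n (scl3 s e)) with (s * dot3 n e) in Hout by (vunf; ring).
    rewrite Hee, Hen in Hout. assert (0 < 2 / m) by (apply Rdiv_lt_0_compat; lra).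
    assert (0 < s * (1 + c)) by nra. assert (0 < 2 / m * (s * (1 + c))) by nra. nra.
Qed.

Definition near_pt (C : P3 -> Prop) (x : P3) : P3 :=
  epsilon (inhabits x) (fun q => ~ C q /\ enorm3 (sub3 x q) = depth C x).

Definition normal (C : P3 -> Prop) (x : P3) : P3 := scl3 (/ depth C x) (sub3 (near_pt C x) x).

Lemma near_pt_spec C x : open C -> bounded3 C -> ~ C (near_pt C x) /\ enorm3 (sub3 x (near_pt C x)) = depth C x.
Proof. intros Ho Hb.
  exact (epsilon_spec (inhabits x) (fun q => ~ C q /\ enorm3 (sub3 x q) = depth C x) (depth_nearest C x Ho Hb)).
Qed.

Lemma normal_spec C m x : open C -> bounded3 C -> 0 < m -> (forall q, boundary3 C q -> pinched C q m) -> C x ->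
  enorm3 (normal C x) = 1 /\ sub3 (near_pt C x) x = scl3 (depth C x) (normal C x) /\
  (forall y, dot3 (sub3 y (near_pt C x)) (sub3 y (near_pt C x)) < - (2 * m * dot3 (normal C x) (sub3 y (near_pt C x))) -> C y) /\
  (forall y, C y -> enorm3 (sub3 y (near_pt C x)) < m ->
     dot3 (sub3 y (near_pt C x)) (sub3 y (near_pt C x)) < - (2 / m * dot3 (normal C x) (sub3 y (near_pt C x)))).
Proof.
  intros Ho Hb Hm Hp Hx. destruct (near_pt_spec C x Ho Hb) as [Hq Hd]. set (q := near_pt C x) in *.
  assert (Hd0 := depth_pos C x Ho Hb Hx).
  destruct (Hp q (nearest_boundary C x q Hb Hx Hq Hd)) as (n & Hn & Hin & Hout).
  assert (E := nearest_normal C m x q Hb Hx Hq Hd Hd0 Hm n Hn Hout).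
  assert (En : normal C x = n).
  { unfold normal. fold q. rewrite E. apply P3_eq; vunf; field; lra. }
  rewrite En. repeat split; assumption.
Qed.

(** The nearest point of [x'] is outside the interior ball of radius [m] at [q] and almost inside
    the ball of radius [d <= m / 2] around [x]. Both are tangent at [q], and their different radii
    leave only a small region there. This is what makes the normal field continuous. *)
Lemma near_pt_close C m x x' : open C -> bounded3 C -> 0 < m -> (forall q, boundary3 C q -> pinched C q m) ->
  C x -> depth C x <= m / 2 ->
  let e := enorm3 (sub3 x x') in
  dot3 (sub3 (near_pt C x') (near_pt C x)) (sub3 (near_pt C x') (near_pt C x)) <= 2 * (4 * depth C x * e + 4 * e * e).
Proof.
  intros Ho Hb Hm Hp Hx Hdm e.
  destruct (normal_spec C m x Ho Hb Hm Hp Hx) as (Hn & E & Hin & _).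
  destruct (near_pt_spec C x' Ho Hb) as [Hq' Hd'].
  set (n := normal C x) in *. set (q := near_pt C x) in *. set (q' := near_pt C x') in *. set (d := depth C x) in *.
  assert (Hd0 : 0 < d) by now apply depth_pos.
  set (y := sub3 q' q).
  assert (H1 : 0 <= dot3 y y + 2 * m * dot3 n y).
  { apply Rnot_lt_le. intros Hlt. apply Hq', Hin. fold y. lra. }
  assert (He : 0 <= e) by apply enorm3_ge0.
  assert (H2 : enorm3 (sub3 q' x) <= d + 2 * e).
  { pose proof (enorm3_sub_tri x x' q'). rewrite (enorm3_sym q' x).
    pose proof (depth_lip C x' x Hb). rewrite (enorm3_sym x' x) in H0. fold d e in H0. fold e in H. lra. }
  assert (E2 : sub3 q' x = add3 y (scl3 d n)) by (rewrite <- E; unfold y; veq).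
  assert (Hnn : dot3 n n = 1) by (rewrite <- enorm3_sq, Hn; ring).
  assert (H3 : dot3 y y + 2 * d * dot3 n y + d * d <= (d + 2 * e) * (d + 2 * e)).
  { replace (dot3 y y + 2 * d * dot3 n y + d * d) with (dot3 (sub3 q' x) (sub3 q' x)).
    - rewrite <- enorm3_sq. pose proof (enorm3_ge0 (sub3 q' x)). nra.
    - rewrite E2, dot3_add_sq.
      replace (dot3 (scl3 d n) (scl3 d n)) with (d * d * dot3 n n) by (vunf; ring).
      replace (dot3 y (scl3 d n)) with (d * dot3 n y) by (vunf; ring). rewrite Hnn. ring. }
  set (a := dot3 n y) in *. set (Y := dot3 y y) in *. assert (HY : 0 <= Y) by apply dot3_ge0.
  assert (- (2 * d * a) <= Y / 2).
  { destruct (Rle_lt_dec 0 a) as [Ha|Ha]; [nra|]. assert (2 * d * - a <= m * - a) by nra. lra. }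
  nra.
Qed.

Lemma ucr_depth C f : bounded3 C -> circle_ucv f -> circle_ucr (fun z => depth C (f z)).
Proof.
  intros Hb Hf e He. destruct (Hf e He) as (d & Hd & H). exists d. split; [exact Hd|].
  intros z w Hz Hw Hzw. specialize (H z w Hz Hw Hzw).
  pose proof (depth_lip C (f z) (f w) Hb). pose proof (depth_lip C (f w) (f z) Hb). rewrite (enorm3_sym (f w)) in H1.
  apply Rabs_lt_between. lra.
Qed.

Lemma ucv_normal C m mu f : open C -> bounded3 C -> 0 < m -> (forall q, boundary3 C q -> pinched C q m) ->
  circle_ucv f -> 0 < mu -> (forall z, Cmod z = 1 -> C (f z) /\ mu <= depth C (f z) <= m / 2) ->
  circle_ucv (fun z => normal C (f z)).
Proof.
  intros Ho Hb Hm Hp Hf Hmu Hr. unfold normal. apply ucv_scl.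
  - apply (ucr_inv _ mu Hmu); [intros z Hz; now apply Hr|]. now apply ucr_depth.
  - apply ucv_sub; [|exact Hf]. intros eps He.
    set (k := Rmin 1 (eps * eps / (8 * (m + 2)))).
    assert (Hk : 0 < k) by (apply Rmin_glb_lt; [lra|apply Rdiv_lt_0_compat; nra]).
    destruct (Hf k Hk) as (d & Hd & H). exists d. split; [exact Hd|].
    intros z w Hz Hw Hzw. specialize (H z w Hz Hw Hzw). rewrite enorm3_sym.
    destruct (Hr z Hz) as (Hc & Hmu1 & Hm2).
    assert (Hcl := near_pt_close C m (f z) (f w) Ho Hb Hm Hp Hc Hm2). cbv zeta in Hcl.
    set (e := enorm3 (sub3 (f z) (f w))) in *. assert (He0 : 0 <= e) by apply enorm3_ge0.
    assert (k <= 1) by apply Rmin_l. assert (Hk2 : k <= eps * eps / (8 * (m + 2))) by apply Rmin_r.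
    apply enorm3_lt; [lra|]. eapply Rle_lt_trans; [apply Hcl|].
    assert (8 * (m + 2) * e < eps * eps).
    { apply Rlt_le_trans with (8 * (m + 2) * k); [nra|].
      apply Rle_trans with (8 * (m + 2) * (eps * eps / (8 * (m + 2)))); [apply Rmult_le_compat_l; lra|right; field; lra]. }
    nra.
Qed.

Lemma surf_sub p0 U V U' V' z w : sub3 (surf p0 U' V' z) (surf p0 U V w) = sub3 (surf0 U' V' z) (surf0 U V w).
Proof. unfold surf. veq. Qed.

Lemma ucv_surf p0 U V : circle_ucv (surf p0 U V).
Proof.
  intros e He. destruct (ucv_surf0 U V e He) as (d & Hd & H). exists d. split; [exact Hd|].
  intros. rewrite surf_sub. auto.
Qed.

Definition inside (D : P3 -> Prop) (mu : R) (f : C -> P3) : Prop :=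
  forall z, Cmod z <= 1 -> D (f z) /\ mu <= depth D (f z).

(** The length [sqrt (m d)] fits both balls. Its square [m d] is below [2 m d], the bound for
    staying in the interior ball of radius [m]; against the exterior ball of radius [1 / m] it
    lowers the depth by at least [m^2 d / 4]. Half of that gain is given away to the errors, which
    leaves [m^2 / 8]. *)
Lemma push_lemma C m p0 U V mu delta B r0 eta :
  open C -> bounded3 C -> 0 < m <= 1 -> (forall q, boundary3 C q -> pinched C q m) ->
  good U V -> 0 < mu -> inside C mu (surf p0 U V) ->
  (forall z, Cmod z = 1 -> depth C (surf p0 U V z) <= delta) -> delta <= m / 16 -> delta <= B ->
  (forall z, r0 <= Cmod z <= 1 -> depth C (surf p0 U V z) <= B) ->
  0 <= r0 < 1 -> 0 < eta ->
  exists U' V' mu', good U' V' /\ adm r0 eta U V U' V' /\ 0 < mu' /\ inside C mu' (surf p0 U' V') /\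
    (forall z, Cmod z = 1 -> depth C (surf p0 U' V' z) <= (1 - m * m / 8) * delta) /\
    (forall z, Cmod z <= 1 -> enorm3 (disp U V U' V' z) <= sqrt (m * delta) + eta) /\
    (forall z, r0 <= Cmod z <= 1 -> depth C (surf p0 U' V' z) <= B + eta).
Proof.
  intros Ho Hb Hm Hp Hg Hmu Hin Hdel Hdm HdB HBd Hr0 He.
  assert (Hmud : mu <= delta).
  { specialize (Hdel 1%C (Cmod_1)). destruct (Hin 1%C) as [_ H]; [rewrite Cmod_1; lra|]. lra. }
  (* As [mu] bounds the boundary depth from below, the error is small against the gain [m^2 d / 4]
     at every boundary point. *)
  set (e := Rmin (Rmin (eta / 4) (1 / 8)) (m * m * mu / 32)).
  assert (Hmm : 0 < m * m) by nra.
  assert (Hmm1 : m * m <= 1) by nra.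
  assert (Hmmu : 0 < m * m * mu) by (apply Rmult_lt_0_compat; lra).
  assert (He0 : 0 < e) by (repeat apply Rmin_glb_lt; lra).
  assert (He1 : e <= eta / 4) by (unfold e; eapply Rle_trans; [apply Rmin_l|apply Rmin_l]).
  assert (He2 : e <= 1 / 8) by (unfold e; eapply Rle_trans; [apply Rmin_l|apply Rmin_r]).
  assert (He3 : e <= m * m * mu / 32) by apply Rmin_r.
  assert (He4 : e <= mu / 32) by nra.
  destruct (surf0_radial U V e He0) as (rr & Hrr & Hrad).
  set (f := surf p0 U V) in *.
  assert (Hf : circle_ucv f) by apply ucv_surf.
  assert (Hcirc : forall z, Cmod z = 1 -> C (f z) /\ mu <= depth C (f z) <= m / 2).
  { intros z Hz. destruct (Hin z ltac:(lra)). specialize (Hdel z Hz). repeat split; [assumption|lra|lra]. }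
  assert (Hnuc := ucv_normal C m mu f Ho Hb ltac:(lra) Hp Hf Hmu Hcirc).
  assert (Htauc : circle_ucr (fun z => sqrt (m * depth C (f z)))).
  { apply ucr_sqrt; [apply ucr_mult; [apply ucr_const|now apply ucr_depth]|].
    intros z Hz. apply Rmult_le_pos; [lra|now apply depth_ge0]. }
  destruct (rh_step U V (fun z => normal C (f z)) (fun z => sqrt (m * depth C (f z))) (Rmax r0 rr) e 1 Hg Hnuc)
    as (U' & V' & r & Hr & Hrb & Hg' & Hadm & Hout & _); auto; try lra.
  { intros z Hz. apply (normal_spec C m (f z)); auto; [lra|]. now apply Hcirc. }
  { intros; apply sqrt_pos. }
  { apply Rmax_lub_lt; lra. }
  pose proof (Rmax_l r0 rr). pose proof (Rmax_r r0 rr).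
  set (f' := surf p0 U' V').
  assert (Hinner : forall z, Cmod z <= r -> enorm3 (sub3 (f' z) (f z)) <= e).
  { intros z Hz. unfold f', f. rewrite surf_sub. destruct Hadm as (A & A' & _ & _ & _ & _ & H1). auto. }
  assert (Hkey : forall z rho, Cmod z = 1 -> r <= rho <= 1 ->
     (C (f' (rho * z)%C) /\ mu / 16 <= depth C (f' (rho * z)%C)) /\
     depth C (f' (rho * z)%C) <= depth C (f z) + 3 * e /\
     (rho = 1 -> depth C (f' (rho * z)%C) <= (1 - m * m / 4) * depth C (f z) + e) /\
     enorm3 (sub3 (f' (rho * z)%C) (f (rho * z)%C)) <= sqrt (m * delta) + 2 * e).
  { intros z rho Hz Hrho. destruct (Hout z rho Hz Hrho) as (w & Hw1 & Hw2 & Hw3 & Hw4).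
    destruct (Hcirc z Hz) as (HCf & Hd1 & _). specialize (Hdel z Hz).
    destruct (normal_spec C m (f z) Ho Hb ltac:(lra) Hp HCf) as (Hn & Eq & Hpin & Hpout).
    set (n := normal C (f z)) in *. set (q := near_pt C (f z)) in *. set (d := depth C (f z)) in *.
    set (x := add3 (f z) w).
    assert (Hx : enorm3 (sub3 (f' (rho * z)%C) x) <= e).
    { replace (sub3 (f' (rho * z)%C) x) with (sub3 (sub3 (f' (rho * z)%C) (f z)) w) by (unfold x; veq).
      unfold f', f. rewrite surf_sub. exact Hw4. }
    set (tau := sqrt (m * d)) in *.
    assert (Htau2 : tau * tau = m * d) by (apply sqrt_sqrt; nra).
    assert (Htau0 : 0 <= tau) by apply sqrt_pos.
    assert (Htaum : tau <= m / 4) by (apply sq_le_le; [lra|]; rewrite Htau2; nra).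
    assert (Hnn : dot3 n n = 1) by (rewrite <- enorm3_sq, Hn; ring).
    set (a := dot3 w n) in *. apply Rabs_le_between in Hw1.
    assert (Hww : dot3 w w <= m * d).
    { rewrite <- enorm3_sq, <- Htau2. pose proof (enorm3_ge0 w). apply Rmult_le_compat; lra. }
    pose proof (dot3_ge0 w) as Hww0. pose proof (enorm3_ge0 w) as Hw0.
    assert (Hxq : sub3 x q = sub3 w (scl3 d n)) by (rewrite <- Eq; unfold x; veq).
    (* All points within [d / 8] of the displaced point still lie in the interior ball at [q], so
       the surface stays inside [C]. *)
    assert (Hlow : d / 8 <= depth C x).
    { apply depth_ge; [exact Hb|]. intros y Hy. apply Rnot_lt_le. intros Hlt. apply Hy, Hpin.
      set (v := sub3 y x). assert (Hv : enorm3 v < d / 8) by (unfold v; rewrite enorm3_sym; exact Hlt).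
      assert (Eyq : sub3 y q = sub3 (add3 w v) (scl3 d n)) by (replace (sub3 y q) with (add3 (sub3 x q) v) by (unfold v; veq); rewrite Hxq; veq).
      rewrite Eyq.
      replace (dot3 (sub3 (add3 w v) (scl3 d n)) (sub3 (add3 w v) (scl3 d n))) with
        (dot3 w w + 2 * dot3 w v + dot3 v v - 2 * d * (dot3 w n + dot3 v n) + d * d * dot3 n n) by (vunf; ring).
      replace (dot3 n (sub3 (add3 w v) (scl3 d n))) with (dot3 w n + dot3 v n - d * dot3 n n) by (vunf; ring).
      rewrite Hnn. fold a.
      pose proof (enorm3_ge0 v). pose proof (dot3_ub w v). pose proof (dot3_ub v n). rewrite Hn in *.
      pose proof (enorm3_sq v).
      assert (dot3 w v <= m / 4 * (d / 8)) by (assert (enorm3 w * enorm3 v <= m / 4 * (d / 8)) by (apply Rmult_le_compat; lra); lra).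
      assert (dot3 v v <= d / 8 * (d / 8)) by nra.
      assert (a + dot3 v n <= d / 32 + d / 8) by lra.
      assert (d * d <= m / 16 * d) by nra.
      assert ((m - d) * (a + dot3 v n) <= (m - d) * (d / 32 + d / 8)) by (apply Rmult_le_compat_l; lra).
      assert (0 < m * d) by nra. nra. }
    assert (Hdx : depth C x - e <= depth C (f' (rho * z)%C) <= depth C x + e).
    { pose proof (depth_lip C x (f' (rho * z)%C) Hb). pose proof (depth_lip C (f' (rho * z)%C) x Hb).
      rewrite (enorm3_sym x) in H1. lra. }
    assert (HCx' : C (f' (rho * z)%C)).
    { apply (depth_in C x); [exact Hb|]. rewrite enorm3_sym. lra. }
    (* the point x + s n lies outside C as soon as it is outside the exterior ball *)
    assert (Hup : forall s, 0 <= s -> s <= 2 * d + m / 8 ->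
       0 <= dot3 w w + 2 * (s - d) * a + (s - d) * (s - d) + 2 / m * (a + (s - d)) -> depth C x <= s).
    { intros s Hs0 Hs Hq. set (y := add3 x (scl3 s n)).
      assert (Eyq : sub3 y q = add3 w (scl3 (s - d) n)).
      { replace (sub3 y q) with (add3 (sub3 x q) (scl3 s n)) by (unfold y; veq). rewrite Hxq. veq. }
      assert (Hny : ~ C y).
      { intros HCy. assert (Hlt := Hpout y HCy). rewrite Eyq in Hlt.
        replace (dot3 (add3 w (scl3 (s - d) n)) (add3 w (scl3 (s - d) n))) with
          (dot3 w w + 2 * (s - d) * dot3 w n + (s - d) * (s - d) * dot3 n n) in Hlt by (vunf; ring).
        replace (dot3 n (add3 w (scl3 (s - d) n))) with (dot3 w n + (s - d) * dot3 n n) in Hlt by (vunf; ring).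
        rewrite Hnn in Hlt. fold a in Hlt.
        assert (Hm' : enorm3 (add3 w (scl3 (s - d) n)) < m).
        { eapply Rle_lt_trans; [apply enorm3_tri|]. rewrite enorm3_scl, Hn.
          assert (Rabs (s - d) <= d + m / 8) by (apply Rabs_le; lra). lra. }
        specialize (Hlt Hm'). lra. }
      eapply Rle_trans; [apply (depth_le C x y Hb Hny)|].
      replace (sub3 x y) with (scl3 (- s) n) by (unfold y; veq). rewrite enorm3_scl, Hn, Rabs_Ropp, Rabs_right by lra. lra. }
    assert (H2m : 2 <= 2 / m).
    { apply Rmult_le_reg_r with m; [lra|]. unfold Rdiv. rewrite Rmult_assoc, Rinv_l; lra. }
    split; [split; [exact HCx'|lra]|]. split; [|split].
    (* At intermediate radii [w] may be short, and only an increase beyond the error can be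
       excluded. *)
    - assert (depth C x <= d + 2 * e); [|lra].
      apply Hup; [lra|lra|]. replace (d + 2 * e - d) with (2 * e) by ring.
      assert (2 * e <= 2 / m * (a + 2 * e)) by nra.
      assert (- (e / 2) <= 2 * (2 * e) * a) by nra. nra.
    - intros Hrho1. assert (Hwt : dot3 w w = m * d) by (rewrite <- enorm3_sq, (Hw3 Hrho1); exact Htau2).
      assert (depth C x <= (1 - m * m / 4) * d); [|lra].
      (* With [s - d = - m^2 d / 4] the gain [|w|^2 = m d] outweighs the loss
         [2/m * m^2 d / 4 = m d / 2]; the remaining half covers the deviation [a] from the tangent
         plane. *)
      apply Hup; [nra|nra|]. rewrite Hwt.
      replace ((1 - m * m / 4) * d - d) with (- (m * m / 4 * d)) by ring.
      replace (2 / m * (a + - (m * m / 4 * d))) with (2 / m * a - m * d / 2) by (field; lra).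
      assert (H2a : - (m * d / 16) <= 2 / m * a).
      { apply Rle_trans with (2 / m * (- (m * m * d / 32))).
        - right. field. lra.
        - apply Rmult_le_compat_l; [lra|]. assert (m * m * mu <= m * m * d) by (apply Rmult_le_compat_l; lra). lra. }
      assert (- (m * d / 16) <= 2 * - (m * m / 4 * d) * a).
      { assert (m * m / 4 * d * a <= m * m / 4 * d * (1 / 8)) by (apply Rmult_le_compat_l; [nra|lra]).
        assert (m * m * d <= m * d) by nra. nra. }
      assert (0 <= - (m * m / 4 * d) * - (m * m / 4 * d)) by nra. lra.
    - replace (sub3 (f' (rho * z)%C) (f (rho * z)%C)) with
        (add3 (sub3 (f' (rho * z)%C) x) (add3 w (sub3 (f z) (f (rho * z)%C)))) by (unfold x; veq).
      eapply Rle_trans; [apply enorm3_tri|]. eapply Rle_trans; [apply Rplus_le_compat_l, enorm3_tri|].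
      assert (enorm3 (sub3 (f z) (f (rho * z)%C)) <= e).
      { unfold f. rewrite surf_sub, enorm3_sym. apply Hrad; [exact Hz|lra|lra]. }
      assert (tau <= sqrt (m * delta)) by (apply sqrt_le_1_alt; nra). lra. }
  exists U', V', (mu / 16). split; [exact Hg'|]. split; [apply (adm_weaken r r0 e eta); [lra|lra|exact Hadm]|].
  split; [lra|]. fold f'.
  assert (Hpolar : forall z, Cmod z <= 1 -> r < Cmod z -> exists w, Cmod w = 1 /\ z = (Cmod z * w)%C).
  { intros z _ _. destruct (polar z) as (rho & w & Hw & -> & E). now exists w. }
  split; [|split; [|split]].
  - intros z Hz. destruct (Rle_lt_dec (Cmod z) r) as [Hle|Hlt].
    + destruct (Hin z Hz) as [HCz Hdz]. specialize (Hinner z Hle).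
      split; [apply (depth_in C (f z)); [exact Hb|]; rewrite enorm3_sym; lra|].
      pose proof (depth_lip C (f z) (f' z) Hb). rewrite enorm3_sym in H1. lra.
    + destruct (Hpolar z Hz Hlt) as (w & Hw & Ew). rewrite Ew. apply Hkey; [exact Hw|lra].
  - intros z Hz. destruct (Hkey z 1 Hz ltac:(lra)) as (_ & _ & H1 & _).
    replace (1 * z)%C with z in H1 by ring. specialize (H1 eq_refl). specialize (Hdel z Hz).
    assert (0 <= depth C (f z)) by now apply depth_ge0.
    assert ((1 - m * m / 4) * depth C (f z) <= (1 - m * m / 4) * delta) by (apply Rmult_le_compat_l; lra).
    assert (m * m * mu <= m * m * delta) by (apply Rmult_le_compat_l; lra). lra.
  - intros z Hz. assert (Ed : disp U V U' V' z = sub3 (f' z) (f z)) by (unfold disp, f', f; now rewrite surf_sub).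
    rewrite Ed. pose proof (sqrt_pos (m * delta)).
    destruct (Rle_lt_dec (Cmod z) r) as [Hle|Hlt]; [specialize (Hinner z Hle); lra|].
    destruct (Hpolar z Hz Hlt) as (w & Hw & Ew). destruct (Hkey w (Cmod z) Hw ltac:(lra)) as (_ & _ & _ & H2).
    rewrite <- Ew in H2. lra.
  - intros z Hz. destruct (Rle_lt_dec (Cmod z) r) as [Hle|Hlt].
    + specialize (Hinner z Hle). specialize (HBd z Hz). pose proof (depth_lip C (f' z) (f z) Hb). lra.
    + destruct (Hpolar z ltac:(lra) Hlt) as (w & Hw & Ew). destruct (Hkey w (Cmod z) Hw ltac:(lra)) as (_ & H2 & _).
      rewrite <- Ew in H2. specialize (Hdel w Hw). lra.
Qed.

(** * The initial disc *)

Lemma Csqrt_exists (w : C) : exists z : C, (z * z = w)%C.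
Proof.
  destruct w as [x y]. set (r := Cmod (x, y)).
  assert (Hr : r * r = x * x + y * y) by (unfold r; rewrite Cmod_sq; reflexivity).
  assert (Hr0 : 0 <= r) by apply Cmod_ge_0.
  assert (Hx : Rabs x <= r) by apply (Cmod_ge_abs_re (x, y)). apply Rabs_le_between in Hx.
  set (a := sqrt ((r + x) / 2)). set (b := sqrt ((r - x) / 2)).
  assert (Ha : a * a = (r + x) / 2) by (apply sqrt_sqrt; lra).
  assert (Hb : b * b = (r - x) / 2) by (apply sqrt_sqrt; lra).
  assert (Ha0 : 0 <= a) by apply sqrt_pos. assert (Hb0 : 0 <= b) by apply sqrt_pos.
  assert (Hab : (2 * (a * b)) * (2 * (a * b)) = y * y).
  { transitivity (4 * (a * a) * (b * b)); [ring|]. rewrite Ha, Hb. nra. }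
  destruct (Rle_lt_dec 0 y) as [Hy|Hy].
  - exists (a, b). apply C_eq; simpl; [lra|]. assert (0 <= a * b) by nra. nra.
  - exists (a, - b)%R. apply C_eq; simpl; [lra|]. assert (0 <= a * b) by nra. nra.
Qed.

Lemma orth_unit (v : P3) : enorm3 v = 1 -> exists u, enorm3 u = 1 /\ dot3 u v = 0.
Proof.
  intros Hv.
  assert (K : forall w, w <> mk3 0 0 0 -> dot3 w v = 0 -> exists u, enorm3 u = 1 /\ dot3 u v = 0).
  { intros w Hw Hd. exists (scl3 (/ enorm3 w) w). split; [apply enorm3_unit, enorm3_pos, Hw|].
    replace (dot3 (scl3 (/ enorm3 w) w) v) with (/ enorm3 w * dot3 w v) by (vunf; ring). rewrite Hd; ring. }
  destruct (classic (mk3 (- py v) (px v) 0 = mk3 0 0 0)) as [E|E].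
  - assert (E1 := f_equal px E). assert (E2 := f_equal py E). rewrite !px_mk in E1. rewrite !py_mk in E2.
    apply (K (mk3 1 0 0)).
    + intros E'. apply (f_equal px) in E'. rewrite !px_mk in E'. lra.
    + vunf. lra.
  - apply (K _ E). vunf. ring.
Qed.

(** Complete [v] by an orthogonal unit vector [u] to the complex null vector [v + i u], and read off
    [a^2] and [b^2] from its first two coordinates. The third then agrees with [2 a b] up to a sign,
    which the sign of [b] corrects. *)
Lemma null_direction (v : P3) : enorm3 v = 1 -> exists a b : C, nullv 1 a b = v.
Proof.
  intros Hv. destruct (orth_unit v Hv) as (u & Hu & Huv).
  assert (Hvv : dot3 v v = 1) by (rewrite <- enorm3_sq, Hv; ring).
  assert (Huu : dot3 u u = 1) by (rewrite <- enorm3_sq, Hu; ring).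
  set (X1 := (px v, px u) : C). set (X2 := (py v, py u) : C). set (X3 := (pz v, pz u) : C).
  assert (Hnull : (X1 * X1 + X2 * X2 + X3 * X3 = 0)%C).
  { unfold dot3 in *. apply C_eq; simpl; lra. }
  destruct (Csqrt_exists ((X1 - Ci * X2) / 2)%C) as [a Ha].
  destruct (Csqrt_exists (- ((X1 + Ci * X2) / 2))%C) as [b Hb].
  assert (H2 : RtoC 2 <> 0%C) by (intros E; apply RtoC_inj in E; lra).
  assert (H3 : ((2 * (a * b)) * (2 * (a * b)) = X3 * X3)%C).
  { transitivity (4 * (a * a) * (b * b))%C; [ring|]. rewrite Ha, Hb.
    transitivity (- (X1 * X1) + (Ci * Ci) * (X2 * X2))%C; [field; exact H2|].
    replace (Ci * Ci)%C with (RtoC (-1)) by (apply C_eq; simpl; ring).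
    transitivity (X3 * X3 - (X1 * X1 + X2 * X2 + X3 * X3))%C; [|rewrite Hnull; ring].
    replace (RtoC (-1)) with (Copp 1) by (apply C_eq; simpl; ring). ring. }
  assert (Hs : exists b' : C, (b' * b' = b * b)%C /\ (2 * (a * b') = X3)%C).
  { destruct (classic (2 * (a * b) = X3)%C) as [E|E]; [now exists b|]. exists (- b)%C. split; [ring|].
    assert (Hz : ((2 * (a * b) - X3) * (2 * (a * b) + X3) = 0)%C).
    { transitivity ((2 * (a * b)) * (2 * (a * b)) - X3 * X3)%C; [ring|]. rewrite H3; ring. }
    destruct (Ceq_dec (2 * (a * b) + X3) 0) as [E2|E2].
    - transitivity (- (2 * (a * b) + X3) + X3)%C; [ring|]. rewrite E2; ring.
    - exfalso. apply (Cmult_neq_0 (2 * (a * b) - X3) (2 * (a * b) + X3))%C; [|exact E2|exact Hz].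
      intros E3. apply E. transitivity ((2 * (a * b) - X3) + X3)%C; [ring|]. rewrite E3; ring. }
  destruct Hs as (b' & Hb' & Hab).
  exists a, b'. unfold nullv. rewrite Hb', Ha, Hb, Hab.
  replace (1 * ((X1 - Ci * X2) / 2 - - ((X1 + Ci * X2) / 2)))%C with X1 by (field; exact H2).
  replace (1 * (Ci * ((X1 - Ci * X2) / 2 + - ((X1 + Ci * X2) / 2))))%C with (- (Ci * Ci) * X2)%C by (field; exact H2).
  replace (- (Ci * Ci) * X2)%C with X2 by (apply C_eq; simpl; ring).
  replace (1 * X3)%C with X3 by ring. apply P3_eq; vunf; reflexivity.
Qed.

Lemma unit_angle (z : C) : Cmod z = 1 -> exists t, z = (cos t, sin t).
Proof.
  intros Hz. assert (E := Cmod_sq z). rewrite Hz in E. destruct z as [x y]; simpl in E.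
  assert (Hx : -1 <= x <= 1) by nra.
  assert (Hs : sqrt (1 - x²) * sqrt (1 - x²) = y * y) by (rewrite sqrt_sqrt; unfold Rsqr; nra).
  pose proof (sqrt_pos (1 - x²)).
  destruct (Rle_lt_dec 0 y) as [Hy|Hy].
  - exists (acos x). rewrite cos_acos, sin_acos by lra. f_equal. nra.
  - exists (- acos x). rewrite cos_neg, sin_neg, cos_acos, sin_acos by lra. f_equal. nra.
Qed.

Lemma cis_lip s t : Cmod ((cos s, sin s) - (cos t, sin t)) <= 2 * Rabs (s - t).
Proof.
  assert (Kc : Rabs (cos s - cos t) <= Rabs (s - t)).
  { destruct (MVT_gen cos t s (fun x => - sin x)) as (c & _ & E).
    - intros; apply is_derive_Reals, derivable_pt_lim_cos.
    - intros; apply derivable_continuous_pt, derivable_pt_cos.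
    - rewrite E, Rabs_mult, Rabs_Ropp. pose proof (SIN_bound c). assert (Rabs (sin c) <= 1) by (apply Rabs_le; lra).
      pose proof (Rabs_pos (s - t)). nra. }
  assert (Ks : Rabs (sin s - sin t) <= Rabs (s - t)).
  { destruct (MVT_gen sin t s cos) as (c & _ & E).
    - intros; apply is_derive_Reals, derivable_pt_lim_sin.
    - intros; apply derivable_continuous_pt, derivable_pt_sin.
    - rewrite E, Rabs_mult. pose proof (COS_bound c). assert (Rabs (cos c) <= 1) by (apply Rabs_le; lra).
      pose proof (Rabs_pos (s - t)). nra. }
  eapply Rle_trans; [apply Cmod_le_sum|]. simpl. unfold Rminus in *. lra.
Qed.

(** At an [M]-th root of unity the phase [z^M] equals 1, so there the move has exactly the intended
    direction and sign; such points are dense for large [M]. *)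
Lemma root_near (z : C) M : Cmod z = 1 -> 0 < INR M ->
  exists w, Cmod w = 1 /\ (w ^ M)%C = 1%C /\ Cmod (w - z) <= 4 * PI / INR M.
Proof.
  intros Hz HM. destruct (unit_angle z Hz) as [t ->]. pose proof PI_RGT_0.
  set (x := INR M * t / (2 * PI)).
  destruct (archimed x) as [H1 H2]. set (k := (up x - 1)%Z).
  assert (Hk : IZR k <= x < IZR k + 1) by (unfold k; rewrite minus_IZR; lra).
  exists (cos (2 * IZR k * PI / INR M), sin (2 * IZR k * PI / INR M)). split; [apply Cmod_cis|]. split.
  - rewrite cis_pow. replace (INR M * (2 * IZR k * PI / INR M)) with (2 * IZR k * PI) by (field; lra).
    assert (Hn : forall n, cos (2 * INR n * PI) = 1 /\ sin (2 * INR n * PI) = 0).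
    { intros n. replace (2 * INR n * PI) with (0 + 2 * INR n * PI) by ring. rewrite cos_period, sin_period, cos_0, sin_0. now split. }
    destruct (Z_le_gt_dec 0 k) as [Hk0|Hk0].
    + destruct (Hn (Z.to_nat k)) as [Hc Hs]. rewrite INR_IZR_INZ, Z2Nat.id in Hc, Hs by exact Hk0. rewrite Hc, Hs. reflexivity.
    + destruct (Hn (Z.to_nat (- k))) as [Hc Hs]. rewrite INR_IZR_INZ, Z2Nat.id, opp_IZR in Hc, Hs by lia.
      replace (2 * - IZR k * PI) with (- (2 * IZR k * PI)) in Hc, Hs by ring. rewrite cos_neg in Hc. rewrite sin_neg in Hs.
      rewrite Hc. replace (sin (2 * IZR k * PI)) with 0 by lra. reflexivity.
  - eapply Rle_trans; [apply cis_lip|].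
    assert (E : t = 2 * x * PI / INR M) by (unfold x; field; lra).
    replace (2 * IZR k * PI / INR M - t) with ((IZR k - x) * (2 * PI / INR M)) by (rewrite E at 1; field; lra).
    assert (Hp : 0 < 2 * PI / INR M) by (apply Rdiv_lt_0_compat; lra).
    rewrite Rabs_mult, (Rabs_right (2 * PI / INR M)) by lra.
    assert (Rabs (IZR k - x) <= 1) by (apply Rabs_le; lra).
    replace (4 * PI / INR M) with (2 * (1 * (2 * PI / INR M))) by (field; lra).
    apply Rmult_le_compat_l; [lra|]. apply Rmult_le_compat_r; lra.
Qed.

Lemma nullv_real_scale c (t : R) a b : 0 <= t -> nullv c (RtoC (sqrt t) * a)%C (RtoC (sqrt t) * b)%C = scl3 t (nullv c a b).
Proof.
  intros Ht. rewrite nullv_scale, <- RtoC_mult, sqrt_sqrt by exact Ht.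
  unfold nullv. apply P3_eq; vunf; destruct c, a, b; simpl; ring.
Qed.

Lemma unit_direction (p : P3) : exists v, enorm3 v = 1 /\ p = scl3 (enorm3 p) v.
Proof.
  destruct (Req_dec (enorm3 p) 0) as [E|E].
  - exists (mk3 1 0 0). split.
    + unfold enorm3. replace (dot3 (mk3 1 0 0) (mk3 1 0 0)) with 1 by (vunf; ring). apply sqrt_1.
    + rewrite E. apply enorm3_eq0 in E. rewrite E. veq.
  - pose proof (enorm3_ge0 p). exists (scl3 (/ enorm3 p) p). split; [apply enorm3_unit; lra|].
    apply P3_eq; vunf; field; exact E.
Qed.

(* The amplitude of the Riemann-Hilbert step is a bump around [tip], so that the disc grows a thin
   spike from near [g] to near [g']. *)
Lemma spike_step p0 U V (tip : C) k0 s g g' nu :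
  good U V -> Cmod tip = 1 -> 0 < k0 -> 0 < s -> enorm3 (sub3 g' g) <= s / 4 ->
  enorm3 (sub3 (surf p0 U V tip) g) <= nu / 4 -> 0 < nu ->
  exists U' V' tip' k1, good U' V' /\ Cmod tip' = 1 /\ 0 < k1 /\
    enorm3 (sub3 (surf p0 U' V' tip') g') <= nu /\
    (forall z, Cmod z <= 1 -> enorm3 (sub3 (surf p0 U' V' z) g) <= 3 * s / 8 + nu \/
        exists w, Cmod w <= 1 /\ enorm3 (sub3 (surf p0 U' V' z) (surf p0 U V w)) <= nu / 4) /\
    (forall z, Cmod z = 1 -> k0 <= Cmod (z - tip) -> k1 <= Cmod (z - tip') /\ enorm3 (sub3 (surf p0 U' V' z) (surf p0 U V z)) <= nu / 4) /\
    (exists z, Cmod z = 1 /\ k1 <= Cmod (z - tip') /\ enorm3 (sub3 (surf p0 U' V' z) g) <= s / 4 + nu).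
Proof.
  intros Hg Htip Hk0 Hs Hgg Htg Hnu.
  destruct (surf0_lip U V) as (K & HK & HL).
  set (f := surf p0 U V) in *.
  assert (HLf : forall z w, Cmod z <= 1 -> Cmod w <= 1 -> enorm3 (sub3 (f z) (f w)) <= K * Cmod (z - w)).
  { intros z w Hz Hw. unfold f. replace (sub3 (surf p0 U V z) (surf p0 U V w)) with (sub3 (surf0 U V z) (surf0 U V w)) by (unfold surf; veq). auto. }
  (* Half-width of the bump: the old surface varies by at most [s / 8] over twice this distance. *)
  set (k := Rmin (Rmin k0 1) (s / (16 * K))).
  assert (Hk : 0 < k) by (repeat apply Rmin_glb_lt; try lra; apply Rdiv_lt_0_compat; lra).
  assert (Hk1 : k <= k0) by (unfold k; eapply Rle_trans; [apply Rmin_l|apply Rmin_l]).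
  assert (Hk2 : k <= 1) by (unfold k; eapply Rle_trans; [apply Rmin_l|apply Rmin_r]).
  assert (Hk3 : K * (2 * k) <= s / 8).
  { apply Rle_trans with (K * (2 * (s / (16 * K)))); [apply Rmult_le_compat_l; [lra|]; apply Rmult_le_compat_l; [lra|apply Rmin_r]|right; field; lra]. }
  destruct (unit_direction (sub3 g' g)) as (v & Hv & Ev).
  destruct (null_direction v Hv) as (a0 & b0 & Hab).
  assert (Hn1 : Cmod a0 * Cmod a0 + Cmod b0 * Cmod b0 = 1).
  { assert (E := enorm3_nullv 1 a0 b0). rewrite Hab, Hv, Cmod_1 in E. lra. }
  set (H := enorm3 (sub3 g' g)) in *. assert (HH : 0 <= H) by apply enorm3_ge0.
  set (tau := fun z : C => H * Rmax 0 (1 - Cmod (z - tip) / k)).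
  assert (Htau : forall z, 0 <= tau z <= H).
  { intros z. unfold tau. pose proof (Rmax_l 0 (1 - Cmod (z - tip) / k)).
    assert (0 <= Cmod (z - tip) / k) by (apply Rdiv_le_0_compat; [apply Cmod_ge_0|lra]).
    assert (Rmax 0 (1 - Cmod (z - tip) / k) <= 1) by (apply Rmax_lub; lra). nra. }
  assert (Htau0 : forall z, k <= Cmod (z - tip) -> tau z = 0).
  { intros z Hz. unfold tau. rewrite Rmax_left; [ring|].
    assert (1 <= Cmod (z - tip) / k); [|lra]. apply Rmult_le_reg_r with k; [lra|]. unfold Rdiv; rewrite Rmult_assoc, Rinv_l; lra. }
  assert (Hutau : circle_ucr tau).
  { unfold tau. apply ucr_mult; [apply ucr_const|]. intros e He. exists (e * k). split; [nra|]. intros z w _ _ Hzw.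
    assert (Hm : Rabs (Rmax 0 (1 - Cmod (z - tip) / k) - Rmax 0 (1 - Cmod (w - tip) / k)) <= Rabs (Cmod (z - tip) / k - Cmod (w - tip) / k)).
    { unfold Rmax, Rabs. destruct (Rle_dec 0 (1 - Cmod (z - tip) / k)), (Rle_dec 0 (1 - Cmod (w - tip) / k));
        repeat destruct (Rcase_abs _); lra. }
    eapply Rle_lt_trans; [exact Hm|]. replace (Cmod (z - tip) / k - Cmod (w - tip) / k) with ((Cmod (z - tip) - Cmod (w - tip)) / k) by (field; lra).
    unfold Rdiv. rewrite Rabs_mult, (Rabs_right (/ k)) by (apply Rle_ge; left; now apply Rinv_0_lt_compat).
    apply Rmult_lt_reg_r with k; [lra|]. rewrite Rmult_assoc, Rinv_l, Rmult_1_r by lra.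
    eapply Rle_lt_trans; [apply Cmod_diff|]. replace (z - tip - (w - tip))%C with (z - w)%C by ring. exact Hzw. }
  assert (Husq : circle_uc (fun z => RtoC (sqrt (tau z)))) by (apply uc_RtoC, ucr_sqrt; [exact Hutau|intros; apply Htau]).
  (* The root of unity used as new tip lies within [4 PI eta] of [tip]; the last two bounds keep it
     at most half way to the edge of the bump and the resulting loss below [nu / 4]. *)
  set (eta := Rmin (Rmin (nu / 16) (k / (8 * PI))) (nu / (16 * PI * (K + H / k + 1)))).
  pose proof PI_RGT_0 as Hpi.
  assert (HHk : 0 <= H / k) by (apply Rdiv_le_0_compat; lra).
  assert (Heta : 0 < eta).
  { repeat apply Rmin_glb_lt; try lra; apply Rdiv_lt_0_compat; try lra. apply Rmult_lt_0_compat; lra. }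
  assert (He1 : eta <= nu / 16) by (unfold eta; eapply Rle_trans; [apply Rmin_l|apply Rmin_l]).
  assert (He2 : eta <= k / (8 * PI)) by (unfold eta; eapply Rle_trans; [apply Rmin_l|apply Rmin_r]).
  assert (He3 : eta <= nu / (16 * PI * (K + H / k + 1))) by apply Rmin_r.
  destruct (surf0_radial U V eta Heta) as (rr & Hrr & Hrad).
  destruct (riemann_hilbert U V (fun z => RtoC (sqrt (tau z)) * a0)%C (fun z => RtoC (sqrt (tau z)) * b0)%C rr eta 1 Hg
    (uc_mult _ _ Husq (uc_const a0)) (uc_mult _ _ Husq (uc_const b0)) Hrr Heta Rlt_0_1)
    as (A & B & r & M & Hr1 & Hr2 & Hg' & _ & _ & Hin & Hout & HM & _).
  set (U' := padd U A) in *. set (V' := padd V B) in *. set (f' := surf p0 U' V').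
  assert (Hsub : forall z w, sub3 (f' z) (f w) = sub3 (surf0 U' V' z) (surf0 U V w)) by (intros; unfold f', f, surf; veq).
  assert (HMp : 0 < INR M) by (eapply Rlt_le_trans; [|exact HM]; now apply Rinv_0_lt_compat).
  destruct (root_near tip M Htip HMp) as (tip' & Htip' & Hroot & Hnear).
  assert (Hd : Cmod (tip' - tip) <= 4 * PI * eta).
  { eapply Rle_trans; [exact Hnear|]. apply Rmult_le_compat_l; [lra|]. rewrite <- (Rinv_inv eta). apply Rinv_le_contravar; [now apply Rinv_0_lt_compat|exact HM]. }
  assert (Hdk : 4 * PI * eta <= k / 2).
  { apply Rle_trans with (4 * PI * (k / (8 * PI))); [apply Rmult_le_compat_l; lra|right; field; lra]. }
  assert (Hfar : forall z, k <= Cmod (z - tip) -> k / 2 <= Cmod (z - tip')).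
  { intros z Hz. pose proof (Cmod_sub_tri z tip' tip). lra. }
  assert (Hbdry : forall z, Cmod z = 1 -> exists c, Cmod c <= 1 /\ c = (z ^ M)%C /\
     enorm3 (sub3 (sub3 (f' z) (f z)) (scl3 (tau z) (nullv c a0 b0))) <= eta).
  { intros z Hz. destruct (Hout z 1 Hz ltac:(lra)) as (c & Hc & Hc1 & Hcl). exists c. split; [exact Hc|]. split; [now apply Hc1|].
    rewrite nullv_real_scale in Hcl by apply Htau. rewrite Hsub. replace (1 * z)%C with z in Hcl by ring. exact Hcl. }
  assert (Hstill : forall z, Cmod z = 1 -> k <= Cmod (z - tip) -> enorm3 (sub3 (f' z) (f z)) <= nu / 4).
  { intros z Hz Hzk. destruct (Hbdry z Hz) as (c & _ & _ & Hcl). rewrite (Htau0 z Hzk) in Hcl.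
    replace (sub3 (sub3 (f' z) (f z)) (scl3 0 (nullv c a0 b0))) with (sub3 (f' z) (f z)) in Hcl by veq. lra. }
  exists U', V', tip', (k / 2). split; [exact Hg'|]. split; [exact Htip'|]. split; [lra|]. fold f'.
  split; [|split; [|split]].
  - destruct (Hbdry tip' Htip') as (c & _ & -> & Hcl). rewrite Hroot, Hab in Hcl.
    replace (sub3 (f' tip') g') with (add3 (sub3 (sub3 (f' tip') (f tip')) (scl3 (tau tip') v))
      (add3 (sub3 (f tip') (f tip)) (add3 (sub3 (f tip) g) (scl3 (tau tip' - H) v)))).
    2:{ replace g' with (add3 g (scl3 H v)) by (rewrite <- Ev; veq). veq. }
    eapply Rle_trans; [apply enorm3_tri|]. eapply Rle_trans; [apply Rplus_le_compat_l, enorm3_tri|].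
    eapply Rle_trans; [apply Rplus_le_compat_l, Rplus_le_compat_l, enorm3_tri|].
    assert (HL1 := HLf tip' tip ltac:(lra) ltac:(lra)).
    assert (HL2 : enorm3 (scl3 (tau tip' - H) v) <= H / k * Cmod (tip' - tip)).
    { rewrite enorm3_scl, Hv, Rmult_1_r. unfold tau.
      assert (Hq : 0 <= Cmod (tip' - tip) / k <= 1).
      { split; [apply Rdiv_le_0_compat; [apply Cmod_ge_0|lra]|]. apply Rmult_le_reg_r with k; [lra|]. unfold Rdiv; rewrite Rmult_assoc, Rinv_l; lra. }
      rewrite Rmax_right by lra. replace (H * (1 - Cmod (tip' - tip) / k) - H) with (- (H * (Cmod (tip' - tip) / k))) by ring.
      rewrite Rabs_Ropp, Rabs_right by (apply Rle_ge, Rmult_le_pos; lra). right; field; lra. }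
    assert (Hsum : (K + H / k + 1) * Cmod (tip' - tip) <= nu / 4).
    { assert (HX0 : 0 < K + H / k + 1) by lra. clear - HX0 He3 Hd Hpi Hnu. set (X := K + H / k + 1) in *.
      apply Rle_trans with (X * (4 * PI * (nu / (16 * PI * X)))).
      - apply Rmult_le_compat_l; [lra|]. eapply Rle_trans; [exact Hd|]. apply Rmult_le_compat_l; lra.
      - right. field. repeat split; lra. }
    pose proof (Cmod_ge_0 (tip' - tip)). set (hk := H / k) in *. set (dd := Cmod (tip' - tip)) in *.
    assert (K * dd + hk * dd + dd <= nu / 4) by lra. lra.
  - intros z Hz. destruct (Rle_lt_dec (Cmod z) r) as [Hle|Hlt].
    + right. exists z. split; [exact Hz|]. rewrite Hsub. specialize (Hin z Hle). lra.
    + destruct (polar z) as (rho & w & Hw & _ & Ez0).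
      destruct (polar z) as (rho' & w' & Hw' & Erho & Ez). subst rho'.
      destruct (Hout w' (Cmod z) Hw' ltac:(lra)) as (c & Hc & _ & Hcl).
      rewrite nullv_real_scale in Hcl by apply Htau. rewrite <- Ez, <- Hsub in Hcl.
      destruct (Rle_lt_dec k (Cmod (w' - tip))) as [Hfark|Hclose].
      * right. exists w'. split; [lra|]. rewrite (Htau0 w' Hfark) in Hcl.
        replace (sub3 (sub3 (f' z) (f w')) (scl3 0 (nullv c a0 b0))) with (sub3 (f' z) (f w')) in Hcl by veq. lra.
      * left. replace (sub3 (f' z) g) with (add3 (sub3 (sub3 (f' z) (f w')) (scl3 (tau w') (nullv c a0 b0)))
          (add3 (scl3 (tau w') (nullv c a0 b0)) (add3 (sub3 (f w') (f tip)) (sub3 (f tip) g)))) by veq.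
        eapply Rle_trans; [apply enorm3_tri|]. eapply Rle_trans; [apply Rplus_le_compat_l, enorm3_tri|].
        eapply Rle_trans; [apply Rplus_le_compat_l, Rplus_le_compat_l, enorm3_tri|].
        assert (HL1 := HLf w' tip ltac:(lra) ltac:(lra)).
        assert (enorm3 (scl3 (tau w') (nullv c a0 b0)) <= H).
        { rewrite enorm3_scl, enorm3_nullv, Hn1, Rabs_right by (apply Rle_ge, Htau). pose proof (Htau w').
          pose proof (Cmod_ge_0 c). nra. }
        assert (K * Cmod (w' - tip) <= K * (2 * k)) by (apply Rmult_le_compat_l; lra). lra.
  - intros z Hz Hzk. split; [apply Hfar; lra|]. apply Hstill; [exact Hz|lra].
  (* Rotating [tip] by [u] leaves the bump just barely: the chord is between [k] and [2 k]. This
     point is not moved, stays near [g], and remains a witness for [g] after later spikes. *)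
  -    set (u := (sqrt (1 - k * k), k) : C).
    assert (Hsq : sqrt (1 - k * k) * sqrt (1 - k * k) = 1 - k * k) by (apply sqrt_sqrt; nra).
    assert (Hsq0 := sqrt_pos (1 - k * k)).
    assert (Hu : Cmod u = 1).
    { apply Rsqr_inj; [apply Cmod_ge_0|lra|]. unfold Rsqr. rewrite Cmod_sq. unfold u; simpl. lra. }
    assert (Hd1 : Cmod (tip * u - tip) = Cmod (u - 1)).
    { replace (tip * u - tip)%C with (tip * (u - 1))%C by ring. rewrite Cmod_mult, Htip. ring. }
    assert (Hd2 : k <= Cmod (u - 1) <= 2 * k).
    { assert (E := Cmod_sq (u - 1)%C). unfold u in E at 3 4 5 6. simpl in E. pose proof (Cmod_ge_0 (u - 1)).
      assert (sqrt (1 - k * k) <= 1) by nra. assert (1 - sqrt (1 - k * k) <= k * k) by nra.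
      split; apply sq_le_le; try lra; rewrite E; nra. }
    exists (tip * u)%C. assert (Hz : Cmod (tip * u) = 1) by (rewrite Cmod_mult, Htip, Hu; ring).
    split; [exact Hz|]. split; [apply Hfar; lra|].
    replace (sub3 (f' (tip * u)%C) g) with (add3 (sub3 (f' (tip * u)%C) (f (tip * u)%C)) (add3 (sub3 (f (tip * u)%C) (f tip)) (sub3 (f tip) g))) by veq.
    eapply Rle_trans; [apply enorm3_tri|]. eapply Rle_trans; [apply Rplus_le_compat_l, enorm3_tri|].
    assert (HL1 := HLf (tip * u)%C tip ltac:(lra) ltac:(lra)). rewrite Hd1 in HL1.
    assert (Hst := Hstill (tip * u)%C Hz ltac:(lra)).
    assert (K * Cmod (u - 1) <= K * (2 * k)) by (apply Rmult_le_compat_l; lra). lra.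
Qed.

(** The witnesses for earlier points are kept at distance at least [k] from the tip, hence outside
    all later bumps. Asking the previous stage for precision [nu / 4] keeps the error independent of
    the number of spikes. *)
Lemma chain_disc (g : nat -> P3) s : 0 < s -> (forall j, enorm3 (sub3 (g (S j)) (g j)) <= s / 4) ->
  forall j nu, 0 < nu -> exists U V tip k, good U V /\ Cmod tip = 1 /\ 0 < k /\
    enorm3 (sub3 (surf (g 0%nat) U V tip) (g j)) <= nu /\
    (forall z, Cmod z <= 1 -> exists i, (i <= j)%nat /\ enorm3 (sub3 (surf (g 0%nat) U V z) (g i)) <= 3 * s / 8 + nu) /\
    (forall i, (i < j)%nat -> exists z, Cmod z = 1 /\ k <= Cmod (z - tip) /\ enorm3 (sub3 (surf (g 0%nat) U V z) (g i)) <= s / 4 + nu).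
Proof.
  intros Hs Hg. induction j as [|j IH]; intros nu Hnu.
  (* The chain starts with a tiny flat disc, the surface of the constant spinor [(0, c)]. *)
  - set (c := Rmin 1 (nu / 8)). assert (Hc : 0 < c) by (apply Rmin_glb_lt; lra).
    assert (Hc1 : c <= 1) by apply Rmin_l. assert (Hc2 : c <= nu / 8) by apply Rmin_r.
    assert (Hsm : forall z, Cmod z <= 1 -> enorm3 (sub3 (surf (g 0%nat) nil (RtoC c :: nil) z) (g 0%nat)) <= nu).
    { intros z Hz. replace (sub3 (surf (g 0%nat) nil (RtoC c :: nil) z) (g 0%nat)) with (surf0 nil (RtoC c :: nil) z) by (unfold surf; veq).
      eapply Rle_trans; [apply enorm3_le_sum|]. unfold surf0. vunf.
      assert (E1 : bint nil nil z = RtoC 0) by (unfold bint; simpl; ring).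
      assert (E2 : bint nil (RtoC c :: nil) z = RtoC 0) by (unfold bint; simpl; ring).
      assert (E3 : bint (RtoC c :: nil) (RtoC c :: nil) z = (RtoC (c * c) * z)%C).
      { unfold bint, prim. cbn [pmul padd pscale map jint peval INR]. rewrite RtoC_mult. field. }
      rewrite E1, E2, E3.
      assert (Hb : Cmod (RtoC (c * c) * z) <= c).
      { rewrite Cmod_mult, Cmod_R, Rabs_right by nra. pose proof (Cmod_ge_0 z). nra. }
      pose proof (Cmod_ge_abs_re (RtoC (c * c) * z)%C). pose proof (Cmod_ge_abs_im (RtoC (c * c) * z)%C).
      set (q := (RtoC (c * c) * z)%C) in *.
      replace (fst (0 - q)%C) with (- fst q) by (destruct q; simpl; ring).
      replace (fst (Ci * (0 + q))%C) with (- snd q) by (destruct q; simpl; ring).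
      replace (fst (2 * 0)%C) with 0 by (simpl; ring). rewrite !Rabs_Ropp, Rabs_R0. lra. }
    exists nil, (RtoC c :: nil), (RtoC 1), 1. split.
    { split; [|simpl; intros E; apply (f_equal fst) in E; simpl in E; lra].
      intros z _. unfold sn2. simpl. rewrite Cmod_0. replace (c + z * 0)%C with (RtoC c) by ring. rewrite Cmod_R, Rabs_right by lra. nra. }
    split; [apply Cmod_1|]. split; [lra|]. split; [apply Hsm; rewrite Cmod_1; lra|]. split.
    + intros z Hz. exists 0%nat. split; [lia|]. specialize (Hsm z Hz). lra.
    + intros i Hi; lia.
  - destruct (IH (nu / 4) ltac:(lra)) as (U & V & tip & k & H1 & H2 & H3 & H4 & H5 & H6).
    destruct (spike_step (g 0%nat) U V tip k s (g j) (g (S j)) nu H1 H2 H3 Hs (Hg j) H4 Hnu)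
      as (U' & V' & tip' & k' & K1 & K2 & K3 & K4 & K5 & K6 & z0 & K7 & K8 & K9).
    exists U', V', tip', k'. split; [exact K1|]. split; [exact K2|]. split; [exact K3|]. split; [exact K4|]. split.
    + intros z Hz. destruct (K5 z Hz) as [Ha|(w & Hw & Hb)].
      * exists j. split; [lia|exact Ha].
      * destruct (H5 w Hw) as (i & Hi & Hi2). exists i. split; [lia|].
        pose proof (enorm3_sub_tri (surf (g 0%nat) U' V' z) (surf (g 0%nat) U V w) (g i)). lra.
    + intros i Hi. destruct (Nat.eq_dec i j) as [->|Hne].
      * exists z0. repeat split; assumption.
      * destruct (H6 i ltac:(lia)) as (z & Hz1 & Hz2 & Hz3). destruct (K6 z Hz1 Hz2) as [L1 L2].
        exists z. split; [exact Hz1|]. split; [exact L1|].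
        pose proof (enorm3_sub_tri (surf (g 0%nat) U' V' z) (surf (g 0%nat) U V z) (g i)). lra.
Qed.

(** The body of [pinched] with its normal exposed, so that a normal can be selected and compared at
    different points. *)
Definition pinch_normal (D : P3 -> Prop) (m : R) (q n : P3) : Prop :=
  enorm3 n = 1 /\
  (forall x, dot3 (sub3 x q) (sub3 x q) < - (2 * m * dot3 n (sub3 x q)) -> D x) /\
  (forall x, D x -> enorm3 (sub3 x q) < m -> dot3 (sub3 x q) (sub3 x q) < - (2 / m * dot3 n (sub3 x q))).

(* If the normals differed, a segment entering the interior ball at [q] would leave through
   the exterior ball at [q']. *)
Lemma normals_close D m h : 0 < m <= 1 -> 0 < h <= 1 -> exists k, 0 < k /\
  forall q q' n n', pinch_normal D m q n -> pinch_normal D m q' n' -> enorm3 (sub3 q q') <= k -> enorm3 (sub3 n n') <= h.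
Proof.
  intros Hm Hh. set (s := m * (h * h) / 8).
  assert (Hhh : 0 < h * h) by nra. assert (Hhh1 : h * h <= 1) by nra.
  assert (Hmh : 0 < m * (h * h)) by (apply Rmult_lt_0_compat; lra).
  assert (Hs : 0 < s) by (unfold s; lra). assert (Hs1 : s <= h * h / 8) by (unfold s; nra).
  assert (Hs2 : s <= m / 8) by (unfold s; nra).
  exists (s * s). split; [nra|]. intros q q' n n' (Hn & Hin & _) (Hn' & _ & Hout) Hq.
  apply Rnot_lt_le. intros Hbig.
  set (v := sub3 n' n). assert (Hv : enorm3 v = enorm3 (sub3 n n')) by apply enorm3_sym.
  assert (Hnn : dot3 n n = 1) by (rewrite <- enorm3_sq, Hn; ring).
  assert (Hnn' : dot3 n' n' = 1) by (rewrite <- enorm3_sq, Hn'; ring).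
  set (c := dot3 n n').
  assert (Hvv : dot3 v v = 2 - 2 * c).
  { replace (dot3 v v) with (dot3 n n + dot3 n' n' - 2 * dot3 n n') by (unfold v; vunf; ring). fold c. lra. }
  assert (Hc : c < 1 - h * h / 2).
  { assert (h * h < dot3 v v) by (rewrite <- enorm3_sq, Hv; nra). lra. }
  assert (Hv2 : enorm3 v <= 2).
  { unfold v. replace (sub3 n' n) with (add3 n' (scl3 (-1) n)) by veq. eapply Rle_trans; [apply enorm3_tri|].
    rewrite enorm3_scl, Rabs_left by lra. lra. }
  assert (Hvn : dot3 n v = c - 1) by (replace (dot3 n v) with (dot3 n n' - dot3 n n) by (unfold v; vunf; ring); fold c; lra).
  assert (Hvn' : dot3 n' v = 1 - c) by (replace (dot3 n' v) with (dot3 n' n' - dot3 n n') by (unfold v; vunf; ring); fold c; lra).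
  set (x := add3 q (scl3 s v)).
  assert (HDx : D x).
  { apply Hin. replace (sub3 x q) with (scl3 s v) by (unfold x; veq).
    replace (dot3 (scl3 s v) (scl3 s v)) with (s * (s * dot3 v v)) by (vunf; ring).
    replace (dot3 n (scl3 s v)) with (s * dot3 n v) by (vunf; ring). rewrite Hvv, Hvn.
    assert (0 < s * (1 - c)) by (apply Rmult_lt_0_compat; lra).
    replace (s * (s * (2 - 2 * c))) with (2 * s * (s * (1 - c))) by ring.
    replace (- (2 * m * (s * (c - 1)))) with (2 * m * (s * (1 - c))) by ring. apply Rmult_lt_compat_r; lra. }
  assert (Exq : sub3 x q' = add3 (scl3 s v) (sub3 q q')) by (unfold x; veq).
  assert (Hxq : enorm3 (sub3 x q') < m).
  { rewrite Exq. eapply Rle_lt_trans; [apply enorm3_tri|]. rewrite enorm3_scl, Rabs_right by lra. nra. }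
  specialize (Hout x HDx Hxq). rewrite Exq in Hout at 3.
  replace (dot3 n' (add3 (scl3 s v) (sub3 q q'))) with (s * dot3 n' v + dot3 n' (sub3 q q')) in Hout by (vunf; ring).
  rewrite Hvn' in Hout. pose proof (dot3_ge0 (sub3 x q')).
  assert (Hl := dot3_lb n' (sub3 q q')). rewrite Hn' in Hl.
  assert (0 < 2 / m) by (apply Rdiv_lt_0_compat; lra).
  assert (0 < s * (1 - c) + dot3 n' (sub3 q q')); [nra|nra].
Qed.

Lemma curve_uc (g : R -> P3) k : smooth_map_on basis1 (fun _ => True) g -> 0 < k ->
  exists d, 0 < d /\ forall s t, 0 <= s <= 1 -> 0 <= t <= 1 -> Rabs (s - t) < d -> enorm3 (sub3 (g s) (g t)) <= k.
Proof.
  intros (Hx & Hy & Hz) Hk.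
  assert (Hone : forall f : R -> R, smooth_on basis1 (fun _ => True) f -> exists d, 0 < d /\
     forall s t, 0 <= s <= 1 -> 0 <= t <= 1 -> Rabs (s - t) < d -> Rabs (f s - f t) <= k / 3).
  { intros f Hf. assert (Hk3 : 0 < k / 3) by lra.
    assert (Hc : forall x, 0 <= x <= 1 -> continuity_pt f x).
    { intros x _. apply continuity_pt_filterlim. apply (Hf 0%nat x I). }
    destruct (Heine_cor2 Hc (mkposreal _ Hk3)) as [d Hd].
    - exists d. split; [apply cond_pos|]. intros s t Hs Ht Hst. apply Rlt_le, Hd; assumption. }
  destruct (Hone _ Hx) as (d1 & Hd1 & H1). destruct (Hone _ Hy) as (d2 & Hd2 & H2). destruct (Hone _ Hz) as (d3 & Hd3 & H3).
  exists (Rmin d1 (Rmin d2 d3)). split; [repeat apply Rmin_glb_lt; lra|].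
  pose proof (Rmin_l d1 (Rmin d2 d3)). pose proof (Rmin_r d1 (Rmin d2 d3)). pose proof (Rmin_l d2 d3). pose proof (Rmin_r d2 d3).
  intros s t Hs Ht Hst. specialize (H1 s t Hs Ht ltac:(lra)). specialize (H2 s t Hs Ht ltac:(lra)). specialize (H3 s t Hs Ht ltac:(lra)).
  eapply Rle_trans; [apply enorm3_le_sum|]. vunf. lra.
Qed.

Lemma periodic_unit {T} (g : R -> T) : (forall t, g (t + 1) = g t) -> forall t, exists t', 0 <= t' <= 1 /\ g t = g t'.
Proof.
  intros Hp t. destruct (base_fp t) as [H1 H2]. exists (frac_part t). split; [lra|].
  assert (Hn : forall n s, g (s + INR n) = g s).
  { induction n as [|n IH]; intros s; [f_equal; simpl; ring|]. rewrite S_INR.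
    replace (s + (INR n + 1)) with ((s + INR n) + 1) by ring. rewrite Hp. apply IH. }
  unfold frac_part. set (k := Int_part t).
  destruct (Z_le_gt_dec 0 k) as [Hk|Hk].
  - rewrite <- (Hn (Z.to_nat k) (t - IZR k)). f_equal. rewrite INR_IZR_INZ, Z2Nat.id by exact Hk. ring.
  - rewrite <- (Hn (Z.to_nat (- k)) t). f_equal. rewrite INR_IZR_INZ, Z2Nat.id, opp_IZR by lia. ring.
Qed.

(** The chain follows the curve shifted inwards by [s <= m]. The ball of radius [s] around each
    shifted point lies in an interior tangent ball, and the disc stays within [s / 2] of these
    centres, so it is inside [D] with depth at least [s / 2]. *)
Lemma initial_disc D Gam m eps : open D -> bounded3 D -> 0 < m <= 1 -> (forall q, boundary3 D q -> pinched D q m) ->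
  smooth_jordan_curve Gam -> (forall x, Gam x -> boundary3 D x) -> 0 < eps ->
  exists p0 U V mu, good U V /\ 0 < mu /\ inside D mu (surf p0 U V) /\
    (forall z, Cmod z <= 1 -> exists x, Gam x /\ enorm3 (sub3 (surf p0 U V z) x) <= eps) /\
    (forall x, Gam x -> exists z, Cmod z = 1 /\ enorm3 (sub3 (surf p0 U V z) x) <= eps).
Proof.
  intros Ho Hb Hm Hp (g & Hsm & Hper & _ & _ & Himg) HG He.
  set (s := Rmin m (eps / 4)). assert (Hs : 0 < s) by (apply Rmin_glb_lt; lra).
  assert (Hsm1 : s <= m) by apply Rmin_l. assert (Hse : s <= eps / 4) by apply Rmin_r.
  destruct (normals_close D m (1 / 8) Hm ltac:(lra)) as (k & Hk & Hnc).
  set (k' := Rmin k (s / 8)). assert (Hk' : 0 < k') by (apply Rmin_glb_lt; lra).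
  destruct (curve_uc g k' Hsm Hk') as (d & Hd & Huc).
  destruct (INR_unbounded (/ d)) as [K0 HK0]. set (K := S K0).
  assert (HK1 : / d < INR K) by (unfold K; rewrite S_INR; lra).
  assert (HK : 0 < INR K) by (apply lt_0_INR; unfold K; lia).
  assert (HKd : / INR K < d) by (rewrite <- (Rinv_inv d); apply Rinv_lt_contravar; [apply Rmult_lt_0_compat; [apply Rinv_0_lt_compat|]; lra|lra]).
  (* The sequence stops at parameter 1, since [chain_disc] requires small steps for all indices. *)
  set (par := fun j : nat => INR (Nat.min j K) / INR K).
  assert (Hpar : forall j, 0 <= par j <= 1).
  { intros j. unfold par. split; [apply Rdiv_le_0_compat; [apply pos_INR|lra]|].
    apply Rmult_le_reg_r with (INR K); [lra|]. unfold Rdiv; rewrite Rmult_assoc, Rinv_l, Rmult_1_r, Rmult_1_l by lra. apply le_INR; lia. }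
  set (q := fun j => g (par j)).
  assert (Hqb : forall j, boundary3 D (q j)) by (intros j; apply HG, Himg; now exists (par j)).
  (* The normals are selected point by point; [normals_close] makes neighbouring choices close, as
     any two pinching normals at nearby points are. *)
  set (nn := fun j => epsilon (inhabits (q j)) (fun n => pinch_normal D m (q j) n)).
  assert (Hnn : forall j, pinch_normal D m (q j) (nn j)) by (intros j; unfold nn; apply epsilon_spec; exact (Hp (q j) (Hqb j))).
  set (G := fun j => sub3 (q j) (scl3 s (nn j))).
  assert (Hball : forall j x, enorm3 (sub3 x (G j)) < s -> D x).
  { intros j x Hx. destruct (Hnn j) as (Hn & Hin & _). apply Hin. set (y := sub3 x (q j)).
    assert (Ey : sub3 x (G j) = add3 y (scl3 s (nn j))) by (unfold y, G; veq).
    assert (Hsq : dot3 (sub3 x (G j)) (sub3 x (G j)) < s * s).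
    { rewrite <- enorm3_sq. pose proof (enorm3_ge0 (sub3 x (G j))). nra. }
    rewrite Ey, dot3_add_sq in Hsq.
    replace (dot3 (scl3 s (nn j)) (scl3 s (nn j))) with (s * s * dot3 (nn j) (nn j)) in Hsq by (vunf; ring).
    replace (dot3 y (scl3 s (nn j))) with (s * dot3 (nn j) y) in Hsq by (vunf; ring).
    rewrite <- (enorm3_sq (nn j)), Hn in Hsq. pose proof (dot3_ge0 y).
    assert (dot3 (nn j) y < 0) by nra. nra. }
  assert (Hstep : forall j, enorm3 (sub3 (G (S j)) (G j)) <= s / 4).
  { intros j.
    assert (Hq : enorm3 (sub3 (q (S j)) (q j)) <= k').
    { apply Huc; auto. unfold par. eapply Rle_lt_trans; [|exact HKd].
      assert (Hcase : Nat.min (S j) K = Nat.min j K \/ Nat.min (S j) K = S (Nat.min j K)) by lia.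
      destruct Hcase as [E|E]; rewrite E.
      - unfold Rminus. rewrite Rplus_opp_r, Rabs_R0. left; now apply Rinv_0_lt_compat.
      - rewrite S_INR. replace ((INR (Nat.min j K) + 1) / INR K - INR (Nat.min j K) / INR K) with (/ INR K) by (field; lra).
        rewrite Rabs_right; [lra|]. apply Rle_ge; left; now apply Rinv_0_lt_compat. }
    assert (k' <= k) by apply Rmin_l. assert (k' <= s / 8) by apply Rmin_r.
    assert (Hn : enorm3 (sub3 (nn j) (nn (S j))) <= 1 / 8).
    { apply (Hnc (q j) (q (S j))); auto. rewrite enorm3_sym. lra. }
    replace (sub3 (G (S j)) (G j)) with (add3 (sub3 (q (S j)) (q j)) (scl3 s (sub3 (nn j) (nn (S j))))) by (unfold G; veq).
    eapply Rle_trans; [apply enorm3_tri|]. rewrite enorm3_scl, Rabs_right by lra. nra. }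
  destruct (chain_disc G s Hs Hstep K (s / 16) ltac:(lra)) as (U & V & tip & kk & Hg & Htip & _ & Htg & Hnear & Hwit).
  exists (G 0%nat), U, V, (s / 2). set (f := surf (G 0%nat) U V) in *.
  assert (HGq : forall j, enorm3 (sub3 (G j) (q j)) = s).
  { intros j. replace (sub3 (G j) (q j)) with (scl3 (- s) (nn j)) by (unfold G; veq).
    rewrite enorm3_scl, Rabs_Ropp, Rabs_right by lra. rewrite (proj1 (Hnn j)). ring. }
  split; [exact Hg|]. split; [lra|]. split; [|split].
  - intros z Hz. destruct (Hnear z Hz) as (i & _ & Hi).
    split; [apply (Hball i); lra|]. apply depth_ge; [exact Hb|]. intros y Hy.
    apply Rnot_lt_le. intros Hlt. apply Hy, (Hball i).
    pose proof (enorm3_sub_tri y (f z) (G i)). rewrite (enorm3_sym y (f z)) in H. lra.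
  - intros z Hz. destruct (Hnear z Hz) as (i & _ & Hi). exists (q i). split; [apply Himg; now exists (par i)|].
    pose proof (enorm3_sub_tri (f z) (G i) (q i)). rewrite HGq in H. lra.
  - intros x Hx. apply Himg in Hx as [t ->]. destruct (periodic_unit g Hper t) as (t' & Ht' & ->).
    destruct (nfloor_ex (t' * INR K)) as (j & Hj1 & Hj2); [apply Rmult_le_pos; lra|].
    assert (HtK : t' * INR K <= 1 * INR K) by (apply Rmult_le_compat_r; lra).
    assert (HjK : (j <= K)%nat) by (apply INR_le; lra).
    assert (Hqj : enorm3 (sub3 (q j) (g t')) <= k').
    { apply Huc; auto. unfold par. rewrite Nat.min_l by exact HjK. eapply Rle_lt_trans; [|exact HKd].
      replace (INR j / INR K - t') with (- ((t' * INR K - INR j) * / INR K)) by (field; lra).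
      rewrite Rabs_Ropp, Rabs_mult, !Rabs_right; try lra.
      - assert (0 < / INR K) by now apply Rinv_0_lt_compat. assert ((t' * INR K - INR j) * / INR K <= 1 * / INR K) by (apply Rmult_le_compat_r; lra). lra.
      - apply Rle_ge; left; now apply Rinv_0_lt_compat. }
    assert (k' <= s / 8) by apply Rmin_r.
    assert (Hz : exists z, Cmod z = 1 /\ enorm3 (sub3 (f z) (G j)) <= s / 2).
    { destruct (Nat.eq_dec j K) as [->|Hne].
      - exists tip. split; [exact Htip|lra].
      - destruct (Hwit j ltac:(lia)) as (z & Hz & _ & Hzz). exists z. split; [exact Hz|lra]. }
    destruct Hz as (z & Hz & Hzz). exists z. split; [exact Hz|].
    pose proof (enorm3_sub_tri (f z) (G j) (g t')). pose proof (enorm3_sub_tri (G j) (q j) (g t')). rewrite HGq in H1. lra.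
Qed.

(** * The iteration *)

Definition state : Type := (list C * list C * R * R)%type.

Definition stU (s : state) : list C := fst (fst (fst s)).

Definition stV (s : state) : list C := snd (fst (fst s)).

Definition str (s : state) : R := snd (fst s).

Definition ste (s : state) : R := snd s.

(* [del] bounds the depth of the boundary curve; [ste] is the tolerance on the disc of radius
   [str] that all later changes together have to respect. *)
Definition Inv (D : P3 -> Prop) (p0 : P3) (del lo : R) (s : state) : Prop :=
  good (stU s) (stV s) /\ 1 / 2 <= str s < 1 /\ 1 - lo <= str s /\ 0 < ste s /\ ste s <= lo /\ ste s <= del / 8 /\
  inside D (4 * ste s) (surf p0 (stU s) (stV s)) /\
  (forall z, Cmod z = 1 -> depth D (surf p0 (stU s) (stV s) z) <= del) /\
  (forall z, str s <= Cmod z <= 1 -> depth D (surf p0 (stU s) (stV s) z) <= 2 * del) /\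
  (forall U V, adm (str s) (2 * ste s) (stU s) (stV s) U V ->
     forall z, Cmod z <= str s -> sn2 (stU s) (stV s) z / 2 <= sn2 U V z).

(** The halving of tolerances makes later changes summable, the depth bound on the new surface
    outside the old radius will give properness, and the unit barrier between the two radii
    completeness. *)
Definition St (D : P3 -> Prop) (p0 : P3) (m del : R) (s s' : state) : Prop :=
  adm (str s) (ste s) (stU s) (stV s) (stU s') (stV s') /\ ste s' <= ste s / 2 /\ str s <= str s' /\
  (forall z, Cmod z <= 1 -> enorm3 (disp (stU s) (stV s) (stU s') (stV s') z) <= 2 * sqrt (m * del)) /\
  (forall z, str s <= Cmod z <= 1 -> depth D (surf p0 (stU s') (stV s') z) <= 3 * del) /\
  barrier (str s) (str s') 1 (stU s') (stV s').

(** All clauses of [Inv] involving radius and tolerance hold once the radius is close enough to 1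
    and the tolerance small enough for the polynomial disc at hand. *)
Lemma finish_state D p0 U V mu del lo r e : bounded3 D -> good U V -> 0 < mu -> inside D mu (surf p0 U V) ->
  (forall z, Cmod z = 1 -> depth D (surf p0 U V z) <= del) -> 0 < del -> 0 < lo -> r < 1 -> 0 < e ->
  exists s, Inv D p0 del lo s /\ stU s = U /\ stV s = V /\ r <= str s /\ ste s <= e.
Proof.
  intros Hb Hg Hmu Hin Hd Hdel Hlo Hr He.
  destruct (good_min U V Hg) as (m0 & Hm0 & Hmin).
  set (S := pnorm 1 U + pnorm 1 V). assert (HU0 : 0 <= pnorm 1 U) by (apply pnorm_ge0; lra).
  assert (HV0 : 0 <= pnorm 1 V) by (apply pnorm_ge0; lra). assert (HS : 0 <= S) by (unfold S; lra).
  destruct (surf0_radial U V del Hdel) as (rr & Hrr & Hrad).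
  set (r' := Rmax (Rmax r (1 / 2)) (Rmax rr (1 - lo))).
  assert (H1 : r <= r') by (unfold r'; eapply Rle_trans; [|apply Rmax_l]; apply Rmax_l).
  assert (H2 : 1 / 2 <= r') by (unfold r'; eapply Rle_trans; [|apply Rmax_l]; apply Rmax_r).
  assert (H3 : rr <= r') by (unfold r'; eapply Rle_trans; [|apply Rmax_r]; apply Rmax_l).
  assert (H4 : 1 - lo <= r') by (unfold r'; eapply Rle_trans; [|apply Rmax_r]; apply Rmax_r).
  assert (H5 : r' < 1) by (unfold r'; repeat apply Rmax_lub_lt; lra).
  set (e' := Rmin (Rmin (Rmin e lo) (Rmin (del / 8) (mu / 4))) (Rmin (1 / 2) (m0 / (8 * (2 * S + 1))))).
  assert (Hq : 0 < m0 / (8 * (2 * S + 1))) by (apply Rdiv_lt_0_compat; lra).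
  assert (E0 : 0 < e') by (repeat apply Rmin_glb_lt; lra).
  assert (E1 : e' <= Rmin (Rmin e lo) (Rmin (del / 8) (mu / 4))) by apply Rmin_l.
  assert (E2 : e' <= Rmin (1 / 2) (m0 / (8 * (2 * S + 1)))) by apply Rmin_r.
  pose proof (Rmin_l (Rmin e lo) (Rmin (del / 8) (mu / 4))). pose proof (Rmin_r (Rmin e lo) (Rmin (del / 8) (mu / 4))).
  pose proof (Rmin_l e lo). pose proof (Rmin_r e lo). pose proof (Rmin_l (del / 8) (mu / 4)). pose proof (Rmin_r (del / 8) (mu / 4)).
  pose proof (Rmin_l (1 / 2) (m0 / (8 * (2 * S + 1)))). pose proof (Rmin_r (1 / 2) (m0 / (8 * (2 * S + 1)))).
  exists (U, V, r', e'). unfold Inv, stU, stV, str, ste; simpl.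
  split; [|repeat split; lra].
  split; [exact Hg|]. split; [lra|]. split; [exact H4|]. split; [exact E0|]. split; [lra|]. split; [lra|].
  split; [|split; [exact Hd|split]].
  - intros z Hz. destruct (Hin z Hz). split; [assumption|lra].
  - intros z Hz. destruct (polar z) as (rho & w & Hw & Erho & Ez). subst rho.
    specialize (Hrad w (Cmod z) Hw ltac:(lra) ltac:(lra)). rewrite <- Ez in Hrad.
    rewrite <- (surf_sub p0) in Hrad. specialize (Hd w Hw).
    pose proof (depth_lip D (surf p0 U V z) (surf p0 U V w) Hb). lra.
  - intros U' V' Hadm z Hz.
    assert (Hp := sn2_perturb U V U' V' r' (2 * e') S Hadm ltac:(lra) ltac:(lra) ltac:(unfold S; lra) ltac:(unfold S; lra) z Hz).
    apply Rabs_le_between in Hp. specialize (Hmin z ltac:(lra)).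
    assert (2 * (2 * S + 1) * (2 * e') <= m0 / 2); [|lra].
    apply Rle_trans with (2 * (2 * S + 1) * (2 * (m0 / (8 * (2 * S + 1))))); [apply Rmult_le_compat_l; lra|right; field; lra].
Qed.

Lemma barrier_widen r r' r'' l U V : 0 <= r' <= r'' -> barrier r r' l U V -> barrier r r'' l U V.
Proof.
  intros Hr (b & H1 & H2 & H3 & H4 & H5). exists b. do 3 (split; [assumption|]). split; [|exact H5].
  intros x Hx. apply H4. nra.
Qed.

(** The push multiplies the depth bound by [1 - m^2 / 8]; gaining length then moves the disc by at
    most [m^2 del / 16], which leaves the factor [1 - m^2 / 16]. *)
Lemma state_step D m p0 del lo lo' s : open D -> bounded3 D -> 0 < m <= 1 -> (forall q, boundary3 D q -> pinched D q m) ->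
  0 < del -> del <= m / 16 -> 0 < lo' -> Inv D p0 del lo s ->
  exists s', Inv D p0 ((1 - m * m / 16) * del) lo' s' /\ St D p0 m del s s'.
Proof.
  intros Ho Hb Hm Hp Hd Hdm Hlo' (Hg & Hr & Hrlo & He & Helo & Hed & Hin & Hcirc & Hann & Hsn).
  set (U := stU s) in *. set (V := stV s) in *. set (r := str s) in *. set (e := ste s) in *.
  assert (Hsq : 0 < sqrt (m * del)) by (apply sqrt_lt_R0; nra).
  set (ep := Rmin (Rmin (e / 2) (sqrt (m * del) / 2)) (del / 4)).
  assert (Hep : 0 < ep) by (repeat apply Rmin_glb_lt; lra).
  assert (Hep1 : ep <= e / 2) by (unfold ep; eapply Rle_trans; [apply Rmin_l|apply Rmin_l]).
  assert (Hep2 : ep <= sqrt (m * del) / 2) by (unfold ep; eapply Rle_trans; [apply Rmin_l|apply Rmin_r]).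
  assert (Hep3 : ep <= del / 4) by apply Rmin_r.
  destruct (push_lemma D m p0 U V (4 * e) del (2 * del) r ep Ho Hb Hm Hp Hg ltac:(lra) Hin Hcirc Hdm ltac:(lra) Hann ltac:(lra) Hep)
    as (U1 & V1 & mu1 & Hg1 & Hadm1 & Hmu1 & Hin1 & Hcirc1 & Hdisp1 & Hann1).
  assert (Hmm : 0 < m * m * del) by (apply Rmult_lt_0_compat; nra).
  set (ec := Rmin (Rmin ep (mu1 / 2)) (m * m * del / 16)).
  assert (Hec : 0 < ec) by (repeat apply Rmin_glb_lt; lra).
  assert (Hec1 : ec <= ep) by (unfold ec; eapply Rle_trans; [apply Rmin_l|apply Rmin_l]).
  assert (Hec2 : ec <= mu1 / 2) by (unfold ec; eapply Rle_trans; [apply Rmin_l|apply Rmin_r]).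
  assert (Hec3 : ec <= m * m * del / 16) by apply Rmin_r.
  destruct (completeness_lemma U1 V1 r ec Hg1 Hr Hec) as (U2 & V2 & r2 & Hg2 & Hadm2 & Hr2 & Hbar & Hdisp2).
  set (f1 := surf p0 U1 V1) in *. set (f2 := surf p0 U2 V2).
  assert (Hc : forall z, Cmod z <= 1 -> enorm3 (sub3 (f2 z) (f1 z)) <= ec).
  { intros z Hz. unfold f2, f1. rewrite surf_sub. now apply Hdisp2. }
  assert (Hin2 : inside D (mu1 / 2) f2).
  { intros z Hz. destruct (Hin1 z Hz) as [HD1 Hdd]. specialize (Hc z Hz). rewrite enorm3_sym in Hc. split.
    - apply (depth_in D (f1 z)); [exact Hb|lra].
    - pose proof (depth_lip D (f1 z) (f2 z) Hb). lra. }
  assert (Hm2 : m * m <= 1) by nra.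
  destruct (finish_state D p0 U2 V2 (mu1 / 2) ((1 - m * m / 16) * del) lo' r2 (e / 2) Hb Hg2 ltac:(lra) Hin2)
    as (s' & Hinv & EU & EV & Hrs & Hes); try lra.
  { intros z Hz. specialize (Hcirc1 z Hz). specialize (Hc z ltac:(lra)).
    pose proof (depth_lip D (f2 z) (f1 z) Hb). fold f2. lra. }
  { apply Rmult_lt_0_compat; lra. }
  exists s'. split; [exact Hinv|]. unfold St. rewrite EU, EV. fold U V r e.
  split; [|split; [exact Hes|split; [lra|split; [|split]]]].
  - apply (adm_weaken r r (ep + ec)); [lra|lra|]. apply (adm_trans r ep ec U V U1 V1); [lra|assumption|assumption].
  - intros z Hz. specialize (Hdisp1 z Hz). specialize (Hdisp2 z Hz).
    replace (disp U V U2 V2 z) with (add3 (disp U1 V1 U2 V2 z) (disp U V U1 V1 z)) by (unfold disp; veq).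
    eapply Rle_trans; [apply enorm3_tri|]. lra.
  - intros z Hz. specialize (Hann1 z Hz). specialize (Hc z ltac:(lra)). fold f1 in Hann1. fold f2.
    pose proof (depth_lip D (f2 z) (f1 z) Hb). lra.
  - apply (barrier_widen r r2); [lra|exact Hbar].
Qed.

(** Dependent choice: the next state is picked by [epsilon], and the invariant that makes the pick
    legitimate is proved along the recursion. *)
Lemma state_sequence D m p0 del0 s0 : open D -> bounded3 D -> 0 < m <= 1 -> (forall q, boundary3 D q -> pinched D q m) ->
  0 < del0 -> del0 <= m / 16 -> Inv D p0 del0 1 s0 ->
  exists sq : nat -> state, sq 0%nat = s0 /\
    forall n, let del := del0 * (1 - m * m / 16) ^ n in
      Inv D p0 del (/ 2 ^ n) (sq n) /\ St D p0 m del (sq n) (sq (S n)).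
Proof.
  intros Ho Hb Hm Hp Hd Hdm H0.
  set (kap := 1 - m * m / 16). assert (Hmm : 0 < m * m <= 1) by nra.
  assert (Hkap : 0 < kap <= 1) by (unfold kap; lra).
  set (P := fun n s s' => Inv D p0 (del0 * kap ^ S n) (/ 2 ^ S n) s' /\ St D p0 m (del0 * kap ^ n) s s').
  set (nxt := fun n s => epsilon (inhabits s0) (P n s)).
  set (sq := fix sq (n : nat) : state := match n with O => s0 | S n' => nxt n' (sq n') end).
  exists sq. split; [reflexivity|].
  assert (Hk : forall n, 0 < del0 * kap ^ n <= m / 16).
  { intros n. assert (0 < kap ^ n) by (apply pow_lt; lra).
    assert (kap ^ n <= 1) by (rewrite <- (pow1 n); apply pow_incr; lra). split; [nra|nra]. }
  assert (Hstep : forall n, Inv D p0 (del0 * kap ^ n) (/ 2 ^ n) (sq n) -> P n (sq n) (sq (S n))).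
  { intros n Hn. change (sq (S n)) with (nxt n (sq n)). unfold nxt. apply epsilon_spec.
    assert (H2 : 0 < / 2 ^ S n) by (apply Rinv_0_lt_compat, pow_lt; lra).
    destruct (state_step D m p0 (del0 * kap ^ n) (/ 2 ^ n) (/ 2 ^ S n) (sq n) Ho Hb Hm Hp (proj1 (Hk n)) (proj2 (Hk n)) H2 Hn)
      as (s' & K1 & K2).
    exists s'. split; [|exact K2]. replace (del0 * kap ^ S n) with ((1 - m * m / 16) * (del0 * kap ^ n)); [exact K1|].
    simpl. fold kap. ring. }
  assert (Hall : forall n, Inv D p0 (del0 * kap ^ n) (/ 2 ^ n) (sq n)).
  { induction n as [|n IH].
    - simpl. rewrite Rmult_1_r, Rinv_1. exact H0.
    - apply Hstep, IH. }
  intros n. cbv zeta. split; [apply Hall|]. apply Hstep, Hall.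
Qed.

(** As [ste] at least halves, [ste (sq k) <= 2 * ste (sq k) - 2 * ste (sq (S k))], so the tolerances
    telescope. *)
Lemma adm_chain D m p0 del0 (sq : nat -> state) kap :
  (forall n, Inv D p0 (del0 * kap ^ n) (/ 2 ^ n) (sq n) /\ St D p0 m (del0 * kap ^ n) (sq n) (sq (S n))) ->
  forall n k, (n <= k)%nat -> str (sq n) <= str (sq k) /\
    adm (str (sq n)) (2 * ste (sq n) - 2 * ste (sq k)) (stU (sq n)) (stV (sq n)) (stU (sq k)) (stV (sq k)).
Proof.
  intros H n k Hk. induction Hk as [|k Hk IH].
  - split; [lra|]. apply adm_refl. lra.
  - destruct IH as [IH1 IH2]. destruct (H k) as [_ (S1 & S2 & S3 & _)]. destruct (H n) as [(_ & Hr & _) _].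
    split; [lra|].
    apply (adm_weaken (str (sq n)) (str (sq n)) (2 * ste (sq n) - 2 * ste (sq k) + ste (sq k))); [lra|lra|].
    apply (adm_trans _ _ _ _ _ (stU (sq k)) (stV (sq k))); [lra|exact IH2|].
    apply (adm_weaken (str (sq k)) _ (ste (sq k))); [lra|lra|exact S1].
Qed.

(** * Limits of holomorphic functions *)

Lemma half_pow_small A t : 0 < t -> exists n0, forall n, (n0 <= n)%nat -> A * / 2 ^ n <= t.
Proof.
  intros Ht. destruct (INR_unbounded (A / t)) as [n0 Hn0]. exists n0. intros n Hn.
  assert (H2 : INR n <= 2 ^ n) by (clear; induction n as [|n IH]; [simpl; lra|]; rewrite S_INR; simpl; assert (1 <= 2 ^ n) by (apply pow_R1_Rle; lra); lra).
  apply le_INR in Hn. assert (Hp : 0 < 2 ^ n) by (apply pow_lt; lra).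
  apply Rmult_le_reg_r with (2 ^ n); [lra|]. rewrite Rmult_assoc, Rinv_l, Rmult_1_r by lra.
  assert (A / t <= 2 ^ n) by lra.
  apply (Rmult_le_compat_r t) in H; [|lra]. unfold Rdiv in H. rewrite Rmult_assoc, Rinv_l in H; lra.
Qed.

Definition Clim (a : nat -> C) : C :=
  (real (Lim_seq (fun k => fst (a k))), real (Lim_seq (fun k => snd (a k)))).

Lemma geo_telescope (a : nat -> C) A n0 : (forall k, (n0 <= k)%nat -> Cmod (a (S k) - a k) <= A * / 2 ^ k) ->
  forall k j, (n0 <= k)%nat -> (k <= j)%nat -> Cmod (a j - a k) <= 2 * A * / 2 ^ k - 2 * A * / 2 ^ j.
Proof.
  intros H k j Hk Hj. induction Hj as [|j Hj IH].
  - replace (a k - a k)%C with (RtoC 0) by ring. rewrite Cmod_0. lra.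
  - eapply Rle_trans; [apply (Cmod_sub_tri _ (a j))|]. specialize (H j ltac:(lia)).
    simpl pow. assert (Hp : 0 < 2 ^ j) by (apply pow_lt; lra).
    replace (2 * A * / (2 * 2 ^ j)) with (A * / 2 ^ j) by (field; lra). lra.
Qed.

Lemma Clim_geo (a : nat -> C) A n0 : 0 <= A -> (forall k, (n0 <= k)%nat -> Cmod (a (S k) - a k) <= A * / 2 ^ k) ->
  forall k, (n0 <= k)%nat -> Cmod (Clim a - a k) <= 4 * A * / 2 ^ k.
Proof.
  intros HA H.
  assert (T := geo_telescope a A n0 H).
  assert (T' : forall k j, (n0 <= k)%nat -> (k <= j)%nat -> Cmod (a j - a k) <= 2 * A * / 2 ^ k).
  { intros k j Hk Hj. specialize (T k j Hk Hj). assert (0 < / 2 ^ j) by (apply Rinv_0_lt_compat, pow_lt; lra). nra. }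
  assert (Comp : forall p : C -> R, (forall x y, Rabs (p x - p y) <= Cmod (x - y)) ->
     forall k, (n0 <= k)%nat -> Rabs (real (Lim_seq (fun k => p (a k))) - p (a k)) <= 2 * A * / 2 ^ k).
  { intros p Hp.
    assert (Hex : ex_finite_lim_seq (fun k => p (a k))).
    { apply ex_lim_seq_cauchy_corr. intros eps. destruct (half_pow_small (2 * A) (eps / 4)) as [n1 Hn1]; [pose proof (cond_pos eps); lra|].
      exists (Nat.max n0 n1). intros n k Hn Hk. pose proof (cond_pos eps).
      assert (K : forall i, (Nat.max n0 n1 <= i)%nat -> Rabs (p (a i) - p (a (Nat.max n0 n1))) <= eps / 4).
      { intros i Hi. eapply Rle_trans; [apply Hp|]. eapply Rle_trans; [apply T'; lia|]. apply Hn1; lia. }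
      assert (K1 := K n Hn). assert (K2 := K k Hk). apply Rabs_le_between in K1, K2. apply Rabs_lt_between. lra. }
    apply Lim_seq_correct' in Hex. intros k Hk.
    assert (L : is_lim_seq (fun j => p (a j) - p (a k)) (real (Lim_seq (fun k => p (a k))) - p (a k))).
    { apply is_lim_seq_minus'; [exact Hex|apply is_lim_seq_const]. }
    apply is_lim_seq_abs in L. simpl in L.
    assert (Hle : Rbar_le (Finite (Rabs (real (Lim_seq (fun k => p (a k))) - p (a k)))) (Finite (2 * A * / 2 ^ k))).
    { apply (is_lim_seq_le_loc (fun j => Rabs (p (a j) - p (a k))) (fun _ => 2 * A * / 2 ^ k)); [|exact L|apply is_lim_seq_const].
      exists k. intros j Hj. eapply Rle_trans; [apply Hp|]. now apply T'. }
    exact Hle. }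
  intros k Hk.
  assert (K1 := Comp fst (fun x y => Cmod_ge_abs_re (x - y)%C) k Hk).
  assert (K2 := Comp snd (fun x y => Cmod_ge_abs_im (x - y)%C) k Hk).
  eapply Rle_trans; [apply Cmod_le_sum|]. unfold Clim. simpl. unfold Rminus in *. lra.
Qed.

(** The starting index depends on [rho] because step [k] is controlled only on a disc whose radius
    tends to 1. *)
Definition locgeo (F : nat -> C -> C) : Prop := forall rho, rho < 1 -> exists A n0, 0 <= A /\
  forall k, (n0 <= k)%nat -> forall z, Cmod z <= rho -> Cmod (F (S k) z - F k z) <= A * / 2 ^ k.

Definition Climf (F : nat -> C -> C) (z : C) : C := Clim (fun k => F k z).

Lemma Climf_unif F rho : locgeo F -> rho < 1 -> exists A n0, 0 <= A /\
  forall k, (n0 <= k)%nat -> forall z, Cmod z <= rho -> Cmod (Climf F z - F k z) <= A * / 2 ^ k.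
Proof.
  intros HF Hr. destruct (HF rho Hr) as (A & n0 & HA & H). exists (4 * A), n0. split; [lra|].
  intros k Hk z Hz. apply (Clim_geo (fun k => F k z) A n0); auto.
Qed.

Lemma Climf_close F eps z : locgeo F -> Cmod z < 1 -> 0 < eps ->
  exists n0, forall k, (n0 <= k)%nat -> Cmod (Climf F z - F k z) <= eps.
Proof.
  intros HF Hz He. destruct (Climf_unif F (Cmod z) HF Hz) as (A & n0 & HA & H).
  destruct (half_pow_small A eps He) as [n1 Hn1]. exists (Nat.max n0 n1). intros k Hk.
  eapply Rle_trans; [apply H; [lia|lra]|]. apply Hn1; lia.
Qed.

(** Since [F j - F n] has the uniformly small derivative [G j - G n], it is Lipschitz with a small
    constant. This survives [j -> oo], and the differentiability of the single function [F n] does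
    the rest. *)
Lemma Climf_CD (F G : nat -> C -> C) : (forall k z, CD (F k) z (G k z)) -> locgeo F -> locgeo G ->
  forall z, Cmod z < 1 -> CD (Climf F) z (Climf G z).
Proof.
  intros HD HF HG z Hz e He. set (rho := (1 + Cmod z) / 2).
  destruct (HG rho ltac:(unfold rho; lra)) as (A & n0 & HA & HA').
  destruct (half_pow_small (4 * A) (e / 4)) as [n1 Hn1]; [lra|].
  set (n := Nat.max n0 n1).
  destruct (HD n z (e / 4)) as (d & Hd & Hdn); [lra|].
  exists (Rmin d ((1 - Cmod z) / 2)). split; [apply Rmin_glb_lt; lra|]. intros w Hw.
  pose proof (Rmin_l d ((1 - Cmod z) / 2)). pose proof (Rmin_r d ((1 - Cmod z) / 2)).
  specialize (Hdn w ltac:(lra)). pose proof (Cmod_ge_0 (w - z)) as Hwz.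
  assert (Hseg : forall t, 0 <= t <= 1 -> Cmod (z + RtoC t * (w - z)) <= rho).
  { intros t Ht. eapply Rle_trans; [apply Cmod_triangle|]. rewrite Cmod_mult, Cmod_R, Rabs_right by lra. unfold rho. nra. }
  assert (Hw1 : Cmod w <= rho).
  { specialize (Hseg 1 ltac:(lra)). replace (z + 1 * (w - z))%C with w in Hseg by ring. exact Hseg. }
  assert (Hz1 : Cmod z <= rho) by (unfold rho; lra).
  assert (HGn : forall x, Cmod x <= rho -> Cmod (Climf G x - G n x) <= e / 4).
  { intros x Hx. eapply Rle_trans; [apply (Clim_geo (fun k => G k x) A n0 HA); [intros; now apply HA'|unfold n; lia]|]. apply Hn1; unfold n; lia. }
  assert (HGj : forall j, (n <= j)%nat -> forall x, Cmod x <= rho -> Cmod (G j x - G n x) <= e / 4).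
  { intros j Hj x Hx.
    eapply Rle_trans; [apply (geo_telescope (fun k => G k x) A n0); [intros; now apply HA'|unfold n; lia|exact Hj]|].
    assert (0 < / 2 ^ j) by (apply Rinv_0_lt_compat, pow_lt; lra).
    assert (0 < / 2 ^ n) by (apply Rinv_0_lt_compat, pow_lt; lra).
    assert (4 * A * / 2 ^ n <= e / 4) by (apply Hn1; unfold n; lia). nra. }
  assert (Hmv : forall j, (n <= j)%nat -> Cmod ((F j w - F n w) - (F j z - F n z)) <= e / 4 * Cmod (w - z)).
  { intros j Hj. apply (Cmod_mean_value (fun x => F j x - F n x)%C (fun x => G j x - G n x)%C z w).
    - intros t Ht. apply CD_minus; apply HD.
    - intros t Ht. apply HGj; auto. }
  assert (Hfirst : Cmod ((Climf F w - F n w) - (Climf F z - F n z)) <= e / 4 * Cmod (w - z)).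
  { apply Rnot_lt_le. intros Hlt.
    set (gap := Cmod (Climf F w - F n w - (Climf F z - F n z)) - e / 4 * Cmod (w - z)) in *.
    assert (Hgap : 0 < gap) by (unfold gap; lra).
    destruct (Climf_close F (gap / 4) w HF) as [k1 Hk1]; [unfold rho in Hw1; lra|lra|].
    destruct (Climf_close F (gap / 4) z HF Hz) as [k2 Hk2]; [lra|].
    set (j := Nat.max n (Nat.max k1 k2)).
    assert (M := Hmv j ltac:(unfold j; lia)). specialize (Hk1 j ltac:(unfold j; lia)). specialize (Hk2 j ltac:(unfold j; lia)).
    assert (Cmod (Climf F w - F n w - (Climf F z - F n z)) <= gap / 4 + gap / 4 + e / 4 * Cmod (w - z)).
    { replace (Climf F w - F n w - (Climf F z - F n z))%C with
        ((Climf F w - F j w) + (- (Climf F z - F j z) + ((F j w - F n w) - (F j z - F n z))))%C by ring.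
      eapply Rle_trans; [apply Cmod_triangle|]. eapply Rle_trans; [apply Rplus_le_compat_l, Cmod_triangle|].
      rewrite Cmod_opp. lra. }
    unfold gap in *. lra. }
  replace (Climf F w - Climf F z - Climf G z * (w - z))%C with
    (((Climf F w - F n w) - (Climf F z - F n z)) + ((F n w - F n z - G n z * (w - z)) + - ((Climf G z - G n z) * (w - z))))%C by ring.
  eapply Rle_trans; [apply Cmod_triangle|]. eapply Rle_trans; [apply Rplus_le_compat_l, Cmod_triangle|].
  rewrite Cmod_opp, Cmod_mult. specialize (HGn z Hz1). nra.
Qed.

(** An explicit chain of [k] complex derivatives on the open disc, the last one continuous; it
    mirrors the recursion of [CkOn]. *)
Fixpoint Hol (k : nat) (f : C -> C) : Prop :=
  match k with
  | O => forall z, Cmod z < 1 -> forall eps, 0 < eps -> exists del, 0 < del /\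
           forall w, Cmod (w - z) < del -> Cmod (f w - f z) < eps
  | S k' => exists g, (forall z, Cmod z < 1 -> CD f z (g z)) /\ Hol k' g
  end.

Lemma Hol_cont k f : Hol k f -> Hol 0 f.
Proof.
  destruct k; [tauto|]. intros (g & Hg & _) z Hz. eapply CD_cont, Hg, Hz.
Qed.

Lemma Hol_pred k f : Hol (S k) f -> Hol k f.
Proof.
  revert f; induction k as [|k IH]; intros f H.
  - exact (Hol_cont 1 f H).
  - destruct H as (g & Hg & Hk). exists g. split; [exact Hg|]. now apply IH.
Qed.

Lemma Hol_plus k f g : Hol k f -> Hol k g -> Hol k (fun z => f z + g z)%C.
Proof.
  revert f g; induction k as [|k IH]; intros f g Hf Hg.
  - intros z Hz e He. destruct (Hf z Hz (e / 2)) as (d1 & Hd1 & H1); [lra|]. destruct (Hg z Hz (e / 2)) as (d2 & Hd2 & H2); [lra|].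
    exists (Rmin d1 d2). split; [now apply Rmin_glb_lt|]. intros w Hw. pose proof (Rmin_l d1 d2). pose proof (Rmin_r d1 d2).
    specialize (H1 w ltac:(lra)). specialize (H2 w ltac:(lra)).
    replace (f w + g w - (f z + g z))%C with ((f w - f z) + (g w - g z))%C by ring. eapply Rle_lt_trans; [apply Cmod_triangle|]; lra.
  - destruct Hf as (f' & Hf & Hf'). destruct Hg as (g' & Hg & Hg'). exists (fun z => f' z + g' z)%C.
    split; [intros; apply CD_plus; auto|]. now apply IH.
Qed.

Lemma Hol_const k c : Hol k (fun _ => c).
Proof.
  revert c; induction k as [|k IH]; intros c.
  - intros z _ e He. exists 1. split; [lra|]. intros. replace (c - c)%C with (RtoC 0) by ring. rewrite Cmod_0; exact He.
  - exists (fun _ => RtoC 0). split; [intros; apply CD_const|apply IH].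
Qed.

Lemma Hol_mult k f g : Hol k f -> Hol k g -> Hol k (fun z => f z * g z)%C.
Proof.
  revert f g; induction k as [|k IH]; intros f g Hf Hg.
  - intros z Hz e He. pose proof (Cmod_ge_0 (f z)). pose proof (Cmod_ge_0 (g z)).
    set (M := Cmod (f z) + Cmod (g z) + 1).
    set (e1 := Rmin 1 (e / (2 * M))). assert (HM : 0 < M) by (unfold M; lra).
    assert (He1 : 0 < e1) by (apply Rmin_glb_lt; [lra|apply Rdiv_lt_0_compat; lra]).
    assert (He1a : e1 <= 1) by apply Rmin_l.
    assert (He1b : e1 * M <= e / 2).
    { apply Rle_trans with (e / (2 * M) * M); [apply Rmult_le_compat_r; [lra|apply Rmin_r]|right; field; lra]. }
    destruct (Hf z Hz e1 He1) as (d1 & Hd1 & H1). destruct (Hg z Hz e1 He1) as (d2 & Hd2 & H2).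
    exists (Rmin d1 d2). split; [now apply Rmin_glb_lt|]. intros w Hw. pose proof (Rmin_l d1 d2). pose proof (Rmin_r d1 d2).
    specialize (H1 w ltac:(lra)). specialize (H2 w ltac:(lra)).
    replace (f w * g w - f z * g z)%C with ((f w - f z) * (g w - g z) + ((f w - f z) * g z + f z * (g w - g z)))%C by ring.
    eapply Rle_lt_trans; [apply Cmod_triangle|]. eapply Rle_lt_trans; [apply Rplus_le_compat_l, Cmod_triangle|]. rewrite !Cmod_mult.
    pose proof (Cmod_ge_0 (f w - f z)). pose proof (Cmod_ge_0 (g w - g z)).
    assert (Cmod (f w - f z) * Cmod (g w - g z) <= e1 * 1) by (apply Rmult_le_compat; lra).
    assert (Cmod (f w - f z) * Cmod (g z) <= e1 * Cmod (g z)) by (apply Rmult_le_compat_r; lra).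
    assert (Cmod (f z) * Cmod (g w - g z) <= Cmod (f z) * e1) by (apply Rmult_le_compat_l; lra).
    unfold M in He1b. lra.
  - assert (Hf0 := Hol_pred _ _ Hf). assert (Hg0 := Hol_pred _ _ Hg).
    destruct Hf as (f' & Hf & Hf'). destruct Hg as (g' & Hg & Hg'). exists (fun z => f' z * g z + f z * g' z)%C.
    split; [intros; apply CD_mult; auto|]. apply Hol_plus; apply IH; assumption.
Qed.

(** [T i] plays the sequence of [i]-th derivatives, so the limit of [T (S i)] is the derivative of
    the limit of [T i]. *)
Lemma Hol_Climf (T : nat -> nat -> C -> C) : (forall i k z, CD (T i k) z (T (S i) k z)) -> (forall i, locgeo (T i)) ->
  forall j i, Hol j (Climf (T i)).
Proof.
  intros HD HL j. induction j as [|j IH]; intros i.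
  - intros z Hz. eapply CD_cont, (Climf_CD (T i) (T (S i))); auto.
  - exists (Climf (T (S i))). split; [|apply IH]. intros z Hz. apply Climf_CD; auto.
Qed.

(** * Derivatives, products and primitives of convergent polynomial sequences *)

Lemma padd_comm l m : padd l m = padd m l.
Proof.
  revert m; induction l as [|a l IH]; intros [|b m]; simpl; try reflexivity. rewrite IH. f_equal. ring.
Qed.

Lemma pder_padd l m : pder (padd l m) = padd (pder l) (pder m).
Proof.
  revert m; induction l as [|a l IH]; intros [|b m]; simpl; try reflexivity.
  - destruct (padd l (RtoC 0 :: pder l)); reflexivity.
  - rewrite IH.
    replace (RtoC 0 :: padd (pder l) (pder m)) with (padd (RtoC 0 :: pder l) (RtoC 0 :: pder m))
      by (simpl; f_equal; ring).
    rewrite !padd_assoc. f_equal. rewrite <- !padd_assoc. f_equal. apply padd_comm.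
Qed.

Definition pders (i : nat) (l : list C) : list C := Nat.iter i pder l.

Lemma pders_padd i l m : pders i (padd l m) = padd (pders i l) (pders i m).
Proof. induction i as [|i IH]; simpl; [reflexivity|]. unfold pders in *. simpl. rewrite IH. apply pder_padd. Qed.

(** Iterated Cauchy estimates, half of the available gap being spent on each derivative. *)
Lemma pnorm_pders i : forall r1 r2, 0 <= r1 < r2 -> exists K, 0 <= K /\ forall l, pnorm r1 (pders i l) <= K * pnorm r2 l.
Proof.
  induction i as [|i IH]; intros r1 r2 Hr.
  - exists 1. split; [lra|]. intros l. simpl. pose proof (pnorm_mono r1 r2 l ltac:(lra)). lra.
  - set (rm := (r1 + r2) / 2). destruct (IH rm r2 ltac:(unfold rm; lra)) as (K & HK & H).
    assert (Hi : 0 < / (rm - r1)) by (apply Rinv_0_lt_compat; unfold rm; lra).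
    exists (K * / (rm - r1)). split; [nra|]. intros l.
    change (pders (S i) l) with (pder (pders i l)).
    eapply Rle_trans; [apply (pnorm_pder r1 rm); unfold rm; lra|]. unfold Rdiv.
    specialize (H l). apply Rle_trans with (K * pnorm r2 l * / (rm - r1)); [apply Rmult_le_compat_r; lra|right; ring].
Qed.

(** From some index on [r k] exceeds a radius [r2] strictly between [rho] and 1, and the Cauchy
    constant for passing from [r2] down does not depend on [k]. *)
Lemma locgeo_poly (L A : nat -> list C) (r : nat -> R) i :
  (forall k, L (S k) = padd (L k) (A k)) -> (forall k, 1 - / 2 ^ k <= r k) -> (forall k, pnorm (r k) (A k) <= / 2 ^ k) ->
  locgeo (fun k => peval (pders i (L k))).
Proof.
  intros HL Hr HA rho Hrho. set (r1 := Rmax 0 rho). assert (Hr1 : 0 <= r1) by apply Rmax_l.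
  assert (Hr1' : rho <= r1) by apply Rmax_r. assert (Hr11 : r1 < 1) by (apply Rmax_lub_lt; lra).
  set (r2 := (r1 + 1) / 2).
  destruct (pnorm_pders i r1 r2 ltac:(unfold r2; lra)) as (K & HK & H).
  destruct (half_pow_small 1 (1 - r2)) as [n0 Hn0]; [unfold r2; lra|].
  exists K, n0. split; [exact HK|]. intros k Hk z Hz.
  rewrite HL, pders_padd, peval_padd.
  replace (peval (pders i (L k)) z + peval (pders i (A k)) z - peval (pders i (L k)) z)%C with (peval (pders i (A k)) z) by ring.
  eapply Rle_trans; [apply (peval_le r1); lra|]. eapply Rle_trans; [apply H|].
  apply Rmult_le_compat_l; [exact HK|]. eapply Rle_trans; [|apply (HA k)]. apply pnorm_mono.
  specialize (Hn0 k Hk). specialize (Hr k). unfold r2 in *. lra.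
Qed.

Lemma locgeo_mult F G : locgeo F -> locgeo G ->
  (forall k rho, rho < 1 -> exists M, forall z, Cmod z <= rho -> Cmod (F k z) <= M) ->
  (forall k rho, rho < 1 -> exists M, forall z, Cmod z <= rho -> Cmod (G k z) <= M) ->
  locgeo (fun k z => F k z * G k z)%C.
Proof.
  intros HF HG BF BG rho Hr.
  assert (Bd : forall F, locgeo F -> (forall k rho, rho < 1 -> exists M, forall z, Cmod z <= rho -> Cmod (F k z) <= M) ->
     exists M n0, 0 <= M /\ forall k, (n0 <= k)%nat -> forall z, Cmod z <= rho -> Cmod (F k z) <= M).
  { clear F G HF HG BF BG. intros F HF BF. destruct (HF rho Hr) as (A & n0 & HA & H). destruct (BF n0 rho Hr) as [M HM].
    exists (Rmax 0 M + 2 * A), n0. split; [pose proof (Rmax_l 0 M); lra|]. intros k Hk z Hz.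
    assert (T := geo_telescope (fun k => F k z) A n0 (fun k Hk => H k Hk z Hz) n0 k (le_n _) Hk). simpl in T.
    assert (0 < / 2 ^ k) by (apply Rinv_0_lt_compat, pow_lt; lra).
    assert (Hp : 1 <= 2 ^ n0) by (apply pow_R1_Rle; lra).
    assert (/ 2 ^ n0 <= 1) by (rewrite <- Rinv_1; apply Rinv_le_contravar; lra).
    replace (F k z) with ((F k z - F n0 z) + F n0 z)%C by ring. eapply Rle_trans; [apply Cmod_triangle|].
    specialize (HM z Hz). pose proof (Rmax_r 0 M). assert (2 * A * / 2 ^ n0 <= 2 * A) by nra.
    assert (0 <= 2 * A * / 2 ^ k) by nra. lra. }
  destruct (Bd F HF BF) as (MF & n1 & HMF & KF). destruct (Bd G HG BG) as (MG & n2 & HMG & KG).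
  destruct (HF rho Hr) as (A & n3 & HA & HA'). destruct (HG rho Hr) as (B & n4 & HB & HB').
  exists (A * MG + MF * B), (Nat.max (Nat.max n1 n2) (Nat.max n3 n4)). split; [nra|]. intros k Hk z Hz.
  replace (F (S k) z * G (S k) z - F k z * G k z)%C with ((F (S k) z - F k z) * G (S k) z + F k z * (G (S k) z - G k z))%C by ring.
  eapply Rle_trans; [apply Cmod_triangle|]. rewrite !Cmod_mult.
  specialize (HA' k ltac:(lia) z Hz). specialize (HB' k ltac:(lia) z Hz). assert (K1 := KF k ltac:(lia) z Hz). assert (K2 := KG (S k) ltac:(lia) z Hz).
  pose proof (Cmod_ge_0 (F (S k) z - F k z)). pose proof (Cmod_ge_0 (G (S k) z - G k z)).
  pose proof (Cmod_ge_0 (F k z)). pose proof (Cmod_ge_0 (G (S k) z)).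
  assert (Cmod (F (S k) z - F k z) * Cmod (G (S k) z) <= A * / 2 ^ k * MG) by (apply Rmult_le_compat; lra).
  assert (Cmod (F k z) * Cmod (G (S k) z - G k z) <= MF * (B * / 2 ^ k)) by (apply Rmult_le_compat; lra). lra.
Qed.

(* Local geometric convergence of derivatives integrates up from the common value at 0. *)
Lemma locgeo_primitive F G : (forall k z, CD (F k) z (G k z)) -> (forall k, F k 0%C = 0%C) -> locgeo G -> locgeo F.
Proof.
  intros HD H0 HG rho Hr. destruct (HG (Rmax 0 rho)) as (A & n0 & HA & H); [apply Rmax_lub_lt; lra|].
  exists A, n0. split; [exact HA|]. intros k Hk z Hz.
  assert (Hi : 0 < / 2 ^ k) by (apply Rinv_0_lt_compat, pow_lt; lra).
  assert (M := Cmod_mean_value (fun x => F (S k) x - F k x)%C (fun x => G (S k) x - G k x)%C 0 z (A * / 2 ^ k)).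
  simpl in M. rewrite !H0 in M. replace (F (S k) z - F k z - (0 - 0))%C with (F (S k) z - F k z)%C in M by ring.
  replace (z - 0)%C with z in M by ring.
  pose proof (Cmod_ge_0 z). pose proof (Rmax_l 0 rho). pose proof (Rmax_r 0 rho).
  apply Rle_trans with (A * / 2 ^ k * Cmod z).
  - apply M.
    + intros t _. apply CD_minus; apply HD.
    + intros t Ht. apply H; [exact Hk|]. replace (0 + t * z)%C with (t * z)%C by ring.
      rewrite Cmod_mult, Cmod_R, Rabs_right by lra. nra.
  - assert (0 <= A * / 2 ^ k) by nra. nra.
Qed.

(** * Weierstrass data *)

Lemma Disk_Cmod (p : R * R) : Disk p <-> Cmod p < 1.
Proof.
  unfold Disk. pose proof (Cmod_ge_0 p). assert (E := Cmod_sq p). split; intros H1; nra.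
Qed.

Lemma locally2_intro (x : R * R) (P : R * R -> Prop) eps :
  0 < eps -> (forall y : R * R, Cmod (y - x)%C < eps -> P y) -> locally x P.
Proof.
  intros He H. assert (He4 : 0 < eps / 4) by lra.
  exists (mkposreal _ He4). intros y Hy. apply H.
  destruct x as [a b], y as [a' b'].
  destruct Hy as [H1 H2]; simpl in *.
  unfold ball in H1, H2; simpl in H1, H2; unfold AbsRing_ball, abs, minus, plus, opp in *; simpl in *.
  eapply Rle_lt_trans; [apply Cmod_le_sum|]. simpl. lra.
Qed.

Lemma locally2_elim (x : R * R) (P : R * R -> Prop) :
  locally x P -> exists eps, 0 < eps /\ forall y : R * R, Cmod (y - x)%C < eps -> P y.
Proof.
  intros [[e He] H]; exists e; split; [exact He|].
  intros y Hy; apply H.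
  pose proof (Cmod_ge_abs_re (y - x)%C); pose proof (Cmod_ge_abs_im (y - x)%C).
  destruct x as [a b], y as [a' b']. simpl in *.
  repeat split; simpl; unfold ball; simpl; unfold AbsRing_ball, abs, minus, plus, opp; simpl; lra.
Qed.

Lemma Disk_open p : Disk p -> exists d, 0 < d /\ forall w : R * R, Cmod (w - p)%C < d -> Disk w.
Proof.
  intros Hp. apply Disk_Cmod in Hp. exists (1 - Cmod p). split; [lra|]. intros w Hw. apply Disk_Cmod.
  pose proof (Cmod_diff w p) as T. apply Rabs_le_between in T. lra.
Qed.

Lemma plus_scal2 (p v : R * R) (t : R) : plus p (scal t v) = (p + RtoC t * v)%C.
Proof. destruct p as [a b], v as [x y]. apply C_eq; simpl; unfold plus, scal; simpl; unfold mult; simpl; ring. Qed.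

Lemma Disk_line p (v : R * R) : Disk p -> exists d : posreal, forall t, Rabs t < d -> Disk (plus p (scal t v)).
Proof.
  intros Hp. destruct (Disk_open p Hp) as (d & Hd & H). pose proof (Cmod_ge_0 v).
  assert (Hdd : 0 < d / (Cmod v + 1)) by (apply Rdiv_lt_0_compat; lra).
  exists (mkposreal _ Hdd). intros t Ht; simpl in Ht. apply H. rewrite plus_scal2.
  replace (p + t * v - p)%C with (t * v)%C by ring. rewrite Cmod_mult, Cmod_R.
  apply Rle_lt_trans with (Rabs t * (Cmod v + 1)); [apply Rmult_le_compat_l; [apply Rabs_pos|lra]|].
  apply Rlt_le_trans with (d / (Cmod v + 1) * (Cmod v + 1)); [apply Rmult_lt_compat_r; lra|right; field; lra].
Qed.

Lemma locally_0_abs (d : posreal) (P : R -> Prop) : (forall t, Rabs t < d -> P t) -> locally 0 P.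
Proof.
  intros H. exists d. intros t Ht. apply H.
  unfold ball in Ht; simpl in Ht; unfold AbsRing_ball, abs, minus, plus, opp in Ht; simpl in Ht.
  rewrite Ropp_0, Rplus_0_r in Ht. exact Ht.
Qed.

Lemma dderiv_ext_disk (f g : R * R -> R) v p : (forall q, Disk q -> f q = g q) -> Disk p -> dderiv f v p = dderiv g v p.
Proof.
  intros E Hp. destruct (Disk_line p v Hp) as [d Hd]. apply Derive_ext_loc.
  apply (locally_0_abs d). intros t Ht. apply E, Hd, Ht.
Qed.

Lemma CkOn_ext_disk dirs k : forall f g : R * R -> R, (forall q, Disk q -> f q = g q) -> CkOn dirs k Disk f -> CkOn dirs k Disk g.
Proof.
  assert (Hc : forall f g : R * R -> R, (forall q, Disk q -> f q = g q) -> forall p, Disk p -> continuous f p -> continuous g p).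
  { intros f g E p Hp Hf. apply (continuous_ext_loc g f p); [|exact Hf].
    destruct (Disk_open p Hp) as (d & Hd & H). apply (locally2_intro p _ d Hd). intros y Hy. apply E, H, Hy. }
  induction k as [|k IH]; intros f g E H.
  - intros p Hp. apply (Hc f g E p Hp), H, Hp.
  - destruct H as [H1 H2]. split.
    + intros p Hp. destruct (H1 p Hp) as [Hcf Hd]. split; [now apply (Hc f g E)|].
      intros v Hv. specialize (Hd v Hv). destruct (Disk_line p v Hp) as [d Hdd].
      eapply ex_derive_ext_loc; [|exact Hd]. apply (locally_0_abs d). intros t Ht. apply E, Hdd, Ht.
    + intros v Hv. apply (IH (dderiv f v)); [|now apply H2]. intros q Hq. now apply dderiv_ext_disk.
Qed.

Lemma is_derive_re_line (f : C -> C) (p v : R * R) l : CD f p l ->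
  is_derive (fun t => fst (f (plus p (scal t v)))) 0 (fst (l * v)%C).
Proof.
  intros H.
  apply (is_derive_ext (fun s : R => fst (1 * f (p + RtoC s * v))%C)).
  - intros t. rewrite plus_scal2. destruct (f _); simpl; ring.
  - replace (fst (l * v)%C) with (fst (1 * (l * v))%C) by (destruct l, v; simpl; ring).
    apply CD_line. replace (p + RtoC 0 * v)%C with p by (apply C_eq; simpl; ring). exact H.
Qed.

Lemma dderiv_re (f : C -> C) (p v : R * R) l : CD f p l -> dderiv (fun q => fst (f q)) v p = fst (l * v)%C.
Proof. intros H. apply is_derive_unique, is_derive_re_line, H. Qed.

Lemma continuous_re (f : C -> C) (p : R * R) : (forall eps, 0 < eps -> exists del, 0 < del /\
   forall w, Cmod (w - p) < del -> Cmod (f w - f p) < eps) -> continuous (fun q : R * R => fst (f q)) p.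
Proof.
  intros H P [e He]. destruct (H e (cond_pos e)) as (d & Hd & Hf).
  apply (locally2_intro p _ d Hd). intros y Hy. apply He.
  eapply Rle_lt_trans; [apply (Cmod_ge_abs_re (f y - f p)%C)|]. now apply Hf.
Qed.

(** The derivative of [Re f] along [v] is [Re (f' v)], again the real part of a function with one
    complex derivative fewer. *)
Lemma CkOn_Hol dirs k : forall f, Hol k f -> CkOn dirs k Disk (fun q : R * R => fst (f q)).
Proof.
  induction k as [|k IH]; intros f H.
  - intros p Hp. apply continuous_re. intros e He. apply H; [now apply Disk_Cmod|exact He].
  - assert (H0 := Hol_cont _ _ H). destruct H as (g & Hg & Hk). split.
    + intros p Hp. apply Disk_Cmod in Hp. split; [apply continuous_re; intros e He; now apply H0|].
      intros v _. eexists. apply is_derive_re_line, Hg, Hp.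
    + intros v _. apply (CkOn_ext_disk _ _ (fun q => fst (g q * v)%C)).
      * intros q Hq. symmetry. apply dderiv_re, Hg. now apply Disk_Cmod.
      * apply (IH (fun z => g z * v)%C). apply Hol_mult; [exact Hk|apply Hol_const].
Qed.

Definition weierstrass_data (F1 F2 F3 u v : C -> C) : Prop :=
  (forall k, Hol k u) /\ (forall k, Hol k v) /\
  (forall z, Cmod z < 1 -> CD F1 z (u z * u z - v z * v z)%C) /\
  (forall z, Cmod z < 1 -> CD F2 z (Ci * (u z * u z + v z * v z))%C) /\
  (forall z, Cmod z < 1 -> CD F3 z (2 * (u z * v z))%C) /\
  (forall z, Cmod z < 1 -> 0 < Cmod (u z) * Cmod (u z) + Cmod (v z) * Cmod (v z)).

Definition realpart3 (F1 F2 F3 : C -> C) (p : R * R) : P3 := mk3 (fst (F1 p)) (fst (F2 p)) (fst (F3 p)).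

Lemma cross3_sq a b : dot3 (cross3 a b) (cross3 a b) = dot3 a a * dot3 b b - dot3 a b * dot3 a b.
Proof. vunf. ring. Qed.

Lemma dderiv3_re (G : R * R -> P3) (F1 F2 F3 : C -> C) (p v : R * R) l1 l2 l3 :
  (forall q, Disk q -> G q = realpart3 F1 F2 F3 q) -> Disk p -> CD F1 p l1 -> CD F2 p l2 -> CD F3 p l3 ->
  dderiv3 G v p = mk3 (fst (l1 * v)%C) (fst (l2 * v)%C) (fst (l3 * v)%C).
Proof.
  intros E Hp H1 H2 H3. unfold dderiv3. f_equal.
  - rewrite (dderiv_ext_disk _ (fun q => fst (F1 q))); [now apply dderiv_re| |exact Hp].
    intros q Hq. now rewrite E.
  - rewrite (dderiv_ext_disk _ (fun q => fst (F2 q))); [now apply dderiv_re| |exact Hp].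
    intros q Hq. now rewrite E.
  - rewrite (dderiv_ext_disk _ (fun q => fst (F3 q))); [now apply dderiv_re| |exact Hp].
    intros q Hq. now rewrite E.
Qed.

(** Nullity of the derivative makes the coordinates conformal, [E = G] and [F = 0]; with harmonicity
    the numerator [e G + g E] of the mean curvature vanishes. The squared norm of the cross product
    is [E G - F^2], a power of the positive conformal factor. *)
Lemma weierstrass_minimal F1 F2 F3 u v : weierstrass_data F1 F2 F3 u v -> minimal_immersion (realpart3 F1 F2 F3).
Proof.
  intros (Hu & Hv & D1 & D2 & D3 & Hpos).
  set (f1 := fun z => (u z * u z - v z * v z)%C). set (f2 := fun z => (Ci * (u z * u z + v z * v z))%C).
  set (f3 := fun z => (2 * (u z * v z))%C).
  assert (H1 : forall k, Hol k f1).
  { intros k. unfold f1. assert (H := Hol_plus k _ _ (Hol_mult k _ _ (Hu k) (Hu k)) (Hol_mult k _ _ (Hol_const k (Copp 1)) (Hol_mult k _ _ (Hv k) (Hv k)))).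
    assert (Ext : forall k f g, (forall z, f z = g z) -> Hol k f -> Hol k g).
    { clear. induction k as [|k IH]; intros f g E Hf.
      - intros z Hz e He. destruct (Hf z Hz e He) as (d & Hd & Hd'). exists d. split; [exact Hd|]. intros w Hw. rewrite <- !E. auto.
      - destruct Hf as (f' & Hf1 & Hf2). exists f'. split; [|exact Hf2]. intros z Hz.
        apply (CD_ext_at f g z _ 1 Rlt_0_1); auto. }
    eapply Ext; [|exact H]. intros z; simpl; ring. }
  assert (H2 : forall k, Hol k f2).
  { intros k. unfold f2. apply (Hol_mult k (fun _ => Ci)); [apply Hol_const|]. apply Hol_plus; apply Hol_mult; auto. }
  assert (H3 : forall k, Hol k f3).
  { intros k. unfold f3. apply (Hol_mult k (fun _ => RtoC 2)); [apply Hol_const|]. apply Hol_mult; auto. }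
  assert (HF : forall k, Hol k F1 /\ Hol k F2 /\ Hol k F3).
  { intros k. split; [|split].
    - apply (Hol_pred k F1). exists f1. split; [exact D1|apply H1].
    - apply (Hol_pred k F2). exists f2. split; [exact D2|apply H2].
    - apply (Hol_pred k F3). exists f3. split; [exact D3|apply H3]. }
  set (psi := realpart3 F1 F2 F3).
  assert (Hpu : forall p, Disk p -> psi_u psi p = mk3 (fst (f1 p * 1)%C) (fst (f2 p * 1)%C) (fst (f3 p * 1)%C)).
  { intros p Hp. apply Disk_Cmod in Hp as Hp'. apply (dderiv3_re psi F1 F2 F3); auto. }
  assert (Hpv : forall p, Disk p -> psi_v psi p = mk3 (fst (f1 p * Ci)%C) (fst (f2 p * Ci)%C) (fst (f3 p * Ci)%C)).
  { intros p Hp. apply Disk_Cmod in Hp as Hp'. apply (dderiv3_re psi F1 F2 F3); auto. }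
  assert (Hnull : forall p, dot3 (mk3 (fst (f1 p * 1)%C) (fst (f2 p * 1)%C) (fst (f3 p * 1)%C)) (mk3 (fst (f1 p * Ci)%C) (fst (f2 p * Ci)%C) (fst (f3 p * Ci)%C)) = 0).
  { intros p. unfold f1, f2, f3. vunf. destruct (u p), (v p); simpl. ring. }
  assert (HE : forall p, dot3 (mk3 (fst (f1 p * 1)%C) (fst (f2 p * 1)%C) (fst (f3 p * 1)%C)) (mk3 (fst (f1 p * 1)%C) (fst (f2 p * 1)%C) (fst (f3 p * 1)%C))
     = (Cmod (u p) * Cmod (u p) + Cmod (v p) * Cmod (v p)) * (Cmod (u p) * Cmod (u p) + Cmod (v p) * Cmod (v p))).
  { intros p. rewrite !Cmod_sq. unfold f1, f2, f3. vunf. destruct (u p), (v p); simpl. ring. }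
  assert (HG : forall p, dot3 (mk3 (fst (f1 p * Ci)%C) (fst (f2 p * Ci)%C) (fst (f3 p * Ci)%C)) (mk3 (fst (f1 p * Ci)%C) (fst (f2 p * Ci)%C) (fst (f3 p * Ci)%C))
     = (Cmod (u p) * Cmod (u p) + Cmod (v p) * Cmod (v p)) * (Cmod (u p) * Cmod (u p) + Cmod (v p) * Cmod (v p))).
  { intros p. rewrite !Cmod_sq. unfold f1, f2, f3. vunf. destruct (u p), (v p); simpl. ring. }
  split.
  - split.
    + split; [|split]; intros k; destruct (HF k) as (K1 & K2 & K3).
      * exact (CkOn_Hol basis2 k F1 K1).
      * exact (CkOn_Hol basis2 k F2 K2).
      * exact (CkOn_Hol basis2 k F3 K3).
    + intros p Hp E. rewrite Hpu, Hpv in E by exact Hp.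
      assert (T := cross3_sq (mk3 (fst (f1 p * 1)%C) (fst (f2 p * 1)%C) (fst (f3 p * 1)%C)) (mk3 (fst (f1 p * Ci)%C) (fst (f2 p * Ci)%C) (fst (f3 p * Ci)%C))).
      rewrite E, Hnull, HE, HG in T. apply Disk_Cmod in Hp. specialize (Hpos p Hp).
      set (s := Cmod (u p) * Cmod (u p) + Cmod (v p) * Cmod (v p)) in *.
      replace (dot3 (mk3 0 0 0) (mk3 0 0 0)) with 0 in T by (vunf; ring).
      assert (0 < s * s) by nra. nra.
  - intros p Hp. cbv zeta.
    destruct (H1 1%nat) as (g1 & G1 & _). destruct (H2 1%nat) as (g2 & G2 & _). destruct (H3 1%nat) as (g3 & G3 & _).
    apply Disk_Cmod in Hp as Hp'.
    assert (Exx : dderiv3 (psi_u psi) (1, 0) p = mk3 (fst (g1 p * 1)%C) (fst (g2 p * 1)%C) (fst (g3 p * 1)%C)).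
    { apply (dderiv3_re (psi_u psi) f1 f2 f3); auto.
      intros q Hq. rewrite Hpu by exact Hq. unfold realpart3. rewrite !Cmult_1_r. reflexivity. }
    (* Harmonicity: differentiating twice in the direction [i] multiplies the second complex
       derivative by [i^2]. *)
    assert (Eyy : dderiv3 (psi_v psi) (0, 1) p = scl3 (-1) (dderiv3 (psi_u psi) (1, 0) p)).
    { rewrite Exx. rewrite (dderiv3_re (psi_v psi) (fun z => f1 z * Ci)%C (fun z => f2 z * Ci)%C (fun z => f3 z * Ci)%C p (0, 1)
        (g1 p * Ci)%C (g2 p * Ci)%C (g3 p * Ci)%C); auto.
      - apply P3_eq; vunf; destruct (g1 p), (g2 p), (g3 p); simpl; ring.
      - eapply CD_unique_val; [|apply CD_mult; [apply G1, Hp'|apply CD_const]]. simpl; ring.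
      - eapply CD_unique_val; [|apply CD_mult; [apply G2, Hp'|apply CD_const]]. simpl; ring.
      - eapply CD_unique_val; [|apply CD_mult; [apply G3, Hp'|apply CD_const]]. simpl; ring. }
    rewrite Eyy. rewrite Hpu, Hpv by exact Hp. rewrite Hnull, HE, HG.
    set (n := cross3 _ _). set (xuu := dderiv3 (psi_u psi) (1, 0) p).
    replace (dot3 (scl3 (-1) xuu) n) with (- dot3 xuu n) by (vunf; ring).
    unfold Rdiv. match goal with |- ?a * _ = 0 => replace a with 0 by ring end. ring.
Qed.

(** * Speed of curves on the surface *)

Lemma CD_curve (f : C -> C) (g : R -> C) (c g' l : C) t :
  is_derive (fun s => fst (g s)) t (fst g') -> is_derive (fun s => snd (g s)) t (snd g') -> CD f (g t) l ->
  is_derive (fun s => fst (c * f (g s))%C) t (fst (c * (l * g'))%C).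
Proof.
  intros Hg1 Hg2 Hf. apply is_derive_Reals in Hg1, Hg2. apply is_derive_Reals. intros e He.
  pose proof (Cmod_ge_0 c). pose proof (Cmod_ge_0 g'). pose proof (Cmod_ge_0 l).
  set (e1 := e / (4 * (Cmod c + 1) * (Cmod g' + 1))).
  set (e2 := Rmin (1 / 2) (e / (8 * (Cmod c + 1) * (Cmod l + 1)))).
  assert (HD1 : 0 < 4 * (Cmod c + 1) * (Cmod g' + 1)) by nra.
  assert (HD2 : 0 < 8 * (Cmod c + 1) * (Cmod l + 1)) by nra.
  assert (He1 : 0 < e1) by (apply Rdiv_lt_0_compat; lra).
  assert (He2 : 0 < e2) by (apply Rmin_glb_lt; [lra|apply Rdiv_lt_0_compat; lra]).
  assert (He2a : e2 <= 1 / 2) by apply Rmin_l. assert (He2b : e2 <= e / (8 * (Cmod c + 1) * (Cmod l + 1))) by apply Rmin_r.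
  destruct (Hf e1 He1) as (d & Hd & Kf).
  destruct (Hg1 e2 He2) as [d1 K1]. destruct (Hg2 e2 He2) as [d2 K2].
  pose proof (cond_pos d1). pose proof (cond_pos d2).
  assert (Hdd : 0 < Rmin (Rmin d1 d2) (d / (Cmod g' + 1))) by (repeat apply Rmin_glb_lt; try lra; apply Rdiv_lt_0_compat; lra).
  exists (mkposreal _ Hdd). intros h Hh0 Hh; simpl in Hh.
  pose proof (Rmin_l (Rmin d1 d2) (d / (Cmod g' + 1))). pose proof (Rmin_r (Rmin d1 d2) (d / (Cmod g' + 1))).
  pose proof (Rmin_l d1 d2). pose proof (Rmin_r d1 d2).
  specialize (K1 h Hh0 ltac:(lra)). specialize (K2 h Hh0 ltac:(lra)).
  assert (Hah : 0 < Rabs h) by now apply Rabs_pos_lt.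
  set (w := g (t + h)) in *. set (w0 := g t) in *.
  assert (Hrem : Cmod (w - w0 - RtoC h * g') <= 2 * e2 * Rabs h).
  { eapply Rle_trans; [apply Cmod_le_sum|].
    assert (Q : forall a b x, Rabs ((a - b) / h - x) < e2 -> Rabs (a - b - h * x) <= e2 * Rabs h).
    { intros a b x Hx. replace (a - b - h * x) with (((a - b) / h - x) * h) by (field; exact Hh0). rewrite Rabs_mult. nra. }
    assert (Q1 := Q _ _ _ K1). assert (Q2 := Q _ _ _ K2).
    replace (fst (w - w0 - RtoC h * g')%C) with (fst w - fst w0 - h * fst g') by (destruct w, w0, g'; simpl; ring).
    replace (snd (w - w0 - RtoC h * g')%C) with (snd w - snd w0 - h * snd g') by (destruct w, w0, g'; simpl; ring).
    lra. }
  assert (Hww : Cmod (w - w0) <= Rabs h * (Cmod g' + 1)).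
  { replace (w - w0)%C with ((w - w0 - RtoC h * g') + RtoC h * g')%C by ring. eapply Rle_trans; [apply Cmod_triangle|].
    rewrite Cmod_mult, Cmod_R. nra. }
  assert (Hwd : Cmod (w - w0) < d).
  { eapply Rle_lt_trans; [apply Hww|]. apply Rlt_le_trans with (d / (Cmod g' + 1) * (Cmod g' + 1)); [apply Rmult_lt_compat_r; lra|right; field; lra]. }
  specialize (Kf w Hwd).
  replace ((fst (c * f w)%C - fst (c * f w0)%C) / h - fst (c * (l * g'))%C)
    with (fst (c * ((f w - f w0 - l * (w - w0)) + l * (w - w0 - RtoC h * g')))%C / h).
  2:{ destruct c, g', l, (f w), (f w0), w, w0; simpl. field; exact Hh0. }
  unfold Rdiv. rewrite Rabs_mult, Rabs_inv.
  apply Rmult_lt_reg_r with (Rabs h); [lra|]. rewrite Rmult_assoc, Rinv_l, Rmult_1_r by lra.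
  eapply Rle_lt_trans; [apply Cmod_ge_abs_re|]. rewrite Cmod_mult.
  assert (Hs : Cmod (f w - f w0 - l * (w - w0) + l * (w - w0 - RtoC h * g')) <=
     e1 * (Rabs h * (Cmod g' + 1)) + Cmod l * (2 * e2 * Rabs h)).
  { eapply Rle_trans; [apply Cmod_triangle|]. rewrite Cmod_mult. apply Rplus_le_compat.
    - eapply Rle_trans; [exact Kf|]. apply Rmult_le_compat_l; lra.
    - apply Rmult_le_compat_l; lra. }
  apply Rle_lt_trans with ((Cmod c + 1) * (e1 * (Rabs h * (Cmod g' + 1)) + (Cmod l + 1) * (2 * e2 * Rabs h))).
  { apply Rmult_le_compat; [lra|apply Cmod_ge_0|lra|]. eapply Rle_trans; [exact Hs|]. apply Rplus_le_compat_l, Rmult_le_compat_r; [|lra]. nra. }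
  assert (E1 : (Cmod c + 1) * (e1 * (Rabs h * (Cmod g' + 1))) = e / 4 * Rabs h) by (unfold e1; field; lra).
  assert (E2 : (Cmod c + 1) * ((Cmod l + 1) * (2 * e2 * Rabs h)) <= e / 4 * Rabs h).
  { apply Rle_trans with ((Cmod c + 1) * ((Cmod l + 1) * (2 * (e / (8 * (Cmod c + 1) * (Cmod l + 1))) * Rabs h))).
    - apply Rmult_le_compat_l; [lra|]. apply Rmult_le_compat_l; [lra|]. apply Rmult_le_compat_r; lra.
    - right; field; lra. }
  nra.
Qed.

(** By the chain rule the velocity is the null vector of [(u, v)] with the complex number [gam'] as
    factor, and [enorm3_nullv] computes its length. *)
Lemma speed_formula F1 F2 F3 u v (gam : R -> R * R) t : weierstrass_data F1 F2 F3 u v -> Disk (gam t) ->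
  ex_derive (fun s => fst (gam s)) t -> ex_derive (fun s => snd (gam s)) t ->
  enorm3 (mk3 (Derive (fun s => px (realpart3 F1 F2 F3 (gam s))) t) (Derive (fun s => py (realpart3 F1 F2 F3 (gam s))) t)
     (Derive (fun s => pz (realpart3 F1 F2 F3 (gam s))) t)) =
  Cmod (Derive (fun s => fst (gam s)) t, Derive (fun s => snd (gam s)) t) *
    (Cmod (u (gam t)) * Cmod (u (gam t)) + Cmod (v (gam t)) * Cmod (v (gam t))).
Proof.
  intros (_ & _ & D1 & D2 & D3 & _) Hd Hg1 Hg2. apply Disk_Cmod in Hd.
  set (g' := (Derive (fun s => fst (gam s)) t, Derive (fun s => snd (gam s)) t) : C).
  apply Derive_correct in Hg1, Hg2.
  assert (K : forall F l, CD F (gam t) l -> Derive (fun s => fst (F (gam s))) t = fst (g' * l)%C).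
  { intros F l HF. apply is_derive_unique.
    apply (is_derive_ext (fun s => fst (1 * F (gam s))%C)); [intros s; destruct (F (gam s)); simpl; ring|].
    replace (fst (g' * l)%C) with (fst (1 * (l * g'))%C) by (destruct g', l; simpl; ring).
    now apply (CD_curve F gam 1 g' l t). }
  rewrite <- enorm3_nullv. f_equal. unfold nullv.
  assert (E1 := K F1 _ (D1 _ Hd)). assert (E2 := K F2 _ (D2 _ Hd)). assert (E3 := K F3 _ (D3 _ Hd)).
  f_equal; assumption.
Qed.

(** * The limit surface *)

Definition geo_states (D : P3 -> Prop) (p0 : P3) (m del0 kap : R) (sq : nat -> state) : Prop :=
  forall n, Inv D p0 (del0 * kap ^ n) (/ 2 ^ n) (sq n) /\ St D p0 m (del0 * kap ^ n) (sq n) (sq (S n)).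

(** Displacements are of the order of the square root of the depth, hence form a geometric series
    with ratio [sqrt kap]. *)
Lemma displacement_sum D p0 m del0 kap sq : geo_states D p0 m del0 kap sq -> 0 < m -> 0 < del0 -> 0 < kap < 1 ->
  forall k z, Cmod z <= 1 ->
  enorm3 (sub3 (surf p0 (stU (sq k)) (stV (sq k)) z) (surf p0 (stU (sq 0%nat)) (stV (sq 0%nat)) z))
    <= 2 * sqrt (m * del0) / (1 - sqrt kap).
Proof.
  intros H Hm Hd Hk k z Hz.
  set (q := sqrt kap). assert (Hq2 : q * q = kap) by (apply sqrt_sqrt; lra).
  assert (Hq0 : 0 < q) by (apply sqrt_lt_R0; lra). assert (Hq1 : q < 1) by nra.
  set (c := 2 * sqrt (m * del0)).
  assert (Hc : 0 <= c) by (unfold c; pose proof (sqrt_pos (m * del0)); lra).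
  assert (G : forall k, enorm3 (sub3 (surf p0 (stU (sq k)) (stV (sq k)) z) (surf p0 (stU (sq 0%nat)) (stV (sq 0%nat)) z))
    <= c * (1 - q ^ k) / (1 - q)).
  { clear k. induction k as [|k IH].
    - rewrite sub3_diag, enorm3_0. simpl. right; field; lra.
    - destruct (H k) as [_ (_ & _ & _ & S4 & _)]. specialize (S4 z Hz).
      eapply Rle_trans; [apply (enorm3_sub_tri _ (surf p0 (stU (sq k)) (stV (sq k)) z))|].
      rewrite surf_sub. unfold disp in S4.
      assert (E : 2 * sqrt (m * (del0 * kap ^ k)) = c * q ^ k).
      { unfold c. replace (m * (del0 * kap ^ k)) with (m * del0 * kap ^ k) by ring.
        rewrite sqrt_mult; [|nra|apply pow_le; lra].
        replace (sqrt (kap ^ k)) with (q ^ k); [ring|]. symmetry. apply sqrt_lem_1; [apply pow_le; lra|apply pow_le; lra|].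
        rewrite <- Rpow_mult_distr, Hq2. reflexivity. }
      rewrite E in S4.
      apply Rle_trans with (c * q ^ k + c * (1 - q ^ k) / (1 - q)); [lra|]. right. simpl. field; lra. }
  eapply Rle_trans; [apply G|]. unfold Rdiv. apply Rmult_le_compat_r; [left; apply Rinv_0_lt_compat; lra|].
  assert (0 < q ^ k) by (apply pow_lt; lra). nra.
Qed.

Lemma str_reaches D p0 m del0 kap sq z : geo_states D p0 m del0 kap sq -> Cmod z < 1 -> exists n, Cmod z <= str (sq n).
Proof.
  intros H Hz. destruct (half_pow_small 1 (1 - Cmod z)) as [n Hn]; [lra|]. exists n.
  destruct (H n) as [(_ & _ & Hr & _) _]. specialize (Hn n (le_n _)). lra.
Qed.

Lemma enorm_limit (F : nat -> P3) (X Y : P3) B : (forall eps, 0 < eps -> exists n0, forall k, (n0 <= k)%nat -> enorm3 (sub3 (F k) X) <= eps) ->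
  (exists n0, forall k, (n0 <= k)%nat -> enorm3 (sub3 (F k) Y) <= B) -> enorm3 (sub3 X Y) <= B.
Proof.
  intros HF (n1 & Hn1). apply Rnot_lt_le. intros Hlt.
  destruct (HF ((enorm3 (sub3 X Y) - B) / 2)) as (n0 & Hn0); [lra|].
  specialize (Hn0 (Nat.max n0 n1) ltac:(lia)). specialize (Hn1 (Nat.max n0 n1) ltac:(lia)).
  pose proof (enorm3_sub_tri X (F (Nat.max n0 n1)) Y). rewrite (enorm3_sym X (F (Nat.max n0 n1))) in H. lra.
Qed.

(** The spinors converge with all derivatives, and so do their integrals. The third conclusion, that
    at most half of the metric of any stage is lost, gives both the immersion property and the later
    length estimates. *)
Lemma limit_surface D p0 m del0 kap sq : geo_states D p0 m del0 kap sq ->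
  exists F1 F2 F3 u v, weierstrass_data F1 F2 F3 u v /\
    (forall n z, Cmod z <= str (sq n) -> enorm3 (sub3 (realpart3 F1 F2 F3 z) (surf p0 (stU (sq n)) (stV (sq n)) z)) <= 2 * ste (sq n)) /\
    (forall n z, Cmod z <= str (sq n) ->
       sn2 (stU (sq n)) (stV (sq n)) z / 2 <= Cmod (u z) * Cmod (u z) + Cmod (v z) * Cmod (v z)) /\
    (forall z, Cmod z < 1 -> forall eps, 0 < eps -> exists n0, forall k, (n0 <= k)%nat ->
       enorm3 (sub3 (surf p0 (stU (sq k)) (stV (sq k)) z) (realpart3 F1 F2 F3 z)) <= eps).
Proof.
  intros H.
  set (L := fun k => stU (sq k)). set (M := fun k => stV (sq k)).
  (* The increments hidden in [adm] are chosen for all steps at once; their norms are at most [2^-k]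
     by the bound [ste <= lo]. *)
  assert (HA : exists A B : nat -> list C, (forall k, L (S k) = padd (L k) (A k)) /\ (forall k, M (S k) = padd (M k) (B k)) /\
    (forall k, pnorm (str (sq k)) (A k) <= / 2 ^ k) /\ (forall k, pnorm (str (sq k)) (B k) <= / 2 ^ k)).
  { exists (fun k => fst (epsilon (inhabits (nil, nil)) (fun AB : list C * list C => L (S k) = padd (L k) (fst AB) /\ M (S k) = padd (M k) (snd AB) /\
      pnorm (str (sq k)) (fst AB) <= / 2 ^ k /\ pnorm (str (sq k)) (snd AB) <= / 2 ^ k))).
    exists (fun k => snd (epsilon (inhabits (nil, nil)) (fun AB : list C * list C => L (S k) = padd (L k) (fst AB) /\ M (S k) = padd (M k) (snd AB) /\
      pnorm (str (sq k)) (fst AB) <= / 2 ^ k /\ pnorm (str (sq k)) (snd AB) <= / 2 ^ k))).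
    assert (E : forall k, exists AB : list C * list C, L (S k) = padd (L k) (fst AB) /\ M (S k) = padd (M k) (snd AB) /\
      pnorm (str (sq k)) (fst AB) <= / 2 ^ k /\ pnorm (str (sq k)) (snd AB) <= / 2 ^ k).
    { intros k. destruct (H k) as [(_ & _ & _ & _ & He & _) ((A & B & E1 & E2 & HA & HB & _) & _)].
      exists (A, B). simpl. repeat split; try assumption; lra. }
    assert (E' := fun k => epsilon_spec (inhabits (nil, nil)) _ (E k)).
    split; [|split; [|split]]; intros k; destruct (E' k) as (K1 & K2 & K3 & K4); assumption. }
  destruct HA as (A & B & HL & HM & HnA & HnB).
  assert (Hr : forall k, 1 - / 2 ^ k <= str (sq k)) by (intros k; destruct (H k) as [(_ & _ & Hr & _) _]; exact Hr).
  set (TU := fun i k => peval (pders i (L k))). set (TV := fun i k => peval (pders i (M k))).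
  assert (GU : forall i, locgeo (TU i)) by (intros i; apply (locgeo_poly L A (fun k => str (sq k)) i); auto).
  assert (GV : forall i, locgeo (TV i)) by (intros i; apply (locgeo_poly M B (fun k => str (sq k)) i); auto).
  assert (DU : forall i k z, CD (TU i k) z (TU (S i) k z)) by (intros; apply CD_peval).
  assert (DV : forall i k z, CD (TV i k) z (TV (S i) k z)) by (intros; apply CD_peval).
  assert (Bd : forall X : nat -> list C, forall k rho, rho < 1 -> exists M, forall z, Cmod z <= rho -> Cmod (peval (X k) z) <= M).
  { intros X k rho _. exists (pnorm rho (X k)). intros z Hz. now apply peval_le. }
  set (u := Climf (TU 0%nat)). set (v := Climf (TV 0%nat)).
  (* The limit of the integrals is a primitive of the limit of the products; what remains is that
     the latter is the product of the limits. *)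
  assert (HB : forall X Y : nat -> list C, locgeo (fun k => peval (X k)) -> locgeo (fun k => peval (Y k)) ->
    locgeo (fun k => bint (X k) (Y k)) /\
    forall z, Cmod z < 1 -> CD (Climf (fun k => bint (X k) (Y k))) z (Climf (fun k => peval (X k)) z * Climf (fun k => peval (Y k)) z)%C).
  { intros X Y GX GY.
    assert (GXY : locgeo (fun k z => peval (X k) z * peval (Y k) z)%C) by (apply locgeo_mult; auto).
    assert (DB : forall k z, CD (bint (X k) (Y k)) z (peval (X k) z * peval (Y k) z)%C).
    { intros k z. unfold bint. rewrite <- peval_pmul. apply CD_prim. }
    assert (GB : locgeo (fun k => bint (X k) (Y k))).
    { apply (locgeo_primitive (fun k => bint (X k) (Y k)) (fun k z => peval (X k) z * peval (Y k) z)%C); auto.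
      intros k. unfold bint. simpl. ring. }
    split; [exact GB|]. intros z Hz.
    eapply CD_unique_val; [|apply (Climf_CD (fun k => bint (X k) (Y k)) (fun k z => peval (X k) z * peval (Y k) z)%C DB GB GXY z Hz)].
    set (a := Climf (fun k z => peval (X k) z * peval (Y k) z)%C z). set (x := Climf (fun k => peval (X k)) z). set (y := Climf (fun k => peval (Y k)) z).
    assert (E : Cmod (a - x * y) = 0); [|replace a with ((a - x * y) + x * y)%C by ring; apply Cmod_eq_0 in E; rewrite E; ring].
    apply Rle_antisym; [|apply Cmod_ge_0]. apply Rnot_lt_le. intros Hpos. set (e := Cmod (a - x * y)) in *.
    pose proof (Cmod_ge_0 x). pose proof (Cmod_ge_0 y).
    set (t := Rmin 1 (e / (4 * (Cmod x + Cmod y + 1)))). assert (Ht : 0 < t) by (apply Rmin_glb_lt; [lra|apply Rdiv_lt_0_compat; lra]).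
    assert (Ht1 : t <= 1) by apply Rmin_l.
    assert (Ht2 : t * (Cmod x + Cmod y + 1) <= e / 4).
    { apply Rle_trans with (e / (4 * (Cmod x + Cmod y + 1)) * (Cmod x + Cmod y + 1)); [apply Rmult_le_compat_r; [lra|apply Rmin_r]|right; field; lra]. }
    destruct (Climf_close _ (e / 4) z GXY Hz) as [n1 K1]; [lra|].
    destruct (Climf_close _ t z GX Hz Ht) as [n2 K2]. destruct (Climf_close _ t z GY Hz Ht) as [n3 K3].
    set (n := Nat.max n1 (Nat.max n2 n3)).
    specialize (K1 n ltac:(unfold n; lia)). specialize (K2 n ltac:(unfold n; lia)). specialize (K3 n ltac:(unfold n; lia)).
    fold a in K1. fold x in K2. fold y in K3. set (xn := peval (X n) z) in *. set (yn := peval (Y n) z) in *.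
    assert (e <= e / 4 + (t * t + t * Cmod y + Cmod x * t)).
    { unfold e at 1. replace (a - x * y)%C with ((a - xn * yn) + ((x - xn) * (y - yn) + (- (x - xn) * y + - (x * (y - yn)))))%C by ring.
      eapply Rle_trans; [apply Cmod_triangle|]. apply Rplus_le_compat; [exact K1|].
      eapply Rle_trans; [apply Cmod_triangle|]. rewrite Rplus_assoc. apply Rplus_le_compat.
      - rewrite Cmod_mult. apply Rmult_le_compat; try apply Cmod_ge_0; assumption.
      - eapply Rle_trans; [apply Cmod_triangle|]. rewrite !Cmod_opp, !Cmod_mult, Cmod_opp. apply Rplus_le_compat.
        + apply Rmult_le_compat_r; [lra|exact K2].
        + apply Rmult_le_compat_l; [lra|exact K3]. }
    nra. }
  destruct (HB L L (GU 0%nat) (GU 0%nat)) as [G1 D1]. destruct (HB M M (GV 0%nat) (GV 0%nat)) as [G2 D2].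
  destruct (HB L M (GU 0%nat) (GV 0%nat)) as [G3 D3].
  set (P := Climf (fun k => bint (L k) (L k))) in *. set (Q := Climf (fun k => bint (M k) (M k))) in *.
  set (W := Climf (fun k => bint (L k) (M k))) in *.
  set (F1 := fun z => (RtoC (px p0) + (P z - Q z))%C). set (F2 := fun z => (RtoC (py p0) + Ci * (P z + Q z))%C).
  set (F3 := fun z => (RtoC (pz p0) + 2 * W z)%C).
  assert (Hconv : forall z, Cmod z < 1 -> forall eps, 0 < eps -> exists n0, forall k, (n0 <= k)%nat ->
       enorm3 (sub3 (surf p0 (L k) (M k) z) (realpart3 F1 F2 F3 z)) <= eps).
  { intros z Hz eps He. assert (He6 : 0 < eps / 6) by lra.
    destruct (Climf_close _ (eps / 6) z G1 Hz He6) as [n1 K1]. destruct (Climf_close _ (eps / 6) z G2 Hz He6) as [n2 K2].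
    destruct (Climf_close _ (eps / 6) z G3 Hz He6) as [n3 K3].
    exists (Nat.max n1 (Nat.max n2 n3)). intros k Hk.
    specialize (K1 k ltac:(lia)). specialize (K2 k ltac:(lia)). specialize (K3 k ltac:(lia)). fold P in K1. fold Q in K2. fold W in K3.
    eapply Rle_trans; [apply enorm3_le_sum|]. unfold surf, surf0, realpart3, F1, F2, F3. vunf.
    set (p := bint (L k) (L k) z) in *. set (q := bint (M k) (M k) z) in *. set (w := bint (L k) (M k) z) in *.
    assert (R1 : Rabs (px p0 + fst (p - q)%C - fst (RtoC (px p0) + (P z - Q z))%C) <= eps / 6 + eps / 6).
    { eapply Rle_trans; [|apply Rplus_le_compat; [exact K1|exact K2]]. rewrite <- (Cmod_opp (P z - p)).
      eapply Rle_trans; [|apply Cmod_triangle]. eapply Rle_trans; [|apply Cmod_ge_abs_re].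
      right; f_equal. destruct p, q, (P z), (Q z); simpl; ring. }
    assert (R2 : Rabs (py p0 + fst (Ci * (p + q))%C - fst (RtoC (py p0) + Ci * (P z + Q z))%C) <= eps / 6 + eps / 6).
    { eapply Rle_trans; [|apply Rplus_le_compat; [exact K1|exact K2]].
      eapply Rle_trans; [|apply Cmod_triangle]. eapply Rle_trans; [|apply Cmod_ge_abs_im].
      right; f_equal. destruct p, q, (P z), (Q z); simpl; ring. }
    assert (R3 : Rabs (pz p0 + fst (2 * w)%C - fst (RtoC (pz p0) + 2 * W z)%C) <= 2 * (eps / 6)).
    { replace (pz p0 + fst (2 * w)%C - fst (RtoC (pz p0) + 2 * W z)%C) with (- (2 * fst (W z - w)%C)) by (destruct w, (W z); simpl; ring).
      rewrite Rabs_Ropp, Rabs_mult, (Rabs_right 2) by lra. pose proof (Cmod_ge_abs_re (W z - w)%C). lra. }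
    lra. }
  (* All later stages are within tolerance [2 * ste] of stage [n], so the last clause of [Inv]
     applies to each of them, and a non-strict inequality passes to the limit. *)
  assert (Hsn : forall n z, Cmod z <= str (sq n) -> sn2 (L n) (M n) z / 2 <= Cmod (u z) * Cmod (u z) + Cmod (v z) * Cmod (v z)).
  { intros n z Hz. destruct (H n) as [(_ & Hrn & _ & _ & _ & _ & _ & _ & _ & Hst) _].
    assert (Hz1 : Cmod z < 1) by lra.
    assert (Hk : forall k, (n <= k)%nat -> sn2 (L n) (M n) z / 2 <= sn2 (L k) (M k) z).
    { intros k Hk. destruct (adm_chain D m p0 del0 sq kap H n k Hk) as [_ Had].
      apply Hst; [|exact Hz]. apply (adm_weaken (str (sq n)) (str (sq n)) (2 * ste (sq n) - 2 * ste (sq k))); [lra| |exact Had].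
      destruct (H k) as [(_ & _ & _ & He & _) _]. lra. }
    apply Rnot_lt_le. intros Hlt. set (a := Cmod (u z)) in *. set (b := Cmod (v z)) in *.
    assert (Ha : 0 <= a) by apply Cmod_ge_0. assert (Hb : 0 <= b) by apply Cmod_ge_0.
    set (e := sn2 (L n) (M n) z / 2 - (a * a + b * b)) in *. assert (He : 0 < e) by (unfold e; lra).
    set (t := Rmin 1 (e / (4 * (a + b + 1)))). assert (Ht : 0 < t) by (apply Rmin_glb_lt; [lra|apply Rdiv_lt_0_compat; lra]).
    assert (Ht1 : t <= 1) by apply Rmin_l.
    assert (Ht2 : t * (a + b + 1) <= e / 4).
    { apply Rle_trans with (e / (4 * (a + b + 1)) * (a + b + 1)); [apply Rmult_le_compat_r; [lra|apply Rmin_r]|right; field; lra]. }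
    destruct (Climf_close _ t z (GU 0%nat) Hz1 Ht) as [n1 K1]. destruct (Climf_close _ t z (GV 0%nat) Hz1 Ht) as [n2 K2].
    set (k := Nat.max n (Nat.max n1 n2)).
    specialize (Hk k ltac:(unfold k; lia)). specialize (K1 k ltac:(unfold k; lia)). specialize (K2 k ltac:(unfold k; lia)).
    fold u in K1. fold v in K2. change (TU 0%nat k z) with (peval (L k) z) in K1. change (TV 0%nat k z) with (peval (M k) z) in K2.
    unfold sn2 in Hk at 2. rewrite Cmod_sym in K1, K2.
    pose proof (Cmod_diff (peval (L k) z) (u z)) as Q1. pose proof (Cmod_diff (peval (M k) z) (v z)) as Q2.
    apply Rabs_le_between in Q1, Q2. fold a in Q1. fold b in Q2.
    pose proof (Cmod_ge_0 (peval (L k) z)). pose proof (Cmod_ge_0 (peval (M k) z)).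
    assert (Cmod (peval (L k) z) * Cmod (peval (L k) z) <= (a + t) * (a + t)) by (apply Rmult_le_compat; lra).
    assert (Cmod (peval (M k) z) * Cmod (peval (M k) z) <= (b + t) * (b + t)) by (apply Rmult_le_compat; lra).
    assert (t * t <= t) by nra. unfold e in *. nra. }
  exists F1, F2, F3, u, v. split; [|split; [|split]].
  - assert (K : forall (c : C) f z l, CD f z l -> CD (fun w => c + f w)%C z l).
    { intros c f z l Hf. apply (CD_unique_val _ _ (0 + l)%C); [ring|]. apply (CD_plus (fun _ => c)); [apply CD_const|exact Hf]. }
    split; [intros k; apply (Hol_Climf TU DU GU k 0%nat)|]. split; [intros k; apply (Hol_Climf TV DV GV k 0%nat)|].
    split; [|split; [|split]].
    + intros z Hz. apply K. apply CD_minus; [now apply D1|now apply D2].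
    + intros z Hz. apply K. apply CD_scal. apply CD_plus; [now apply D1|now apply D2].
    + intros z Hz. apply K. apply CD_scal. now apply D3.
    + intros z Hz. destruct (str_reaches D p0 m del0 kap sq z H Hz) as [n Hn]. specialize (Hsn n z Hn).
      destruct (H n) as [((Hg & _) & Hrn & _) _]. specialize (Hg z ltac:(lra)). unfold L, M in Hsn. lra.
  - intros n z Hz. destruct (H n) as [(_ & Hrn & _) _].
    apply (enorm_limit (fun k => surf p0 (L k) (M k) z)); [apply Hconv; lra|].
    exists n. intros k Hk. destruct (adm_chain D m p0 del0 sq kap H n k Hk) as [_ (A' & B' & _ & _ & _ & _ & Hs)].
    rewrite surf_sub. specialize (Hs z Hz). destruct (H k) as [(_ & _ & _ & He & _) _]. unfold L, M. lra.
  - exact Hsn.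
  - exact Hconv.
Qed.

(** * Completeness *)

Definition conf (u v : C -> C) (z : C) : R := Cmod (u z) * Cmod (u z) + Cmod (v z) * Cmod (v z).

Definition speed (u v : C -> C) (gam : R -> R * R) (t : R) : R :=
  Cmod (Derive (fun s => fst (gam s)) t, Derive (fun s => snd (gam s)) t) * conf u v (gam t).

Lemma continuous_sq (f : R -> R) t : continuous f t -> continuous (fun s => f s * f s) t.
Proof. intros H. apply (continuous_mult f f); assumption. Qed.

Lemma speed_continuous u v gam t : (forall k, Hol k u) -> (forall k, Hol k v) -> C1_curve_in_disk gam -> 0 <= t <= 1 ->
  continuous (speed u v gam) t.
Proof.
  intros Hu Hv [Hg Hd] Ht. destruct (Hg t) as (Dx & Dy & Cx & Cy). specialize (Hd t Ht).
  assert (K : forall f, (forall k, Hol k f) -> continuous (fun s => Cmod (f (gam s)) * Cmod (f (gam s))) t).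
  { intros f Hf. destruct (Hf 1%nat) as (f' & Hf' & _). apply Disk_Cmod in Hd.
    set (g' := (Derive (fun s => fst (gam s)) t, Derive (fun s => snd (gam s)) t) : C).
    assert (Hc : forall c, continuous (fun s => fst (c * f (gam s))%C) t).
    { intros c. apply (ex_derive_continuous (fun s => fst (c * f (gam s))%C)). eexists.
      apply (CD_curve f gam c g' (f' (gam t)) t); [now apply Derive_correct|now apply Derive_correct|now apply Hf']. }
    apply (continuous_ext (fun s => fst (1 * f (gam s))%C * fst (1 * f (gam s))%C + fst (- Ci * f (gam s))%C * fst (- Ci * f (gam s))%C)).
    - intros s. rewrite Cmod_sq. destruct (f (gam s)); simpl; ring.
    - apply (continuous_plus (fun s => fst (1 * f (gam s))%C * fst (1 * f (gam s))%C)); apply continuous_sq, Hc. }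
  apply (continuous_mult (fun s => Cmod (Derive (fun s => fst (gam s)) s, Derive (fun s => snd (gam s)) s)) (fun s => conf u v (gam s))).
  - unfold Cmod. simpl. apply (continuous_comp _ sqrt); [|apply continuous_sqrt].
    apply (continuous_ext (fun s => Derive (fun s => fst (gam s)) s * Derive (fun s => fst (gam s)) s + Derive (fun s => snd (gam s)) s * Derive (fun s => snd (gam s)) s)).
    + intros s; simpl; ring.
    + apply (continuous_plus (fun s => Derive (fun s => fst (gam s)) s * Derive (fun s => fst (gam s)) s)); now apply continuous_sq.
  - apply (continuous_plus (fun s => Cmod (u (gam s)) * Cmod (u (gam s)))); now apply K.
Qed.

Lemma speed_ge0 u v gam t : 0 <= speed u v gam t.
Proof.
  unfold speed, conf. pose proof (Cmod_ge_0 (u (gam t))). pose proof (Cmod_ge_0 (v (gam t))).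
  apply Rmult_le_pos; [apply Cmod_ge_0|nra].
Qed.

Lemma cont_ex_RInt_on (f : R -> R) a b : a <= b -> (forall x, a <= x <= b -> continuous f x) -> ex_RInt f a b.
Proof. intros Hab H. apply (ex_RInt_continuous f a b). intros x Hx. rewrite Rmin_left, Rmax_right in Hx by lra. apply H; lra. Qed.

Lemma induced_length_speed F1 F2 F3 u v gam : weierstrass_data F1 F2 F3 u v -> C1_curve_in_disk gam ->
  induced_length (realpart3 F1 F2 F3) gam = RInt (speed u v gam) 0 1.
Proof.
  intros HW [Hg Hd]. unfold induced_length. apply RInt_ext. intros t Ht. rewrite Rmin_left, Rmax_right in Ht by lra.
  destruct (Hg t) as (Dx & Dy & _). apply (speed_formula F1 F2 F3 u v gam t HW); [apply Hd; lra|exact Dx|exact Dy].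
Qed.

(** Calibration: a quantity that grows along the curve no faster than [K] times the speed bounds the
    length from below. The intermediate time [tau] serves curves that reach a far point before
    returning. *)
Lemma length_dominates F1 F2 F3 u v gam (Phi phi : R -> R) K tau : weierstrass_data F1 F2 F3 u v -> C1_curve_in_disk gam ->
  0 <= tau <= 1 -> 0 <= K -> (forall t, 0 <= t <= 1 -> is_derive Phi t (phi t)) -> (forall t, 0 <= t <= 1 -> continuous phi t) ->
  (forall t, 0 <= t <= 1 -> phi t <= K * speed u v gam t) ->
  Phi tau - Phi 0 <= K * induced_length (realpart3 F1 F2 F3) gam.
Proof.
  intros HW Hgam Htau HK HD Hc Hle. rewrite (induced_length_speed F1 F2 F3 u v) by assumption.
  assert (Hsc : forall t, 0 <= t <= 1 -> continuous (speed u v gam) t) by (intros; apply speed_continuous; auto; apply HW).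
  assert (E : RInt phi 0 tau = Phi tau - Phi 0).
  { apply is_RInt_unique. apply (is_RInt_derive Phi phi 0 tau).
    - intros x Hx. rewrite Rmin_left, Rmax_right in Hx by lra. apply HD; lra.
    - intros x Hx. rewrite Rmin_left, Rmax_right in Hx by lra. apply Hc; lra. }
  rewrite <- E.
  assert (Hex : ex_RInt (speed u v gam) 0 tau) by (apply cont_ex_RInt_on; [lra|intros; apply Hsc; lra]).
  assert (Hex2 : ex_RInt (speed u v gam) tau 1) by (apply cont_ex_RInt_on; [lra|intros; apply Hsc; lra]).
  apply Rle_trans with (K * RInt (speed u v gam) 0 tau).
  - assert (ES : RInt (fun t => K * speed u v gam t) 0 tau = K * RInt (speed u v gam) 0 tau) by apply (RInt_scal (speed u v gam) 0 tau K Hex).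
    rewrite <- ES. apply RInt_le; [lra| | |].
    + apply cont_ex_RInt_on; [lra|intros; apply Hc; lra].
    + apply (ex_RInt_scal (speed u v gam)); exact Hex.
    + intros x Hx. apply Hle; lra.
  - apply Rmult_le_compat_l; [exact HK|]. rewrite <- (RInt_Chasles (speed u v gam) 0 tau 1 Hex Hex2).
    assert (0 <= RInt (speed u v gam) tau 1) by (apply RInt_ge_0; [lra|exact Hex2|intros; apply speed_ge0]).
    unfold plus; simpl. lra.
Qed.

(** Calibrate with the primitive of [b] evaluated at [|gam|^2], which is differentiable even where
    [gam] passes through 0. Its rate is at most [2 |gam| |gam'| b], hence at most twice the speed,
    because [|gam| < 1] and [b] minorises the conformal factor. *)
Lemma crossing_length F1 F2 F3 u v (b : R -> R) r r' l gam tau : weierstrass_data F1 F2 F3 u v ->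
  (forall x, continuous b x) -> (forall x, 0 <= b x) -> (forall x, x <= r * r -> b x = 0) -> (forall x, r' * r' <= x -> b x = 0) ->
  l <= RInt b 0 1 -> (forall z, Cmod z < 1 -> b (Cmod z * Cmod z) <= conf u v z) ->
  C1_curve_in_disk gam -> 0 <= tau <= 1 -> 0 <= r -> 0 <= r' < 1 -> Cmod (gam 0) <= r -> r' <= Cmod (gam tau) ->
  l <= 2 * induced_length (realpart3 F1 F2 F3) gam.
Proof.
  intros HW Hbc Hb0 Hz1 Hz2 HI Hbs Hgam Htau Hr Hr' H0 H1.
  set (N := fun t => fst (gam t) * fst (gam t) + snd (gam t) * snd (gam t)).
  assert (HN : forall t, N t = Cmod (gam t) * Cmod (gam t)) by (intros; rewrite Cmod_sq; reflexivity).
  set (x' := Derive (fun s => fst (gam s))). set (y' := Derive (fun s => snd (gam s))).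
  set (n' := fun t => 2 * (fst (gam t) * x' t + snd (gam t) * y' t)).
  destruct Hgam as [Hg Hd].
  assert (HND : forall t, is_derive N t (n' t)).
  { intros t. destruct (Hg t) as (Dx & Dy & _). apply Derive_correct in Dx, Dy. fold x' in Dx. fold y' in Dy.
    assert (D1 := is_derive_mult (fun s => fst (gam s)) (fun s => fst (gam s)) t _ _ Dx Dx Rmult_comm).
    assert (D2 := is_derive_mult (fun s => snd (gam s)) (fun s => snd (gam s)) t _ _ Dy Dy Rmult_comm).
    assert (D3 := is_derive_plus _ _ t _ _ D1 D2).
    replace (n' t) with (plus (plus (mult (x' t) (fst (gam t))) (mult (fst (gam t)) (x' t))) (plus (mult (y' t) (snd (gam t))) (mult (snd (gam t)) (y' t))))
      by (unfold n', plus, mult; simpl; ring).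
    exact D3. }
  assert (HNc : forall t, continuous n' t).
  { intros t. destruct (Hg t) as (Dx & Dy & Cx & Cy).
    assert (Kx := ex_derive_continuous _ t Dx). assert (Ky := ex_derive_continuous _ t Dy).
    apply (continuous_mult (fun _ => 2)); [apply continuous_const|].
    apply (continuous_plus (fun t => fst (gam t) * x' t)); apply (continuous_mult (K := R_AbsRing)); assumption. }
  set (B := (fun x => RInt b 0 x) : R -> R).
  assert (HB : forall x : R, is_derive B x (b x)).
  { intros x. apply (is_derive_RInt b B 0 x); [|apply Hbc]. apply filter_forall. intros y. apply (RInt_correct b 0 y). now apply cont_ex_RInt. }
  assert (HL := length_dominates F1 F2 F3 u v gam (fun t => B (N t)) (fun t => n' t * b (N t)) 2 tau HW (conj Hg Hd) Htau ltac:(lra)).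
  assert (Hgoal : B (N tau) - B (N 0) <= 2 * induced_length (realpart3 F1 F2 F3) gam).
  { apply HL.
    - intros t _. apply (is_derive_comp B N t); [apply HB|apply HND].
    - intros t _. apply (continuous_mult n' (fun t => b (N t))); [apply HNc|].
      apply (continuous_comp N b); [|apply Hbc]. apply (ex_derive_continuous N). eexists; apply HND.
    - intros t Ht. specialize (Hd t Ht). apply Disk_Cmod in Hd. specialize (Hbs (gam t) Hd). rewrite <- HN in Hbs.
      unfold speed. fold x' y'. set (dg := Cmod (x' t, y' t)). assert (Hdg : 0 <= dg) by apply Cmod_ge_0.
      assert (Hn : n' t <= 2 * dg).
      { assert (CSq : (fst (gam t) * x' t + snd (gam t) * y' t) <= Cmod (gam t) * dg).
        { assert (E := Cmod_ge_abs_re (Cmult (Cconj (gam t)) (x' t, y' t))). rewrite Cmod_mult, Cmod_conj in E. fold dg in E.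
          eapply Rle_trans; [|exact E]. eapply Rle_trans; [|apply Rle_abs]. simpl. right; ring. }
        unfold n'. pose proof (Cmod_ge_0 (gam t)). nra. }
      specialize (Hb0 (N t)). apply Rle_trans with (2 * dg * b (N t)); [apply Rmult_le_compat_r; lra|].
      replace (2 * (dg * conf u v (gam t))) with (2 * dg * conf u v (gam t)) by ring. apply Rmult_le_compat_l; lra. }
  assert (E0 : B (N 0) = 0).
  { unfold B. rewrite (RInt_ext _ (fun _ => 0)).
    - rewrite RInt_const. unfold scal; simpl; unfold mult; simpl; ring.
    - intros x Hx. apply Hz1. pose proof (Cmod_ge_0 (gam 0)). assert (0 <= N 0 <= r * r) by (rewrite HN; split; nra).
      unfold Rmax in Hx. destruct (Rle_dec 0 (N 0)); lra. }
  assert (E1 : B (N tau) = RInt b 0 1).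
  { assert (HdT : Cmod (gam tau) < 1) by (apply Disk_Cmod, Hd; lra).
    assert (HNt : r' * r' <= N tau <= 1) by (rewrite HN; split; nra).
    unfold B. rewrite <- (RInt_Chasles b 0 (N tau) 1) by now apply cont_ex_RInt.
    rewrite (RInt_ext b (fun _ => 0) (N tau) 1).
    - rewrite RInt_const. unfold scal, plus; simpl; unfold mult; simpl. rewrite Rmult_0_r. symmetry; apply Rplus_0_r.
    - intros x Hx. apply Hz2. rewrite Rmin_left in Hx by lra. lra. }
  lra.
Qed.

Lemma C1_segment (x p : R * R) : Disk x -> Disk p -> exists gam, C1_curve_in_disk gam /\ gam 0 = x /\ gam 1 = p /\
  (forall t, Derive (fun s => fst (gam s)) t = fst p - fst x /\ Derive (fun s => snd (gam s)) t = snd p - snd x) /\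
  (forall t, 0 <= t <= 1 -> Cmod (gam t) <= Rmax (Cmod x) (Cmod p)).
Proof.
  intros Hx Hp. set (gam := fun t : R => (fst x + t * (fst p - fst x), snd x + t * (snd p - snd x))).
  assert (D : forall a c t, is_derive (fun s => a + s * c) t c) by (intros a c t; auto_derive; [exact I|ring]).
  assert (Ex : forall t, Derive (fun s => fst (gam s)) t = fst p - fst x) by (intros t; apply is_derive_unique, D).
  assert (Ey : forall t, Derive (fun s => snd (gam s)) t = snd p - snd x) by (intros t; apply is_derive_unique, D).
  assert (Hm : forall t, 0 <= t <= 1 -> Cmod (gam t) <= Rmax (Cmod x) (Cmod p)).
  { intros t Ht. replace (gam t) with (RtoC (1 - t) * x + RtoC t * p)%C by (apply C_eq; simpl; ring).
    eapply Rle_trans; [apply Cmod_triangle|]. rewrite !Cmod_mult, !Cmod_R, !Rabs_right by lra.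
    pose proof (Rmax_l (Cmod x) (Cmod p)). pose proof (Rmax_r (Cmod x) (Cmod p)). nra. }
  exists gam. split; [split|].
  - intros t. split; [eexists; apply D|]. split; [eexists; apply D|]. split.
    + apply (continuous_ext (fun _ => fst p - fst x)); [intros; symmetry; apply Ex|apply continuous_const].
    + apply (continuous_ext (fun _ => snd p - snd x)); [intros; symmetry; apply Ey|apply continuous_const].
  - intros t Ht. apply Disk_Cmod in Hx, Hp. apply Disk_Cmod. eapply Rle_lt_trans; [apply Hm, Ht|]. now apply Rmax_lub_lt.
  - split; [apply C_eq; simpl; ring|]. split; [apply C_eq; simpl; ring|]. split; [intros t; split; auto|exact Hm].
Qed.

Lemma conf_bounded u v rho : (forall k, Hol k u) -> (forall k, Hol k v) -> rho < 1 -> exists S, 0 < S /\ forall z, Cmod z <= rho -> conf u v z <= S.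
Proof.
  intros Hu Hv Hrho.
  assert (K : forall f, (forall k, Hol k f) -> exists S, 0 < S /\ forall z, Cmod z <= rho -> Cmod (f z) <= S).
  { intros f Hf. destruct (covers_uniform distC (fun z => Cmod z <= rho) (fun z m => Cmod (f z) <= / m) (covers_cdisk rho)) as (m & Hm & H).
    - intros x m m' H1 H2. eapply Rle_trans; [exact H1|]. apply Rinv_le_contravar; lra.
    - intros x Hx. destruct (Hf 0%nat x ltac:(lra) 1 Rlt_0_1) as (d & Hd & H). pose proof (Cmod_ge_0 (f x)).
      exists d, (/ (Cmod (f x) + 1)). split; [exact Hd|]. split; [apply Rinv_0_lt_compat; lra|].
      intros y _ Hy. rewrite Rinv_inv. specialize (H y Hy). pose proof (Cmod_diff (f y) (f x)) as T. apply Rabs_le_between in T. lra.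
    - exists (/ m). split; [now apply Rinv_0_lt_compat|exact H]. }
  destruct (K u Hu) as (S1 & H1 & B1). destruct (K v Hv) as (S2 & H2 & B2).
  exists (S1 * S1 + S2 * S2). split; [nra|]. intros z Hz. specialize (B1 z Hz). specialize (B2 z Hz).
  unfold conf. pose proof (Cmod_ge_0 (u z)). pose proof (Cmod_ge_0 (v z)). nra.
Qed.

(* Each barrier forces curves crossing its annulus to have length at least 1/2, so an intrinsic Cauchy
   sequence is trapped in a compact subdisc, where the intrinsic and Euclidean metrics are comparable. *)
Lemma limit_complete D p0 m del0 kap sq F1 F2 F3 u v : geo_states D p0 m del0 kap sq -> weierstrass_data F1 F2 F3 u v ->
  (forall n z, Cmod z <= str (sq n) -> sn2 (stU (sq n)) (stV (sq n)) z / 2 <= conf u v z) ->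
  complete_immersion (realpart3 F1 F2 F3).
Proof.
  intros H HW Hsn.
  assert (Hcross : forall n gam tau, C1_curve_in_disk gam -> 0 <= tau <= 1 -> Cmod (gam 0) <= str (sq n) -> str (sq (S n)) <= Cmod (gam tau) ->
    1 <= 2 * induced_length (realpart3 F1 F2 F3) gam).
  { intros n gam tau Hgam Htau H0 H1. destruct (H n) as [(_ & Hr & _) (_ & _ & _ & _ & _ & b & Hb1 & Hb2 & Hb3 & Hb4 & Hb5 & k & Hk & Hb6)].
    destruct (H (S n)) as [(_ & Hr' & _) _].
    apply (crossing_length F1 F2 F3 u v b (str (sq n)) (str (sq (S n))) 1 gam tau); auto; try lra.
    (* The factor 2 in [barrier] compensates the half of the metric that may be lost in the limit;
       beyond this radius [b] is zero. *)
    intros z Hz. destruct (Rle_lt_dec (Cmod z) (str (sq (S n)))) as [Hle|Hlt].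
    - specialize (Hsn (S n) z Hle). specialize (Hb6 z ltac:(lra)). lra.
    - rewrite Hb4 by nra. unfold conf. pose proof (Cmod_ge_0 (u z)). pose proof (Cmod_ge_0 (v z)). nra. }
  intros x Hx Hcau.
  (* Any length below the crossing length [1 / 2] would do. *)
  destruct (Hcau (1 / 4) ltac:(lra)) as [N0 HN0].
  assert (Hx0 := Hx N0). apply Disk_Cmod in Hx0.
  destruct (str_reaches D p0 m del0 kap sq (x N0) H Hx0) as [n Hn].
  assert (Htrap : forall j, (N0 <= j)%nat -> Cmod (x j) <= str (sq (S n))).
  { intros j Hj. apply Rnot_lt_le. intros Hlt. destruct (HN0 N0 j (le_n _) Hj) as (gam & Hgam & E0 & E1 & Hlen).
    assert (T := Hcross n gam 1 Hgam ltac:(lra)). rewrite E0, E1 in T. specialize (T Hn ltac:(lra)). lra. }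
  destruct (H (S (S n))) as [(Hgood & Hr2 & _) _]. destruct (H (S n)) as [(_ & Hr1 & _) _].
  destruct (good_min _ _ Hgood) as (c0 & Hc0 & Hmin).
  assert (Hlow : forall z, Cmod z <= str (sq (S (S n))) -> c0 / 2 <= conf u v z).
  { intros z Hz. specialize (Hsn (S (S n)) z Hz). specialize (Hmin z ltac:(lra)). lra. }
  (* A connecting curve may leave the disc that holds the sequence, but being short it cannot cross
     the next annulus; one more stage therefore contains it. *)
  assert (Heuc : forall i j eps, (N0 <= i)%nat -> (N0 <= j)%nat -> 0 < eps <= 1 / 4 ->
     induced_dist_lt (realpart3 F1 F2 F3) (x i) (x j) eps -> Cmod (x j - x i)%C <= 2 / c0 * eps).
  { intros i j eps Hi Hj Heps (gam & Hgam & E0 & E1 & Hlen).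
    assert (Hin : forall t, 0 <= t <= 1 -> Cmod (gam t) <= str (sq (S (S n)))).
    { intros t Ht. apply Rnot_lt_le. intros Hlt.
      assert (T := Hcross (S n) gam t Hgam Ht). rewrite E0 in T. specialize (T (Htrap i Hi) ltac:(lra)). lra. }
    set (w := (x j - x i)%C). set (M := Cmod w).
    assert (HM : 0 <= M) by apply Cmod_ge_0.
    set (x' := Derive (fun s => fst (gam s))). set (y' := Derive (fun s => snd (gam s))).
    assert (Hg := proj1 Hgam).
    (* Calibration by the projection onto the chord: its increment is [M^2], and its rate is at most
       [M |gam'|], which the lower bound [c0 / 2] of the metric turns into a multiple of the
       speed. *)
    assert (T := length_dominates F1 F2 F3 u v gam (fun t => fst w * fst (gam t) + snd w * snd (gam t)) (fun t => fst w * x' t + snd w * y' t)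
      (M * (2 / c0)) 1 HW Hgam ltac:(lra)).
    assert (Hc2 : 0 < 2 / c0) by (apply Rdiv_lt_0_compat; lra).
    specialize (T ltac:(apply Rmult_le_pos; lra)). simpl in T. rewrite E0, E1 in T.
    assert (E : fst w * fst (x j) + snd w * snd (x j) - (fst w * fst (x i) + snd w * snd (x i)) = M * M).
    { unfold M. rewrite Cmod_sq. unfold w. destruct (x i), (x j); simpl; ring. }
    assert (T' : M * M <= M * (2 / c0) * induced_length (realpart3 F1 F2 F3) gam).
    { rewrite <- E at 1. apply T.
      - intros t _. destruct (Hg t) as (Dx & Dy & _). apply Derive_correct in Dx, Dy.
        apply (is_derive_plus (fun t => fst w * fst (gam t))); apply is_derive_scal; assumption.
      - intros t _. destruct (Hg t) as (_ & _ & Cx & Cy).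
        apply (continuous_plus (fun t => fst w * x' t)); apply (continuous_mult (K := R_AbsRing)); try apply continuous_const; assumption.
      - intros t Ht. unfold speed. fold x' y'. set (dg := Cmod (x' t, y' t)). assert (Hdg : 0 <= dg) by apply Cmod_ge_0.
        apply Rle_trans with (M * dg).
        + assert (Q := Cmod_ge_abs_re (Cmult (Cconj w) (x' t, y' t))). rewrite Cmod_mult, Cmod_conj in Q. fold M dg in Q.
          eapply Rle_trans; [|exact Q]. eapply Rle_trans; [|apply Rle_abs]. simpl. right; ring.
        + specialize (Hlow (gam t) (Hin t Ht)). replace (M * (2 / c0) * (dg * conf u v (gam t))) with ((M * dg) * (2 / c0 * conf u v (gam t))) by ring.
          assert (1 <= 2 / c0 * conf u v (gam t)).
          { apply Rle_trans with (2 / c0 * (c0 / 2)); [right; field; lra|apply Rmult_le_compat_l; lra]. }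
          assert (0 <= M * dg) by (apply Rmult_le_pos; lra). nra. }
    fold w. fold M. destruct (Req_dec M 0) as [EM|EM]; [rewrite EM; apply Rmult_le_pos; lra|].
    apply Rmult_le_reg_l with M; [lra|]. eapply Rle_trans; [exact T'|].
    replace (M * (2 / c0 * eps)) with (M * (2 / c0) * eps) by ring. apply Rmult_le_compat_l; [apply Rmult_le_pos; lra|lra]. }
  assert (HcauE : forall eps, 0 < eps -> exists N, (N0 <= N)%nat /\ forall i j, (N <= i)%nat -> (N <= j)%nat -> Cmod (x j - x i)%C <= eps).
  { intros eps Heps. set (e := Rmin (1 / 4) (eps * c0 / 2)). assert (He : 0 < e) by (apply Rmin_glb_lt; [lra|nra]).
    assert (He1 : e <= 1 / 4) by apply Rmin_l. assert (He2 : e <= eps * c0 / 2) by apply Rmin_r.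
    destruct (Hcau e He) as [N HN]. exists (Nat.max N0 N). split; [lia|]. intros i j Hi Hj.
    eapply Rle_trans; [apply (Heuc i j e); [lia|lia|lra|apply HN; lia]|].
    apply Rle_trans with (2 / c0 * (eps * c0 / 2)); [apply Rmult_le_compat_l; [left; apply Rdiv_lt_0_compat; lra|lra]|right; field; lra]. }
  assert (Hlim : forall pr : C -> R, (forall a b, Rabs (pr a - pr b) <= Cmod (a - b)) -> exists l : R, forall eps, 0 < eps -> exists N, forall i, (N <= i)%nat -> Rabs (pr (x i) - l) <= eps).
  { intros pr Hpr.
    assert (Hex : ex_finite_lim_seq (fun i => pr (x i))).
    { apply ex_lim_seq_cauchy_corr. intros eps. pose proof (cond_pos eps). destruct (HcauE (eps / 2)) as (N & _ & HN); [lra|].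
      exists N. intros i j Hi Hj. eapply Rle_lt_trans; [apply Hpr|]. specialize (HN j i Hj Hi). lra. }
    destruct Hex as [l Hl]. exists l. intros eps Heps. apply is_lim_seq_spec in Hl. destruct (Hl (mkposreal eps Heps)) as [N HN].
    exists N. intros i Hi. left. apply HN, Hi. }
  destruct (Hlim fst (fun a b => Cmod_ge_abs_re (a - b)%C)) as [l1 Hl1]. destruct (Hlim snd (fun a b => Cmod_ge_abs_im (a - b)%C)) as [l2 Hl2].
  set (p := (l1, l2) : C).
  assert (Hp : forall eps, 0 < eps -> exists N, (N0 <= N)%nat /\ forall i, (N <= i)%nat -> Cmod (x i - p)%C <= eps).
  { intros eps Heps. destruct (Hl1 (eps / 2) ltac:(lra)) as [N1 HN1]. destruct (Hl2 (eps / 2) ltac:(lra)) as [N2 HN2].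
    exists (Nat.max N0 (Nat.max N1 N2)). split; [lia|]. intros i Hi. specialize (HN1 i ltac:(lia)). specialize (HN2 i ltac:(lia)).
    eapply Rle_trans; [apply Cmod_le_sum|]. unfold p. simpl. unfold Rminus in *. lra. }
  assert (Hpr : Cmod p <= str (sq (S n))).
  { apply Rnot_lt_le. intros Hlt. destruct (Hp ((Cmod p - str (sq (S n))) / 2)) as (N & HNN & HN); [lra|].
    specialize (HN N (le_n _)). specialize (Htrap N HNN). pose proof (Cmod_diff (x N) p) as T. apply Rabs_le_between in T. lra. }
  assert (Hpd : Disk p) by (apply Disk_Cmod; lra).
  exists p. split; [exact Hpd|]. intros eps Heps.
  destruct HW as (Hu & Hv & HW'). destruct (conf_bounded u v (str (sq (S n))) Hu Hv ltac:(lra)) as (S & HS & HSb).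
  destruct (Hp (eps / (2 * S))) as (N & HNN & HN); [apply Rdiv_lt_0_compat; lra|].
  (* Euclidean convergence becomes intrinsic along segments, since the metric is bounded on the
     compact subdisc containing them. *)
  exists N. intros i Hi. destruct (C1_segment (x i) p (Hx i) Hpd) as (gam & Hgam & E0 & E1 & ED & Hm).
  exists gam. split; [exact Hgam|]. split; [exact E0|]. split; [exact E1|].
  rewrite (induced_length_speed F1 F2 F3 u v) by (auto; repeat split; auto; apply HW').
  specialize (HN i Hi). specialize (Htrap i ltac:(lia)).
  assert (Hsp : forall t, 0 <= t <= 1 -> speed u v gam t <= eps / 2).
  { intros t Ht. unfold speed. destruct (ED t) as [-> ->].
    replace (fst p - fst (x i), snd p - snd (x i)) with (p - x i)%C by (apply C_eq; simpl; ring).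
    rewrite Cmod_sym. specialize (Hm t Ht). specialize (HSb (gam t)).
    assert (Cmod (gam t) <= str (sq (Datatypes.S n))) by (eapply Rle_trans; [exact Hm|]; apply Rmax_lub; lra).
    specialize (HSb H0).
    apply Rle_trans with (eps / (2 * S) * S); [|right; field; lra].
    apply Rmult_le_compat; [apply Cmod_ge_0| |exact HN|exact HSb].
    unfold conf. pose proof (Cmod_ge_0 (u (gam t))). pose proof (Cmod_ge_0 (v (gam t))). nra. }
  assert (Hle : RInt (speed u v gam) 0 1 <= RInt (fun _ => eps / 2) 0 1).
  { apply RInt_le; [lra| |apply ex_RInt_const|intros; apply Hsp; lra].
    apply cont_ex_RInt_on; [lra|]. intros t Ht. now apply speed_continuous. }
  rewrite RInt_const in Hle. unfold scal in Hle; simpl in Hle; unfold mult in Hle; simpl in Hle. lra.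
Qed.

(** * Properness and the limit set *)

Lemma realpart3_cont F1 F2 F3 u v z : weierstrass_data F1 F2 F3 u v -> Cmod z < 1 ->
  forall eps, 0 < eps -> exists d, 0 < d /\ forall w, Cmod (w - z)%C < d ->
    enorm3 (sub3 (realpart3 F1 F2 F3 w) (realpart3 F1 F2 F3 z)) < eps.
Proof.
  intros (_ & _ & D1 & D2 & D3 & _) Hz eps He.
  assert (He4 : 0 < eps / 4) by lra.
  destruct (CD_cont F1 z _ (D1 z Hz) (eps / 4) He4) as (d1 & Hd1 & H1).
  destruct (CD_cont F2 z _ (D2 z Hz) (eps / 4) He4) as (d2 & Hd2 & H2).
  destruct (CD_cont F3 z _ (D3 z Hz) (eps / 4) He4) as (d3 & Hd3 & H3).
  exists (Rmin d1 (Rmin d2 d3)). split; [repeat apply Rmin_glb_lt; assumption|]. intros w Hw.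
  pose proof (Rmin_l d1 (Rmin d2 d3)). pose proof (Rmin_r d1 (Rmin d2 d3)). pose proof (Rmin_l d2 d3). pose proof (Rmin_r d2 d3).
  specialize (H1 w ltac:(lra)). specialize (H2 w ltac:(lra)). specialize (H3 w ltac:(lra)).
  eapply Rle_lt_trans; [apply enorm3_le_sum|]. unfold realpart3. vunf.
  pose proof (Cmod_ge_abs_re (F1 w - F1 z)%C) as K1. pose proof (Cmod_ge_abs_re (F2 w - F2 z)%C) as K2.
  pose proof (Cmod_ge_abs_re (F3 w - F3 z)%C) as K3. simpl in K1, K2, K3. unfold Rminus in *. lra.
Qed.

(** On a compact subset of [D] the depth has a positive lower bound, so its preimage stays in a
    smaller closed disc; it is closed by continuity, hence compact. *)
Lemma proper_of_depth D psi : open D -> bounded3 D -> (forall z, Cmod z < 1 -> D (psi z)) ->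
  (forall z, Cmod z < 1 -> forall eps, 0 < eps -> exists d, 0 < d /\ forall w, Cmod (w - z)%C < d -> enorm3 (sub3 (psi w) (psi z)) < eps) ->
  (forall eps, 0 < eps -> exists rho, rho < 1 /\ forall z, rho <= Cmod z < 1 -> depth D (psi z) <= eps) ->
  proper_into D psi.
Proof.
  intros Ho Hb HD Hc Hdep. split; [intros p Hp; apply HD; now apply Disk_Cmod|].
  intros K HK HKc.
  assert (Hopen : forall U : P3 -> Prop, (forall x, U x -> exists e, 0 < e /\ forall y, enorm3 (sub3 y x) < e -> U y) -> open U).
  { intros U HU x Hx. destruct (HU x Hx) as (e & He & H). now apply (locally3_intro x U e). }
  assert (Hlow : exists c, 0 < c /\ forall x, K x -> c <= depth D x).
  { destruct (HKc nat (fun i x => / INR (S i) < depth D x)) as [l Hl].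
    - intros i. apply Hopen. intros x Hx. exists (depth D x - / INR (S i)). split; [lra|]. intros y Hy.
      pose proof (depth_lip D x y Hb). rewrite enorm3_sym in H. lra.
    - intros x Hx. assert (H := depth_pos D x Ho Hb (HK x Hx)).
      destruct (INR_unbounded (/ depth D x)) as [n Hn]. exists n.
      rewrite <- (Rinv_inv (depth D x)). apply Rinv_lt_contravar.
      + apply Rmult_lt_0_compat; [now apply Rinv_0_lt_compat|apply lt_0_INR; lia].
      + rewrite S_INR. lra.
    - assert (HM : exists M, forall i, In i l -> (i <= M)%nat).
      { clear. induction l as [|a l [M HM]]; [exists 0%nat; intros i []|].
        exists (Nat.max a M). intros i [<-|Hi]; [lia|]. specialize (HM i Hi). lia. }
      destruct HM as [M HM]. exists (/ INR (S M)). split; [apply Rinv_0_lt_compat, lt_0_INR; lia|].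
      intros x Hx. destruct (Hl x Hx) as (i & Hi & Hx'). specialize (HM i Hi).
      left. eapply Rle_lt_trans; [|exact Hx']. apply Rinv_le_contravar; [apply lt_0_INR; lia|apply le_INR; lia]. }
  destruct Hlow as (c & Hc0 & Hlow).
  destruct (Hdep (c / 2)) as (rho & Hrho & Hdr); [lra|].
  set (Q := fun p : C => Disk p /\ K (psi p)).
  assert (HQr : forall p, Q p -> Cmod p <= rho).
  { intros p [Hp HKp]. apply Disk_Cmod in Hp. apply Rnot_lt_le. intros Hlt. specialize (Hdr p ltac:(lra)). specialize (Hlow _ HKp). lra. }
  assert (HKcl : forall x, ~ K x -> exists r, 0 < r /\ forall y, enorm3 (sub3 y x) < r -> ~ K y).
  { intros x Hx. destruct (HKc nat (fun i y => / INR (S i) < enorm3 (sub3 y x))) as [l Hl].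
    - intros i. apply Hopen. intros y Hy. exists (enorm3 (sub3 y x) - / INR (S i)). split; [lra|]. intros y' Hy'.
      pose proof (enorm3_sub_tri y y' x). rewrite (enorm3_sym y y') in H. lra.
    - intros y Hy. assert (Hp : 0 < enorm3 (sub3 y x)).
      { destruct (Rle_lt_dec (enorm3 (sub3 y x)) 0) as [Hle|]; [|assumption]. exfalso.
        assert (E0 : enorm3 (sub3 y x) = 0) by (apply Rle_antisym; [exact Hle|apply enorm3_ge0]).
        apply Hx. replace x with y; [exact Hy|]. apply enorm3_eq0 in E0.
        replace y with (add3 (sub3 y x) x) by veq. rewrite E0. veq. }
      destruct (INR_unbounded (/ enorm3 (sub3 y x))) as [n Hn]. exists n.
      rewrite <- (Rinv_inv (enorm3 (sub3 y x))). apply Rinv_lt_contravar.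
      + apply Rmult_lt_0_compat; [now apply Rinv_0_lt_compat|apply lt_0_INR; lia].
      + rewrite S_INR. lra.
    - assert (HM : exists M, forall i, In i l -> (i <= M)%nat).
      { clear. induction l as [|a l [M HM]]; [exists 0%nat; intros i []|].
        exists (Nat.max a M). intros i [<-|Hi]; [lia|]. specialize (HM i Hi). lia. }
      destruct HM as [M HM]. exists (/ INR (S M)). split; [apply Rinv_0_lt_compat, lt_0_INR; lia|].
      intros y Hy HKy. destruct (Hl y HKy) as (i & Hi & Hx'). specialize (HM i Hi).
      assert (/ INR (S M) <= / INR (S i)) by (apply Rinv_le_contravar; [apply lt_0_INR; lia|apply le_INR; lia]). lra. }
  assert (HQ : covers distC Q).
  { apply (covers_C Q rho HQr). intros x Hx. destruct (Rle_lt_dec (Cmod x) rho) as [Hle|Hlt].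
    - assert (HKx : ~ K (psi x)) by (intros HKx; apply Hx; split; [apply Disk_Cmod; lra|exact HKx]).
      destruct (HKcl _ HKx) as (r & Hr & Hball). destruct (Hc x ltac:(lra) r Hr) as (d & Hd & Hd').
      exists d. split; [exact Hd|]. intros y Hy [_ HKy]. exact (Hball (psi y) (Hd' y Hy) HKy).
    - exists (Cmod x - rho). split; [lra|]. intros y Hy HQy. apply HQr in HQy. unfold distC in Hy.
      pose proof (Cmod_diff y x) as T. apply Rabs_le_between in T. lra. }
  intros I U HU Hcov.
  (* The option supplies a default for the choice operator even if the index type is empty. *)
  assert (Hloc : forall p : C, exists id : option I * R, Q p -> 0 < snd id /\ exists i, fst id = Some i /\ forall y : C, Cmod (y - p)%C < snd id -> U i y).
  { intros p. destruct (classic (Q p)) as [HQp|HQp].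
    - destruct (Hcov p HQp) as [i Hi]. destruct (locally2_elim p (U i) (HU i p Hi)) as (e & He & H).
      exists (Some i, e). intros _. split; [exact He|]. now exists i.
    - exists (None, 0). intros; contradiction. }
  set (ch := fun p => epsilon (inhabits (None, 0)) (fun id : option I * R => Q p -> 0 < snd id /\ exists i, fst id = Some i /\ forall y : C, Cmod (y - p)%C < snd id -> U i y)).
  assert (Hch : forall p, Q p -> 0 < snd (ch p) /\ exists i, fst (ch p) = Some i /\ forall y : C, Cmod (y - p)%C < snd (ch p) -> U i y).
  { intros p. apply (epsilon_spec (inhabits (None, 0)) _ (Hloc p)). }
  destruct (HQ (fun p => snd (ch p)) (fun p Hp => proj1 (Hch p Hp))) as (l & Hl1 & Hl2).
  exists (flat_map (fun p => match fst (ch p) with Some i => i :: nil | None => nil end) l).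
  intros x Hx. destruct (Hl2 x Hx) as (p & Hp & Hd). destruct (Hch p (Hl1 p Hp)) as (_ & i & Ei & Hi).
  exists i. split; [|now apply Hi]. apply in_flat_map. exists p. split; [exact Hp|]. rewrite Ei. now left.
Qed.

(** If the closed ball around [p] contained no limit point, each of its points would be either in
    the image, with positive depth, or away from the image. Compactness would bound the depth of
    image points in the ball from below, yet points near the circle enter the ball with arbitrarily
    small depth. *)
Lemma limit_set_near D psi p R0 : open D -> bounded3 D -> (forall z, Cmod z < 1 -> D (psi z)) ->
  (forall eps, 0 < eps -> exists rho, rho < 1 /\ forall z, rho <= Cmod z < 1 -> depth D (psi z) <= eps) ->
  (forall rho, rho < 1 -> exists z, rho <= Cmod z < 1 /\ enorm3 (sub3 (psi z) p) <= R0) ->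
  exists x, limit_set psi x /\ enorm3 (sub3 x p) <= R0.
Proof.
  intros Ho Hb HD Hdep Hacc. apply NNPP. intros Hno.
  destruct (covers_uniform dist3 (fun y => enorm3 (sub3 y p) <= R0) (fun y m => (exists z, Disk z /\ y = psi z) -> m <= depth D y)) as (m & Hm & H).
  - apply (covers_P3 _ (R0 + enorm3 p)).
    + intros z Hz. pose proof (enorm3_tri (sub3 z p) p). replace (add3 (sub3 z p) p) with z in H by veq. lra.
    + intros x Hx. exists (enorm3 (sub3 x p) - R0). split; [lra|]. intros y Hy Hy'. unfold dist3 in Hy.
      pose proof (enorm3_sub_tri x y p). rewrite (enorm3_sym x y) in H. lra.
  - intros x m m' H1 H2 Hz. specialize (H1 Hz). lra.
  - intros x Hx. destruct (classic (exists z, Disk z /\ x = psi z)) as [(z & Hz & Ez)|Hni].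
    + assert (HDx : 0 < depth D x) by (apply depth_pos; auto; rewrite Ez; apply HD; now apply Disk_Cmod).
      exists (depth D x / 2), (depth D x / 2). split; [lra|]. split; [lra|]. intros y _ Hy _. unfold dist3 in Hy.
      pose proof (depth_lip D x y Hb). rewrite (enorm3_sym x y) in H. lra.
    + assert (Hncl : ~ closure3 (fun y => exists q, Disk q /\ y = psi q) x).
      { intros Hcl. apply Hno. exists x. split; [split; [exact Hcl|exact Hni]|exact Hx]. }
      apply not_all_ex_not in Hncl. destruct Hncl as [e He]. apply imply_to_and in He. destruct He as [He Hav].
      exists e, 1. split; [exact He|]. split; [lra|]. intros y _ Hy Hyi. exfalso. apply Hav. exists y. split; [exact Hyi|].
      unfold dist3 in Hy. now rewrite enorm3_sym.
  - destruct (Hdep (m / 2)) as (rho & Hrho & Hd); [lra|]. destruct (Hacc rho Hrho) as (z & Hz & Hzp).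
    specialize (Hd z Hz). assert (m <= depth D (psi z)); [|lra].
    apply (H (psi z) Hzp). exists z. split; [apply Disk_Cmod; lra|reflexivity].
Qed.

Lemma hausdorff_le A B e : (forall x, A x -> exists y, B y /\ enorm3 (sub3 x y) <= e) ->
  (forall y, B y -> exists x, A x /\ enorm3 (sub3 y x) <= e) -> Rbar_le (hausdorff_dist A B) (Finite e).
Proof.
  assert (G : forall A B, (forall x, A x -> exists y, B y /\ enorm3 (sub3 x y) <= e) ->
    Rbar_le (Lub_Rbar (fun r => exists x, A x /\ dist_to B x = Finite r)) (Finite e)).
  { clear A B. intros A B H. apply (proj2 (Lub_Rbar_correct _)). intros r (x & Hx & Hr). destruct (H x Hx) as (y & Hy & Hxy).
    assert (K := proj1 (Glb_Rbar_correct (fun s => exists y, B y /\ s = enorm3 (sub3 x y))) _ (ex_intro _ y (conj Hy eq_refl))).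
    unfold dist_to in Hr. rewrite Hr in K. simpl in *. lra. }
  intros H1 H2. unfold hausdorff_dist, Rbar_max2. destruct (Rbar_lt_dec _ _); now apply G.
Qed.

(** The depth [4 * ste] kept by [Inv] exceeds the remaining displacement [2 * ste]. *)
Lemma limit_inside D p0 m del0 kap sq psi : bounded3 D -> geo_states D p0 m del0 kap sq ->
  (forall n z, Cmod z <= str (sq n) -> enorm3 (sub3 (psi z) (surf p0 (stU (sq n)) (stV (sq n)) z)) <= 2 * ste (sq n)) ->
  forall z, Cmod z < 1 -> D (psi z).
Proof.
  intros Hb H Hcl z Hz. destruct (str_reaches D p0 m del0 kap sq z H Hz) as [n Hn].
  destruct (H n) as [(_ & Hr & _ & He & _ & _ & Hin & _) _]. destruct (Hin z ltac:(lra)) as [_ Hd].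
  specialize (Hcl n z Hn). apply (depth_in D (surf p0 (stU (sq n)) (stV (sq n)) z)); [exact Hb|].
  rewrite enorm3_sym. lra.
Qed.

(** Locate [z] in the annulus between two consecutive radii. There the next stage has depth at most
    three times the current bound, and the remaining displacement is at most a quarter of that
    bound, so four times it suffices. *)
Lemma limit_depth D p0 m del0 kap sq psi : bounded3 D -> 0 < del0 -> 0 < kap < 1 -> geo_states D p0 m del0 kap sq ->
  (forall n z, Cmod z <= str (sq n) -> enorm3 (sub3 (psi z) (surf p0 (stU (sq n)) (stV (sq n)) z)) <= 2 * ste (sq n)) ->
  forall eps, 0 < eps -> exists rho, rho < 1 /\ forall z, rho <= Cmod z < 1 -> depth D (psi z) <= eps.
Proof.
  intros Hb Hd0 Hk H Hcl eps He.
  destruct (pow_lt_1_zero kap ltac:(rewrite Rabs_right; lra) (eps / (4 * del0))) as [n Hn]; [apply Rdiv_lt_0_compat; lra|].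
  exists (str (sq n)). destruct (H n) as [(_ & Hr & _) _]. split; [lra|]. intros z [Hz1 Hz2].
  assert (Hj : exists j, (n <= j)%nat /\ str (sq j) <= Cmod z <= str (sq (S j))).
  { destruct (str_reaches D p0 m del0 kap sq z H Hz2) as [k Hkz].
    assert (G : forall k, Cmod z <= str (sq (n + k)%nat) -> exists j, (n <= j)%nat /\ str (sq j) <= Cmod z <= str (sq (S j))).
    { induction k0 as [|k0 IH]; intros Hle.
      - rewrite Nat.add_0_r in Hle. exists n. destruct (adm_chain D m p0 del0 sq kap H n (S n) ltac:(lia)) as [Hs _]. split; [lia|lra].
      - destruct (Rle_lt_dec (Cmod z) (str (sq (n + k0)%nat))) as [Hle'|Hlt]; [now apply IH|].
        exists (n + k0)%nat. split; [lia|]. rewrite Nat.add_succ_r in Hle. lra. }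
    apply (G k). destruct (adm_chain D m p0 del0 sq kap H k (n + k)%nat ltac:(lia)) as [Hs _]. lra. }
  destruct Hj as (j & Hnj & Hz). destruct (H j) as [_ (_ & _ & _ & _ & Hdep & _)]. destruct (H (S j)) as [(_ & _ & _ & _ & _ & Hes & _) _].
  specialize (Hdep z ltac:(lra)). specialize (Hcl (S j) z ltac:(lra)).
  assert (Hp : kap ^ S j <= kap ^ j) by (simpl; assert (0 < kap ^ j) by (apply pow_lt; lra); nra).
  specialize (Hn j Hnj). rewrite Rabs_right in Hn by (left; apply pow_lt; lra).
  pose proof (depth_lip D (psi z) (surf p0 (stU (sq (S j))) (stV (sq (S j))) z) Hb).
  assert (del0 * kap ^ S j <= del0 * kap ^ j) by (apply Rmult_le_compat_l; lra).
  assert (4 * (del0 * kap ^ j) <= eps); [|lra].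
  apply Rle_trans with (4 * (del0 * (eps / (4 * del0)))); [|right; field; lra].
  apply Rmult_le_compat_l; [lra|]. apply Rmult_le_compat_l; lra.
Qed.

Theorem theoremA :
  forall (C : P3 -> Prop) (Gamma : P3 -> Prop) (eps : R),
    domain3 C -> bounded3 C -> smooth_strictly_convex_boundary C ->
    smooth_jordan_curve Gamma -> (forall x, Gamma x -> boundary3 C x) ->
    0 < eps ->
    exists psi : R * R -> P3,
      minimal_immersion psi /\ complete_immersion psi /\ proper_into C psi /\
      Rbar_lt (hausdorff_dist (limit_set psi) Gamma) (Finite eps).
Proof.
  intros D Gam eps (Ho & _ & _) Hb Hcv HJ HG Heps.
  destruct (uniform_pinching D Ho Hb Hcv) as (m & Hm0 & Hm1 & Hpin).
  set (kap := 1 - m * m / 16). assert (Hmm : 0 < m * m <= 1) by nra.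
  assert (Hkap : 0 < kap < 1) by (unfold kap; lra).
  set (q := sqrt kap). assert (Hq2 : q * q = kap) by (apply sqrt_sqrt; lra).
  assert (Hq0 : 0 < q) by (apply sqrt_lt_R0; lra). assert (Hq1 : q < 1) by nra.
  set (e := eps / 8). assert (He : 0 < e) by (unfold e; lra).
  (* If [sqrt (m * del0) <= a], the total displacement [2 a / (1 - q)] of the iteration is [e]. *)
  set (a := e * (1 - q) / 2). assert (Ha : 0 < a) by (unfold a; apply Rdiv_lt_0_compat; [apply Rmult_lt_0_compat; lra|lra]).
  set (del0 := Rmin (m / 16) (a * a)).
  assert (Hdel : 0 < del0) by (apply Rmin_glb_lt; [lra|nra]).
  assert (Hdel1 : del0 <= m / 16) by apply Rmin_l. assert (Hdel2 : del0 <= a * a) by apply Rmin_r.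
  (* Closeness to the curve, which lies outside [D], also bounds the initial depth; the bound [del0]
     starts the iteration. *)
  set (e1 := Rmin e del0). assert (He1 : 0 < e1) by (apply Rmin_glb_lt; lra).
  assert (He1a : e1 <= e) by apply Rmin_l. assert (He1b : e1 <= del0) by apply Rmin_r.
  destruct (initial_disc D Gam m e1 Ho Hb (conj Hm0 Hm1) Hpin HJ HG He1) as (p0 & U & V & mu & Hg & Hmu & Hin & Hnear & Hcov).
  destruct (finish_state D p0 U V mu del0 1 0 1 Hb Hg Hmu Hin) as (s0 & Hinv & EU & EV & _ & _); try lra.
  { intros z Hz. destruct (Hnear z ltac:(lra)) as (x & Hx & Hxz). destruct (HG x Hx) as [_ Hnx].
    pose proof (depth_le D (surf p0 U V z) x Hb Hnx). lra. }
  destruct (state_sequence D m p0 del0 s0 Ho Hb (conj Hm0 Hm1) Hpin Hdel Hdel1 Hinv) as (sq & E0 & Hseq).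
  assert (H : geo_states D p0 m del0 kap sq) by exact Hseq.
  destruct (limit_surface D p0 m del0 kap sq H) as (F1 & F2 & F3 & u & v & HW & Hcl & Hsn & Hconv).
  set (psi := realpart3 F1 F2 F3) in *.
  assert (HD : forall z, Cmod z < 1 -> D (psi z)) by (apply (limit_inside D p0 m del0 kap sq psi Hb H Hcl)).
  assert (Hdep := limit_depth D p0 m del0 kap sq psi Hb Hdel Hkap H Hcl).
  assert (Htot : forall z, Cmod z < 1 -> enorm3 (sub3 (psi z) (surf p0 U V z)) <= e).
  { intros z Hz. apply (enorm_limit (fun k => surf p0 (stU (sq k)) (stV (sq k)) z)); [now apply Hconv|].
    exists 0%nat. intros k _. rewrite <- EU, <- EV, <- E0.
    eapply Rle_trans; [apply (displacement_sum D p0 m del0 kap sq H Hm0 Hdel Hkap); lra|]. fold q.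
    assert (Hs : sqrt (m * del0) <= a).
    { apply Rle_trans with (sqrt (a * a)); [apply sqrt_le_1_alt; nra|]. rewrite sqrt_square; lra. }
    apply Rle_trans with (2 * a / (1 - q)).
    - unfold Rdiv. apply Rmult_le_compat_r; [left; apply Rinv_0_lt_compat; lra|lra].
    - right. unfold a. field. lra. }
  exists psi. split; [now apply (weierstrass_minimal F1 F2 F3 u v)|].
  split; [now apply (limit_complete D p0 m del0 kap sq F1 F2 F3 u v)|].
  split; [apply (proper_of_depth D psi Ho Hb HD); [|exact Hdep]; intros z Hz; now apply (realpart3_cont F1 F2 F3 u v)|].
  apply Rbar_le_lt_trans with (Finite (4 * e)); [|unfold e; simpl; lra].
  apply hausdorff_le.
  (* Three errors of at most [e]: from the limit point to the surface, from there to the initial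
     disc, and on to the curve. *)
  - intros x [Hcx _]. destruct (Hcx e He) as (y & (z & Hz & ->) & Hxy). apply Disk_Cmod in Hz.
    destruct (Hnear z ltac:(lra)) as (g & Hgg & Hgz). exists g. split; [exact Hgg|].
    specialize (Htot z Hz). pose proof (enorm3_sub_tri x (psi z) g). pose proof (enorm3_sub_tri (psi z) (surf p0 U V z) g). lra.
  - intros g Hgg. destruct (Hcov g Hgg) as (z & Hz & Hgz). destruct (surf0_radial U V e He) as (rr & Hrr & Hrad).
    destruct (limit_set_near D psi g (3 * e) Ho Hb HD Hdep) as (x & Hx & Hxg).
    (* The limit is not defined on the circle, so the boundary point is replaced by a point on its
       ray where the initial disc has changed by at most [e]. *)
    + intros rho Hrho. set (t := Rmax 0 (Rmax rr rho)). assert (Ht0 : 0 <= t) by apply Rmax_l.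
      assert (Ht1 : rr <= t) by (unfold t; eapply Rle_trans; [|apply Rmax_r]; apply Rmax_l).
      assert (Ht2 : rho <= t) by (unfold t; eapply Rle_trans; [|apply Rmax_r]; apply Rmax_r).
      assert (Ht3 : t < 1) by (unfold t; repeat apply Rmax_lub_lt; lra).
      assert (Hmod : Cmod (t * z)%C = t) by (rewrite Cmod_mult, Hz, Cmod_R, Rabs_right; lra).
      exists (t * z)%C. rewrite Hmod. split; [lra|].
      specialize (Htot (t * z)%C ltac:(lra)). specialize (Hrad z t Hz Ht0 ltac:(lra)). rewrite <- (surf_sub p0) in Hrad.
      pose proof (enorm3_sub_tri (psi (t * z)%C) (surf p0 U V (t * z)%C) g).
      pose proof (enorm3_sub_tri (surf p0 U V (t * z)%C) (surf p0 U V z) g). lra.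
    + exists x. split; [exact Hx|]. rewrite enorm3_sym. lra.
Qed.
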